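(* Let $P\subset\mathbb{R}^d$ be a closed convex cone with $P-P=\mathbb{R}^d$ and $P\cap(-P)=\{0\}$. Let $(Y,\mathcal{B}_Y)$ be a measurable space with $\mathcal{B}_Y$ countably generated, on which $\mathbb{R}^d$ acts measurably, let $\rho_0$ be an $\mathbb{R}^d$-invariant $\sigma$-finite measure on $Y$, and let $X\in\mathcal{B}_Y$ satisfy $X+a\subset X$ for all $a\in P$ and $\bigcap_{a\in P}(X+a)=\emptyset$. Let $\nu$ be a measure on $(0,\infty)$ with $\int (r\wedge1)\,\nu(dr)<\infty$, let $\eta$ be a Poisson process on $\widetilde{Y}=Y\times(0,\infty)$ with intensity measure $\lambda=\rho_0\otimes\nu$, and let $\xi$ be the $\rho_0$-symmetric compound Poisson process on $Y$ with Lévy measure $\nu$, i.e. $\xi(B)=\int r1_B(y)\,\eta(d(y,r))$ for $B\in\mathcal{B}_Y$. Let $E$ be the product system over $P$ associated to $\xi$ (and $X$), and let $\widetilde{E}$ be the product system over $P$ associated to the Poisson process $\eta$ (and $\widetilde{X}=X\times(0,\infty)$). Then $E=\widetilde{E}$. Consequently, $E$ is isomorphic to the product system of a CCR flow.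
   Context: All probability spaces and sub-$\sigma$-algebras are complete; ''generated by random variables'' means the smallest complete $\sigma$-algebra making them measurable. For $a,b\in P$, $a\le b$ means $b-a\in P$. The action of $\mathbb{R}^d$ on $Y$ is written additively, and $\mathbb{R}^d$ acts on $\widetilde{Y}$ through the first coordinate. Poisson process: with $\overline{\mathbb{N}}=\{0,1,2,\dots\}\cup\{\infty\}$, a point process on a measurable space is a measurable map $\eta$ from a probability space $(\Omega,\mathcal{F},\mathbb{P})$ to the $\overline{\mathbb{N}}$-valued $\sigma$-finite measures (with the smallest $\sigma$-algebra making each $\mu\mapsto\mu(B)$ measurable). It is a Poisson process with intensity $\lambda$ if each $\eta(B)$ is Poisson with parameter $\lambda(B)$ (a.s. $\infty$ if $\lambda(B)=\infty$) and $\eta(B_1),\dots,\eta(B_n)$ are independent for disjoint measurable $B_i$. It is assumed that $\mathcal{F}$ is generated by the random variables $\eta(B)$, $B$ measurable in $\widetilde{Y}$. The product systems: for $a\le b$ in $P$ let $\mathcal{F}_{a,b}$ be generated by $\{\xi(B):B\in\mathcal{B}_Y,\ B\subset(X+a)\setminus(X+b)\}$, and let $\widetilde{\mathcal{F}}_{a,b}$ be generated by $\{\eta(B):B\subset(\widetilde{X}+a)\setminus(\widetilde{X}+b)\text{ measurable}\}$; put $\mathcal{F}_a=\mathcal{F}_{0,a}$, $\widetilde{\mathcal{F}}_a=\widetilde{\mathcal{F}}_{0,a}$. Then $$E=\{(a,f):a\in P,\ f\in L^2(\Omega,\mathcal{F}_a,\mathbb{P})\},\qquad \widetilde{E}=\{(a,f):a\in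 P,\ f\in L^2(\Omega,\widetilde{\mathcal{F}}_a,\mathbb{P})\},$$ both subsets of $P\times L^2(\Omega,\mathcal{F},\mathbb{P})$ with the inherited measurable structure. Multiplication is $(a,f)(b,g)=(a+b,fS_a(g))$, where for $\widetilde{E}$, $S_c:L^2(\Omega,\widetilde{\mathcal{F}}_{a,b},\mathbb{P})\to L^2(\Omega,\widetilde{\mathcal{F}}_{a+c,b+c},\mathbb{P})$ is the unitary with $S_c(f(\eta(B_1),\dots,\eta(B_n)))=f(\eta(B_1+c),\dots,\eta(B_n+c))$, and for $E$ the same formula is used with $\xi$ in place of $\eta$ (and $\mathcal{F}_{a,b}$ in place of $\widetilde{\mathcal{F}}_{a,b}$). CCR flow: $\Gamma(H)$ is the symmetric Fock space of $H$ with exponential vectors $e(\zeta)$, $\langle e(\zeta)|e(\zeta')\rangle=e^{\langle\zeta|\zeta'\rangle}$. For a strongly continuous semigroup of isometries $V=(V_a)_{a\in P}$ on a separable Hilbert space $H$, the CCR flow associated to $V$ is the $E_0$-semigroup $\alpha$ on $B(\Gamma(H))$ with $\alpha_a(W(\zeta))=W(V_a\zeta)$, $W(\cdot)$ the Weyl operators. Its product system is identified with the one having fibres $\Gamma(\ker V_a^* )\subset\Gamma(H)$, $a\in P$, the measurable structure inherited from $P\times\Gamma(H)$, and multiplication determined by $e(\zeta)\cdot e(\zeta')=e(\zeta+V_a\zeta')$ for $\zeta\in\ker V_a^*$, $\zeta'\in\ker V_b^*$. An isomorphism of product systems over $P$ is a Borel isomorphism that maps fibres unitarily onto corresponding fibres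 and preserves multiplication. *)

(* Defs.v *)
From HB Require Import structures.
From mathcomp Require Import all_boot all_order all_algebra sesquilinear.
From mathcomp Require Import complex.
From mathcomp Require Import all_classical all_reals all_analysis.
From mathcomp Require Import measurable_realfun.

Set Implicit Arguments.
Unset Strict Implicit.
Unset Printing Implicit Defensive.
Import Order.TTheory GRing.Theory Num.Def Num.Theory.
Import numFieldNormedType.Exports.
Local Open Scope classical_set_scope.
Local Open Scope ring_scope.
Local Open Scope complex_scope.
Local Open Scope quotient_scope.

Section cL2.
Context d (T : measurableType d) (R : realType).
Variable mu : {measure set T -> \bar R}.

(* Complex-valued measurable square-integrable functions. *)
Definition cLfun2 : {pred T -> R[i]} :=
  [pred f : T -> R[i] | ((fun x => complex.Re (f x)) \in Lfun mu 2%:E) &&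
                        ((fun x => complex.Im (f x)) \in Lfun mu 2%:E)].

Lemma cLfun2_submod_closed : submod_closed cLfun2.
Proof.
have [/= L0 LP] := @Lfun_submod_closed _ _ _ mu 2%:E (lee1n 2).
split; first by rewrite !inE; apply/andP; split; exact: L0.
move=> [a b] f g /andP[f1 f2] /andP[g1 g2]; apply/andP; split.
- have -> : (fun x => complex.Re (((a +i* b) *: f + g) x)) =
      a *: (fun x => complex.Re (f x)) + ((- b) *: (fun x => complex.Im (f x)) + (fun x => complex.Re (g x))).
    apply/funext => x; rewrite !fctE /=.
    by case: (f x) (g x) => ? ? [? ?] /=; rewrite scaleNr addrA.
  by apply: (LP) => //; exact: LP.
- have -> : (fun x => complex.Im (((a +i* b) *: f + g) x)) =
      a *: (fun x => complex.Im (f x)) + (b *: (fun x => complex.Re (f x)) + (fun x => complex.Im (g x))).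
    apply/funext => x; rewrite !fctE /=.
    by case: (f x) (g x) => ? ? [? ?] /=; rewrite addrA.
  by apply: (LP) => //; exact: LP.
Qed.

HB.instance Definition _ := GRing.isSubmodClosed.Build _ _ cLfun2
  cLfun2_submod_closed.

Record cLfunType := CLfun { cLfun_val :> T -> R[i]; _ : cLfun_val \in cLfun2 }.
HB.instance Definition _ := [isSub for cLfun_val].
HB.instance Definition _ := [Choice of cLfunType by <:].
HB.instance Definition _ := [SubChoice_isSubLmodule of cLfunType by <:].

Definition cae_eq (f g : cLfunType) : bool := `[< {ae mu, forall x, f x = g x} >].

Lemma cae_eq_refl : reflexive cae_eq.
Proof. by move=> f; apply/asboolP; exact: nearW. Qed.

Lemma cae_eq_sym : symmetric cae_eq.
Proof. by move=> f g; apply/idP/idP => /asboolP h; apply/asboolP; move: h; apply: filterS => x ->. Qed.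

Lemma cae_eq_trans : transitive cae_eq.
Proof. by move=> g f h /asboolP fg /asboolP gh; apply/asboolP; move: fg gh; apply: filterS2 => x -> ->. Qed.

Canonical cae_eq_canonical := EquivRel cae_eq cae_eq_refl cae_eq_sym cae_eq_trans.

(* L^2(mu), with complex scalars *)
Definition cL2 : Type := {eq_quot cae_eq}.
HB.instance Definition _ := Choice.on cL2.
HB.instance Definition _ := EqQuotient.on cL2.
End cL2.

Section cL2_lmod.
Context d (T : measurableType d) (R : realType).
Variable mu : {measure set T -> \bar R}.
Local Notation L := (cL2 mu).
Implicit Types (f g : cLfunType mu) (x y z : L).

Lemma cL2_eqP f g : reflect ({ae mu, forall t, f t = g t}) (\pi_L f == \pi_L g).
Proof. by apply: (iffP idP); rewrite eqmodE => /asboolP. Qed.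

Lemma cL2_pi f g : {ae mu, forall t, f t = g t} -> \pi_L f = \pi_L g.
Proof. by move=> /cL2_eqP/eqP. Qed.

Lemma cL2_repr f : {ae mu, forall t, repr (\pi_L f) t = f t}.
Proof. by apply/cL2_eqP; rewrite reprK. Qed.

Definition cL2_add x y : L := \pi_L (repr x + repr y).
Definition cL2_opp x : L := \pi_L (- repr x).
Definition cL2_scale (c : R[i]) x : L := \pi_L (c *: repr x).

Lemma cL2_piD f g : cL2_add (\pi_L f) (\pi_L g) = \pi_L (f + g).
Proof.
apply: cL2_pi; have := cL2_repr f; have := cL2_repr g.
by apply: filterS2 => t gt ft /=; rewrite !fctE gt ft.
Qed.

Lemma cL2_piN f : cL2_opp (\pi_L f) = \pi_L (- f).
Proof.
by apply: cL2_pi; have := cL2_repr f; apply: filterS => t ft; rewrite /= !fctE ft.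
Qed.

Lemma cL2_piZ c f : cL2_scale c (\pi_L f) = \pi_L (c *: f).
Proof.
by apply: cL2_pi; have := cL2_repr f; apply: filterS => t ft; rewrite /= !fctE ft.
Qed.

Lemma cL2_addA : associative cL2_add.
Proof.
elim/quotW => f; elim/quotW => g; elim/quotW => h.
by rewrite (cL2_piD g h) (cL2_piD f g) (cL2_piD f) (cL2_piD (f + g)) addrA.
Qed.

Lemma cL2_addC : commutative cL2_add.
Proof. by elim/quotW => f; elim/quotW => g; rewrite (cL2_piD f) (cL2_piD g) addrC. Qed.

Lemma cL2_add0 : left_id (\pi_L 0) cL2_add.
Proof. by elim/quotW => f; rewrite (cL2_piD 0 f) add0r. Qed.

Lemma cL2_addN : left_inverse (\pi_L 0) cL2_opp cL2_add.
Proof. by elim/quotW => f; rewrite (cL2_piN f) (cL2_piD _ f) addNr. Qed.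

HB.instance Definition _ :=
  @GRing.isZmodule.Build (cL2 mu) _ _ _ cL2_addA cL2_addC cL2_add0 cL2_addN.

Lemma cL2_scaleA a b x : cL2_scale a (cL2_scale b x) = cL2_scale (a * b) x.
Proof. by elim/quotW: x => f; rewrite (cL2_piZ b f) (cL2_piZ a) (cL2_piZ _ f) scalerA. Qed.

Lemma cL2_scale1 : left_id 1 cL2_scale.
Proof. by elim/quotW => f; rewrite (cL2_piZ 1 f) scale1r. Qed.

Lemma cL2_scaleDr : right_distributive cL2_scale +%R.
Proof.
move=> c; elim/quotW => f; elim/quotW => g.
have -> : \pi_L f + \pi_L g = \pi_L (f + g) := cL2_piD f g.
rewrite (cL2_piZ c (f + g)) (cL2_piZ c f) (cL2_piZ c g) scalerDr.
exact/esym/cL2_piD.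
Qed.

Lemma cL2_scaleDl x : {morph cL2_scale^~ x : a b / a + b}.
Proof.
move=> a b; elim/quotW: x => f.
rewrite (cL2_piZ (a + b) f) (cL2_piZ a f) (cL2_piZ b f) scalerDl.
exact/esym/cL2_piD.
Qed.

HB.instance Definition _ := GRing.Zmodule_isLmodule.Build R[i] L
  cL2_scaleA cL2_scale1 cL2_scaleDr cL2_scaleDl.

Definition cintegrable (h : T -> R[i]) :=
  mu.-integrable setT (EFin \o (fun t => complex.Re (h t))) /\
  mu.-integrable setT (EFin \o (fun t => complex.Im (h t))).

Definition cint (h : T -> R[i]) : R[i] :=
  (\int[mu]_t complex.Re (h t)) +i* (\int[mu]_t complex.Im (h t)).

Definition cL2_dot x y : R[i] := cint (fun t => repr x t * (repr y t)^*).

Lemma cLfun_mul_integrable f g : cintegrable (fun t => f t * (g t)^*).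
Proof.
case: f g => [f /= /andP[f1 f2]] [g /= /andP[g1 g2]].
have M a b : a \in Lfun mu 2%:E -> b \in Lfun mu 2%:E ->
    mu.-integrable setT (EFin \o (a \* b)).
  by move=> ha hb; apply/Lfun1_integrable; exact: Lfun2_mul_Lfun1.
split.
- have := integrableD measurableT (M _ _ f1 g1) (M _ _ f2 g2).
  apply: eq_integrable => // t _; rewrite /= -EFinD.
  by case: (f t) (g t) => ? ? [? ?] /=; rewrite mulrN opprK.
- have := integrableB measurableT (M _ _ f2 g1) (M _ _ f1 g2).
  apply: eq_integrable => // t _; rewrite /= -EFinB.
  by case: (f t) (g t) => ? ? [? ?] /=; rewrite mulrN addrC.
Qed.

Lemma cintP (c : R[i]) (h k : T -> R[i]) : cintegrable h -> cintegrable k ->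
  cint (fun t => c * h t + k t) = c * cint h + cint k.
Proof.
move=> [h1 h2] [k1 k2]; case: c => a b.
have Z (r : R) u : mu.-integrable setT (EFin \o u) ->
    mu.-integrable setT (EFin \o (fun t => r * u t)).
  move=> /(integrableZl measurableT r).
  by apply: eq_integrable => // t _ /=; rewrite EFinM.
have D u v : mu.-integrable setT (EFin \o u) -> mu.-integrable setT (EFin \o v) ->
    mu.-integrable setT (EFin \o (fun t => u t + v t)).
  by move=> hu /(integrableD measurableT hu); exact: eq_integrable.
have B u v : mu.-integrable setT (EFin \o u) -> mu.-integrable setT (EFin \o v) ->
    mu.-integrable setT (EFin \o (fun t => u t - v t)).
  by move=> hu /(integrableB measurableT hu); exact: eq_integrable.
rewrite /cint; set p := @complex.Re R; set q := @complex.Im R.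
apply/eqP; rewrite eq_complex /=; apply/andP; split; apply/eqP.
- under eq_Rintegral => t _.
    have -> : p ((a +i* b) * h t + k t) =
      (a * p (h t) - b * q (h t)) + p (k t).
      by case: (h t) (k t) => ? ? [? ?].
    over.
  rewrite RintegralD//; last exact: B (Z _ _ h1) (Z _ _ h2).
  rewrite RintegralB//; [|exact: Z h1|exact: Z h2].
  by rewrite !RintegralZl.
- under eq_Rintegral => t _.
    have -> : q ((a +i* b) * h t + k t) =
      (a * q (h t) + b * p (h t)) + q (k t).
      by case: (h t) (k t) => ? ? [? ?].
    over.
  rewrite RintegralD//; last exact: D (Z _ _ h2) (Z _ _ h1).
  rewrite RintegralD//; [|exact: Z h2|exact: Z h1].
  by rewrite !RintegralZl.
Qed.

Lemma ae_eq_cint (h k : T -> R[i]) : cintegrable h -> cintegrable k ->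
  {ae mu, forall t, h t = k t} -> cint h = cint k.
Proof.
move=> [h1 h2] [k1 k2] hk; rewrite /cint; congr (_ +i* _).
- rewrite /Rintegral; congr fine; apply: ae_eq_integral => //.
  + exact: measurable_int h1.
  + exact: measurable_int k1.
  + by apply: filterS hk => t /= ->.
- rewrite /Rintegral; congr fine; apply: ae_eq_integral => //.
  + exact: measurable_int h2.
  + exact: measurable_int k2.
  + by apply: filterS hk => t /= ->.
Qed.

Lemma cL2_dotE f g : cL2_dot (\pi_L f) (\pi_L g) = cint (fun t => f t * (g t)^*).
Proof.
apply: ae_eq_cint; [exact: cLfun_mul_integrable..|].
by have := cL2_repr f; have := cL2_repr g; apply: filterS2 => t -> ->.
Qed.

Lemma cint_conj h : cintegrable h -> cint (fun t => (h t)^*) = (cint h)^*.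
Proof.
move=> [h1 h2]; apply/eqP; rewrite eq_complex /=; apply/andP; split; apply/eqP.
  by apply: eq_Rintegral => t _; case: (h t).
under eq_Rintegral => t _.
  have -> : complex.Im (h t)^* = - 1 * complex.Im (h t).
    by case: (h t) => ? ? /=; rewrite mulN1r.
  over.
by rewrite RintegralZl// mulN1r.
Qed.

Lemma cL2_dotC x y : cL2_dot x y = (-1) ^+ false * conjC (cL2_dot y x).
Proof.
rewrite expr0 mul1r; elim/quotW: x => f; elim/quotW: y => g.
rewrite !cL2_dotE -[RHS]cint_conj; last exact: cLfun_mul_integrable.
by congr cint; apply/funext => t; rewrite rmorphM /= conjcK mulrC.
Qed.

Lemma cL2_dot_linearl y : GRing.linear_for *%R (cL2_dot^~ y).
Proof.
move=> c; elim/quotW => f; elim/quotW => g; elim/quotW: y => h.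
have -> : c *: \pi_L f + \pi_L g = \pi_L (c *: f + g).
  by rewrite -[c *: \pi_L f]/(cL2_scale c _) cL2_piZ [LHS]cL2_piD.
rewrite !cL2_dotE -cintP; [|exact: cLfun_mul_integrable..].
by congr cint; apply/funext => t; rewrite /= !fctE mulrDl mulrA.
Qed.

Lemma cL2_dot_linearr x : GRing.linear_for (conjC \; *%R) (cL2_dot x).
Proof.
move=> c y z; rewrite [LHS]cL2_dotC cL2_dot_linearl.
rewrite [X in _ = _ X + _]cL2_dotC [X in _ = _ + X]cL2_dotC.
by rewrite !expr0 !mul1r rmorphD rmorphM.
Qed.

Lemma cL2_dot_gt0 x : x != 0 -> 0 < cL2_dot x x.
Proof.
elim/quotW: x => f f0; rewrite cL2_dotE.
have [h1 h2] := cLfun_mul_integrable f f.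
pose n t := complex.Re (f t) ^+ 2 + complex.Im (f t) ^+ 2.
have ff t : f t * (f t)^* = (n t)%:C.
  rewrite /n; case: (f t) => a b /=; apply/eqP; rewrite eq_complex /=.
  by rewrite mulrN opprK -!expr2 mulrN (mulrC b) addNr !eqxx.
have ni : mu.-integrable setT (EFin \o n).
  by apply: eq_integrable h1 => // t _; rewrite /= ff.
have -> : (fun t => f t * (f t)^*) = (fun t => (n t)%:C) by apply/funext.
have n0 t : 0 <= n t by rewrite addr_ge0 ?sqr_ge0.
rewrite ltcE /= /Rintegral integral0 eqxx /= lt0r fine_ge0; last first.
  by apply: integral_ge0 => t _; rewrite lee_fin.
rewrite andbT; apply: contra f0 => /eqP I0.
have {}I0 : (\int[mu]_t `|(n t)%:E| = 0)%E.
  under eq_integral do rewrite gee0_abs ?lee_fin//.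
  by rewrite -[LHS]fineK ?I0//; exact: integrable_fin_num.
have := (ae_eq_integral_abs mu measurableT (measurable_int _ ni)).1 I0.
move=> h; apply/cL2_eqP; apply: filterS h => t /(_ I) /= [] /eqP.
rewrite paddr_eq0 ?sqr_ge0// !sqrf_eq0 => /andP[/eqP fr /eqP fi].
by apply/eqP; rewrite eq_complex fr fi !eqxx.
Qed.

HB.instance Definition _ := bilinear_isBilinear.Build R[i] L L R[i]
  (GRing.Scale.Law.clone _ _ ( *%R ) _)
  (GRing.Scale.Law.clone _ _ (conjC \; *%R) _)
  cL2_dot (cL2_dot_linearl, cL2_dot_linearr).
HB.instance Definition _ :=
  isHermitianSesquilinear.Build R[i] L false conjC cL2_dot cL2_dotC.
HB.instance Definition _ := isDotProduct.Build R[i] L cL2_dot cL2_dot_gt0.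

End cL2_lmod.

(* The inner product is linear in its first argument. *)
Record innerProductSpace (R : realType) := InnerProductSpace {
  ips_sort :> lmodType R[i];
  ips_dot : {dot ips_sort for conjC} }.

Definition cL2_ips d (T : measurableType d) (R : realType)
    (mu : {measure set T -> \bar R}) : innerProductSpace R :=
  InnerProductSpace (@cL2_dot d T R mu : {dot cL2 mu for conjC}).

Definition hdot (R : realType) (H : innerProductSpace R) (x y : H) : R[i] :=
  ips_dot H x y.

Section hilbert.
Context {R : realType}.
Implicit Types (H G K : innerProductSpace R).

Definition hnorm H (x : H) : R := Num.sqrt (complex.Re (hdot x x)).

Definition hcomplete H := forall u : nat -> H,
  (forall eps : R, 0 < eps -> exists N, forall m n, (N <= m)%N -> (N <= n)%N ->
     hnorm (u m - u n) < eps) ->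
  exists l : H, (fun n => hnorm (u n - l)) @ \oo --> (0 : R).

Definition hseparable H := exists2 D : set H, countable D &
  forall (x : H) (eps : R), 0 < eps -> exists2 y, D y & hnorm (x - y) < eps.

Definition hopen H (U : set H) := forall x, U x ->
  exists2 eps : R, 0 < eps & forall y, hnorm (y - x) < eps -> U y.

Definition closed_span H (S : set H) : set H := [set x | forall eps : R, 0 < eps ->
  exists n (c : 'I_n -> R[i]) (v : 'I_n -> H), (forall i, S (v i)) /\
    hnorm (x - \sum_(i < n) c i *: v i) < eps].

Definition unitary_on H K (A : set H) (B : set K) (T : H -> K) :=
  [/\ set_bij A B T,
      forall (c : R[i]) x y, A x -> A y -> T (c *: x + y) = c *: T x + T y &
      forall x y, A x -> A y -> hdot (T x) (T y) = hdot x y].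

(* Uniquely determined when T is bounded and H is complete. *)
Definition adjoint H (T : H -> H) : H -> H :=
  xget (fun=> 0) [set T' : H -> H | forall x y, hdot (T' x) y = hdot x (T y)].

Definition cexp (z : R[i]) : R[i] :=
  (expR (complex.Re z))%:C * (cos (complex.Im z) +i* sin (complex.Im z)).

(* G, with the exponential vectors e, is a model of the symmetric Fock space of H;
   these conditions determine (G, e) up to a unique unitary *)
Definition is_fock H G (e : H -> G) :=
  [/\ hcomplete G,
      forall x y, hdot (e x) (e y) = cexp (hdot x y) &
      closed_span (range e) = setT].

End hilbert.

Section product_systems.
Context {R : realType} {d : nat}.
Local Notation V := 'rV[R]_d.
Implicit Types (H K : innerProductSpace R) (C : set V).

Definition closed_convex_cone C := [/\ closed C, C 0,
  forall x y, C x -> C y -> C (x + y) &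
  forall (t : R) x, 0 <= t -> C x -> C (t *: x)].

(* A product system given as a subset of V x H with the inherited measurable
   structure; the values of [ps_mul] outside [ps_set] are irrelevant. *)
Record prodsys H := ProdSys {
  ps_set : set (V * H) ;
  ps_mul : V * H -> V * H -> V * H }.

Definition ps_fiber H (E : prodsys H) (a : V) : set H := [set x | ps_set E (a, x)].

Definition prodsys_eq H (E F : prodsys H) := ps_set E = ps_set F /\
  forall x y, ps_set E x -> ps_set E y -> ps_mul E x y = ps_mul F x y.

Definition borelVH H : set (set (V * H)) :=
  <<s [set A `*` U | A in open & U in @hopen R H] >>.

Definition borel_iso H K (A : set (V * H)) (B : set (V * K))
    (theta : V * H -> V * K) :=
  [/\ set_bij A B theta,
      forall D, borelVH D -> exists2 D', borelVH D' &
        A `&` theta @^-1` D = A `&` D' &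
      forall D', borelVH D' -> exists2 D, borelVH D &
        theta @` (A `&` D') = B `&` D].

Definition prodsys_isomorphic H K (E : prodsys H) (F : prodsys K) :=
  exists theta : V * H -> V * K,
  [/\ borel_iso (ps_set E) (ps_set F) theta,
      forall x, ps_set E x -> (theta x).1 = x.1,
      forall a, unitary_on (ps_fiber E a) (ps_fiber F a)
        (fun x => (theta (a, x)).2) &
      forall x y, ps_set E x -> ps_set E y ->
        theta (ps_mul E x y) = ps_mul F (theta x) (theta y)].

Definition isometry_semigroup C H (W : V -> H -> H) :=
  [/\ forall a, C a -> forall (c : R[i]) x y, W a (c *: x + y) = c *: W a x + W a y,
      forall a, C a -> forall x y, hdot (W a x) (W a y) = hdot x y,
      forall x, W 0 x = x,
      forall a b, C a -> C b -> forall x, W (a + b) x = W a (W b x) &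
      forall x a, C a ->
        (fun b => hnorm (W b x - W a x)) @ within C (nbhs a) --> (0 : R)].

Section ccr.
Variables (C : set V) (H G : innerProductSpace R).
Variables (W : V -> H -> H) (e : H -> G).

Definition ker_adj (a : V) : set H := [set x | adjoint (W a) x = 0].

(* \Gamma(ker W_a^* ) as a subspace of \Gamma(H) *)
Definition ccr_fiber (a : V) : set G := closed_span (e @` ker_adj a).

Definition is_ccr_mul (a b : V) (m : G -> G -> G) :=
  [/\ forall x y, ccr_fiber a x -> ccr_fiber b y -> ccr_fiber (a + b) (m x y),
      forall (c : R[i]) x x' y, ccr_fiber a x -> ccr_fiber a x' -> ccr_fiber b y ->
        m (c *: x + x') y = c *: m x y + m x' y,
      forall (c : R[i]) x y y', ccr_fiber a x -> ccr_fiber b y -> ccr_fiber b y' ->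
        m x (c *: y + y') = c *: m x y + m x y',
      forall x x' y y', ccr_fiber a x -> ccr_fiber a x' ->
        ccr_fiber b y -> ccr_fiber b y' ->
        hdot (m x y) (m x' y') = hdot x x' * hdot y y' &
      forall z z', ker_adj a z -> ker_adj b z' -> m (e z) (e z') = e (z + W a z')].

(* [is_ccr_mul] determines m on ccr_fiber a x ccr_fiber b, since the exponential
   vectors are total there and |m x y| = |x| |y|. *)
Definition ccr_mul (a b : V) : G -> G -> G :=
  xget (fun _ _ => 0) [set m | is_ccr_mul a b m].

(* The product system of the CCR flow associated to the semigroup W. *)
Definition ccr_prodsys : prodsys G := ProdSys
  [set p | C p.1 /\ ccr_fiber p.1 p.2]
  (fun x y => (x.1 + y.1, ccr_mul x.1 y.1 x.2 y.2)).

End ccr.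
End product_systems.

Section actions.
Context {R : realType} {d : nat} {dS} {S : measurableType dS}.
Local Notation V := 'rV[R]_d.

Definition borelV : Type := g_sigma_algebraType (@open V).

Definition measurable_action (act : S -> V -> S) :=
  [/\ forall y, act y 0 = y,
      forall y a b, act (act y a) b = act y (a + b) &
      measurable_fun setT (fun p : S * borelV => act p.1 p.2)].

Definition translate (act : S -> V -> S) (A : set S) (a : V) : set S :=
  [set act y a | y in A].

End actions.

Section random_fields.
Context {R : realType} {dO} {O : measurableType dO} (P : probability O R).

(* Complete sub-sigma-algebras contain all the P-null sets. *)
Definition complete_sigma (G : set (set O)) : set (set O) :=
  <<s G `|` P.-negligible >>.

Definition is_class (x : cL2_ips P) (f : O -> R[i]) :=
  exists2 g : cLfunType P, g = f :> (O -> R[i]) & x = \pi_(cL2 P) g.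

(* L^2(O, F, P) inside L^2(O, P) *)
Definition cL2_sub (F : set (set O)) : set (cL2_ips P) :=
  [set x | exists2 f : O -> R[i], is_class x f & forall A : set R, measurable A ->
     F ((fun w => complex.Re (f w)) @^-1` A) /\
     F ((fun w => complex.Im (f w)) @^-1` A)].

(* Pointwise product, when it is square integrable. *)
Definition cL2_mul (x y : cL2_ips P) : cL2_ips P :=
  xget 0 [set z | exists f g : cLfunType P,
    [/\ x = \pi_(cL2 P) f, y = \pi_(cL2 P) g & is_class z (fun w => f w * g w)]].

Context {dS} {S : measurableType dS} {d : nat}.
Local Notation V := 'rV[R]_d.
Variables (act : S -> V -> S) (X : set S) (Z : set S -> O -> \bar R).

Definition sigma_field (D : set S) : set (set O) := complete_sigma
  [set A | exists B (M : set (\bar R)),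
     [/\ measurable B, B `<=` D, measurable M & A = Z B @^-1` M]].

Definition region (a b : V) : set S := translate act X a `\` translate act X b.

Definition is_shift (a b c : V) (T : cL2_ips P -> cL2_ips P) :=
  unitary_on (cL2_sub (sigma_field (region a b)))
             (cL2_sub (sigma_field (region (a + c) (b + c)))) T /\
  forall n (B : 'I_n -> set S) (f : n.-tuple (\bar R) -> R[i]),
    (forall i, measurable (B i) /\ B i `<=` region a b) ->
    measurable_fun setT (fun t => complex.Re (f t)) ->
    measurable_fun setT (fun t => complex.Im (f t)) ->
    forall x, is_class x (fun w => f [tuple Z (B i) w | i < n]) ->
      is_class (T x) (fun w => f [tuple Z (translate act (B i) c) w | i < n]).

(* The unitary S_c from L^2(F_{a,b}) to L^2(F_{a+c,b+c}): [is_shift] determines it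
   on L^2(F_{a,b}), by density of the functions of finitely many Z(B). *)
Definition shift (a b c : V) : cL2_ips P -> cL2_ips P :=
  xget (fun=> 0) [set T | is_shift a b c T].

(* (a, f)(b, g) = (a + b, f S_a(g)), with S_a : L^2(F_{0,b}) -> L^2(F_{a,a+b}) *)
Definition field_prodsys (C : set V) : prodsys (cL2_ips P) := ProdSys
  [set p | C p.1 /\ cL2_sub (sigma_field (region 0 p.1)) p.2]
  (fun x y => (x.1 + y.1, cL2_mul x.2 (shift 0 y.1 x.1 y.2))).

End random_fields.

Definition posR (R : realType) : Type := {posnum R}.
HB.instance Definition _ (R : realType) := Choice.on (posR R).
HB.instance Definition _ (R : realType) := isPointed.Build (posR R) 1%:pos.
Definition posR_val (R : realType) (r : posR R) : R := r%:num.

(* ]0, +oo[ with its Borel sigma-algebra *)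
Definition bposR (R : realType) : Type := g_sigma_algebra_preimageType (@posR_val R).
HB.instance Definition _ (R : realType) := Measurable.on (bposR R).

Section poisson_process.
Local Open Scope ereal_scope.
Context {R : realType} {dO} {O : measurableType dO} (P : probability O R).

Definition point_process dS (S : measurableType dS)
    (eta : O -> {measure set S -> \bar R}) :=
  [/\ forall w, sigma_finite setT (eta w),
      forall w B, measurable B ->
        eta w B = +oo \/ exists k : nat, eta w B = k%:R%:E &
      forall B, measurable B -> measurable_fun setT (fun w => eta w B)].

Definition poisson_process dS (S : measurableType dS) (lambda : set S -> \bar R)
    (eta : O -> {measure set S -> \bar R}) :=
  [/\ point_process eta,
      (* the second argument of [poisson_prob] is a dummy *)
      forall B (l : R), measurable B -> lambda B = l%:E -> forall k : nat,
        P [set w | eta w B = k%:R%:E] = poisson_prob l k [set k],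
      forall B, measurable B -> lambda B = +oo -> P [set w | eta w B = +oo] = 1 &
      forall n (B : 'I_n -> set S), (forall i, measurable (B i)) ->
        trivIset setT B -> forall M : 'I_n -> set (\bar R),
        (forall i, measurable (M i)) ->
        P (\bigcap_i ((fun w => eta w (B i)) @^-1` M i)) =
        \prod_(i < n) P ((fun w => eta w (B i)) @^-1` M i)].

(* xi(B) = \int r 1_B(y) eta(d(y, r)) *)
Definition compound dY (Y : measurableType dY)
    (eta : O -> {measure set (Y * bposR R) -> \bar R}) (B : set Y) (w : O) : \bar R :=
  \int[eta w]_z (posR_val z.2 * \1_B z.1)%:E.

End poisson_process.

Definition act_fst (R : realType) (d : nat) (Y : Type) (Z : Type)
    (act : Y -> 'rV[R]_d -> Y) (z : Y * Z) (a : 'rV[R]_d) : Y * Z :=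
  (act z.1 a, z.2).

(* Main.v *)
Require Import Defs.
From HB Require Import structures.
From mathcomp Require Import all_boot all_order all_algebra sesquilinear.
From mathcomp Require Import complex.
From mathcomp Require Import all_classical all_reals all_analysis.
From mathcomp Require Import measurable_realfun.
From mathcomp Require Import ring lra zify.

(** For a simple function u on a space S with intensity lam, put
    e(u) = prod_z (1 + u(z)) exp (- int u d lam), the product over the points z of the Poisson
    process eta. Then <e(u)|e(v)> = exp <u|v>, so e extends to L^2(lam), and its values on
    functions supported in D are total in L^2 of the sigma-algebra of eta on D: the closed span
    of these values is stable under multiplication by z^eta(B), B in D, |z| = 1. The second
    quantization of the translation by a maps e(u) to e(U_a u) and is the shift S_a, and
    e(u) e(v) = e(u + v) when u and v have disjoint supports. Hence the product system of eta
    is that of the CCR flow of the semigroup U_a on L^2(X x (0,oo)), where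
    ker U_a^* = L^2((X minus X + a) x (0,oo)). U is strongly continuous because it is measurable
    and L^2 is separable (Steinhaus).

    For E = E~ the points of eta over D, D included in X, must be recovered from xi. An atom
    A of the Borel structure that meets X at y is null: choose a with y not in X + a; if A
    met A + s a, s > 0, then all y - n s a would be in A, hence in X, and y in X + a; so the
    translates of A along a are disjoint. So if a set of finite measure is cut into the
    cells of ever finer finite partitions, almost surely each cell eventually carries at
    most one jump of size at least 1/k, while the small jumps have a small sum; the number
    of jumps at least x is the eventual number of cells B with xi(B) >= x. *)

Set Implicit Arguments.
Unset Strict Implicit.
Unset Printing Implicit Defensive.
Import Order.TTheory GRing.Theory Num.Def Num.Theory.
Import numFieldNormedType.Exports.
Local Open Scope classical_set_scope.
Local Open Scope ring_scope.
Import HBNNSimple.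
Local Notation Re := complex.Re.
Local Notation Im := complex.Im.

(** * Hilbert spaces *)

Section ips_theory.
Context {R : realType} {H : innerProductSpace R}.
Implicit Types (x y z : H) (c : R[i]).

(** The operators [shift], [cL2_mul], [adjoint] and [ccr_mul] are chosen among the maps with a given
    property. Each must be shown to exist, and to be determined on the fibre where it is used. So
    [E = Et] is more than an equality of sigma-algebras: the shift of [xi] is a priori another
    unitary than the shift of [eta], and both are identified with the same second quantization.

    Questions on sigma-algebras become questions on closed subspaces of L^2: the bounded multipliers
    that preserve a closed subspace form a class to which the functional monotone class argument
    applies. They need not be stable under conjugation, so counts are recovered from non-negative
    powers of z^eta(B) alone, with the single z = (3 + 4i)/5, which is no root of unity.

    Countably many disjoint sets of equal measure do not contradict sigma-finiteness; that an atom
    is null comes from a continuum of disjoint translates, through Tonelli.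

    The definition of a Poisson process gives independence of finitely many counts. Independence of
    the whole fields over disjoint sets comes from <e(u)|e(v)> = 1 for orthogonal u and v; it makes
    the products square integrable. *)

Definition hlim (u : nat -> H) (l : H) := (fun n => hnorm (u n - l)) @ \oo --> (0 : R).
(** The squared modulus with values in [R]: a polynomial in the two coordinates, convenient under
    integrals and for real arithmetic. *)
Definition csqn (c : R[i]) : R := Re c ^+ 2 + Im c ^+ 2.

Lemma hdotC x y : hdot x y = (hdot y x)^*%C.
Proof. by rewrite /hdot hermC expr0 mul1r. Qed.
Lemma hdotDl x y z : hdot (x + y) z = hdot x z + hdot y z.
Proof. exact: linearDl. Qed.
Lemma hdotDr x y z : hdot z (x + y) = hdot z x + hdot z y.
Proof. exact: linearDr. Qed.
Lemma hdotNl x z : hdot (- x) z = - hdot x z.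
Proof. exact: linearNl. Qed.
Lemma hdotNr x z : hdot z (- x) = - hdot z x.
Proof. exact: linearNr. Qed.
Lemma hdotZl c x z : hdot (c *: x) z = c * hdot x z.
Proof. exact: linearZl_LR. Qed.
Lemma hdotZr c x z : hdot z (c *: x) = c^*%C * hdot z x.
Proof. exact: linearZr_LR. Qed.
Lemma hdot0l z : hdot 0 z = 0. Proof. exact: linear0l. Qed.
Lemma hdot0r z : hdot z 0 = 0. Proof. exact: linear0r. Qed.

Lemma hdotxx_ge0 x : 0 <= Re (hdot x x).
Proof.
have : 0 <= hdot x x by rewrite /hdot dnorm_ge0.
by rewrite lecE => /andP[].
Qed.
Lemma hnorm_ge0 x : 0 <= hnorm x. Proof. exact: sqrtr_ge0. Qed.
Lemma hnorm_sq x : hnorm x ^+ 2 = Re (hdot x x).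
Proof. by rewrite sqr_sqrtr// hdotxx_ge0. Qed.
Lemma hdotxxE x : hdot x x = (hnorm x ^+ 2)%:C%C.
Proof.
have : 0 <= hdot x x by rewrite /hdot dnorm_ge0.
by rewrite lecE hnorm_sq => /andP[/eqP h _]; case: (hdot x x) h => a b /= ->.
Qed.
Lemma hnorm_eq0 x : hnorm x = 0 -> x = 0.
Proof.
by move=> x0; apply/eqP; rewrite -(dnorm_eq0 (ips_dot H)) -/(hdot _ _) hdotxxE x0 expr0n.
Qed.
Lemma hnorm0 : hnorm (0 : H) = 0.
Proof. by rewrite /hnorm hdot0l sqrtr0. Qed.
Lemma hnormN x : hnorm (- x) = hnorm x.
Proof. by rewrite /hnorm hdotNl hdotNr opprK. Qed.
Lemma hnorm_distC x y : hnorm (x - y) = hnorm (y - x).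
Proof. by rewrite -hnormN opprB. Qed.

Lemma RehdotC x y : Re (hdot x y) = Re (hdot y x).
Proof. by rewrite hdotC; case: (hdot y x). Qed.
Lemma hnormDsq x y : hnorm (x + y) ^+ 2 =
  hnorm x ^+ 2 + hnorm y ^+ 2 + 2 * Re (hdot x y).
Proof.
rewrite !hnorm_sq hdotDl !hdotDr !raddfD /= (RehdotC y x); lra.
Qed.
Lemma hnormZsq c x : hnorm (c *: x) ^+ 2 = csqn c * hnorm x ^+ 2.
Proof.
by rewrite hnorm_sq hdotZl hdotZr hdotxxE /csqn; case: c => a b /=; ring.
Qed.

Lemma csqn_ge0 c : 0 <= csqn c.
Proof. by rewrite addr_ge0 ?sqr_ge0. Qed.
Lemma hnormZ c x : hnorm (c *: x) = Num.sqrt (csqn c) * hnorm x.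
Proof.
apply: (@pexpIrn _ 2) => //; rewrite ?nnegrE ?mulr_ge0 ?sqrtr_ge0 ?hnorm_ge0//.
by rewrite hnormZsq exprMn (sqr_sqrtr (csqn_ge0 c)).
Qed.

Lemma Re_hdot_le x y : `|Re (hdot x y)| <= hnorm x * hnorm y.
Proof.
have q t : 0 <= hnorm x ^+ 2 + t ^+ 2 * hnorm y ^+ 2 + 2 * t * Re (hdot x y).
  have := sqr_ge0 (hnorm (x + t%:C%C *: y)); rewrite hnormDsq hnormZsq hdotZr.
  rewrite /csqn /=; case: (hdot x y) => a b /=; rewrite oppr0 mul0r subr0 expr0n addr0.
  by rewrite [2 * (t * a)]mulrA.
have := hnorm_ge0 x; have := hnorm_ge0 y.
move: q; set a := hnorm x; set b := hnorm y; set r := Re _ => q.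
rewrite le_eqVlt => /predU1P[b0|b0] a0.
  rewrite -b0 mulr0 normr_le0; apply/negPn/negP => r0.
  (* For b = 0 the quadratic is a^2 + 2tr, and this t makes it equal to -1. *)
  have := q (- (a ^+ 2 + 1) / (2 * r)); rewrite -b0 expr0n mulr0 addr0.
  have -> : 2 * (- (a ^+ 2 + 1) / (2 * r)) * r = - (a ^+ 2 + 1) by field.
  by lra.
rewrite -(ler_pXn2r (n := 2)) ?nnegrE ?mulr_ge0//; last exact: ltW.
rewrite real_normK ?num_real//.
(* The t at which the quadratic is minimal. *)
have := q (- r / b ^+ 2).
have -> : a ^+ 2 + (- r / b ^+ 2) ^+ 2 * b ^+ 2 + 2 * (- r / b ^+ 2) * r =
          (a ^+ 2 * b ^+ 2 - r ^+ 2) / b ^+ 2 by field; rewrite gt_eqF.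
by rewrite pmulr_lge0 ?invr_gt0 ?exprn_gt0// subr_ge0 exprMn.
Qed.

Lemma Im_hdotE x y : Im (hdot x y) = Re (hdot x ('i%C *: y)).
Proof. by rewrite hdotZr; case: (hdot x y) => a b /=; ring. Qed.

Lemma hnormD x y : hnorm (x + y) <= hnorm x + hnorm y.
Proof.
rewrite -(ler_pXn2r (n := 2)) ?nnegrE ?addr_ge0 ?hnorm_ge0//.
rewrite hnormDsq; have := le_trans (ler_norm _) (Re_hdot_le x y); nra.
Qed.
Lemma hnorm_tri z x y : hnorm (x - y) <= hnorm (x - z) + hnorm (z - y).
Proof. by rewrite (le_trans _ (hnormD _ _))// addrA subrK. Qed.

Lemma hlimP (u : nat -> H) l : hlim u l <->
  forall e : R, 0 < e -> \forall n \near \oo, hnorm (u n - l) < e.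
Proof.
split=> [/cvgrPdist_lt ul e e0|ul].
  by have := ul _ e0; apply: filterS => n; rewrite sub0r normrN ger0_norm ?hnorm_ge0.
apply/cvgrPdist_lt => e e0; have := ul _ e0.
by apply: filterS => n; rewrite sub0r normrN ger0_norm ?hnorm_ge0.
Qed.

Lemma hlim_le (u : nat -> H) l (e : nat -> R) :
  (forall n, hnorm (u n - l) <= e n) -> e @ \oo --> (0 : R) -> hlim u l.
Proof.
move=> ue e0; apply: (squeeze_cvgr _ (cvg_cst 0) e0).
by apply: nearW => n; rewrite hnorm_ge0 ue.
Qed.

Lemma hlim_cst x : hlim (fun=> x) x.
Proof. by apply: (hlim_le (e := fun=> 0)) (cvg_cst _) => n; rewrite subrr hnorm0. Qed.

Lemma hlimD u v x y : hlim u x -> hlim v y -> hlim (fun n => u n + v n) (x + y).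
Proof.
move=> ux vy; apply: (hlim_le (e := fun n => hnorm (u n - x) + hnorm (v n - y))).
  by move=> n; rewrite opprD addrACA hnormD.
by rewrite -[X in _ --> X](addr0 0); exact: cvgD.
Qed.
Lemma hlimZ u c x : hlim u x -> hlim (fun n => c *: u n) (c *: x).
Proof.
move=> ux; apply: (hlim_le (e := fun n => Num.sqrt (csqn c) * hnorm (u n - x))).
  by move=> n; rewrite -scalerBr hnormZ.
by rewrite -[X in _ --> X](mulr0 (Num.sqrt (csqn c))); apply: cvgM => //; exact: cvg_cst.
Qed.
Lemma hlimB u v x y : hlim u x -> hlim v y -> hlim (fun n => u n - v n) (x - y).
Proof.
move=> ux /(hlimZ (-1)) vy.
rewrite -scaleN1r; have := hlimD ux vy.
by congr hlim; apply/funext => n; rewrite scaleN1r.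
Qed.
Lemma hlim_norm u x : hlim u x -> (fun n => hnorm (u n)) @ \oo --> hnorm x.
Proof.
move=> ux; apply/cvgrPdist_le => e e0; move/hlimP : ux => /(_ _ e0).
apply: filterS => n h; rewrite ler_norml; apply/andP; split.
  rewrite lerBrDl; have := hnorm_tri x (u n) 0; rewrite !subr0; lra.
rewrite lerBlDr; have := hnorm_tri (u n) x 0; rewrite !subr0 hnorm_distC; lra.
Qed.
Lemma hlim_uniq u x y : hlim u x -> hlim u y -> x = y.
Proof.
move=> ux uy; apply/eqP; rewrite -subr_eq0; apply/eqP/hnorm_eq0.
have := hlim_norm (hlimB ux uy).
have -> : (fun n => hnorm (u n - u n)) = fun=> 0 by apply/funext => n; rewrite subrr hnorm0.
by move=> h; apply: (cvg_unique _ h (cvg_cst _)); exact: Rhausdorff.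
Qed.

Lemma hlim_Redot u v x y : hlim u x -> hlim v y ->
  (fun n => Re (hdot (u n) (v n))) @ \oo --> Re (hdot x y).
Proof.
move=> ux vy; rewrite -subr_cvg0.
pose e n := hnorm (u n - x) * hnorm (v n) + hnorm x * hnorm (v n - y).
have e0 : e @ \oo --> (0 : R).
  rewrite -[0](addr0 0) -{1}(mul0r (hnorm y)) -{2}(mulr0 (hnorm x)).
  by apply: cvgD; apply: cvgM => //; [exact: hlim_norm|exact: cvg_cst].
apply/norm_cvg0P; apply: (squeeze_cvgr _ (cvg_cst 0) e0).
apply: nearW => n; rewrite normr_ge0 /=.
have -> : Re (hdot (u n) (v n)) - Re (hdot x y) =
  Re (hdot (u n - x) (v n)) + Re (hdot x (v n - y)).
  by rewrite !hdotDl !hdotDr !hdotNl !hdotNr !raddfD /= !raddfN /=; lra.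
by rewrite (le_trans (ler_normD _ _))// lerD// Re_hdot_le.
Qed.
Lemma hlim_Imdot u v x y : hlim u x -> hlim v y ->
  (fun n => Im (hdot (u n) (v n))) @ \oo --> Im (hdot x y).
Proof.
move=> ux vy; rewrite Im_hdotE; under eq_fun do rewrite Im_hdotE.
by apply: hlim_Redot => //; exact: hlimZ.
Qed.

Lemma hlim_sub (f : nat -> nat) u x : (forall n, (n <= f n)%N) -> hlim u x ->
  hlim (u \o f) x.
Proof.
move=> fh ux; apply: (cvg_comp f (fun n => hnorm (u n - x))) ux.
by apply/cvgnyPge => A; exists A => // n /= An; exact: leq_trans (fh n).
Qed.

Definition hsubspace (M : set H) := [/\ M 0,
  forall c x y, M x -> M y -> M (c *: x + y) &
  forall u x, (forall n, M (u n)) -> hlim u x -> M x].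

Lemma hsub0 M : hsubspace M -> M 0. Proof. by case. Qed.
Lemma hsubP M c x y : hsubspace M -> M x -> M y -> M (c *: x + y).
Proof. by case=> _ + _; exact. Qed.
Lemma hsubZ M c x : hsubspace M -> M x -> M (c *: x).
Proof. by move=> HM Mx; rewrite -[_ *: _]addr0; apply: hsubP => //; exact: hsub0. Qed.
Lemma hsubD M x y : hsubspace M -> M x -> M y -> M (x + y).
Proof. by move=> HM Mx My; rewrite -[x]scale1r; exact: hsubP. Qed.
Lemma hsubB M x y : hsubspace M -> M x -> M y -> M (x - y).
Proof. by move=> HM Mx My; rewrite addrC -scaleN1r; exact: hsubP. Qed.
Lemma hsub_sum M n (F : 'I_n -> H) : hsubspace M -> (forall i, M (F i)) ->
  M (\sum_(i < n) F i).
Proof.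
move=> HM; elim: n F => [|n IH] F MF; first by rewrite big_ord0; exact: hsub0.
by rewrite big_ord_recr /=; apply: hsubD => //; exact: IH.
Qed.
Lemma hsub_lim M u x : hsubspace M -> (forall n, M (u n)) -> hlim u x -> M x.
Proof. by case=> _ _; exact. Qed.

Lemma hlim_approx (M : set H) x :
  (forall e : R, 0 < e -> exists2 y, M y & hnorm (x - y) < e) ->
  exists2 u : nat -> H, (forall n, M (u n)) & forall n, hnorm (x - u n) < 2^-1 ^+ n.
Proof.
move=> h; have h2 n : {y | M y & hnorm (x - y) < 2^-1 ^+ n}.
  have p : (0 : R) < 2^-1 ^+ n by rewrite exprn_gt0// invr_gt0.
  by have /cid2[y My xy] := h _ p; exists y.
by exists (fun n => s2val (h2 n)) => n; case: (h2 n).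
Qed.

Lemma hlim_geo u x : (forall n, hnorm (x - u n) < 2^-1 ^+ n) -> hlim u x.
Proof.
move=> h; apply: (hlim_le (e := fun n => 2^-1 ^+ n)).
  by move=> n; rewrite hnorm_distC ltW.
by apply: cvg_expr; rewrite ger0_norm ?invr_ge0// invf_lt1 ?ltr1n.
Qed.

Lemma hsub_closure M x : hsubspace M ->
  (forall e : R, 0 < e -> exists2 y, M y & hnorm (x - y) < e) -> M x.
Proof.
by move=> HM /hlim_approx[u Mu /hlim_geo]; exact: hsub_lim.
Qed.

Lemma closed_span_min (S M : set H) : hsubspace M -> S `<=` M -> closed_span S `<=` M.
Proof.
move=> HM SM x xS; apply: hsub_closure => // e e0.
have [n [c [v [Sv xv]]]] := xS _ e0; exists (\sum_(i < n) c i *: v i) => //.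
by apply: hsub_sum => // i; apply: hsubZ => //; exact: SM.
Qed.

Lemma closed_span_sub (S : set H) : S `<=` closed_span S.
Proof.
move=> x Sx e e0; exists 1%N, (fun=> 1), (fun=> x); split=> //.
by rewrite big_ord1 scale1r subrr hnorm0.
Qed.

Lemma closed_span_hsub (S : set H) : hsubspace (closed_span S).
Proof.
split.
- by move=> e e0; exists 0%N, (fun=> 0), (fun=> 0); split=> [[]//|]; rewrite big_ord0 subrr hnorm0.
- move=> c x y Sx Sy e e0.
  (* The added 1 keeps k positive when c = 0. *)
  pose k := Num.sqrt (csqn c) + 1.
  have k0 : 0 < k by rewrite ltr_wpDl// sqrtr_ge0.
  have [n [a [v [Sv xv]]]] := Sx _ (divr_gt0 e0 (mulr_gt0 (ltr0n _ 2) k0)).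
  have [m [b [w [Sw yw]]]] := Sy _ (divr_gt0 e0 (ltr0n _ 2)).
  exists (n + m)%N, (fun i => match fintype.split i with inl j => c * a j | inr j => b j end),
    (fun i => match fintype.split i with inl j => v j | inr j => w j end); split.
    by move=> i; case: (fintype.split i).
  rewrite big_split_ord /=.
  under eq_bigr do rewrite -[lshift m _]/(unsplit (inl _)) unsplitK.
  under [X in _ - (_ + X)]eq_bigr do rewrite -[rshift n _]/(unsplit (inr _)) unsplitK.
  under eq_bigr do rewrite -scalerA.
  rewrite -scaler_sumr opprD addrACA -scalerBr.
  rewrite (le_lt_trans (hnormD _ _))// hnormZ (splitr e) ltr_leD// ?(ltW yw)//.
  move: xv; set s := hnorm _ => xv.
  have : k * s < k * (e / (2 * k)) by rewrite ltr_pM2l.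
  have -> : k * (e / (2 * k)) = e / 2 by field; rewrite gt_eqF.
  by apply: le_lt_trans; rewrite ler_wpM2r ?hnorm_ge0// lerDl.
- move=> u x Su /hlimP ux e e0.
  have e2 : 0 < e / 2 by rewrite divr_gt0.
  have [N _ /(_ N (leqnn N)) uN] := ux _ e2.
  have [n [c [v [Sv xv]]]] := Su N _ e2; exists n, c, v; split=> //.
  by rewrite (le_lt_trans (hnorm_tri (u N) _ _))// (splitr e) ltrD// hnorm_distC.
Qed.

Lemma hcauchy_lim (u : nat -> H) : hcomplete H ->
  (forall e : R, 0 < e -> exists N, forall m n, (N <= m)%N -> (N <= n)%N ->
     hnorm (u m - u n) < e) -> exists l, hlim u l.
Proof. by move=> HH /HH. Qed.

Lemma hlim_dotl (u : nat -> H) x z w : hlim u x -> (forall n, hdot (u n) z = w) ->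
  hdot x z = w.
Proof.
move=> ux h; have r := hlim_Redot ux (hlim_cst z); have i := hlim_Imdot ux (hlim_cst z).
apply/eqP; rewrite eq_complex; apply/andP; split; apply/eqP.
- have e : (fun n => Re (hdot (u n) z)) = fun=> Re w by apply/funext => n; rewrite h.
  by rewrite e in r; apply: (cvg_unique _ r (cvg_cst _)); exact: Rhausdorff.
- have e : (fun n => Im (hdot (u n) z)) = fun=> Im w by apply/funext => n; rewrite h.
  by rewrite e in i; apply: (cvg_unique _ i (cvg_cst _)); exact: Rhausdorff.
Qed.
End ips_theory.

(** * The complex exponential *)

Section cexp_theory.
Context {R : realType}.
Implicit Types z w : R[i].

Lemma cexpD z w : cexp (z + w) = cexp z * cexp w.
Proof.
case: z w => a b [c d]; rewrite /cexp /= expRD cosD sinD.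
by apply/eqP; rewrite eq_complex /=; apply/andP; split; apply/eqP; ring.
Qed.
Lemma cexp0 : cexp 0 = 1 :> R[i].
Proof.
rewrite /cexp /= expR0 cos0 sin0.
by apply/eqP; rewrite eq_complex /= !mulr0 !mul0r !mulr1 subr0 addr0 !eqxx.
Qed.
Lemma cexp_conj z : cexp (z^*)%C = (cexp z)^*%C.
Proof.
case: z => a b; rewrite /cexp /= cosN sinN.
by apply/eqP; rewrite eq_complex /=; apply/andP; split; apply/eqP; ring.
Qed.
Lemma cexp_sum (I : Type) (r : seq I) (F : I -> R[i]) :
  cexp (\sum_(i <- r) F i) = \prod_(i <- r) cexp (F i).
Proof. exact: (big_morph _ cexpD cexp0). Qed.
Lemma cexpR (r : R) : cexp r%:C%C = (expR r)%:C%C.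
Proof.
rewrite /cexp /= cos0 sin0.
by apply/eqP; rewrite eq_complex /= !mulr0 !mul0r !mulr1 subr0 addr0 !eqxx.
Qed.
Lemma Re_cexp z : Re (cexp z) = expR (Re z) * cos (Im z).
Proof. by rewrite /cexp /= mul0r subr0. Qed.
Lemma Im_cexp z : Im (cexp z) = expR (Re z) * sin (Im z).
Proof. by rewrite /cexp /= mul0r addr0. Qed.
Lemma cvg_Recexp (u : nat -> R[i]) z :
  (fun n => Re (u n)) @ \oo --> Re z -> (fun n => Im (u n)) @ \oo --> Im z ->
  (fun n => Re (cexp (u n))) @ \oo --> Re (cexp z).
Proof.
move=> uz vz; rewrite Re_cexp; under eq_fun do rewrite Re_cexp.
apply: cvgM; first by apply: continuous_cvg => //; exact: continuous_expR.
by apply: continuous_cvg => //; exact: continuous_cos.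
Qed.
Lemma cvg_Imcexp (u : nat -> R[i]) z :
  (fun n => Re (u n)) @ \oo --> Re z -> (fun n => Im (u n)) @ \oo --> Im z ->
  (fun n => Im (cexp (u n))) @ \oo --> Im (cexp z).
Proof.
move=> uz vz; rewrite Im_cexp; under eq_fun do rewrite Im_cexp.
apply: cvgM; first by apply: continuous_cvg => //; exact: continuous_expR.
by apply: continuous_cvg => //; exact: continuous_sin.
Qed.
End cexp_theory.

Lemma cvg_ext (R : realType) (f g : nat -> R) (a b : R) :
  f @ \oo --> a -> f =1 g -> a = b -> g @ \oo --> b.
Proof. by move=> fa /funext <- <-. Qed.

(** * Extending maps that are known through their Gram matrix *)

Section extension.
Context {R : realType}.
Implicit Types H G K : innerProductSpace R.

Lemma hdot_lim_eq H G (u v : nat -> H) (u' v' : nat -> G) x y x' y' :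
  hlim u x -> hlim v y -> hlim u' x' -> hlim v' y' ->
  (forall n, hdot (u' n) (v' n) = hdot (u n) (v n)) -> hdot x' y' = hdot x y.
Proof.
move=> ux vy ux' vy' E; apply/eqP; rewrite eq_complex; apply/andP; split; apply/eqP.
- have := hlim_Redot ux' vy'; under eq_fun do rewrite E.
  by move=> h; apply: (cvg_unique _ h (hlim_Redot ux vy)); exact: Rhausdorff.
- have := hlim_Imdot ux' vy'; under eq_fun do rewrite E.
  by move=> h; apply: (cvg_unique _ h (hlim_Imdot ux vy)); exact: Rhausdorff.
Qed.

Lemma hdot_lim_cexp H G (u v : nat -> H) (u' v' : nat -> G) x y x' y' :
  hlim u x -> hlim v y -> hlim u' x' -> hlim v' y' ->
  (forall n, hdot (u' n) (v' n) = cexp (hdot (u n) (v n))) -> hdot x' y' = cexp (hdot x y).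
Proof.
move=> ux vy ux' vy' E; apply/eqP; rewrite eq_complex; apply/andP; split; apply/eqP.
- have := hlim_Redot ux' vy'; under eq_fun do rewrite E.
  move=> h; apply: (cvg_unique _ h); first exact: Rhausdorff.
  by apply: cvg_Recexp; [exact: hlim_Redot|exact: hlim_Imdot].
- have := hlim_Imdot ux' vy'; under eq_fun do rewrite E.
  move=> h; apply: (cvg_unique _ h); first exact: Rhausdorff.
  by apply: cvg_Imcexp; [exact: hlim_Redot|exact: hlim_Imdot].
Qed.

(** The Cauchy criterion in the form that Gram identities provide: distances along two index
    sequences [m] and [n], both tending to infinity. If the sequence were not Cauchy, bad pairs
    beyond every k would form two such sequences. *)
Lemma hlim_of_cauchy_seq H (u : nat -> H) : hcomplete H ->
  (forall m n : nat -> nat, (forall k, (k <= m k)%N) -> (forall k, (k <= n k)%N) ->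
    (fun k => hnorm (u (m k) - u (n k)) ^+ 2) @ \oo --> (0 : R)) ->
  exists l, hlim u l.
Proof.
move=> HH h; apply: hcauchy_lim => // e e0; apply: contrapT => /forallNP no.
have w k : {mn : nat * nat | [/\ (k <= mn.1)%N, (k <= mn.2)%N &
    e <= hnorm (u mn.1 - u mn.2)]}.
  apply: cid; have := no k => /existsNP[m /existsNP[n /not_implyP[km /not_implyP[kn]]]].
  by move=> /negP; rewrite -leNgt => ?; exists (m, n).
have /cvgrPdist_lt := h (fun k => (sval (w k)).1) (fun k => (sval (w k)).2)
  (fun k => let: And3 a _ _ := svalP (w k) in a)
  (fun k => let: And3 _ a _ := svalP (w k) in a).
move=> /(_ _ (exprn_gt0 2 e0))[N _ /(_ N (leqnn N))] /=; case: (w N) => -[m n] /= [_ _ emn].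
rewrite sub0r normrN ger0_norm ?sqr_ge0// ltNge ler_pXn2r// ?nnegrE ?hnorm_ge0 ?emn//.
exact: ltW.
Qed.

Lemma hnormB_sq H (x y : H) :
  hnorm (x - y) ^+ 2 = Re (hdot x x) + Re (hdot y y) - 2 * Re (hdot x y).
Proof. by rewrite hnormDsq hnormN !hnorm_sq hdotNr raddfN /=; lra. Qed.

Lemma cexp_gram_cvg H G (I : Type) (phi : I -> H) (E : I -> G) (i j : nat -> I) x :
  (forall i j, hdot (E i) (E j) = cexp (hdot (phi i) (phi j))) ->
  hlim (phi \o i) x -> hlim (phi \o j) x ->
  (fun n => hnorm (E (i n) - E (j n)) ^+ 2) @ \oo --> (0 : R).
Proof.
move=> gram ix jx.
have F (k l : nat -> I) : hlim (phi \o k) x -> hlim (phi \o l) x ->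
   (fun n => Re (cexp (hdot (phi (k n)) (phi (l n))))) @ \oo --> Re (cexp (hdot x x)).
  by move=> kx lx; apply: cvg_Recexp; [exact: hlim_Redot|exact: hlim_Imdot].
have h2 : (fun n => 2 * Re (cexp (hdot (phi (i n)) (phi (j n))))) @ \oo -->
    2 * Re (cexp (hdot x x)) by apply: cvgM; [exact: cvg_cst|exact: F].
have h := cvgB (cvgD (F _ _ ix ix) (F _ _ jx jx)) h2.
apply: (cvg_ext (h _ _)).
  by move=> n; rewrite hnormB_sq !gram.
by rewrite /=; lra.
Qed.

Lemma hlim_sq H (u : nat -> H) x : (fun n => hnorm (u n - x) ^+ 2) @ \oo --> (0 : R) -> hlim u x.
Proof.
move=> /cvgrPdist_lt h; apply/hlimP => e e0; have := h _ (exprn_gt0 2 e0).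
apply: filterS => n; rewrite sub0r normrN ger0_norm ?sqr_ge0//.
by rewrite ltr_pXn2r// ?nnegrE ?hnorm_ge0// ltW.
Qed.

Lemma fock_continuous H G (e : H -> G) (u : nat -> H) x :
  (forall x y, hdot (e x) (e y) = cexp (hdot x y)) -> hlim u x -> hlim (e \o u) (e x).
Proof.
move=> gram ux; apply: hlim_sq.
by apply: (cexp_gram_cvg (j := fun=> x) gram ux); exact: hlim_cst.
Qed.

(** By the Gram identity [E] maps convergent sequences of arguments to Cauchy sequences, and the
    distance of two limits depends on the arguments alone; so the choice of the approximating
    sequences does not matter. *)
Lemma fock_extension H G (I : Type) (phi : I -> H) (E : I -> G) : hcomplete G ->
  (forall i j, hdot (E i) (E j) = cexp (hdot (phi i) (phi j))) ->
  (forall x (r : R), 0 < r -> exists i, hnorm (x - phi i) < r) ->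
  exists e : H -> G, (forall x y, hdot (e x) (e y) = cexp (hdot x y)) /\
    (forall i, e (phi i) = E i).
Proof.
move=> cG gram dn.
have sq x : {s : nat -> I | hlim (phi \o s) x}.
  apply: cid; have [//|u Mu xu] := @hlim_approx _ _ (range phi) x.
    by move=> r r0; have [i xi] := dn x r r0; exists (phi i) => //; exists i.
  have w n : {i | phi i = u n} by apply: cid; have [i _ ii] := Mu n; exists i.
  exists (fun n => sval (w n)); have := hlim_geo xu; congr hlim.
  by apply/funext => n /=; rewrite (svalP (w n)).
have lims x : {l | hlim (E \o sval (sq x)) l}.
  apply: cid; apply: hlim_of_cauchy_seq => // m n hm hn.
  have sx := svalP (sq x); apply: (cexp_gram_cvg (i := sval (sq x) \o m)
   (j := sval (sq x) \o n) gram (hlim_sub hm sx) (hlim_sub hn sx)).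
pose e x := sval (lims x); have P x : hlim (E \o sval (sq x)) (e x) := svalP (lims x).
have gr x y : hdot (e x) (e y) = cexp (hdot x y).
  by apply: (hdot_lim_cexp (svalP (sq x)) (svalP (sq y)) (P x) (P y)) => n /=.
exists e; split => // i; apply: (hlim_uniq (P (phi i))); apply: hlim_sq.
by apply: (cexp_gram_cvg (j := fun=> i) gram (svalP (sq (phi i)))); exact: hlim_cst.
Qed.

Definition comb H (I : Type) (phi : I -> H) (s : seq (R[i] * I)) : H :=
  \sum_(p <- s) p.1 *: phi p.2.

Lemma comb_dot H K I (phi : I -> H) (psi : I -> K) s t :
  (forall i j, hdot (psi i) (psi j) = hdot (phi i) (phi j)) ->
  hdot (comb psi s) (comb psi t) = hdot (comb phi s) (comb phi t).
Proof.
move=> gram; rewrite /comb; elim: s => [|[c i] s IH]; first by rewrite !big_nil !hdot0l.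
rewrite !big_cons !hdotDl IH; congr (_ + _); rewrite !hdotZl; congr (_ * _) => /=.
elim: t {IH} => [|[d j] t IH]; first by rewrite !big_nil !hdot0r.
by rewrite !big_cons !hdotDr IH !hdotZr gram.
Qed.

Lemma comb_lin H I (phi : I -> H) c s t :
  comb phi ([seq (c * p.1, p.2) | p <- s] ++ t) = c *: comb phi s + comb phi t.
Proof.
rewrite /comb big_cat big_map scaler_sumr; congr (_ + _).
by apply: eq_bigr => p _; rewrite scalerA.
Qed.

Lemma closed_span_comb H I (phi : I -> H) x : closed_span (range phi) x ->
  exists s : nat -> seq (R[i] * I), hlim (fun n => comb phi (s n)) x.
Proof.
move=> xs; have [|u Mu xu] := @hlim_approx _ _ (range (comb phi)) x.
  move=> r /xs[n [c [v [Sv xv]]]].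
  have w i : {j | phi j = v i} by apply: cid; have [j _ <-] := Sv i; exists j.
  exists (comb phi [seq (c i, sval (w i)) | i <- enum 'I_n]); first by exists [seq (c i, sval (w i)) | i <- enum 'I_n].
  rewrite /comb big_map big_enum /=; under eq_bigr do rewrite (svalP (w _)); exact: xv.
have w n : {i | comb phi i = u n} by apply: cid; have [i _ ii] := Mu n; exists i.
exists (fun n => sval (w n)); have := hlim_geo xu; congr hlim.
by apply/funext => n /=; rewrite (svalP (w n)).
Qed.

(** [rel] consists of the limits of pairs of combinations with the same coefficients. Equal Gram
    matrices make it isometric, hence single valued; completeness of [K] and totality of [phi] make
    it everywhere defined. *)
Lemma unitary_extension H K (I : Type) (phi : I -> H) (psi : I -> K) : hcomplete K ->
  closed_span (range phi) = setT ->
  (forall i j, hdot (psi i) (psi j) = hdot (phi i) (phi j)) ->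
  exists T : H -> K, [/\ forall c x y, T (c *: x + y) = c *: T x + T y,
    forall x y, hdot (T x) (T y) = hdot x y & forall i, T (phi i) = psi i].
Proof.
move=> cK tot gram.
pose rel x y := exists s : nat -> seq (R[i] * I), hlim (fun n => comb phi (s n)) x /\
  hlim (fun n => comb psi (s n)) y.
have reldot x x' y y' : rel x y -> rel x' y' -> hdot y y' = hdot x x'.
  move=> [s [sx sy]] [t [tx ty]]; apply: (hdot_lim_eq sx tx sy ty) => n.
  exact: comb_dot.
have rellin c x x' y y' : rel x y -> rel x' y' -> rel (c *: x + x') (c *: y + y').
  move=> [s [sx sy]] [t [tx ty]]; exists (fun n => [seq (c * p.1, p.2) | p <- s n] ++ t n).
  by split; under eq_fun do rewrite comb_lin; apply: hlimD => //; exact: hlimZ.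
have reluniq x y y' : rel x y -> rel x y' -> y = y'.
  move=> r r'; apply/eqP; rewrite -subr_eq0; apply/eqP/hnorm_eq0.
  have := rellin (-1) _ _ _ _ r' r; rewrite !scaleN1r addNr (addrC _ y) => rr.
  by rewrite /hnorm (reldot _ _ _ _ rr rr) hdot0l sqrtr0.
have reltot x : {y | rel x y}.
  apply: cid; have : closed_span (range phi) x by rewrite tot.
  move=> /closed_span_comb[s sx].
  have [|y sy] := @hlim_of_cauchy_seq _ (fun n => comb psi (s n)) cK; last by exists y, s.
  move=> m n hm hn.
  have E k : hnorm (comb psi (s (m k)) - comb psi (s (n k))) ^+ 2 =
             hnorm (comb phi (s (m k)) - comb phi (s (n k))) ^+ 2.
    by rewrite !hnormB_sq !(@comb_dot H K I phi psi)//.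
  have h := hlim_norm (hlimB (hlim_sub hm sx) (hlim_sub hn sx)).
  apply: (cvg_ext (cvgM h h)); first by move=> k; rewrite E expr2.
  by rewrite subrr hnorm0 mulr0.
exists (fun x => sval (reltot x)); split.
- move=> c x y; apply: reluniq (svalP (reltot _)) _.
  by apply: rellin; exact: (svalP (reltot _)).
- by move=> x y; apply: reldot; exact: (svalP (reltot _)).
- move=> i; apply: reluniq (svalP (reltot _)) _; exists (fun=> [:: (1, i)]).
  split; under eq_fun do rewrite /comb big_seq1 scale1r; exact: hlim_cst.
Qed.

End extension.

(** * Closed subspaces as Hilbert spaces *)

Section subspace_ips.
Context {R : realType} {H : innerProductSpace R} {M : set H} (HM : hsubspace M).

(** The predicate carries the proof that [M] is a closed subspace, from which inference recovers its
    submodule structure. *)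
Definition hsub_pred of hsubspace M : {pred H} := fun x => `[< M x >].
Local Notation P := (hsub_pred HM).

Lemma hsub_predP x : reflect (M x) (x \in P).
Proof. exact: asboolP. Qed.

Lemma hsub_pred_closed : submod_closed P.
Proof.
split; first by apply/hsub_predP/(hsub0 HM).
by move=> c x y /hsub_predP Mx /hsub_predP My; apply/hsub_predP/(hsubP c HM).
Qed.
HB.instance Definition _ := GRing.isSubmodClosed.Build _ _ P hsub_pred_closed.

Record hsubType := HSub { hsval :> H; _ : hsval \in P }.
HB.instance Definition _ := [isSub for hsval].
HB.instance Definition _ := [Choice of hsubType by <:].
HB.instance Definition _ := [SubChoice_isSubLmodule of hsubType by <:].

Definition hsdot (x y : hsubType) : R[i] := hdot (hsval x) (hsval y).

Lemma hsdot_linearl y : GRing.linear_for *%R (hsdot^~ y).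
Proof. by move=> c u v; rewrite /hsdot /= hdotDl hdotZl. Qed.
Lemma hsdot_linearr x : GRing.linear_for (conjC \; *%R) (hsdot x).
Proof. by move=> c u v; rewrite /hsdot /= hdotDr hdotZr. Qed.
Lemma hsdotC x y : hsdot x y = (-1) ^+ false * conjC (hsdot y x).
Proof. by rewrite expr0 mul1r /hsdot hdotC. Qed.
Lemma hsdot_gt0 x : x != 0 -> 0 < hsdot x x.
Proof.
move=> x0; rewrite /hsdot /hdot dnorm_gt0.
by apply: contra x0 => /eqP x0; apply/eqP/val_inj.
Qed.
HB.instance Definition _ := bilinear_isBilinear.Build R[i] hsubType hsubType R[i]
  (GRing.Scale.Law.clone _ _ ( *%R ) _)
  (GRing.Scale.Law.clone _ _ (conjC \; *%R) _)
  hsdot (hsdot_linearl, hsdot_linearr).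
HB.instance Definition _ :=
  isHermitianSesquilinear.Build R[i] hsubType false conjC hsdot hsdotC.
HB.instance Definition _ := isDotProduct.Build R[i] hsubType hsdot hsdot_gt0.

Definition sub_ips : innerProductSpace R :=
  InnerProductSpace (hsdot : {dot hsubType for conjC}).

Definition sval_ips (x : sub_ips) : H := hsval x.
(** The inverse of [sval_ips] on [M], extended by 0; it is not the orthogonal projection. *)
Definition sproj (x : H) : sub_ips :=
  if pselect (M x) is left h then HSub (introT (hsub_predP x) h) else 0.

Lemma sval_mem x : M (sval_ips x).
Proof. by case: x => x h; exact/hsub_predP. Qed.
Lemma sprojK x : M x -> sval_ips (sproj x) = x.
Proof. by rewrite /sproj; case: pselect. Qed.
Lemma svalK : cancel sval_ips sproj.
Proof. by move=> x; apply: val_inj; exact: (sprojK (sval_mem x)). Qed.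
Lemma svalP_lin c x y : sval_ips (c *: x + y) = c *: sval_ips x + sval_ips y.
Proof. by []. Qed.
Lemma svalD x y : sval_ips (x + y) = sval_ips x + sval_ips y.
Proof. by []. Qed.
Lemma svalB x y : sval_ips (x - y) = sval_ips x - sval_ips y.
Proof. by []. Qed.
Lemma svalZ c x : sval_ips (c *: x) = c *: sval_ips x.
Proof. by []. Qed.
Lemma sval_sum n (F : 'I_n -> sub_ips) :
  sval_ips (\sum_(i < n) F i) = \sum_(i < n) sval_ips (F i).
Proof.
elim: n F => [|n IH] F; first by rewrite !big_ord0.
by rewrite big_ord_recr [in RHS]big_ord_recr -IH.
Qed.
Lemma sval_dot x y : hdot (sval_ips x) (sval_ips y) = hdot x y.
Proof. by []. Qed.
Lemma sval_norm x : hnorm (sval_ips x) = hnorm x.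
Proof. by []. Qed.
Lemma sval_lim u x : hlim u x <-> hlim (sval_ips \o u) (sval_ips x).
Proof. by []. Qed.

Lemma sub_complete : hcomplete H -> hcomplete sub_ips.
Proof.
move=> cH u cu; have [x ux] := hcauchy_lim cH (u := sval_ips \o u) cu.
have Mx : M x by apply: (hsub_lim HM _ ux) => n; exact: sval_mem.
by exists (sproj x); apply/sval_lim; rewrite sprojK.
Qed.

Lemma sub_closed_span (S : set sub_ips) x :
  closed_span S x <-> closed_span (sval_ips @` S) (sval_ips x).
Proof.
split=> xs e e0; have [n [c [v [Sv xv]]]] := xs e e0.
  exists n, c, (fun i => sval_ips (v i)); split; first by move=> i; exists (v i).
  by move: xv; rewrite -sval_norm svalB sval_sum; under eq_bigr do rewrite svalZ.
exists n, c, (fun i => sproj (v i)); split.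
  by move=> i; have [y Sy <-] := Sv i; rewrite svalK.
have vi i : sval_ips (sproj (v i)) = v i.
  by rewrite sprojK//; have [y _ <-] := Sv i; exact: sval_mem.
by rewrite -sval_norm svalB sval_sum; under eq_bigr do rewrite svalZ vi.
Qed.

Lemma sval_open (U : set H) : hopen U -> hopen (sval_ips @^-1` U).
Proof.
by move=> oU x /oU[e e0 h]; exists e => // y yx; apply: h; rewrite -svalB sval_norm.
Qed.
(** The ambient open set is the union of the balls of [H] centred at points of the subspace whose
    traces lie in [U]. *)
Lemma open_sval (U : set sub_ips) : hopen U ->
  exists2 U' : set H, hopen U' & sval_ips @^-1` U' = U.
Proof.
move=> oU; exists [set x | exists (y : sub_ips) (e : R), [/\ 0 < e,
   hnorm (x - sval_ips y) < e & forall z, hnorm (z - y) < e -> U z]].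
  move=> x [y [e [e0 xy h]]]; exists (e - hnorm (x - sval_ips y)); first by rewrite subr_gt0.
  move=> z zx; exists y, e; split=> //.
  by rewrite (le_lt_trans (hnorm_tri x _ _))// -ltrBrDr.
apply/seteqP; split=> [x [y [e [e0 xy h]]]|x Ux]; first exact: h.
by have [e e0 h] := oU _ Ux; exists x, e; split; rewrite ?subrr ?hnorm0.
Qed.

Lemma borelVH_sval d (D : set ('rV[R]_d * H)) : borelVH D ->
  borelVH ((fun p : 'rV[R]_d * sub_ips => (p.1, sval_ips p.2)) @^-1` D).
Proof.
have sa := @sigma_algebra_bigcap.
move: D; apply: smallest_sub.
  split=> [|A|A].
  - by rewrite preimage_set0; exact: sigma_algebra0.
  - move=> hA; rewrite setTD -preimage_setC -setTD; exact: sigma_algebraCD.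
  - by move=> h; rewrite preimage_bigcup; exact: sigma_algebra_bigcup.
move=> D [A oA [U oU <-]]; apply: sub_sigma_algebra; exists A => //.
by exists (sval_ips @^-1` U) => //; exact: sval_open.
Qed.
Lemma sval_borelVH d (D : set ('rV[R]_d * sub_ips)) : borelVH D ->
  exists2 D', borelVH D' & (fun p : 'rV[R]_d * sub_ips => (p.1, sval_ips p.2)) @^-1` D' = D.
Proof.
move: D; apply: smallest_sub.
  split=> [|A|A].
  - by exists set0; [exact: sigma_algebra0|rewrite preimage_set0].
  - move=> [A' hA' <-]; exists (setT `\` A'); first exact: sigma_algebraCD.
    by rewrite !setTD preimage_setC.
  - move=> h; have w n := cid2 (h n); exists (\bigcup_n s2val (w n)).
      by apply: sigma_algebra_bigcup => n; exact: (s2valP (w n)).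
    by rewrite preimage_bigcup; apply: eq_bigcupr => n _; exact: (s2valP' (w n)).
move=> D [A oA [U /open_sval[U' oU' <-] <-]]; exists (A `*` U') => //.
by apply: sub_sigma_algebra; exists A => //; exists U'.
Qed.

(** The Borel sets of the subspace are the traces of those of the ambient space, so corestriction is
    a Borel isomorphism. It turns a product system inside [H] into one inside the subspace. *)
Lemma borel_iso_sproj d (A : set ('rV[R]_d * H)) :
  (forall p, A p -> M p.2) ->
  borel_iso A ((fun p : 'rV[R]_d * sub_ips => (p.1, sval_ips p.2)) @^-1` A)
    (fun p => (p.1, sproj p.2)).
Proof.
move=> AM; split.
- split.
  + by move=> [a x] Ax /=; rewrite sprojK//; exact: AM Ax.
  + move=> [a x] [b y]; rewrite !inE => Ax Ay [-> ] /(congr1 sval_ips).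
    by rewrite !sprojK; [move->|exact: AM Ay|exact: AM Ax].
  + by move=> [a x] Ax; exists (a, sval_ips x) => //=; rewrite svalK.
- move=> D /sval_borelVH[D' D'b <-]; exists D' => //.
  apply/seteqP; split=> -[a x] [Ax /= Dx]; split=> //=; move: Dx => /=.
    by rewrite sprojK//; exact: AM Ax.
  by rewrite sprojK//; exact: AM Ax.
- move=> D' D'b; exists ((fun p : 'rV[R]_d * sub_ips => (p.1, sval_ips p.2)) @^-1` D').
    exact: borelVH_sval.
  apply/seteqP; split=> [_ [[a x] [Ax Dx] <-]|[a x] [/= Ax Dx]].
    by split=> /=; rewrite sprojK//; exact: AM Ax.
  by exists (a, sval_ips x) => //=; rewrite svalK.
Qed.

End subspace_ips.
Arguments sub_ips {R H M} HM.
Arguments sval_ips {R H M HM} x.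
Arguments sproj {R H M} HM x.

(** * Square integrable functions *)

Local Open Scope quotient_scope.

Section csqn_theory.
Context {R : realType}.
Implicit Types z w : R[i].
Lemma csqnM z w : csqn (z * w) = csqn z * csqn w.
Proof. by case: z w => a b [c d]; rewrite /csqn /=; ring. Qed.
Lemma csqnN z : csqn (- z) = csqn z.
Proof. by case: z => a b; rewrite /csqn /= !sqrrN. Qed.
Lemma csqn0 : csqn (0 : R[i]) = 0.
Proof. by rewrite /csqn /= expr0n addr0. Qed.
Lemma csqn1 : csqn (1 : R[i]) = 1.
Proof. by rewrite /csqn /= expr0n addr0 expr1n. Qed.
Lemma csqnD z w : csqn (z + w) <= 2 * (csqn z + csqn w).
Proof.
case: z w => a b [c d]; rewrite /csqn /=.
have := sqr_ge0 (a - c); have := sqr_ge0 (b - d); nra.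
Qed.
Lemma csqnB z w : csqn (z - w) <= 2 * (csqn z + csqn w).
Proof. by rewrite -(csqnN w) csqnD. Qed.
Lemma csqn_conj z : csqn z^*%C = csqn z.
Proof. by case: z => a b; rewrite /csqn /= sqrrN. Qed.
Lemma csqn_real (r : R) : csqn r%:C%C = r ^+ 2.
Proof. by rewrite /csqn /= expr0n addr0. Qed.
Lemma csqn_mulconj z : z * z^*%C = (csqn z)%:C%C.
Proof.
case: z => a b; apply/eqP; rewrite eq_complex /csqn /=.
by apply/andP; split; apply/eqP; ring.
Qed.
Lemma csqnX z n : csqn (z ^+ n) = csqn z ^+ n.
Proof. by elim: n => [|n IH]; rewrite ?expr0 ?csqn1// !exprS csqnM IH. Qed.
Lemma Re_sq_le z : Re z ^+ 2 <= csqn z.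
Proof. by rewrite /csqn lerDl sqr_ge0. Qed.
Lemma Im_sq_le z : Im z ^+ 2 <= csqn z.
Proof. by rewrite /csqn lerDr sqr_ge0. Qed.
Lemma Re_le_csqn z : `|Re z| <= Num.sqrt (csqn z).
Proof. by rewrite -sqrtr_sqr ler_wsqrtr// Re_sq_le. Qed.
Lemma Im_le_csqn z : `|Im z| <= Num.sqrt (csqn z).
Proof. by rewrite -sqrtr_sqr ler_wsqrtr// Im_sq_le. Qed.
Lemma complex_eqP z w : Re z = Re w -> Im z = Im w -> z = w.
Proof. by case: z w => a b [c d] /= -> ->. Qed.
End csqn_theory.

Section cmeas.
Context {d} {T : measurableType d} {R : realType}.
Implicit Types f g : T -> R[i].

(** Measurability coordinate by coordinate, as in the definitions of [cLfun2] and [cL2_sub]. *)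
Definition cmeas f := measurable_fun setT (fun x => Re (f x)) /\
  measurable_fun setT (fun x => Im (f x)).

Lemma cmeas_cst c : cmeas (fun=> c). Proof. by split. Qed.
Lemma cmeasD f g : cmeas f -> cmeas g -> cmeas (fun x => f x + g x).
Proof.
move=> [fr fi] [gr gi]; split; under eq_fun do rewrite raddfD; exact: measurable_funD.
Qed.
Lemma cmeasM f g : cmeas f -> cmeas g -> cmeas (fun x => f x * g x).
Proof.
move=> [fr fi] [gr gi]; split.
- rewrite (_ : (fun _ => _) = fun x => Re (f x) * Re (g x) - Im (f x) * Im (g x)).
    by apply: measurable_funB; exact: measurable_funM.
  by apply/funext => x; case: (f x) (g x) => a b [].
- rewrite (_ : (fun _ => _) = fun x => Re (f x) * Im (g x) + Im (f x) * Re (g x)).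
    by apply: measurable_funD; exact: measurable_funM.
  by apply/funext => x; case: (f x) (g x) => a b [].
Qed.
Lemma cmeasN f : cmeas f -> cmeas (fun x => - f x).
Proof. by move=> mf; under [X in cmeas X]eq_fun do rewrite -mulN1r; exact: cmeasM (cmeas_cst _) mf. Qed.
Lemma cmeasB f g : cmeas f -> cmeas g -> cmeas (fun x => f x - g x).
Proof. by move=> mf mg; apply: cmeasD => //; exact: cmeasN. Qed.
Lemma cmeas_conj f : cmeas f -> cmeas (fun x => (f x)^*%C).
Proof.
move=> [fr fi]; split.
  rewrite (_ : (fun _ => _) = fun x => Re (f x))//.
  by apply/funext => x; case: (f x).
rewrite (_ : (fun _ => _) = fun x => - Im (f x)).
  exact: measurableT_comp.
by apply/funext => x; case: (f x).
Qed.
Lemma cmeas_real (h : T -> R) : measurable_fun setT h -> cmeas (fun x => (h x)%:C%C).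
Proof. by move=> mh; split. Qed.
Lemma cmeas_indic (A : set T) : measurable A -> cmeas (fun x => (\1_A x)%:C%C).
Proof. by move=> mA; exact: cmeas_real. Qed.
Lemma cmeas_csqn f : cmeas f -> measurable_fun setT (fun x => csqn (f x)).
Proof.
by move=> [fr fi]; rewrite /csqn; apply: measurable_funD; exact: measurable_funX.
Qed.
Lemma cmeas_csqnE f : cmeas f -> measurable_fun setT (fun x => (csqn (f x))%:E).
Proof. by move=> /cmeas_csqn /measurable_EFinP. Qed.
Lemma cmeas_prod (I : Type) (r : seq I) (F : I -> T -> R[i]) :
  (forall i, cmeas (F i)) -> cmeas (fun x => \prod_(i <- r) F i x).
Proof.
move=> mF; elim: r => [|i r IH].
  by under [X in cmeas X]eq_fun do rewrite big_nil; exact: cmeas_cst.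
by under [X in cmeas X]eq_fun do rewrite big_cons; exact: cmeasM.
Qed.
Definition ccvg (u : nat -> R[i]) (z : R[i]) :=
  (fun n => csqn (u n - z)) @ \oo --> (0 : R).
Lemma ccvgP (u : nat -> R[i]) z : ccvg u z <->
  (fun n => Re (u n)) @ \oo --> Re z /\ (fun n => Im (u n)) @ \oo --> Im z.
Proof.
split=> [uz|[rz iz]].
  have s0 : (fun n => Num.sqrt (csqn (u n - z))) @ \oo --> (0 : R).
    by rewrite -(sqrtr0 R); apply: continuous_cvg => //; exact: sqrt_continuous.
  split; rewrite -subr_cvg0; apply/norm_cvg0P; apply: (squeeze_cvgr _ (cvg_cst 0) s0);
    apply: nearW => n; rewrite normr_ge0 /= -raddfB.
    exact: Re_le_csqn.
  exact: Im_le_csqn.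
have h1 : (fun n => Re (u n) - Re z) @ \oo --> (0 : R) by rewrite subr_cvg0.
have h2 : (fun n => Im (u n) - Im z) @ \oo --> (0 : R) by rewrite subr_cvg0.
apply: (cvg_ext (cvgD (cvgM h1 h1) (cvgM h2 h2))); last by rewrite !mul0r addr0.
by move=> n; rewrite /csqn !expr2 !raddfB.
Qed.
Lemma ccvg_cst z : ccvg (fun=> z) z.
Proof. by apply/ccvgP; split; exact: cvg_cst. Qed.
Lemma ccvgD u v z w : ccvg u z -> ccvg v w -> ccvg (fun n => u n + v n) (z + w).
Proof.
move=> /ccvgP[a b] /ccvgP[a' b']; apply/ccvgP.
by split; rewrite raddfD; under eq_fun do rewrite raddfD; exact: cvgD.
Qed.
Lemma ccvgM u v z w : ccvg u z -> ccvg v w -> ccvg (fun n => u n * v n) (z * w).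
Proof.
move=> /ccvgP[a b] /ccvgP[a' b']; apply/ccvgP; split.
  apply: (cvg_ext (cvgB (cvgM a a') (cvgM b b'))) => [n|].
    by rewrite -[LHS]/(Re (u n) * Re (v n) - Im (u n) * Im (v n)); case: (u n) (v n) => ? ? [].
  by case: (z) (w) => ? ? [].
apply: (cvg_ext (cvgD (cvgM a b') (cvgM b a'))) => [n|].
  by rewrite -[LHS]/(Re (u n) * Im (v n) + Im (u n) * Re (v n)); case: (u n) (v n) => ? ? [].
by case: (z) (w) => ? ? [].
Qed.
Lemma cmeas_cvg (h : nat -> T -> R[i]) f : (forall n, cmeas (h n)) ->
  (forall x, ccvg (h ^~ x) (f x)) -> cmeas f.
Proof.
move=> mh hf; split.
  apply: (measurable_fun_cvg (h := fun n x => Re (h n x))) => [m|x _]; first by case: (mh m).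
  by have /ccvgP[] := hf x.
apply: (measurable_fun_cvg (h := fun n x => Im (h n x))) => [m|x _]; first by case: (mh m).
by have /ccvgP[] := hf x.
Qed.
End cmeas.

Section cL2_theory.
Context {d} {T : measurableType d} {R : realType} {mu : {measure set T -> \bar R}}.
Local Notation L := (cL2_ips mu).
Implicit Types (f g : T -> R[i]).

Definition sqint f : \bar R := (\int[mu]_x (csqn (f x))%:E)%E.
Definition L2 f := cmeas f /\ (sqint f < +oo)%E.

Lemma sqint_ge0 f : (0 <= sqint f)%E.
Proof. by apply: integral_ge0 => x _; rewrite lee_fin csqn_ge0. Qed.

Lemma Lfun2P (h : T -> R) : h \in Lfun mu 2%:E <->
  measurable_fun setT h /\ (\int[mu]_x (h x ^+ 2)%:E < +oo)%E.
Proof.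
split=> [hL|[mh hi]].
  split; first by have := sub_Lfun_mfun hL; rewrite inE.
  have /integrableP[_] := Lfun2_integrable_sqr hL.
  apply: le_lt_trans; rewrite le_eqVlt; apply/orP; left; apply/eqP.
  by apply: eq_integral => x _ /=; rewrite ger0_norm ?sqr_ge0.
rewrite inE; apply/andP; split; first by rewrite inE.
rewrite inE /= /finite_norm ltNge leye_eq; apply/negP => /eqP Ny.
have := @poweR_Lnorm _ _ _ mu (EFin \o h) 2 (lt0r_neq0 (ltr0n _ 2)); rewrite Ny poweRyr ?(lt0r_neq0 (ltr0n _ 2))// => E.
move: hi; rewrite ltNge leye_eq => /negP; apply; apply/eqP; rewrite E.
apply: eq_integral => x _ /=.
by rewrite powR_mulrn ?normr_ge0// real_normK ?num_real.
Qed.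

Lemma cLfun2P f : f \in cLfun2 mu <-> L2 f.
Proof.
split=> [/andP[/Lfun2P[mr ir] /Lfun2P[mi ii]]|[[mr mi] ff]].
  split=> //; rewrite /sqint /csqn.
  under eq_integral do rewrite EFinD.
  rewrite ge0_integralD//; first by rewrite lte_add_pinfty.
  - by move=> x _; rewrite lee_fin sqr_ge0.
  - by apply/measurable_EFinP; exact: measurable_funX.
  - by move=> x _; rewrite lee_fin sqr_ge0.
  - by apply/measurable_EFinP; exact: measurable_funX.
have mc : measurable_fun setT (fun x => (csqn (f x))%:E) by exact: cmeas_csqnE.
apply/andP; split; apply/Lfun2P; split=> //; apply: le_lt_trans ff; apply: ge0_le_integral => //.
- by move=> x _; rewrite lee_fin sqr_ge0.
- by apply/measurable_EFinP; exact: measurable_funX.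
- by move=> x _; rewrite lee_fin Re_sq_le.
- by move=> x _; rewrite lee_fin sqr_ge0.
- by apply/measurable_EFinP; exact: measurable_funX.
- by move=> x _; rewrite lee_fin Im_sq_le.
Qed.

(** Defined on bare functions, with value 0 off L^2, so that classes of explicit functions can be
    written without carrying a proof. *)
Definition cls f : L := if pselect (f \in cLfun2 mu) is left h then \pi_(cL2 mu) (CLfun h) else 0.

Lemma clsE f (h : f \in cLfun2 mu) : cls f = \pi_(cL2 mu) (CLfun h).
Proof. by rewrite /cls; case: pselect => // h'; congr (\pi _); exact: val_inj. Qed.

Lemma cls_pi (f : cLfunType mu) : \pi_(cL2 mu) f = cls f.
Proof. by case: f => f h; rewrite /= clsE. Qed.

Lemma cls_surj (x : L) : exists2 f, L2 f & x = cls f.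
Proof.
exists (repr (x : cL2 mu)); first by apply/cLfun2P; case: (repr (x : cL2 mu)).
by rewrite -cls_pi reprK.
Qed.

Lemma cls_ae f g : L2 f -> L2 g -> {ae mu, forall x, f x = g x} -> cls f = cls g.
Proof.
move=> /cLfun2P hf /cLfun2P hg fg; rewrite !clsE.
exact: cL2_pi.
Qed.

Lemma cls_aeP f g : L2 f -> L2 g -> cls f = cls g -> {ae mu, forall x, f x = g x}.
Proof.
by move=> /cLfun2P hf /cLfun2P hg; rewrite !clsE => /eqP/cL2_eqP.
Qed.

Lemma L2D f g : L2 f -> L2 g -> L2 (fun x => f x + g x).
Proof. by move=> /cLfun2P hf /cLfun2P hg; apply/cLfun2P; exact: rpredD. Qed.
Lemma L2Z c f : L2 f -> L2 (fun x => c * f x).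
Proof. by move=> /cLfun2P hf; apply/cLfun2P; exact: rpredZ. Qed.
Lemma L2B f g : L2 f -> L2 g -> L2 (fun x => f x - g x).
Proof. by move=> /cLfun2P hf /cLfun2P hg; apply/cLfun2P; exact: rpredB. Qed.
Lemma L2_0 : L2 (fun=> 0).
Proof. by apply/cLfun2P; exact: rpred0. Qed.

Lemma clsD f g : L2 f -> L2 g -> cls (fun x => f x + g x) = cls f + cls g.
Proof.
move=> Lf Lg; have h := (cLfun2P _).2 (L2D Lf Lg).
move: Lf Lg => /cLfun2P hf /cLfun2P hg; rewrite (clsE hf) (clsE hg) (clsE h).
rewrite [RHS]cL2_piD; congr (\pi _); exact: val_inj.
Qed.
Lemma clsZ c f : L2 f -> cls (fun x => c * f x) = c *: cls f.
Proof.
move=> Lf; have h := (cLfun2P _).2 (L2Z c Lf).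
move: Lf => /cLfun2P hf; rewrite (clsE hf) (clsE h).
rewrite [RHS]cL2_piZ; congr (\pi _); exact: val_inj.
Qed.
Lemma clsB f g : L2 f -> L2 g -> cls (fun x => f x - g x) = cls f - cls g.
Proof.
move=> Lf Lg; rewrite -scaleN1r -clsZ// -clsD//; last exact: L2Z.
by under [X in cls X = _]eq_fun do rewrite -mulN1r.
Qed.
Lemma cls0 : cls (fun=> 0) = 0.
Proof.
by rewrite -(scale0r (cls (fun=> 0))) -clsZ//; [under [in RHS]eq_fun do rewrite mul0r|exact: L2_0].
Qed.

Lemma cls_dot f g : L2 f -> L2 g -> hdot (cls f) (cls g) = cint mu (fun x => f x * (g x)^*%C).
Proof.
move=> /cLfun2P hf /cLfun2P hg; rewrite !clsE.
exact: cL2_dotE.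
Qed.

Lemma cls_norm f : L2 f -> ((hnorm (cls f)) ^+ 2)%:E = sqint f.
Proof.
move=> Lf; rewrite hnorm_sq cls_dot// /cint /= /Rintegral.
under eq_integral do rewrite csqn_mulconj /=.
rewrite fineK//; rewrite ge0_fin_numE; last exact: sqint_ge0.
by case: Lf.
Qed.

Lemma cls_normB f g : L2 f -> L2 g ->
  (hnorm (cls f - cls g) ^+ 2)%:E = sqint (fun x => f x - g x).
Proof. by move=> Lf Lg; rewrite -clsB// cls_norm//; exact: L2B. Qed.

Lemma L2_dom f g (C : R) : cmeas f -> L2 g -> (forall x, csqn (f x) <= C * csqn (g x)) -> L2 f.
Proof.
move=> mf [mg gi] h; split=> //.
have C0 : 0 <= `|C| by [].
apply: (@le_lt_trans _ _ (\int[mu]_x (`|C|%:E * (csqn (g x))%:E))%E).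
  apply: ge0_le_integral => //.
  - by move=> x _; rewrite lee_fin csqn_ge0.
  - exact: cmeas_csqnE.
  - by apply: measurable_funeM; exact: cmeas_csqnE.
  - move=> x _; rewrite -EFinM lee_fin (le_trans (h x))// ler_wpM2r ?csqn_ge0//.
    exact: ler_norm.
rewrite ge0_integralZl//.
- by rewrite lte_mul_pinfty.
- exact: cmeas_csqnE.
- by move=> x _; rewrite lee_fin csqn_ge0.
Qed.

Lemma sqint_cvg_hlim (f : nat -> T -> R[i]) g : (forall n, L2 (f n)) -> L2 g ->
  (fun n => sqint (fun x => f n x - g x)) @ \oo --> 0%E -> hlim (fun n => cls (f n)) (cls g).
Proof.
move=> Lf Lg; have -> : (fun n => sqint (fun x => f n x - g x)) =
    (fun n => (hnorm (cls (f n) - cls g) ^+ 2)%:E).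
  by apply/funext => n; rewrite cls_normB.
by move=> /fine_cvgP[_ h]; exact: hlim_sq.
Qed.
End cL2_theory.
Arguments cls {d T R} mu f.
Arguments sqint {d T R} mu f.
Arguments L2 {d T R} mu f.

Lemma is_classP {R : realType} {dO} {O : measurableType dO} (P : probability O R)
    (x : cL2_ips P) f : is_class x f <-> L2 P f /\ x = cls P f.
Proof.
split=> [[g <- ->]|[Lf ->]].
  by split; [apply/cLfun2P; case: g|rewrite cls_pi].
have h := (cLfun2P f).2 Lf; exists (CLfun h) => //; exact: clsE.
Qed.
Local Close Scope quotient_scope.

Section series_facts.
Context {R : realType}.
Lemma nneseries_le (a : nat -> \bar R) (M : \bar R) : (forall n, 0 <= a n)%E ->
  (forall n, \sum_(0 <= i < n) a i <= M)%E -> (\sum_(0 <= n <oo) a n <= M)%E.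
Proof.
move=> a0 aM; apply: lime_le; first exact: is_cvg_nneseries.
by apply: nearW => n; exact: aM.
Qed.
Lemma nneseries_lt_cvg0 (a : nat -> R) : (forall n, 0 <= a n) ->
  (\sum_(0 <= n <oo) (a n)%:E < +oo)%E -> a @ \oo --> (0 : R).
Proof.
move=> a0 af; apply: cvg_series_cvg_0.
have sf : (\sum_(0 <= n <oo) (a n)%:E)%E \is a fin_num.
  by rewrite ge0_fin_numE// nneseries_ge0// => n _ _; rewrite lee_fin.
apply: nondecreasing_is_cvgn.
  by apply: nondecreasing_series => n _ _; exact: a0.
exists (fine (\sum_(0 <= n <oo) (a n)%:E)%E) => _ [n _ <-].
rewrite -lee_fin fineK// /series /= -sumEFin.
by apply: nneseries_lim_ge => k _ _; rewrite lee_fin.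
Qed.
Lemma sum_half_le n : \sum_(0 <= i < n) (2^-1 : R) ^+ i <= 2.
Proof.
suff : \sum_(0 <= i < n) (2^-1 : R) ^+ i + 2 * 2^-1 ^+ n = 2.
  have : (0 : R) <= 2 * 2^-1 ^+ n by rewrite mulr_ge0// exprn_ge0.
  by set s := \sum_(0 <= i < n) _; set t := _ ^+ n; lra.
elim: n => [|n IH]; first by rewrite big_geq// expr0; lra.
rewrite big_nat_recr//= exprS -[RHS]IH.
by set s := \sum_(0 <= i < n) _; set t := _ ^+ n; lra.
Qed.
Lemma nneseries_half : (\sum_(0 <= n <oo) ((2^-1 : R) ^+ n)%:E <= 2%:E)%E.
Proof.
apply: nneseries_le => n; first by rewrite lee_fin exprn_ge0.
by rewrite sumEFin lee_fin sum_half_le.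
Qed.
Lemma geo_cauchy_cvg (a : nat -> R) (C : R) :
  (forall n, `|a n.+1 - a n| <= C * 2^-1 ^+ n) -> cvgn a.
Proof.
move=> h; rewrite (_ : a = fun n => a 0%N + series (telescope a) n); last first.
  by apply/funext => n; exact: eq_sum_telescope.
apply: is_cvgD; first exact: is_cvg_cst.
apply: normed_cvg; apply: (series_le_cvg (v_ := geometric C 2^-1)) => //.
- by move=> n /=.
- by move=> n; exact: le_trans (normr_ge0 _) (h n).
by apply: is_cvg_geometric_series; rewrite ger0_norm ?invr_ge0// invf_lt1 ?ltr1n.
Qed.
End series_facts.

(** * Almost everywhere convergence and completeness *)

Section L2_conv.
Context {d} {T : measurableType d} {R : realType} {mu : {measure set T -> \bar R}}.
Local Notation L := (cL2_ips mu).
Implicit Types (f g : T -> R[i]).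

Lemma ae_lty (h : T -> \bar R) : measurable_fun setT h -> (forall x, 0 <= h x)%E ->
  (\int[mu]_x h x < +oo)%E -> {ae mu, forall x, h x < +oo}%E.
Proof.
move=> mh h0 hi; have ih : mu.-integrable setT h.
  by apply/integrableP; split=> //; under eq_integral do rewrite gee0_abs//.
apply: filterS (integrable_ae measurableT ih) => x /(_ I).
by rewrite ge0_fin_numE.
Qed.

Lemma fatou_le (h : nat -> T -> \bar R) (g : T -> \bar R) (c : \bar R) :
  (forall n, measurable_fun setT (h n)) -> (forall n x, 0 <= h n x)%E ->
  (forall x, h ^~ x @ \oo --> g x) -> (forall n, \int[mu]_x h n x <= c)%E ->
  (\int[mu]_x g x <= c)%E.
Proof.
move=> mh h0 hg hc.
have <- : (\int[mu]_x limn_einf (h ^~ x) = \int[mu]_x g x)%E.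
  by apply: eq_integral => x _; case: (cvg_limn_einf_sup (hg x)).
apply: (le_trans (fatou mu measurableT mh (fun n x _ => h0 n x))).
rewrite limn_einf_lim; apply: lime_le; first exact: is_cvg_einfs.
apply: nearW => n; apply: le_trans (hc n); apply: ereal_inf_lbound.
by exists n => //=.
Qed.

(** The integrals are summable, so the sum of the squares has a finite integral and is finite almost
    everywhere. *)
Lemma fast_ae (f : nat -> T -> R[i]) : (forall n, cmeas (f n)) ->
  (forall n, sqint mu (f n) <= ((2^-1 : R) ^+ n)%:E)%E ->
  {ae mu, forall x, (\sum_(0 <= n <oo) (csqn (f n x))%:E < +oo)%E}.
Proof.
move=> mf hf; apply: ae_lty.
- apply: ge0_emeasurable_sum => [n x _ _|n _]; first by rewrite lee_fin csqn_ge0.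
  exact: cmeas_csqnE.
- by move=> x; apply: nneseries_ge0 => n _ _; rewrite lee_fin csqn_ge0.
rewrite integral_nneseries//.
- apply: (@le_lt_trans _ _ (\sum_(0 <= n <oo) ((2^-1 : R) ^+ n)%:E)%E).
    by apply: lee_nneseries => [n _ _|n _]; [exact: sqint_ge0|exact: hf].
  by rewrite (le_lt_trans nneseries_half)// ltry.
- by move=> n; exact: cmeas_csqnE.
- by move=> n x _; rewrite lee_fin csqn_ge0.
Qed.

Lemma hnorm_sqint f (r : R) : L2 mu f -> 0 <= r -> (hnorm (cls mu f) <= r) = (sqint mu f <= (r ^+ 2)%:E)%E.
Proof.
by move=> Lf r0; rewrite -cls_norm// lee_fin ler_pXn2r// ?nnegrE ?hnorm_ge0.
Qed.

Lemma hlim_ae (f : nat -> T -> R[i]) g :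
  (forall n, L2 mu (f n)) -> L2 mu g -> hlim (fun n => cls mu (f n)) (cls mu g) ->
  exists s : nat -> nat, (forall n, (n <= s n)%N) /\
    {ae mu, forall x, ccvg (fun n => f (s n) x) (g x)}.
Proof.
move=> Lf Lg /hlimP fg.
have w n : {k | (n <= k)%N & hnorm (cls mu (f k) - cls mu g) <= 2^-1 ^+ n}.
  apply: cid2; have [|N _ h] := fg (2^-1 ^+ n); first by rewrite exprn_gt0// invr_gt0.
  exists (maxn n N); first exact: leq_maxl.
  by rewrite ltW// h//= leq_maxr.
exists (fun n => s2val (w n)); split; first by move=> n; case: (w n).
have := @fast_ae (fun n x => f (s2val (w n)) x - g x).
have /[swap]/[apply] : forall n, cmeas (fun x => f (s2val (w n)) x - g x).
  by move=> n; apply: cmeasB; [case: (Lf (s2val (w n)))|case: Lg].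
have /[swap]/[apply] : forall n, (sqint mu (fun x => f (s2val (w n)) x - g x)%R <= ((2^-1 : R) ^+ n)%:E)%E.
  move=> n; case: (w n) => k nk /= h; rewrite -cls_normB// lee_fin.
  apply: (@le_trans _ _ ((2^-1 ^+ n) ^+ 2)).
    by rewrite ler_pXn2r// ?nnegrE ?hnorm_ge0// exprn_ge0.
  rewrite expr2 ler_piMr ?exprn_ge0// exprn_ile1//.
  by rewrite invf_le1// ler1n.
apply: filterS => t ht; apply: nneseries_lt_cvg0 ht => n; exact: csqn_ge0.
Qed.

(** Riesz-Fischer. Along a subsequence with gaps below 4^-k the differences are square summable
    almost everywhere even after multiplication by 2^n. So they are O(2^-n) at almost every point,
    where the subsequence then converges; Fatou's lemma turns the pointwise limit into a limit in
    norm. *)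
Theorem cL2_complete : hcomplete L.
Proof.
move=> u cu.
have w k : {N | forall m n, (N <= m)%N -> (N <= n)%N -> hnorm (u m - u n) < 4^-1 ^+ k}.
  by apply: cid; apply: cu; rewrite exprn_gt0.
(* Summing the indices makes [s] monotone and keeps [s k] at least the k-th of them. *)
pose s k := (\sum_(j < k.+1) sval (w j))%N.
have sh k m n : (s k <= m)%N -> (s k <= n)%N -> hnorm (u m - u n) < 4^-1 ^+ k.
  move=> km kn; apply: (svalP (w k)); apply: leq_trans (_ : s k <= _)%N => //.
    by rewrite /s big_ord_recr /= leq_addl.
  by rewrite /s big_ord_recr /= leq_addl.
have sS k l : (k <= l)%N -> (s k <= s l)%N.
  elim: l => [|l IH]; first by rewrite leqn0 => /eqP ->.
  rewrite leq_eqVlt => /predU1P[->//|/IH h].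
  by rewrite (leq_trans h)// /s [in X in (_ <= X)%N]big_ord_recr leq_addr.
have wf k : {f | L2 mu f & u (s k) = cls mu f} by exact/cid2/cls_surj.
pose f0 k := s2val (wf k); have Lf0 k : L2 mu (f0 k) := s2valP (wf k).
have uf0 k : u (s k) = cls mu (f0 k) := s2valP' (wf k).
have [N [mN N0 hN]] : {ae mu, forall x, (\sum_(0 <= n <oo) (csqn ((2 ^+ n)%:C%C * (f0 n.+1 x - f0 n x)))%:E < +oo)%E}.
  apply: fast_ae => n.
    by apply: cmeasM; [exact: cmeas_cst|apply: cmeasB; case: (Lf0 n) (Lf0 n.+1) => ? ? []].
  have Ld : L2 mu (fun x => f0 n.+1 x - f0 n x) by exact: L2B.
  rewrite -cls_norm; last exact: L2Z.
  rewrite clsZ// clsB// -!uf0 hnormZsq csqn_real lee_fin -exprMn.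
  have := sh n _ _ (sS _ _ (leqnSn n)) (leqnn _); move/ltW => h.
  apply: (@le_trans _ _ ((2 ^+ n * 4^-1 ^+ n) ^+ 2)).
    by rewrite ler_pXn2r// ?nnegrE ?mulr_ge0 ?exprn_ge0 ?hnorm_ge0// ler_wpM2l ?exprn_ge0.
  rewrite -exprMn (_ : 2 * 4^-1 = 2^-1 :> R); last lra.
  rewrite expr2 ler_piMr ?exprn_ge0// exprn_ile1//.
  by rewrite invf_le1// ler1n.
(* Cut to 0 on the exceptional set, so that the limit exists at every point. *)
pose f k x : R[i] := (\1_(~` N) x)%:C%C * f0 k x.
have mf k : cmeas (f k).
  apply: cmeasM; last by case: (Lf0 k).
  by apply: cmeas_indic; exact: measurableC.
have Lf k : L2 mu (f k).
  apply: (L2_dom (C := 1) (mf k) (Lf0 k)) => x.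
  rewrite /f csqnM csqn_real indicE; case: (x \in _); first by rewrite expr1n.
  by rewrite expr0n mul0r mul1r csqn_ge0.
have uf k : u (s k) = cls mu (f k).
  rewrite uf0; apply: cls_ae => //; exists N; split=> // x /=; apply: contra_notP => xN.
  by rewrite /f indicE mem_set// mul1r.
have fc x : exists z, ccvg (f ^~ x) z.
  have [xN|xN] := pselect (N x).
    exists 0; rewrite (_ : f ^~ x = fun=> 0); first exact: ccvg_cst.
    by apply/funext => k; rewrite /f indicE memNset ?mul0r// => /(_ xN).
  have -> : f ^~ x = f0 ^~ x by apply/funext => k; rewrite /f indicE mem_set// mul1r.
  have /nneseries_lt_cvg0 : (\sum_(0 <= n <oo) (csqn ((2 ^+ n)%:C%C * (f0 n.+1 x - f0 n x)))%:E < +oo)%E.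
    by apply: contrapT => h; apply: xN; exact: hN.
  move=> /(_ (fun n => csqn_ge0 _)) h.
  have [C Ch] : exists C : R, forall n, csqn ((2 ^+ n)%:C%C * (f0 n.+1 x - f0 n x)) <= C.
    have : cvgn (fun n => csqn ((2 ^+ n)%:C%C * (f0 n.+1 x - f0 n x))) by apply/cvg_ex; exists 0.
    move=> /cvg_seq_bounded/bounded_fun_has_ubound[C Ch]; exists C => n.
    by apply: Ch; exists n.
  have C0 : 0 <= C by rewrite (le_trans _ (Ch 0%N))// csqn_ge0.
  have D n : Num.sqrt (csqn (f0 n.+1 x - f0 n x)) <= Num.sqrt C * 2^-1 ^+ n.
    have := Ch n; rewrite csqnM csqn_real => /ler_wsqrtr.
    rewrite sqrtrM ?sqr_ge0// sqrtr_sqr ger0_norm ?exprn_ge0//.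
    rewrite exprVn => h2; rewrite ler_pdivlMr ?exprn_gt0//.
    by rewrite mulrC.
  have cr : cvgn (fun n => Re (f0 n x)).
    apply: (geo_cauchy_cvg (C := Num.sqrt C)) => n.
    by rewrite -raddfB (le_trans (Re_le_csqn _)).
  have ci : cvgn (fun n => Im (f0 n x)).
    apply: (geo_cauchy_cvg (C := Num.sqrt C)) => n.
    by rewrite -raddfB (le_trans (Im_le_csqn _)).
  exists (Complex (limn (fun n => Re (f0 n x))) (limn (fun n => Im (f0 n x)))).
  by apply/ccvgP; split.
pose g x := sval (cid (fc x)); have fg x : ccvg (f ^~ x) (g x) := svalP (cid (fc x)).
have mg : cmeas g by apply: (cmeas_cvg mf).
(* Fatou's lemma for [f k - f (k + l)] as l grows. *)
have bnd k : (sqint mu (fun x => (f k x - g x)%R) <= ((4^-1 ^+ k) ^+ 2)%:E)%E.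
  apply: (fatou_le (h := fun l x => (csqn (f k x - f (k + l)%N x)%R)%:E)).
  - by move=> l; apply/cmeas_csqnE/cmeasB.
  - by move=> l x; rewrite lee_fin csqn_ge0.
  - move=> x; apply: cvg_EFin; first by apply: nearW.
    rewrite /comp /=.
    have : ccvg (fun l => f k x - f (k + l)%N x) (f k x - g x).
      apply: (cvg_ext (f := fun l => csqn (f (l + k)%N x - g x))) => [|n|//].
        by rewrite (cvg_shiftn k (fun l => csqn (f l x - g x))); exact: fg.
      by rewrite -csqnN; congr csqn; rewrite addnC; ring.
    move=> /ccvgP[a b]; rewrite /csqn.
    by apply: (cvg_ext (cvgD (cvgM a a) (cvgM b b))).
  - move=> l; rewrite -/(sqint mu (fun x => f k x - f (k + l)%N x)) -cls_normB// -!uf lee_fin.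
    rewrite ler_pXn2r// ?nnegrE ?hnorm_ge0 ?exprn_ge0//.
    by rewrite ltW// sh// sS// leq_addr.
have Lg : L2 mu g.
  have L0 : L2 mu (fun x => f 0%N x - g x).
    by split; [exact: cmeasB|rewrite (le_lt_trans (bnd 0%N))// ltry].
  have := L2B (Lf 0%N) L0; congr L2; apply/funext => x; ring.
exists (cls mu g); apply/hlimP => e e0.
have [k ke] : exists k, 2 * 4^-1 ^+ k < e.
  have : (fun k => 2 * (4^-1 : R) ^+ k) @ \oo --> (0 : R).
    rewrite -[X in _ --> X](mulr0 2); apply: cvgM; first exact: cvg_cst.
    by apply: cvg_expr; rewrite ger0_norm ?invr_ge0// invf_lt1 ?ltr1n.
  move=> /cvgrPdist_lt /(_ _ e0)[k _ /(_ k (leqnn k))].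
  rewrite sub0r normrN ger0_norm; first by exists k.
  by rewrite mulr_ge0// exprn_ge0.
exists (s k) => // n /= kn; rewrite (le_lt_trans (hnorm_tri (u (s k)) _ _))//.
apply: le_lt_trans ke; rewrite mulr_natl mulr2n; apply: lerD; first by rewrite ltW// sh.
by rewrite uf -clsB// hnorm_sqint ?exprn_ge0//; exact: L2B.
Qed.

End L2_conv.

Section cabs.
Context {R : realType}.
Definition cabs (z : R[i]) : R := Num.sqrt (csqn z).
Lemma cabsD z w : cabs (z + w) <= cabs z + cabs w.
Proof. by have := le_normcD (z : Rcomplex R) w; case: z w => a b [c d]. Qed.
Lemma cabs0 : cabs 0 = 0. Proof. by rewrite /cabs csqn0 sqrtr0. Qed.
Lemma cabs_ge0 z : 0 <= cabs z. Proof. exact: sqrtr_ge0. Qed.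
Lemma cabs_sq z : cabs z ^+ 2 = csqn z. Proof. by rewrite sqr_sqrtr ?csqn_ge0. Qed.
Lemma cabsM z w : cabs (z * w) = cabs z * cabs w.
Proof. by rewrite /cabs csqnM sqrtrM ?csqn_ge0. Qed.
Lemma cabs_sum (I : Type) (r : seq I) (Q : pred I) (F : I -> R[i]) :
  cabs (\sum_(i <- r | Q i) F i) <= \sum_(i <- r | Q i) cabs (F i).
Proof.
elim/big_rec2: _ => [|i y x _ h]; first by rewrite cabs0.
by rewrite (le_trans (cabsD _ _))// lerD2l.
Qed.
Lemma cabs_le z (r : R) : 0 <= r -> (cabs z <= r) = (csqn z <= r ^+ 2).
Proof. by move=> r0; rewrite -cabs_sq ler_pXn2r// nnegrE cabs_ge0. Qed.
Lemma cabs_ccvg (u : nat -> R[i]) z :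
  (fun n => cabs (u n - z)) @ \oo --> (0 : R) -> ccvg u z.
Proof.
move=> h; apply: (cvg_ext (cvgM h h)); last by rewrite mulr0.
by move=> n; rewrite -cabs_sq expr2.
Qed.

Definition zrot : R[i] := Complex (3 / 5) (4 / 5).
Lemma csqn_zrot : csqn zrot = 1. Proof. by rewrite /csqn /=; field. Qed.
(* (3 + 4i)^2 = 3 + 4i mod 5, so that no power of (3 + 4i) / 5 is real. *)
Lemma zrot_neq1 n : zrot ^+ n.+1 != 1.
Proof.
have [a [b E]] : exists a b : int, zrot ^+ n.+1 =
   Complex ((5 * a + 3)%:~R / 5 ^+ n.+1) ((5 * b + 4)%:~R / 5 ^+ n.+1).
  elim: n => [|n [a [b E]]].
    by exists 0, 0; rewrite !mulr0 !add0r !expr1.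
  exists (3 * a - 4 * b - 2), (4 * a + 3 * b + 4).
  rewrite exprS E /zrot; apply: complex_eqP; rewrite /=.
    rewrite (exprS _ n.+1) !(rmorphD, rmorphB, rmorphM) /=.
    by field; rewrite expf_neq0 ?pnatr_eq0.
  rewrite (exprS _ n.+1) !(rmorphD, rmorphB, rmorphM) /=.
  by field; rewrite expf_neq0 ?pnatr_eq0.
rewrite E; apply/negP => /eqP/(congr1 (fun z => Im z)) /= /eqP.
rewrite mulf_eq0 invr_eq0 expf_eq0 pnatr_eq0 /= orbF intr_eq0 => /eqP.
by lia.
Qed.
End cabs.

(** * Classes of functions closed under bounded limits *)

Section bclass.
Context {R : realType} {W : pointedType}.
Implicit Types (m : W -> R[i]) (A : set W).

(** The closure properties of the functional monotone class theorem. Stability under conjugation is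
    not demanded: the conjugate of a multiplier that preserves a closed subspace may fail to
    preserve it, as for multiplication by z on the Hardy space. *)
Definition bclass (F : set (W -> R[i])) := [/\ F (fun=> 1),
  forall c m m', F m -> F m' -> F (fun x => c * m x + m' x),
  forall m m', F m -> F m' -> F (fun x => m x * m' x) &
  forall (h : nat -> W -> R[i]) m (C : R), (forall n, F (h n)) ->
    (forall n x, csqn (h n x) <= C) -> (forall x, ccvg (h ^~ x) (m x)) -> F m].

Definition bsets (F : set (W -> R[i])) : set (set W) := [set A | F (fun x => (\1_A x)%:C%C)].

Variable F : set (W -> R[i]).
Hypothesis HF : bclass F.

Lemma bclass1 : F (fun=> 1). Proof. by case: HF. Qed.
Lemma bclassP c m m' : F m -> F m' -> F (fun x => c * m x + m' x).
Proof. by case: HF => _ + _ _; exact. Qed.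
Lemma bclassM m m' : F m -> F m' -> F (fun x => m x * m' x).
Proof. by case: HF => _ _ + _; exact. Qed.
Lemma bclass_lim (h : nat -> W -> R[i]) m (C : R) : (forall n, F (h n)) ->
  (forall n x, csqn (h n x) <= C) -> (forall x, ccvg (h ^~ x) (m x)) -> F m.
Proof. by case: HF => _ _ _; exact. Qed.
Lemma bclass0 : F (fun=> 0).
Proof.
by have := bclassP (-1) bclass1 bclass1; under eq_fun do rewrite mulN1r addNr.
Qed.
Lemma bclassZ c m : F m -> F (fun x => c * m x).
Proof. by move=> Fm; have := bclassP c Fm bclass0; under eq_fun do rewrite addr0. Qed.
Lemma bclass_cst c : F (fun=> c).
Proof. by have := bclassZ c bclass1; under eq_fun do rewrite mulr1. Qed.
Lemma bclassD m m' : F m -> F m' -> F (fun x => m x + m' x).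
Proof. by move=> Fm Fm'; have := bclassP 1 Fm Fm'; under eq_fun do rewrite mul1r. Qed.
Lemma bclassB m m' : F m -> F m' -> F (fun x => m x - m' x).
Proof.
move=> Fm Fm'; have := bclassP (-1) Fm' Fm.
by under eq_fun do rewrite mulN1r addrC.
Qed.
Lemma bclass_sum (I : Type) (r : seq I) (G : I -> W -> R[i]) :
  (forall i, F (G i)) -> F (fun x => \sum_(i <- r) G i x).
Proof.
move=> FG; elim: r => [|i r IH].
  by under eq_fun do rewrite big_nil; exact: bclass0.
by under eq_fun do rewrite big_cons; exact: bclassD.
Qed.
Lemma bclassX m n : F m -> F (fun x => m x ^+ n).
Proof.
move=> Fm; elim: n => [|n IH]; first exact: bclass1.
by under eq_fun do rewrite exprS; exact: bclassM.
Qed.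

Lemma ccvg_eventually (u : nat -> R[i]) z N : (forall n, (N <= n)%N -> u n = z) -> ccvg u z.
Proof.
move=> h; apply: cvg_near_cst; exists N => // n /= Nn.
by rewrite h// subrr csqn0.
Qed.

Lemma csqn_indic A x : csqn (\1_A x)%:C%C <= (1 : R).
Proof. by rewrite csqn_real indicE; case: (_ \in _); rewrite ?expr1n// expr0n. Qed.

(** Complements and intersections come from the algebra operations, and a countable union is a
    bounded limit of finite unions. *)
Lemma bsets_sigma_algebra : sigma_algebra setT (bsets F).
Proof.
have C A : bsets F A -> bsets F (~` A).
  move=> /(bclassB bclass1); congr F; apply/funext => x.
  by rewrite !indicE in_setC; case: (x \in A); rewrite /= ?subrr ?subr0.
have I A B : bsets F A -> bsets F B -> bsets F (A `&` B).
  move=> FA FB; have := bclassM FA FB; congr F; apply/funext => x.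
  by rewrite !indicE in_setI; case: (x \in A); rewrite ?mul1r ?mul0r.
have z : bsets F set0 by have := bclass0; congr F; apply/funext => x; rewrite indicE in_set0.
have U (A : nat -> set W) n : (forall i, bsets F (A i)) -> bsets F (\bigcup_(i < n) A i).
  move=> FA; rewrite -[X in bsets F X]setCK setC_bigcup; apply: (C).
  elim: n => [|n IH].
    by rewrite (_ : \bigcap_(i < 0) _ = ~` set0); [exact: (C)|rewrite setC0; apply/seteqP; split].
  rewrite (_ : \bigcap_(i < n.+1) _ = (\bigcap_(i < n) ~` A i) `&` ~` A n).
    by apply: (I) => //; exact: (C).
  apply/seteqP; split=> x.
    by move=> h; split=> [i /= ni|]; apply: h => /=; first exact: ltnW.
  by move=> [h hn] i /=; rewrite ltnS leq_eqVlt => /predU1P[->//|/h].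
split=> // [A FA|A FA]; first by rewrite setTD; exact: C.
apply: (bclass_lim (h := fun n x => (\1_(\bigcup_(i < n) A i) x)%:C%C) (C := 1)).
- by move=> n; exact: U.
- by move=> n x; exact: csqn_indic.
- move=> x; have [[N _ Nx]|h] := pselect ((\bigcup_n A n) x).
    apply: (@ccvg_eventually _ _ N.+1) => n Nn; rewrite !indicE !mem_set//; by exists N.
  apply: (@ccvg_eventually _ _ 0%N) => n _; rewrite !indicE !memNset//.
  by move=> -[k _ kx]; apply: h; exists k.
Qed.

Local Notation WF := (g_sigma_algebraType (bsets F)).

Lemma bsets_measurable (A : set W) : measurable (A : set WF) <-> bsets F A.
Proof.
rewrite -[X in X <-> _]/(<<s bsets F >> A).
by rewrite sigma_algebra_id//; exact: bsets_sigma_algebra.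
Qed.

(** The simple functions that approximate h from below stay below C, so their limit is a bounded
    one. *)
Lemma bclass_meas_nneg (h : W -> R) (C : R) : measurable_fun setT (h : WF -> R) ->
  (forall x, 0 <= h x) -> (forall x, h x <= C) -> F (fun x => (h x)%:C%C).
Proof.
move=> mh h0 hC; have mE : measurable_fun setT (EFin \o h : WF -> \bar R).
  exact/measurable_EFinP.
pose g n := nnsfun_approx (@measurableT _ WF) mE n.
have gc x : (fun n => g n x) @ \oo --> h x.
  have := @cvg_nnsfun_approx _ WF R setT measurableT _ mE (fun x _ => ltac:(by rewrite lee_fin)) x I.
  by move=> /fine_cvgP[_].
have gle n x : g n x <= h x.
  have nd := nd_nnsfun_approx measurableT mE.
  have ndx : nondecreasing_seq (fun n => g n x).
    by move=> i j ij; have /lefP := nd _ _ ij; exact.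
  have cx : cvgn (fun n => g n x) by apply/cvg_ex; exists (h x).
  by have := nondecreasing_cvgn_le ndx cx n; rewrite (cvg_lim _ (gc x)).
apply: (bclass_lim (h := fun n x => (g n x)%:C%C) (C := C ^+ 2)).
- move=> n; under eq_fun do rewrite fimfunE fsbig_finite//= rmorph_sum.
  apply: bclass_sum => y; under eq_fun do rewrite rmorphM /=.
  by apply: bclassZ; apply/bsets_measurable; exact: measurable_funPTI.
- move=> n x; rewrite csqn_real ler_pXn2r ?nnegrE//.
  + exact: le_trans (gle n x) (hC x).
  + exact: le_trans (h0 x) (hC x).
- move=> x; apply/ccvgP; split; [exact: gc|exact: cvg_cst].
Qed.

Lemma bclass_meas (h : W -> R[i]) (C : R) : cmeas (h : WF -> R[i]) ->
  (forall x, csqn (h x) <= C) -> F h.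
Proof.
move=> [mr mi] hC.
have key (k : W -> R) : measurable_fun setT (k : WF -> R) ->
    (forall x, k x ^+ 2 <= C) -> F (fun x => (k x)%:C%C).
  move=> mk kC; have kb x : `|k x| <= Num.sqrt C by rewrite -sqrtr_sqr ler_wsqrtr.
  have := @bclass_meas_nneg (fun x => k x + Num.sqrt C) (Num.sqrt C + Num.sqrt C).
  have m1 : measurable_fun setT ((fun x => k x + Num.sqrt C) : WF -> R).
    exact: measurable_funD.
  move=> /(_ m1) /(_ (fun x => ltac:(move: (kb x); rewrite ler_norml => /andP[] ? ?; lra))).
  move=> /(_ (fun x => ltac:(move: (kb x); rewrite ler_norml => /andP[] ? ?; lra))).
  move=> /bclassB /(_ (bclass_cst (Num.sqrt C)%:C%C)).
  by under eq_fun do rewrite rmorphD addrK.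
have h1 := key _ mr (fun x => le_trans (Re_sq_le _) (hC x)).
have h2 := key _ mi (fun x => le_trans (Im_sq_le _) (hC x)).
have := bclassP 'i%C h2 h1; congr F; apply/funext => x.
by rewrite [RHS]complexE addrC.
Qed.

(* [N = k] is recovered from the Cesaro means of (z^N z^-k)^j, z not a root of unity. *)
Lemma bsets_nat (N : W -> nat) k : F (fun x => zrot ^+ N x) -> bsets F [set x | N x = k].
Proof.
move=> FN; pose zc : R[i] := zrot^*%C.
have zzc : zrot * zc = 1 by rewrite csqn_mulconj csqn_zrot.
pose q x := zrot ^+ N x * zc ^+ k.
have q1 x : csqn (q x) = 1 by rewrite csqnM !csqnX csqn_conj csqn_zrot !expr1n mulr1.
have zci n : zc ^+ n * zrot ^+ n = 1 by rewrite -exprMn mulrC zzc expr1n.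
have qE x : N x != k -> q x != 1.
  rewrite neq_ltn => /orP[h|h]; apply/negP => /eqP.
    move=> /(congr1 ( *%R^~ (zrot ^+ (k - N x)))); rewrite mul1r /q.
    rewrite -mulrA (mulrC (_ ^+ k)) mulrA -exprD subnKC; last exact: ltnW.
    rewrite mulrC zci => /esym/eqP; apply/negP.
    by rewrite -(subnSK h); exact: zrot_neq1.
  rewrite /q -(subnK (ltnW h)) exprD -mulrA (mulrC _ (zc ^+ k)) zci mulr1 => /eqP.
  by apply/negP; rewrite -(subnSK h); exact: zrot_neq1.
pose s n x := n.+1%:R^-1 * \sum_(0 <= j < n.+1) q x ^+ j.
apply: (bclass_lim (h := s) (C := 1)).
- move=> n; apply: bclassZ; apply: bclass_sum => j; apply: bclassX.
  by have := bclassZ (zc ^+ k) FN; under eq_fun do rewrite mulrC.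
- move=> n x; rewrite -[leRHS](expr1n _ 2) -cabs_le// cabsM.
  have -> : cabs n.+1%:R^-1 = n.+1%:R^-1 :> R.
    have -> : (n.+1%:R^-1 : R[i]) = (n.+1%:R^-1)%:C%C by rewrite fmorphV rmorph_nat.
    by rewrite /cabs csqn_real sqrtr_sqr ger0_norm.
  rewrite ler_pdivrMl ?ltr0n// mulr1 (le_trans (cabs_sum _ _ _))//.
  under eq_bigr do rewrite /cabs csqnX q1 expr1n sqrtr1.
  by rewrite sumr_const_nat subn0.
- move=> x; rewrite indicE; have [/= Nk|/= Nk] := eqVneq (N x) k.
    rewrite mem_set//; apply: (@ccvg_eventually _ _ 0%N) => n _; rewrite /s.
    have -> : q x = 1 by rewrite /q Nk mulrC zci.
    under eq_bigr do rewrite expr1n.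
    by rewrite sumr_const_nat subn0 mulVf// pnatr_eq0.
  rewrite memNset; last by move=> /eqP; rewrite (negbTE Nk).
  have q1' : 1 - q x != 0 by rewrite subr_eq0 eq_sym qE.
  pose D := cabs ((1 - q x)^-1).
  have D0 : 0 <= D by exact: cabs_ge0.
  apply: cabs_ccvg.
  (* For q of modulus 1 and different from 1, the geometric sums have modulus at most 2D. *)
  have e0 : (fun n : nat => 2 * D * n.+1%:R^-1) @ \oo --> (0 : R).
    rewrite -[X in _ --> X](mulr0 (2 * D)); apply: cvgM; [exact: cvg_cst|exact: cvg_harmonic].
  apply: (squeeze_cvgr _ (cvg_cst 0) e0); apply: nearW => n.
  rewrite cabs_ge0 /= subr0 /s.
  have -> : \sum_(0 <= j < n.+1) q x ^+ j = (1 - q x ^+ n.+1) * (1 - q x)^-1.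
    have -> : 1 - q x ^+ n.+1 = (1 - q x) * \sum_(i < n.+1) q x ^+ i.
      by rewrite -opprB subrX1 -mulNr opprB.
    by rewrite mulrAC mulfV// mul1r big_mkord.
  rewrite !cabsM -/D.
  have -> : cabs n.+1%:R^-1 = n.+1%:R^-1 :> R.
    have -> : (n.+1%:R^-1 : R[i]) = (n.+1%:R^-1)%:C%C by rewrite fmorphV rmorph_nat.
    by rewrite /cabs csqn_real sqrtr_sqr ger0_norm.
  rewrite mulrC ler_wpM2r// ler_wpM2r//.
  rewrite (le_trans (cabsD _ _))// /cabs csqnN csqn1 csqnX q1 expr1n sqrtr1; lra.
Qed.
End bclass.

(** * Multiplication operators *)

Section multiplication.
Context {d} {T : measurableType d} {R : realType} {mu : {measure set T -> \bar R}}.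
Local Notation L := (cL2_ips mu).
Implicit Types (f g m : T -> R[i]) (x y : L).

Definition rep x : T -> R[i] := s2val (cid2 (cls_surj x)).
Lemma rep_L2 x : L2 mu (rep x). Proof. by rewrite /rep; case: cid2. Qed.
Lemma repK x : cls mu (rep x) = x. Proof. by rewrite /rep; case: cid2. Qed.

Definition bmeas m := cmeas m /\ exists C : R, forall t, csqn (m t) <= C.

Lemma bmeas_L2 m f : bmeas m -> L2 mu f -> L2 mu (fun t => m t * f t).
Proof.
move=> [mm [C mC]] Lf; apply: (L2_dom (C := C) _ Lf).
  by apply: cmeasM => //; case: Lf.
by move=> t; rewrite csqnM ler_wpM2r// csqn_ge0.
Qed.
Lemma bmeas_cst c : bmeas (fun=> c).
Proof. by split; [exact: cmeas_cst|exists (csqn c)]. Qed.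
Lemma bmeasM m m' : bmeas m -> bmeas m' -> bmeas (fun t => m t * m' t).
Proof.
move=> [mm [C mC]] [mm' [C' mC']]; split; first exact: cmeasM.
by exists (C * C') => t; rewrite csqnM ler_pM ?csqn_ge0.
Qed.
Lemma bmeasD m m' : bmeas m -> bmeas m' -> bmeas (fun t => m t + m' t).
Proof.
move=> [mm [C mC]] [mm' [C' mC']]; split; first exact: cmeasD.
by exists (2 * (C + C')) => t; rewrite (le_trans (csqnD _ _))// ler_wpM2l// lerD.
Qed.
Lemma bmeas_lin c m m' : bmeas m -> bmeas m' -> bmeas (fun t => c * m t + m' t).
Proof. by move=> bm bm'; apply: bmeasD => //; apply: bmeasM => //; exact: bmeas_cst. Qed.
Lemma bmeas_indic (A : set T) : measurable A -> bmeas (fun t => (\1_A t)%:C%C).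
Proof. by move=> mA; split; [exact: cmeas_indic|exists 1 => t; exact: csqn_indic]. Qed.
Lemma bmeas_conj m : bmeas m -> bmeas (fun t => (m t)^*%C).
Proof.
by move=> [mm [C mC]]; split; [exact: cmeas_conj|exists C => t; rewrite csqn_conj].
Qed.
Lemma bmeas_cvg (h : nat -> T -> R[i]) m (C : R) : (forall n, bmeas (h n)) ->
  (forall n t, csqn (h n t) <= C) -> (forall t, ccvg (h ^~ t) (m t)) -> bmeas m.
Proof.
move=> bh hC hm; split; first by apply: (cmeas_cvg (h := h)) => // n; case: (bh n).
exists C => t; have /ccvgP[a b] := hm t.
have h2 : (fun n => csqn (h n t)) @ \oo --> csqn (m t).
  by apply: (cvg_ext (cvgD (cvgM a a) (cvgM b b))).
rewrite -(cvg_lim _ h2)//; apply: limr_le; first by apply/cvg_ex; exists (csqn (m t)).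
by apply: nearW => n; exact: hC.
Qed.

Definition mulop m x : L := cls mu (fun t => m t * rep x t).

Lemma mulop_cls m f : bmeas m -> L2 mu f -> mulop m (cls mu f) = cls mu (fun t => m t * f t).
Proof.
move=> bm Lf; apply: cls_ae; [exact: bmeas_L2 (rep_L2 _)|exact: bmeas_L2|].
have := cls_aeP (rep_L2 (cls mu f)) Lf (repK _).
by apply: filterS => t ->.
Qed.
Lemma mulop_lin m c x y : bmeas m -> mulop m (c *: x + y) = c *: mulop m x + mulop m y.
Proof.
move=> bm; rewrite -(repK x) -(repK y); have := rep_L2 x; have := rep_L2 y.
move: (rep x) (rep y) => f g Lg Lf; rewrite -clsZ// -clsD//; last exact: L2Z.
rewrite !mulop_cls//; last by apply: L2D => //; exact: L2Z.
have Lmf := bmeas_L2 bm Lf; have Lmg := bmeas_L2 bm Lg.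
rewrite -(clsZ _ Lmf) -(clsD (L2Z c Lmf) Lmg).
by congr cls; apply/funext => t; ring.
Qed.
Lemma mulop0 m : bmeas m -> mulop m 0 = 0.
Proof. by move=> bm; have := mulop_lin (-1) 0 0 bm; rewrite scaler0 addr0 scaleN1r addNr. Qed.
Lemma mulop_linm c m m' x : bmeas m -> bmeas m' ->
  mulop (fun t => c * m t + m' t) x = c *: mulop m x + mulop m' x.
Proof.
move=> bm bm'; have L1 := bmeas_L2 bm (rep_L2 x); have L1' := bmeas_L2 bm' (rep_L2 x).
rewrite /mulop -(clsZ _ L1) -(clsD (L2Z c L1) L1').
by congr cls; apply/funext => t; ring.
Qed.
Lemma mulop_comp m m' x : bmeas m -> bmeas m' ->
  mulop m (mulop m' x) = mulop (fun t => m t * m' t) x.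
Proof.
move=> bm bm'; have L1' := bmeas_L2 bm' (rep_L2 x); rewrite {2}/mulop mulop_cls//.
by congr cls; apply/funext => t; rewrite mulrA.
Qed.
Lemma mulop1 x : mulop (fun=> 1) x = x.
Proof. by rewrite -[RHS]repK; congr cls; apply/funext => t; rewrite mul1r. Qed.
Lemma mulop_ae m m' x : bmeas m -> bmeas m' -> {ae mu, forall t, m t = m' t} ->
  mulop m x = mulop m' x.
Proof.
move=> bm bm' mm'; apply: cls_ae; [exact: bmeas_L2 (rep_L2 _)|exact: bmeas_L2 (rep_L2 _)|].
by apply: filterS mm' => t ->.
Qed.
Lemma mulop_le m (C : R) x : cmeas m -> (forall t, csqn (m t) <= C) ->
  hnorm (mulop m x) <= Num.sqrt C * hnorm x.
Proof.
move=> mm mC; have bm : bmeas m by split=> //; exists C.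
have C0 : 0 <= C by rewrite (le_trans _ (mC point))// csqn_ge0.
have Lx := rep_L2 x.
rewrite hnorm_sqint ?mulr_ge0 ?sqrtr_ge0 ?hnorm_ge0//; last exact: bmeas_L2.
rewrite exprMn sqr_sqrtr// EFinM -[in hnorm x](repK x) cls_norm// /sqint.
rewrite -ge0_integralZl//; last 2 first.
- by apply: cmeas_csqnE; case: Lx.
- by move=> t _; rewrite lee_fin csqn_ge0.
apply: ge0_le_integral => //.
- by move=> t _; rewrite lee_fin csqn_ge0.
- by apply: cmeas_csqnE; apply: cmeasM => //; case: Lx.
- by apply: measurable_funeM; apply: cmeas_csqnE; case: Lx.
- by move=> t _; rewrite -EFinM lee_fin csqnM ler_wpM2r ?csqn_ge0.
Qed.
Lemma mulop_cont m (u : nat -> L) x : bmeas m -> hlim u x -> hlim (mulop m \o u) (mulop m x).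
Proof.
move=> bm ux; have [mm [C mC]] := bm.
apply: (hlim_le (e := fun n => Num.sqrt C * hnorm (u n - x))).
  move=> n /=; rewrite addrC -scaleN1r -mulop_lin// scaleN1r (addrC (- x)).
  exact: mulop_le.
by rewrite -[X in _ --> X](mulr0 (Num.sqrt C)); apply: cvgM => //; exact: cvg_cst.
Qed.
(** Strong convergence, by dominated convergence: |h - m|^2 is at most 2 (C + C), hence the bound 4C
    |x|^2. *)
Lemma mulop_cvg (h : nat -> T -> R[i]) m (C : R) x : (forall n, cmeas (h n)) ->
  (forall n t, csqn (h n t) <= C) -> (forall t, ccvg (h ^~ t) (m t)) ->
  hlim (fun n => mulop (h n) x) (mulop m x).
Proof.
move=> mh hC hm; have bh n : bmeas (h n) by split=> //; exists C.
have bm := bmeas_cvg bh hC hm; have [mm _] := bm.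
have mC t : csqn (m t) <= C.
  have /ccvgP[a b] := hm t.
  have h2 : (fun n => csqn (h n t)) @ \oo --> csqn (m t).
    by apply: (cvg_ext (cvgD (cvgM a a) (cvgM b b))).
  rewrite -(cvg_lim _ h2)//; apply: limr_le; first by apply/cvg_ex; exists (csqn (m t)).
  by apply: nearW => n; exact: hC.
have Lx := rep_L2 x; have [mx ix] := Lx.
apply: sqint_cvg_hlim; [by move=> n; exact: bmeas_L2|exact: bmeas_L2|].
pose F n t := (csqn (h n t * rep x t - m t * rep x t)%R)%:E.
have := @dominated_convergence _ _ _ mu setT measurableT F (fun=> 0%E)
  (fun t => (4 * C * csqn (rep x t))%R%:E).
case.
- by move=> n; apply/cmeas_csqnE/cmeasB; exact: cmeasM.
- exact: measurable_cst.
- apply: nearW => t _; apply: cvg_EFin; first exact: nearW.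
  apply: (cvg_ext (cvgM (hm t) (cvg_cst (csqn (rep x t))))); last by rewrite mul0r.
  by move=> n; rewrite /F /= -csqnM mulrBl.
- have /integrableP[? ?] : mu.-integrable setT (fun t => (csqn (rep x t))%:E).
    apply/integrableP; split; first exact: cmeas_csqnE.
    by under eq_integral do rewrite gee0_abs ?lee_fin ?csqn_ge0//.
  under eq_fun do rewrite EFinM.
  by apply: integrableZl => //; apply/integrableP.
- apply: nearW => t n _; rewrite /F gee0_abs ?lee_fin ?csqn_ge0// -mulrBl csqnM.
  rewrite ler_wpM2r ?csqn_ge0// (le_trans (csqnB _ _))//.
  by have := hC n t; have := mC t; lra.
by move=> _ _; rewrite integral0.
Qed.

Lemma mulop_dot m x y : bmeas m -> hdot (mulop m x) y = hdot x (mulop (fun t => (m t)^*%C) y).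
Proof.
move=> bm; rewrite -{2}(repK x) -{1}(repK y) /mulop !cls_dot; do ?[exact: rep_L2|exact: bmeas_L2 (rep_L2 _)].
  by congr cint; apply/funext => t; rewrite rmorphM /= conjcK; ring.
by apply: bmeas_L2 (rep_L2 _); exact: bmeas_conj.
Qed.

(* A bclass, so M is stable under all bounded multipliers measurable for its [bsets]. *)
Definition mult_class (M : set L) : set (T -> R[i]) :=
  [set m | bmeas m /\ forall x, M x -> M (mulop m x)].

(** Sums, products and bounded limits of multipliers act as sums, compositions and strong limits of
    operators, all of which preserve a closed subspace. *)
Lemma mult_bclass (M : set L) : hsubspace M -> bclass (mult_class M).
Proof.
move=> HM; split.
- by split; [exact: bmeas_cst|move=> x; rewrite mulop1].
- move=> c m m' [bm Mm] [bm' Mm']; split; first exact: bmeas_lin.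
  by move=> x Mx; rewrite mulop_linm//; apply: hsubP => //; [exact: Mm|exact: Mm'].
- move=> m m' [bm Mm] [bm' Mm']; split; first exact: bmeasM.
  by move=> x Mx; rewrite -mulop_comp//; apply/Mm/Mm'.
- move=> h m C hM hC hm; split; first by apply: bmeas_cvg hC hm => n; case: (hM n).
  move=> x Mx; have mh n : cmeas (h n) by case: (hM n) => -[].
  apply: (hsub_lim HM _ (mulop_cvg x mh hC hm)) => n.
  by apply: (hM n).2.
Qed.

(** Cut to 0 where f is large, instead of clipped: the truncation is then f times an indicator
    function. *)
Definition trunc (f : T -> R[i]) (n : nat) (t : T) : R[i] :=
  if csqn (f t) <= n%:R then f t else 0.
Lemma trunc_le f n t : csqn (trunc f n t) <= n%:R.
Proof. by rewrite /trunc; case: ifP => //; rewrite csqn0. Qed.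
Lemma truncE f n t : trunc f n t = (\1_[set t | csqn (f t) <= n%:R] t)%:C%C * f t.
Proof.
rewrite /trunc indicE; case: ifPn => h; first by rewrite mem_set// mul1r.
by rewrite memNset ?mul0r//; apply/negP.
Qed.
Lemma trunc_ind_cvg f t : ccvg (fun n => (\1_[set t | csqn (f t) <= n%:R] t)%:C%C : R[i]) 1.
Proof.
apply: (@ccvg_eventually _ _ _ (Num.truncn (csqn (f t))).+1) => n nt.
rewrite indicE mem_set//=; have := @real_truncnS_gt R (csqn (f t)) (num_real _).
by move=> /ltW h; rewrite (le_trans h)// ler_nat.
Qed.

End multiplication.

Section truncation.
Context {d} {T : measurableType d} {R : realType}.
Lemma trunc_cmeas (f : T -> R[i]) n : cmeas f -> cmeas (trunc f n).
Proof.
move=> mf; rewrite (_ : trunc f n = fun t => (\1_[set t | csqn (f t) <= n%:R] t)%:C%C * f t); last first.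
  by apply/funext => t; exact: truncE.
apply: cmeasM => //.
apply: cmeas_indic; rewrite -[X in measurable X]setTI.
by apply: measurable_fun_le => //; exact: cmeas_csqn.
Qed.
Lemma trunc_bmeas_ind (f : T -> R[i]) n : cmeas f ->
  bmeas (fun t => (\1_[set t | csqn (f t) <= n%:R] t)%:C%C : R[i]).
Proof.
move=> mf; apply: bmeas_indic; rewrite -[X in measurable X]setTI.
by apply: measurable_fun_le => //; exact: cmeas_csqn.
Qed.
End truncation.

Section subspace_of_measurable.
Context {d} {T : measurableType d} {R : realType} {mu : {measure set T -> \bar R}}.
Local Notation L := (cL2_ips mu).

(** The truncations of f are bounded and measurable for [bsets (mult_class M)], so they preserve
    [M]; the truncated products converge to f h by [mulop_cvg]. *)
Lemma mult_mem (M : set L) (f h : T -> R[i]) : hsubspace M -> M (cls mu h) -> L2 mu h ->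
  cmeas (f : g_sigma_algebraType (bsets (mult_class M)) -> R[i]) -> cmeas f ->
  L2 mu (fun t => f t * h t) -> M (cls mu (fun t => f t * h t)).
Proof.
move=> HM Mh Lh mf mf' Lfh.
have bi n := trunc_bmeas_ind n mf'.
apply: (hsub_lim (u := fun n => mulop (fun t => (\1_[set t | csqn (f t) <= n%:R] t)%:C%C)
   (cls mu (fun t => f t * h t))) HM).
  move=> n; rewrite mulop_cls//.
  have [bt Mt] : mult_class M (trunc f n).
    apply: (bclass_meas (mult_bclass HM) (C := n%:R)) => [|t]; last exact: trunc_le.
    exact: trunc_cmeas.
  have := Mt _ Mh; rewrite mulop_cls//; congr (M (cls mu _)).
  by apply/funext => t; rewrite truncE mulrA.
rewrite -[X in hlim _ X]mulop1; apply: (mulop_cvg (C := 1)).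
- by move=> n; case: (bi n).
- by move=> n t; exact: csqn_indic.
- by move=> t; exact: trunc_ind_cvg.
Qed.
End subspace_of_measurable.

(** * The L^2 space of a completed sub-sigma-algebra *)

Section conditional_L2.
Context {R : realType} {dO} {O : measurableType dO} {P : probability O R}.
Hypothesis P_complete : measure_is_complete P.
Local Notation L := (cL2_ips P).
Implicit Types (G : set (set O)).

Local Notation OG G := (g_sigma_algebraType (G `|` P.-negligible)).

Lemma cL2_subP G (x : L) : cL2_sub (complete_sigma P G) x <->
  exists2 f, L2 P f & x = cls P f /\ cmeas (f : OG G -> R[i]).
Proof.
split=> [[f /is_classP[Lf xf] mf]|[f Lf [xf [mr mi]]]].
  by exists f => //; split=> //; split=> _ A mA; rewrite setTI; have [] := mf A mA.
exists f; first exact/is_classP.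
by move=> A mA; split; rewrite -[X in complete_sigma P G X]setTI; [exact: mr|exact: mi].
Qed.

Lemma cmeasG_negl G (N : set O) : P.-negligible N -> measurable (N : set (OG G)).
Proof. by move=> hN; apply: sub_sigma_algebra; right. Qed.

(** For closedness, a subsequence converges off a negligible set. This set belongs to the completed
    sigma-algebra, so that cutting the functions to 0 on it keeps them measurable and makes them
    converge everywhere. *)
Lemma cL2_sub_hsub G : hsubspace (cL2_sub (complete_sigma P G) : set L).
Proof.
split.
- apply/cL2_subP; exists (fun=> 0); [exact: L2_0|split; [by rewrite cls0|exact: cmeas_cst]].
- move=> c x y /cL2_subP[f Lf [-> mf]] /cL2_subP[g Lg [-> mg]]; apply/cL2_subP.
  exists (fun t => c * f t + g t); first by apply: L2D => //; exact: L2Z.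
  split; first by rewrite clsD//; [rewrite clsZ|exact: L2Z].
  by apply: cmeasD => //; apply: cmeasM => //; exact: cmeas_cst.
- move=> u x Mu ux.
  have w n : {f | L2 P f & u n = cls P f /\ cmeas (f : OG G -> R[i])}.
    by apply: cid2; exact/cL2_subP.
  pose f n := s2val (w n); have Lf n : L2 P (f n) := s2valP (w n).
  have uf n : u n = cls P (f n) := (s2valP' (w n)).1.
  have mf n : cmeas (f n : OG G -> R[i]) := (s2valP' (w n)).2.
  have := ux; rewrite -(repK x) (_ : u = fun n => cls P (f n)); last exact/funext.
  move=> /(hlim_ae Lf (rep_L2 x))[s [_ [N [mN N0 hN]]]].
  have Nn : P.-negligible N by exists N; split.
  pose g t : R[i] := (\1_(~` N) t)%:C%C * rep x t.
  have [mx _] := rep_L2 x.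
  have mg : cmeas g by apply: cmeasM => //; apply: cmeas_indic; exact: measurableC.
  have Lg : L2 P g.
    apply: (L2_dom (C := 1) mg (rep_L2 x)) => t.
    by rewrite csqnM ler_wpM2r ?csqn_ge0// csqn_indic.
  apply/cL2_subP; exists g => //; split.
    apply: cls_ae => //; first exact: rep_L2.
    exists N; split=> // t /=; apply: contra_notP => tN.
    by rewrite /g indicE mem_set// mul1r.
  apply: (@cmeas_cvg _ (OG G) R (fun n t => (\1_(~` N) t)%:C%C * f (s n) t)) => [n|t].
    apply: cmeasM => //; apply: (@cmeas_indic _ (OG G)); apply: measurableC.
    exact: cmeasG_negl.
  have [tN|tN] := pselect (N t).
    have E z : (\1_(~` N) t)%:C%C * z = 0 :> R[i] by rewrite indicE memNset ?mul0r// => /(_ tN).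
    by rewrite /g E; under [X in ccvg X]eq_fun do rewrite E; exact: ccvg_cst.
  apply: ccvgM; first exact: ccvg_cst.
  by apply: contrapT => h; apply: tN; exact: hN.
Qed.

Lemma L2_bounded (m : O -> R[i]) : bmeas m -> L2 P m.
Proof.
move=> [mm [C mC]]; have L1 : L2 P (fun=> 1).
  split; first exact: cmeas_cst.
  by rewrite /sqint csqn1 integral_cst// mul1e (@le_lt_trans _ _ 1%E) ?ltry// probability_le1.
apply: (L2_dom (C := C) mm L1) => t; by rewrite csqn1 mulr1.
Qed.
Lemma L2_1 : L2 P (fun=> 1). Proof. exact/L2_bounded/bmeas_cst. Qed.

(** Completeness of [P] makes N measurable; multiplication by its indicator is then the zero
    operator. *)
Lemma mult_negl (M : set L) (N : set O) : hsubspace M -> P.-negligible N ->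
  bsets (mult_class M) N.
Proof.
move=> HM hN; have mN := P_complete hN.
have bN : bmeas (fun x => (\1_N x)%:C%C : R[i]) by exact: bmeas_indic.
split=> // x Mx; rewrite (mulop_ae (m' := fun=> 0) x bN (bmeas_cst _)); last first.
  have [N' [mN' N'0 NN']] := hN; exists N'; split=> // t /= h; apply: NN'.
  by apply: contrapT => tN; apply: h; rewrite indicE memNset.
rewrite /mulop; under eq_fun do rewrite mul0r.
by rewrite cls0; exact: hsub0.
Qed.

Lemma sigma_bsets (M : set L) G : hsubspace M -> G `<=` bsets (mult_class M) ->
  complete_sigma P G `<=` bsets (mult_class M).
Proof.
move=> HM GM; apply: smallest_sub; first exact: bsets_sigma_algebra (mult_bclass HM).
by move=> A [/GM//|]; exact: mult_negl.
Qed.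

(** The tool for showing that a closed subspace contains the L^2 space of a field: only the
    indicators of generating events have to be tested. The monotone class argument yields all
    bounded multipliers of the field; applied to 1, and with truncation, they give all its square
    integrable functions. *)
Lemma cL2_sub_min (M : set L) G : hsubspace M -> M (cls P (fun=> 1)) ->
  G `<=` bsets (mult_class M) -> cL2_sub (complete_sigma P G) `<=` M.
Proof.
move=> HM M1 GM x /cL2_subP[f Lf [-> [mr mi]]].
have := @mult_mem _ _ _ P M f (fun=> 1) HM M1 L2_1.
have -> : (fun t => f t * 1) = f by apply/funext => t; rewrite mulr1.
apply => //; last by case: Lf.
have h : complete_sigma P G `<=` bsets (mult_class M) by exact: sigma_bsets.
split=> _ A mA; apply: sub_sigma_algebra; apply: h; rewrite setTI.
  by have := mr measurableT A mA; rewrite setTI.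
by have := mi measurableT A mA; rewrite setTI.
Qed.

Lemma complete_sigma_sub G G' : G `<=` complete_sigma P G' ->
  complete_sigma P G `<=` complete_sigma P G'.
Proof.
move=> GG'; apply: smallest_sub; first exact: smallest_sigma_algebra.
by move=> A [/GG'//|hA]; apply: sub_sigma_algebra; right.
Qed.

End conditional_L2.

(** * Exponential vectors of a Poisson process *)

Section exponential_series.
Implicit Types F : numFieldType.

Definition exp_part F (x : F) (n : nat) : F := \sum_(k < n) x ^+ k / k`!%:R.
(** The terms of the product of two partial sums that have total degree at least n. *)
Definition exp_tail F (x y : F) (n : nat) : F :=
  \sum_(j < n) \sum_(l < n | (n <= j + l)%N) (x ^+ j / j`!%:R) * (y ^+ l / l`!%:R).

Lemma exp_part_mul F (x y : F) n :
  exp_part x n * exp_part y n = exp_part (x + y) n + exp_tail x y n.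
Proof.
have fne k : (k`!%:R : F) != 0 by rewrite pnatr_eq0 -lt0n fact_gt0.
rewrite /exp_part /exp_tail big_distrlr /=.
have -> : \sum_(k < n) (x + y) ^+ k / k`!%:R =
  \sum_(j < n) \sum_(l < n | (j + l < n)%N) (x ^+ j / j`!%:R) * (y ^+ l / l`!%:R).
  transitivity (\sum_(k < n) \sum_(l < n | (l <= k)%N)
      (x ^+ (k - l) / (k - l)`!%:R) * (y ^+ l / l`!%:R)).
    apply: eq_bigr => k _; rewrite exprDn big_distrl /=.
    rewrite (big_ord_widen_cond n xpredT (fun i => (x ^+ (k - i) * y ^+ i *+ 'C(k, i)) / k`!%:R))//.
    apply: eq_big => [i|i]; first by rewrite /= ltnS.
    rewrite /= ltnS => ik.
    have E : 'C(k, i)%:R * (i`!%:R * (k - i)`!%:R) = k`!%:R :> F.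
      by rewrite -!natrM bin_fact.
    rewrite -E -mulr_natr; field.
    rewrite !fne /= pnatr_eq0 -lt0n bin_gt0//.
  rewrite (exchange_big_dep xpredT)//= [RHS](exchange_big_dep xpredT)//=; apply: eq_bigr => l _.
  pose G k := (x ^+ (k - l) / (k - l)`!%:R) * (y ^+ l / l`!%:R).
  rewrite -(big_mkord (fun k => (l <= k)%N) G).
  rewrite -(big_mkord (fun j => (j + l < n)%N) (fun j => (x ^+ j / j`!%:R) * (y ^+ l / l`!%:R))).
  transitivity (\sum_(l <= k < n) G k).
    by rewrite [RHS](@big_nat_widenl _ _ _ _ 0%N).
  rewrite -{1}(add0n (l : nat)) big_addn.
  rewrite [in LHS](@big_nat_widen _ _ _ _ _ n) ?leq_subr//.
  apply: eq_big => [j|j _]; first by rewrite /= ltn_subRL addnC.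
  by rewrite /G addnK.
rewrite -big_split /=; apply: eq_bigr => j _.
rewrite (bigID (fun l : 'I_n => (j + l < n)%N)) /=; congr (_ + _).
by apply: eq_bigl => l; rewrite -leqNgt.
Qed.
End exponential_series.

Section complex_exponential_series.
Context {R : realType}.

Lemma exp_part_cvg (x : R) : exp_part x @ \oo --> expR x.
Proof.
have : series (exp_coeff x) @ \oo --> expR x by exact: is_cvg_series_exp_coeff.
move=> h; apply: (cvg_ext h) => // n; rewrite /series /= big_mkord.
by apply: eq_bigr => k _; rewrite /exp_coeff.
Qed.

Lemma exp_part_real (x : R) n : exp_part x%:C%C n = (exp_part x n)%:C%C.
Proof.
rewrite /exp_part rmorph_sum; apply: eq_bigr => k _.
by rewrite rmorphM rmorphXn fmorphV rmorph_nat.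
Qed.

Lemma exp_part_imag (y : R) n : exp_part (Complex 0 y) n =
  Complex (series (cos_coeff y) n) (series (sin_coeff y) n).
Proof.
rewrite /exp_part /series /= !big_mkord.
have E k : Complex 0 y ^+ k / k`!%:R = Complex (cos_coeff y k) (sin_coeff y k).
  have -> : (k`!%:R^-1 : R[i]) = (k`!%:R^-1)%:C%C by rewrite fmorphV rmorph_nat.
  have I2 : Complex 0 y ^+ 2 = (- y ^+ 2)%:C%C.
    by apply: complex_eqP; rewrite /=; ring.
  rewrite /cos_coeff /sin_coeff -{1}(odd_double_half k) addnC exprD -mul2n exprM I2.
  have -> : (- y ^+ 2)%:C%C ^+ k./2 = ((-1) ^+ k./2 * (y ^+ 2) ^+ k./2)%:C%C.
    by rewrite -exprNn rmorphXn.
  rewrite /= -exprnP.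
  have yk : y ^+ k = (y ^+ 2) ^+ k./2 * y ^+ odd k.
    by rewrite -{1}(odd_double_half k) addnC exprD -mul2n exprM.
  rewrite yk; set t := (y ^+ 2) ^+ _; case: (boolP (odd k)) => ok /=.
    have -> : (k.-1)./2 = k./2 by case: (k) ok => // j /=; rewrite uphalf_half => /negbTE ->.
    by apply: complex_eqP; rewrite /= ?expr1; ring.
  by apply: complex_eqP; rewrite /= ?expr0; ring.
elim: n => [|n IH]; first by rewrite !big_ord0.
by rewrite !big_ord_recr /= IH E.
Qed.

(** [cexp] is defined by real functions, so its series is found for the real and for the imaginary
    part and then multiplied. The modulus of the tail of the product is at most the tail for |x| and
    |y|, which tends to 0 because [expR] is multiplicative. *)
Lemma exp_part_cvgC (z : R[i]) : ccvg (exp_part z) (cexp z).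
Proof.
case: z => x y; set X : R[i] := x%:C%C; set Y := Complex 0 y.
have XY : Complex x y = X + Y by apply: complex_eqP; rewrite /= ?addr0 ?add0r.
have cX : ccvg (exp_part X) (cexp X).
  rewrite cexpR (_ : exp_part X = fun n => (exp_part x n)%:C%C); last first.
    by apply/funext => n; exact: exp_part_real.
  by apply/ccvgP; split => /=; [exact: exp_part_cvg|exact: cvg_cst].
have cY : ccvg (exp_part Y) (cexp Y).
  rewrite (_ : exp_part Y = fun n => Complex (series (cos_coeff y) n) (series (sin_coeff y) n)); last first.
    by apply/funext => n; exact: exp_part_imag.
  rewrite /cexp /= expR0 mul1r; apply/ccvgP; split => /=.
    by rewrite unlock; exact: is_cvg_series_cos_coeff.
  by rewrite unlock; exact: is_cvg_series_sin_coeff.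
have tl n : cabs (exp_tail X Y n) <= exp_tail `|x| `|y| n.
  rewrite /exp_tail (le_trans (cabs_sum _ _ _))// ler_sum// => j _.
  rewrite (le_trans (cabs_sum _ _ _))// ler_sum// => l _.
  rewrite !cabsM.
  have cf k : cabs k`!%:R^-1 = k`!%:R^-1 :> R.
    have -> : (k`!%:R^-1 : R[i]) = (k`!%:R^-1)%:C%C by rewrite fmorphV rmorph_nat.
    by rewrite /cabs csqn_real sqrtr_sqr ger0_norm.
  have cx z k : cabs (z ^+ k) = cabs z ^+ k.
    elim: k => [|k IH]; first by rewrite !expr0 /cabs csqn1 sqrtr1.
    by rewrite !exprS cabsM IH.
  by rewrite !cf !cx /cabs csqn_real /csqn /= expr0n add0r !sqrtr_sqr.
have t0 : exp_tail `|x| `|y| @ \oo --> (0 : R).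
  have h1 := cvgM (@exp_part_cvg `|x|) (@exp_part_cvg `|y|).
  have h2 := cvgB (h1 _) (@exp_part_cvg (`|x| + `|y|)).
  apply: (cvg_ext (h2 _ _)).
    move=> n; rewrite -[LHS]/(exp_part `|x| n * exp_part `|y| n - exp_part (`|x| + `|y|) n).
    by rewrite exp_part_mul addrC addKr.
  by rewrite expRD subrr.
have tc : ccvg (exp_tail X Y) 0.
  apply: cabs_ccvg; apply: (squeeze_cvgr _ (cvg_cst 0) t0); apply: nearW => n.
  by rewrite cabs_ge0 subr0 tl.
rewrite XY cexpD; have := ccvgD (ccvgM cX cY) (ccvgM (ccvg_cst (-1)) tc).
rewrite mulr0 addr0; congr ccvg; apply/funext => n.
by rewrite exp_part_mul mulN1r addrK.
Qed.
End complex_exponential_series.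

Lemma nneseries_single {R : realType} (f : nat -> \bar R) a : (forall j, j != a -> f j = 0%E) ->
  (\sum_(0 <= j <oo) f j)%E = f a.
Proof.
move=> h; apply: lim_near_cst => //; exists a.+1 => // n /= an.
rewrite big_mkord (bigD1 (Ordinal an)) //= big1 ?adde0// => i ia.
by apply: h; apply: contra ia => /eqP ia; apply/eqP/val_inj.
Qed.

Section complex_integral.
Context {d} {T : measurableType d} {R : realType} {mu : {measure set T -> \bar R}}.
Implicit Types h k : T -> R[i].

Lemma cintegrable_lin (c : R[i]) h k : cintegrable mu h -> cintegrable mu k ->
  cintegrable mu (fun t => c * h t + k t).
Proof.
move=> [h1 h2] [k1 k2]; case: c => a b.
have Z (r : R) u : mu.-integrable setT (EFin \o u) ->
    mu.-integrable setT (EFin \o (fun t => r * u t)).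
  move=> /(integrableZl measurableT r).
  by apply: eq_integrable => // t _ /=; rewrite EFinM.
have D u v : mu.-integrable setT (EFin \o u) -> mu.-integrable setT (EFin \o v) ->
    mu.-integrable setT (EFin \o (fun t => u t + v t)).
  by move=> hu /(integrableD measurableT hu); exact: eq_integrable.
split.
- have := D _ _ (D _ _ (Z a _ h1) (Z (- b) _ h2)) k1.
  apply: eq_integrable => // t _; congr EFin => /=.
  by case: (h t) (k t) => ? ? [? ?] /=; ring.
- have := D _ _ (D _ _ (Z a _ h2) (Z b _ h1)) k2.
  apply: eq_integrable => // t _; congr EFin => /=.
  by case: (h t) (k t) => ? ? [? ?] /=; ring.
Qed.

Lemma cintegrable_real (u : T -> R) : mu.-integrable setT (EFin \o u) ->
  cintegrable mu (fun t => (u t)%:C%C).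
Proof. by move=> hu; split=> //; exact: integrable0. Qed.

Lemma cint_real (u : T -> R) : cint mu (fun t => (u t)%:C%C) = (\int[mu]_t u t)%:C%C.
Proof.
rewrite /cint /=; congr Complex; rewrite /Rintegral /=.
by rewrite integral0.
Qed.

Lemma cintegrable_dom h (u : T -> R) : cmeas h -> mu.-integrable setT (EFin \o u) ->
  (forall t, cabs (h t) <= u t) -> cintegrable mu h.
Proof.
move=> [mr mi] hu hle; split; apply: (le_integrable measurableT _ _ hu) => //.
- exact/measurable_EFinP.
- move=> t _ /=; rewrite lee_fin (le_trans (Re_le_csqn _))// (le_trans (hle t))//.
  exact: ler_norm.
- exact/measurable_EFinP.
- move=> t _ /=; rewrite lee_fin (le_trans (Im_le_csqn _))// (le_trans (hle t))//.
  exact: ler_norm.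
Qed.

Lemma integrable_ge0 (u : T -> R) : measurable_fun setT u -> (forall t, 0 <= u t) ->
  (\int[mu]_t (u t)%:E < +oo)%E -> mu.-integrable setT (EFin \o u).
Proof.
move=> mu_ u0 ui; apply/integrableP; split; first exact/measurable_EFinP.
by under eq_integral do rewrite /= ger0_norm//.
Qed.
End complex_integral.

Lemma prob_indic {R : realType} {dO} {O : measurableType dO} (P : probability O R) (A : set O) :
  measurable A -> P A = (\int[P]_w (\1_A w)%:E)%E.
Proof. by move=> mA; rewrite integral_indic ?setIT. Qed.

(** * Expectations of products of independent counts *)

Section independence.
Context {R : realType} {dO} {O : measurableType dO} {P : probability O R}.
Context {n : nat} (X : 'I_n -> O -> nat).
Hypothesis mX : forall i, measurable_fun setT (X i).
Hypothesis indepX : forall M : 'I_n -> set nat,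
  P (\bigcap_i (X i @^-1` M i)) = (\prod_(i < n) P (X i @^-1` M i))%E.

Lemma mXset i (M : set nat) : measurable (X i @^-1` M).
Proof. by rewrite -[X in measurable X]setTI; exact: mX. Qed.

Lemma mXfun i (u : nat -> R) : measurable_fun setT (fun w => u (X i w)).
Proof. by move=> _ A mA; rewrite setTI; exact: (mXset i (u @^-1` A)). Qed.

Let ind (M : set nat) j : R := \1_M j.
Let ind_ge0 M j : 0 <= ind M j.
Proof. by rewrite /ind indicE. Qed.
Let upd (V : Type) (g : 'I_n -> nat -> V) s u i := if i == s then u else g i.

(** The factors from the k-th on are indicators, and if all are, the claim is the hypothesis. One
    more factor is freed by writing it as the sum of its values [g s j] times the indicators of the
    events [X s = j], and summing over j. *)
Lemma indep_nneg (k : nat) (g : 'I_n -> nat -> R) : (forall i j, 0 <= g i j) ->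
  (forall i, \int[P]_w (g i (X i w))%:E < +oo)%E ->
  (forall i : 'I_n, (k <= i)%N -> exists M, g i = ind M) ->
  (\int[P]_w (\prod_(i < n) g i (X i w))%:E = \prod_(i < n) \int[P]_w (g i (X i w))%:E)%E.
Proof.
elim: k g => [|k IH] g g0 gf gi.
  have gi' i : {M | g i = ind M} by apply: cid; exact: gi.
  pose M i := sval (gi' i); have gM i j : g i j = \1_(M i) j by rewrite /M; case: (gi' i) => ? /= ->.
  transitivity (P (\bigcap_i (X i @^-1` M i))).
    rewrite prob_indic; last first.
      by apply: fin_bigcap_measurable => [|i _]; [exact: finite_finset|exact: mXset].
    apply: eq_integral => w _; congr EFin; under eq_bigr do rewrite gM.
    rewrite indicE; case: (boolP (w \in _)) => [/set_mem h|h].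
      by rewrite big1// => i _; rewrite indicE mem_set//; exact: h.
    have : exists i, ~ M i (X i w).
      apply: contrapT => /forallNP hh; move/negP: h; apply; apply/mem_set => i _.
      exact: contrapT (hh i).
    move=> [i hi]; rewrite (bigD1 i)//= indicE memNset// mul0r//.
  rewrite indepX; apply: eq_bigr => i _.
  rewrite prob_indic; last exact: mXset.
  by apply: eq_integral => w _; rewrite gM indicE.
have [kn|nk] := ltnP k n; last first.
  by apply: IH => // i ki; have := ltn_ord i; rewrite ltnNge (leq_trans nk ki).
pose s := Ordinal kn.
pose gj j := upd g s (ind [set j]).
have mg i (u : nat -> R) : measurable_fun setT (fun w => (u (X i w))%:E).
  by apply/measurable_EFinP; exact: mXfun.
have gjI j : (\int[P]_w (\prod_(i < n) gj j i (X i w))%:E =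
    \int[P]_w (ind [set j] (X s w))%:E * \prod_(i < n | i != s) \int[P]_w (g i (X i w))%:E)%E.
  rewrite IH; first 1 last.
  - by move=> i l; rewrite /gj /upd; case: ifP => // _; rewrite /ind indicE.
  - move=> i; rewrite /gj /upd; case: ifP => // _.
    apply: (@le_lt_trans _ _ (\int[P]_w (cst 1%E) w)%E).
      apply: ge0_le_integral => //.
      - by move=> w _; rewrite lee_fin /ind indicE.
      - by move=> w _; rewrite lee_fin /ind indicE; case: (_ \in _).
    rewrite integral_cst// mul1e (@le_lt_trans _ _ 1%E) ?ltry//.
    exact: probability_le1.
  - move=> i ki; rewrite /gj /upd; case: eqVneq => [_|is_]; first by exists [set j].
    by apply: gi; rewrite ltn_neqAle ki andbT eq_sym.
  rewrite (bigD1 s)//= /gj /upd eqxx; congr (_ * _)%E.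
  by apply: eq_bigr => i /negbTE ->.
have [r r0 rE] : exists2 r : R, 0 <= r & (\prod_(i < n | i != s) \int[P]_w (g i (X i w))%:E = r%:E)%E.
  exists (fine (\prod_(i < n | i != s) \int[P]_w (g i (X i w))%:E))%E.
    apply: fine_ge0; apply: prode_ge0 => i _; apply: integral_ge0 => w _.
    by rewrite lee_fin.
  rewrite fineK//; apply: prode_fin_num => i _.
  by rewrite ge0_fin_numE// integral_ge0// => w _; rewrite lee_fin.
have SJ (h : nat -> O -> R) (F : O -> R) : (forall j, measurable_fun setT (h j)) ->
   (forall j w, 0 <= h j w) -> (forall w, F w = g s (X s w) * h (X s w) w) ->
   (forall j w, X s w != j -> h j w = 0) ->
   (\int[P]_w (F w)%:E = \sum_(0 <= j <oo) ((g s j)%:E * \int[P]_w (h j w)%:E))%E.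
  move=> mh h0 FE hz.
  transitivity (\int[P]_w (\sum_(0 <= j <oo) (g s j * h j w)%:E))%E.
    apply: eq_integral => w _; rewrite (@nneseries_single _ _ (X s w)).
      by rewrite FE.
    by move=> j jX; rewrite hz ?mulr0// eq_sym.
  rewrite integral_nneseries//.
  - apply: eq_eseriesr => j _; under eq_integral do rewrite EFinM.
    rewrite ge0_integralZl// ?lee_fin//; first exact/measurable_EFinP.
    by move=> w _; rewrite lee_fin.
  - by move=> j; apply/measurable_EFinP; exact: measurable_funM.
  - by move=> j w _; rewrite lee_fin mulr_ge0.
rewrite [RHS](bigD1 s)//= rE.
rewrite (SJ (fun j w => \prod_(i < n) gj j i (X i w)) (fun w => \prod_(i < n) g i (X i w))).
- rewrite (SJ (fun j w => ind [set j] (X s w)) (fun w => g s (X s w))).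
  + rewrite muleC -nneseriesZl; last first.
      move=> j _; rewrite mule_ge0 ?lee_fin// integral_ge0// => w _.
      by rewrite lee_fin; exact: ind_ge0.
    by apply: eq_eseriesr => j _; rewrite gjI rE [RHS]muleC -muleA.
  + by move=> j; exact: mXfun.
  + by move=> j w; exact: ind_ge0.
  + by move=> w; rewrite /ind indicE mem_set// mulr1.
  + by move=> j w /eqP h; rewrite /ind indicE memNset.
- move=> j; apply: measurable_prod => i _; exact: mXfun.
- move=> j w; apply: prodr_ge0 => i _; rewrite /gj /upd.
  by case: ifP => _; [exact: ind_ge0|exact: g0].
- move=> w; rewrite (bigD1 s)//= [in RHS](bigD1 s)//=.
  have -> : gj (X s w) s (X s w) = 1 by rewrite /gj /upd eqxx /ind indicE mem_set.
  rewrite mul1r; congr (_ * _).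
  by apply: eq_bigr => i /negbTE h; rewrite /gj /upd h.
- move=> j w /eqP h; rewrite (bigD1 s)//= /gj /upd eqxx /ind indicE memNset//.
  by rewrite mul0r.
Qed.

(** Factors pass one at a time from non-negative to complex. With the others fixed, both sides are
    linear in the new factor, which is a combination of the positive and negative parts of its two
    coordinates. *)
Lemma indep_cint (g : 'I_n -> nat -> R[i]) :
  (forall i, cintegrable P (fun w => g i (X i w))) ->
  cintegrable P (fun w => \prod_(i < n) g i (X i w)) /\
  cint P (fun w => \prod_(i < n) g i (X i w)) = \prod_(i < n) cint P (fun w => g i (X i w)).
Proof.
move=> gI.
suff : forall k (g : 'I_n -> nat -> R[i]), (forall i, cintegrable P (fun w => g i (X i w))) ->
   (forall i : 'I_n, (k <= i)%N -> exists2 u : nat -> R, (forall j, 0 <= u j) & g i = (fun j => (u j)%:C%C)) ->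
   cintegrable P (fun w => \prod_(i < n) g i (X i w)) /\
   cint P (fun w => \prod_(i < n) g i (X i w)) = \prod_(i < n) cint P (fun w => g i (X i w)).
  by move=> /(_ n g gI); apply=> i ni; have := ltn_ord i; rewrite ltnNge ni.
elim=> [|k IH] {}g {}gI gr.
  have w i : {u : nat -> R | (forall j, 0 <= u j) & g i = (fun j => (u j)%:C%C)} by apply: cid2; exact: gr.
  pose u i := s2val (w i); have u0 i j : 0 <= u i j := s2valP (w i) j.
  have gu i j : g i j = (u i j)%:C%C by have := s2valP' (w i) => ->.
  have uI i : P.-integrable setT (fun w => (u i (X i w))%:E).
    have [h _] := gI i; apply: eq_integrable h => // t _; by rewrite /= gu.
  have uf i : (\int[P]_w (u i (X i w))%:E < +oo)%E.
    have /integrableP[_] := uI i; under eq_integral do rewrite /= ger0_norm//.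
    by [].
  have E := @indep_nneg n u u0 uf (fun i ni => ltac:(by have := ltn_ord i; rewrite ltnNge ni)).
  have -> : (fun w => \prod_(i < n) g i (X i w)) = (fun w => (\prod_(i < n) u i (X i w))%:C%C).
    by apply/funext => t; rewrite rmorph_prod; apply: eq_bigr => i _; rewrite gu.
  have ff i : (\int[P]_w (u i (X i w))%:E)%E \is a fin_num.
    by rewrite ge0_fin_numE// integral_ge0// => t _; rewrite lee_fin.
  split.
    apply: cintegrable_real; apply: integrable_ge0.
    - by apply: measurable_prod => i _; exact: mXfun.
    - by move=> t; exact: prodr_ge0.
    - by rewrite E -ge0_fin_numE ?prode_fin_num// prode_ge0// => i _; rewrite integral_ge0// => t _; rewrite lee_fin.
  rewrite cint_real /Rintegral E.
  have -> : (\prod_(i < n) \int[P]_w (u i (X i w))%:E)%E = (\prod_(i < n) fine (\int[P]_w (u i (X i w))%:E))%:E.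
    rewrite -prodEFin; apply: eq_bigr => i _; by rewrite fineK.
  rewrite rmorph_prod; apply: eq_bigr => i _.
  by under [in RHS]eq_fun do rewrite gu; rewrite cint_real.
have [kn|nk] := ltnP k n; last first.
  by apply: IH => // i ki; have := ltn_ord i; rewrite ltnNge (leq_trans nk ki).
pose s := Ordinal kn.
pose Q (u : nat -> R[i]) := cintegrable P (fun w => u (X s w)) /\
  (cintegrable P (fun w => u (X s w) * \prod_(i < n | i != s) g i (X i w)) /\
   cint P (fun w => u (X s w) * \prod_(i < n | i != s) g i (X i w)) =
   cint P (fun w => u (X s w)) * \prod_(i < n | i != s) cint P (fun w => g i (X i w))).
have Qr (u : nat -> R) : (forall j, 0 <= u j) -> cintegrable P (fun w => (u (X s w))%:C%C) ->
    Q (fun j => (u j)%:C%C).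
  move=> u0 uI; split=> //; have := IH (upd g s (fun j => (u j)%:C%C)); case.
  - by move=> i; rewrite /upd; case: eqVneq => [->|].
  - move=> i ki; rewrite /upd; case: eqVneq => [_|is_]; first by exists u.
    by apply: gr; rewrite ltn_neqAle ki andbT eq_sym.
  have E1 : (fun w => \prod_(i < n) upd g s (fun j => (u j)%:C%C) i (X i w)) =
      (fun w => (u (X s w))%:C%C * \prod_(i < n | i != s) g i (X i w)).
    apply/funext => w; rewrite (bigD1 s)//= {1}/upd eqxx; congr (_ * _).
    by apply: eq_bigr => i /negbTE h; rewrite /upd h.
  rewrite E1 => h1 h2; split=> //; rewrite h2 (bigD1 s)//= {1}/upd eqxx; congr (_ * _).
  by apply: eq_bigr => i /negbTE h; rewrite /upd h.
have Ql c u v : Q u -> Q v -> Q (fun j => c * u j + v j).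
  move=> [u1 [u2 u3]] [v1 [v2 v3]]; split; first exact: cintegrable_lin.
  have -> : (fun w => (c * u (X s w) + v (X s w)) * \prod_(i < n | i != s) g i (X i w)) =
    (fun w => c * (u (X s w) * \prod_(i < n | i != s) g i (X i w)) +
       v (X s w) * \prod_(i < n | i != s) g i (X i w)) by apply/funext => w; ring.
  split; first exact: cintegrable_lin.
  by rewrite !cintP// u3 v3; ring.
have mxI (h : O -> R) (u : nat -> R) : (forall w, h w = u (X s w)) -> P.-integrable setT (EFin \o h) ->
    Q (fun j => (u j)%:C%C).
  move=> hu hI.
  pose up j := Num.max (u j) 0; pose un j := Num.max (- u j) 0.
  have upI : cintegrable P (fun w => (up (X s w))%:C%C).
    apply: cintegrable_real; apply: (le_integrable measurableT _ _ hI) => //.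
      by apply/measurable_EFinP; exact: mXfun.
    move=> w _; rewrite /= hu lee_fin /up /Num.max.
    by case: ifP => // _; rewrite normr0.
  have unI : cintegrable P (fun w => (un (X s w))%:C%C).
    apply: cintegrable_real; apply: (le_integrable measurableT _ _ hI) => //.
      by apply/measurable_EFinP; exact: mXfun.
    move=> w _; rewrite /= hu lee_fin /un /Num.max.
    by case: ifP => // _; rewrite ?normr0 ?normrN.
  have := Ql (-1) _ _ (Qr un _ unI) (Qr up _ upI).
  move=> /(_ (fun j => ltac:(by rewrite /un le_max lexx orbT)) (fun j => ltac:(by rewrite /up le_max lexx orbT))).
  congr Q; apply/funext => j; rewrite mulN1r -rmorphN -rmorphD; congr (_%:C%C).
  rewrite /up /un /Num.max oppr_lt0.
  by case: (ltrgt0P (u j)) => [_|_|->]; rewrite ?oppr0 ?opprK ?add0r ?addr0.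
have [gr1 gi1] := gI s.
have Qg : Q (g s).
  have := Ql 'i%C _ _ (mxI _ (fun j => Im (g s j)) (fun=> erefl) gi1)
                      (mxI _ (fun j => Re (g s j)) (fun=> erefl) gr1).
  by congr Q; apply/funext => j; rewrite [RHS]complexE addrC.
have [_ [q1 q2]] := Qg.
have E : (fun w => \prod_(i < n) g i (X i w)) =
    (fun w => g s (X s w) * \prod_(i < n | i != s) g i (X i w)).
  by apply/funext => w; rewrite (bigD1 s).
by rewrite E; split=> //; rewrite q2 [RHS](bigD1 s).
Qed.
End independence.

(** * The generating function of the Poisson law *)

Section nat_valued.
Context {R : realType} {dO} {O : measurableType dO} {P : probability O R}.
Variable X : O -> nat.
Hypothesis mX : measurable_fun setT X.

Let mset (M : set nat) : measurable (X @^-1` M).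
Proof. by rewrite -[X in measurable X]setTI; exact: mX. Qed.

Let p k : R := fine (P (X @^-1` [set k])).
Let pE k : P (X @^-1` [set k]) = (p k)%:E.
Proof. by rewrite /p fineK// fin_num_measure. Qed.

Lemma Rintegral_nat (u : nat -> R) : P.-integrable setT (EFin \o (fun w => u (X w))) ->
  (fun n => \sum_(k < n) u k * p k) @ \oo --> \int[P]_w u (X w).
Proof.
move=> uI; pose F n w : R := \sum_(k < n) u k * \1_(X @^-1` [set (k : nat)]) w.
have Iind k : P.-integrable setT (EFin \o (fun w => u k * \1_(X @^-1` [set k]) w)).
  have /(integrableZl measurableT (u k)) : P.-integrable setT (EFin \o \1_(X @^-1` [set k])).
    by apply: integrable_indic => //; exact: mset.
  by apply: eq_integrable => // w _ /=; rewrite EFinM.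
have FI n : P.-integrable setT (EFin \o F n) /\
    (\int[P]_w (F n w)%:E = (\sum_(k < n) u k * p k)%:E)%E.
  elim: n => [|n [i1 i2]].
    rewrite /F; split; first by under eq_fun do rewrite big_ord0; exact: integrable0.
    by under eq_integral do rewrite big_ord0; rewrite integral0 big_ord0.
  have E w : F n.+1 w = F n w + u n * \1_(X @^-1` [set n]) w by rewrite /F big_ord_recr.
  split.
    have := integrableD measurableT i1 (Iind n).
    by apply: eq_integrable => // w _ /=; rewrite E.
  under eq_integral do rewrite E EFinD.
  transitivity (\int[P]_w (F n w)%:E + \int[P]_w (u n * \1_(X @^-1` [set n]) w)%:E)%E.
    exact: (integralD measurableT i1 (Iind n)).
  rewrite i2 big_ord_recr /= EFinD; congr (_ + _)%E.
  under eq_integral do rewrite EFinM.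
  rewrite integralZl//; first by rewrite -prob_indic ?pE.
  by apply: integrable_indic => //; exact: mset.
have FX n w : F n w = if (X w < n)%N then u (X w) else 0.
  rewrite /F; case: ltnP => h.
    rewrite (bigD1 (Ordinal h))//= indicE mem_set// mulr1 big1 ?addr0// => i ih.
    rewrite indicE memNset ?mulr0// => /= Xi; move/negP: ih; apply.
    by apply/eqP/val_inj.
  rewrite big1// => i _; rewrite indicE memNset ?mulr0// => /= Xi.
  by move: h; rewrite Xi leqNgt ltn_ord.
have := @dominated_convergence _ _ _ P setT measurableT (fun n => EFin \o F n)
  (EFin \o (fun w => u (X w))) (fun w => `|u (X w)|%:E).
case.
- by move=> n; case: (FI n) => /measurable_int.
- exact: measurable_int uI.
- apply: nearW => w _; apply: cvg_near_cst; exists (X w).+1 => // n /= Xn.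
  by rewrite FX Xn.
- have := integrable_abse uI; by apply: eq_integrable.
- by apply: nearW => w n _; rewrite /= FX lee_fin; case: ifP => // _; rewrite normr0.
move=> _ _; under eq_fun do rewrite (FI _).2.
move=> h; have : (\int[P]_w u (X w))%:E = (\int[P]_w ((EFin \o (fun w => u (X w))) w))%E.
  by rewrite /Rintegral fineK//; exact: integrable_fin_num.
by move: h => /[swap] <- /fine_cvgP[].
Qed.

Lemma cint_nat (u : nat -> R[i]) : cintegrable P (fun w => u (X w)) ->
  ccvg (fun n => \sum_(k < n) u k * (p k)%:C%C) (cint P (fun w => u (X w))).
Proof.
move=> [u1 u2]; apply/ccvgP; split.
  apply: (cvg_ext (Rintegral_nat (u := fun k => Re (u k)) u1)) => // n.
  rewrite raddf_sum; apply: eq_bigr => k _; case: (u k) => a b /=; ring.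
apply: (cvg_ext (Rintegral_nat (u := fun k => Im (u k)) u2)) => // n.
rewrite raddf_sum; apply: eq_bigr => k _; case: (u k) => a b /=; ring.
Qed.

Lemma poisson_probE (l : R) k : 0 <= l ->
  poisson_prob l k [set k] = (l ^+ k / k`!%:R * expR (- l))%:E.
Proof.
rewrite le_eqVlt => /predU1P[<-|l0].
  (* At rate 0 [poisson_prob] is the Dirac mass at 0. *)
  rewrite /poisson_prob ltxx diracE; case: k => [|k].
    by rewrite mem_set// expr0 fact0 invr1 oppr0 expR0 !mulr1.
  by rewrite memNset// expr0n !mul0r.
rewrite /poisson_prob l0 esum_set1; first by rewrite /poisson_pmf l0.
by rewrite lee_fin poisson_pmf_ge0.
Qed.

Hypothesis (l : R) (l0 : 0 <= l)
  (lawX : forall k, P (X @^-1` [set k]) = poisson_prob l k [set k]).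

Let pk k : p k = l ^+ k / k`!%:R * expR (- l).
Proof. by apply/EFin_inj; rewrite -pE lawX poisson_probE. Qed.

Lemma poisson_powR_lty (r : R) : 0 <= r -> (\int[P]_w (r ^+ X w)%:E < +oo)%E.
Proof.
move=> r0.
have E w : ((r ^+ X w)%:E = \sum_(0 <= k <oo) (r ^+ k * \1_(X @^-1` [set k]) w)%:E)%E.
  rewrite (@nneseries_single _ _ (X w)); first by rewrite indicE mem_set// mulr1.
  by move=> j /eqP jX; rewrite indicE memNset ?mulr0// => /= /esym.
under eq_integral do rewrite E.
rewrite integral_nneseries//; last 2 first.
- by move=> k; apply/measurable_EFinP; apply: measurable_funM.
- by move=> k w _; rewrite lee_fin mulr_ge0 ?exprn_ge0// indicE.
apply: (@le_lt_trans _ _ (expR (l * r) * expR (- l))%:E); last by rewrite ltry.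
apply: nneseries_le => n.
  by apply: integral_ge0 => w _; rewrite lee_fin mulr_ge0 ?exprn_ge0// indicE.
have I k : (\int[P]_w (r ^+ k * \1_(X @^-1` [set k]) w)%:E = (r ^+ k * p k)%:E)%E.
  under eq_integral do rewrite EFinM.
  rewrite ge0_integralZl ?lee_fin ?exprn_ge0//.
    by rewrite -prob_indic ?pE.
  by apply/measurable_EFinP.
under eq_bigr do rewrite I.
rewrite sumEFin lee_fin big_mkord.
have -> : \sum_(k < n) r ^+ k * p k = exp_part (l * r) n * expR (- l).
  rewrite /exp_part mulr_suml; apply: eq_bigr => k _; rewrite pk exprMn; ring.
rewrite ler_wpM2r ?expR_ge0//.
have nd : nondecreasing_seq (exp_part (l * r)).
  apply/nondecreasing_seqP => m; rewrite /exp_part big_ord_recr /= lerDl.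
  by rewrite divr_ge0// exprn_ge0// mulr_ge0.
have c := @exp_part_cvg R (l * r).
rewrite -(cvg_lim _ c)//; apply: nondecreasing_cvgn_le => //.
by apply/cvg_ex; exists (expR (l * r)).
Qed.

(** The partial sums over the values of [X] are exp(-l) times those of the exponential series at lz,
    whose limit is [exp_part_cvgC]. *)
Lemma poisson_cexp (z : R[i]) : cintegrable P (fun w => z ^+ X w) /\
  cint P (fun w => z ^+ X w) = cexp (l%:C%C * (z - 1)).
Proof.
have mz : cmeas (fun w => z ^+ X w).
  split=> _ A mA; rewrite setTI; exact: (mset ((fun k => _ (z ^+ k)) @^-1` A)).
have zI : cintegrable P (fun w => z ^+ X w).
  apply: (cintegrable_dom (u := fun w => cabs z ^+ X w)) => //.
    apply: integrable_ge0; last exact: poisson_powR_lty (cabs_ge0 z).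
      by move=> _ A mA; rewrite setTI; exact: (mset ((fun k => cabs z ^+ k) @^-1` A)).
    by move=> w; rewrite exprn_ge0// cabs_ge0.
  by move=> w; rewrite {1}/cabs csqnX -cabs_sq exprAC sqrtr_sqr ger0_norm ?exprn_ge0 ?cabs_ge0.
split=> //; have h1 := cint_nat (u := fun k => z ^+ k) zI.
have h2 := ccvgM (exp_part_cvgC (l%:C%C * z)) (ccvg_cst (expR (- l))%:C%C).
have E n : \sum_(k < n) z ^+ k * (p k)%:C%C = exp_part (l%:C%C * z) n * (expR (- l))%:C%C.
  rewrite /exp_part mulr_suml; apply: eq_bigr => k _.
  by rewrite pk !rmorphM /= fmorphV rmorph_nat rmorphXn exprMn; ring.
rewrite (_ : (fun n => _) = fun n => exp_part (l%:C%C * z) n * (expR (- l))%:C%C) in h1; last first.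
  by apply/funext.
have -> : l%:C%C * (z - 1) = l%:C%C * z + (- l)%:C%C by rewrite rmorphN; ring.
rewrite cexpD cexpR; move: h1 h2 => /ccvgP[a b] /ccvgP[a' b'].
apply: complex_eqP; [apply: (cvg_unique _ a a')|apply: (cvg_unique _ b b')]; exact: Rhausdorff.
Qed.

End nat_valued.

Section conjugation.
Context {R : realType}.
Implicit Types z w : R[i].
Lemma conjcM z w : (z * w)^*%C = z^*%C * w^*%C. Proof. exact: (rmorphM conjc). Qed.
Lemma conjcD z w : (z + w)^*%C = z^*%C + w^*%C. Proof. exact: (rmorphD conjc). Qed.
Lemma conjcX z n : (z ^+ n)^*%C = z^*%C ^+ n. Proof. exact: (rmorphXn conjc). Qed.
Lemma conjc_prod (I : Type) (r : seq I) (F : I -> R[i]) :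
  (\prod_(i <- r) F i)^*%C = \prod_(i <- r) (F i)^*%C.
Proof. exact: (rmorph_prod conjc). Qed.
Lemma conjc_sum (I : Type) (r : seq I) (F : I -> R[i]) :
  (\sum_(i <- r) F i)^*%C = \sum_(i <- r) (F i)^*%C.
Proof. exact: (rmorph_sum conjc). Qed.
Lemma conjcN z : (- z)^*%C = - z^*%C. Proof. exact: (rmorphN conjc). Qed.
Lemma cexp_sum_conj (T : finType) (c : T -> R[i]) (r : T -> R) :
  (cexp (- \sum_t c t * (r t)%:C%C))^*%C = cexp (- \sum_t (c t)^*%C * (r t)%:C%C).
Proof.
rewrite -cexp_conj conjcN conjc_sum; congr (cexp (- _)); apply: eq_bigr => t _.
by rewrite conjcM conjc_real.
Qed.
End conjugation.

(** * The counting variables of a Poisson process *)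

Section counting.
Context {R : realType} {dO} {O : measurableType dO} {P : probability O R}.
Context {dS} {S : measurableType dS} {lam : {measure set S -> \bar R}}.
Context {eta : O -> {measure set S -> \bar R}}.
Hypothesis eta_poisson : poisson_process P lam eta.

(** Natural-valued, so that powers z^N make sense. The value is 0 where [eta w B] is infinite, a
    null event when [lam B] is finite ([poisson_infty]). *)
Definition cnt (B : set S) (w : O) : nat := xget 0%N [set k : nat | eta w B = k%:R%:E].

Lemma cnt_eq w B k : eta w B = k%:R%:E -> cnt B w = k.
Proof.
move=> h; rewrite /cnt; case: xgetP => [j _ /= E|/(_ k)//].
by move: E; rewrite h => -[] /eqP; rewrite eqr_nat => /eqP.
Qed.
Lemma cnt_infty w B : eta w B = +oo%E -> cnt B w = 0%N.
Proof. by move=> h; rewrite /cnt; case: xgetP => // j _ /=; rewrite h. Qed.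
Lemma cntE w B : measurable B -> (eta w B < +oo)%E -> eta w B = (cnt B w)%:R%:E.
Proof.
case: eta_poisson => -[_ + _] _ _ _ => /[apply] /(_ w)[->//|[k E] _].
by rewrite (cnt_eq E).
Qed.
Lemma eta_meas B : measurable B -> measurable_fun setT (fun w => eta w B).
Proof. by case: eta_poisson => -[_ _ + ] _ _ _; exact. Qed.

Lemma eta_preimage_meas B (M : set (\bar R)) : measurable B -> measurable M ->
  measurable ((fun w => eta w B) @^-1` M).
Proof. by move=> mB mM; rewrite -[X in measurable X]setTI; exact: (eta_meas mB measurableT). Qed.

(** The values of [eta] that correspond to counts in [M]; infinity joins them when 0 is in [M],
    because of the default value of [cnt]. *)
Let Mx (M : set nat) : set (\bar R) :=
  (\bigcup_(k in M) [set k%:R%:E]) `|` (if pselect (M 0%N) then [set +oo%E] else set0).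
Let mMx M : measurable (Mx M).
Proof.
rewrite /Mx; apply: measurableU; last first.
  by case: (pselect (M 0%N)) => h; [exact: emeasurable_set1|exact: measurable0].
by apply: bigcup_measurable => k _; exact: emeasurable_set1.
Qed.
Let cnt_pre B M : measurable B -> cnt B @^-1` M = (fun w => eta w B) @^-1` (Mx M).
Proof.
move=> mB; apply/seteqP; split=> w /=.
  have [wf|] := ltP (eta w B) +oo%E.
    by move=> h; left; exists (cnt B w) => //=; rewrite -cntE.
  by rewrite leye_eq => /eqP wi; rewrite cnt_infty// => M0; right; case: pselect.
case=> [[k Mk /=] /cnt_eq -> //|]; case: pselect => //= M0 wi.
by rewrite cnt_infty.
Qed.

Lemma cnt_meas B : measurable B -> measurable_fun setT (cnt B).
Proof.
move=> mB _ M _; rewrite setTI cnt_pre//.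
exact: eta_preimage_meas mB (mMx M).
Qed.

Lemma cnt_preimage B M : measurable B -> exists2 M' : set (\bar R), measurable M' &
  cnt B @^-1` M = (fun w => eta w B) @^-1` M'.
Proof. by move=> mB; exists (Mx M) => //; exact: cnt_pre. Qed.

(** The definition of the process prescribes the finite values only; their Poisson probabilities add
    up to 1, which leaves nothing for the value infinity. *)
Lemma poisson_infty B : measurable B -> (lam B < +oo)%E -> P [set w | eta w B = +oo%E] = 0%E.
Proof.
move=> mB lB; have lE : lam B = (fine (lam B))%:E by rewrite fineK// ge0_fin_numE.
case: eta_poisson => -[_ etaN _] law _ _.
pose A k := [set w | eta w B = k%:R%:E].
have mA k : measurable (A k).
  exact: (eta_preimage_meas mB (emeasurable_set1 _)).
have mI : measurable [set w | eta w B = +oo%E].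
  exact: (eta_preimage_meas mB (emeasurable_set1 _)).
have tA : trivIset setT A.
  apply/trivIsetP => i j _ _ /eqP ij; apply/seteqP; split=> // w [/cnt_eq Ai /cnt_eq Aj].
  by apply: ij; rewrite -Ai -Aj.
have PA : P (\bigcup_k A k) = 1%E.
  rewrite measure_semi_bigcup//; last exact: bigcup_measurable.
  have E k : P (A k) = poisson_prob (fine (lam B)) 0 [set k] by exact: law.
  rewrite (eq_eseriesr (fun k _ => E k)) -measure_semi_bigcup//.
    have -> : \bigcup_k [set k] = [set: nat] by apply/seteqP; split=> // k _; exists k.
    exact: probability_setT.
  by apply/trivIsetP => i j _ _ /eqP ij; apply/seteqP; split=> // w [/= -> /ij].
have : [set w | eta w B = +oo%E] = ~` (\bigcup_k A k).
  apply/seteqP; split=> w /=; first by move=> wi [k _]; rewrite /A /= wi.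
  by move=> h; case: (etaN w B mB) => // -[k E]; exfalso; apply: h; exists k.
move=> ->; rewrite probability_setC ?PA ?subee//.
exact: bigcup_measurable.
Qed.

Lemma cnt_law B (l : R) k : measurable B -> lam B = l%:E ->
  P (cnt B @^-1` [set k]) = poisson_prob l k [set k].
Proof.
move=> mB lB; case: eta_poisson => _ law _ _; rewrite -(law B l mB lB k).
have mk : measurable [set w | eta w B = k%:R%:E].
  exact: (eta_preimage_meas mB (emeasurable_set1 _)).
have mI : measurable [set w | eta w B = +oo%E].
  exact: (eta_preimage_meas mB (emeasurable_set1 _)).
have PI : P [set w | eta w B = +oo%E] = 0%E by apply: poisson_infty => //; rewrite lB ltry.
(* For k = 0 the default value of [cnt] adds the null event where [eta] is infinite. *)
case: k mk => [|k] mk.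
  have -> : cnt B @^-1` [set 0%N] = [set w | eta w B = 0%:R%:E] `|` [set w | eta w B = +oo%E].
    apply/seteqP; split=> w /=.
      have [wf h|] := ltP (eta w B) +oo%E; first by left; rewrite cntE// h.
      by rewrite leye_eq => /eqP; right.
    by case=> [/cnt_eq|/cnt_infty].
  by rewrite measureU0.
congr (P _); apply/seteqP; split=> w /=; last exact: cnt_eq.
have [wf h|] := ltP (eta w B) +oo%E; first by rewrite cntE// h.
by rewrite leye_eq => /eqP /cnt_infty ->.
Qed.

Lemma cnt_indep n (B : 'I_n -> set S) (M : 'I_n -> set nat) : (forall i, measurable (B i)) ->
  trivIset setT B ->
  P (\bigcap_i (cnt (B i) @^-1` M i)) = (\prod_(i < n) P (cnt (B i) @^-1` M i))%E.
Proof.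
move=> mB tB; case: eta_poisson => _ _ _ ind.
transitivity (P (\bigcap_i ((fun w => eta w (B i)) @^-1` Mx (M i)))).
  by congr (P _); apply: eq_bigcap => // i _; exact: cnt_pre.
rewrite ind//.
by apply: eq_bigr => i _; rewrite cnt_pre.
Qed.

End counting.
Arguments cnt {R dO O dS S} eta B w.

(** * Simple functions and their stochastic exponentials *)

Section labels.
Context {R : realType} {dS} {S : measurableType dS} (lam : {measure set S -> \bar R}).

(* A simple function c \o q, where q is a finite measurable partition of S. *)
Record slabel := SLabel {
  lT : finType ; lq : S -> lT ; lc : lT -> R[i] ;
  lq_meas : forall t, measurable (lq @^-1` [set t]) ;
  lc_fin : forall t, lc t != 0 -> (lam (lq @^-1` [set t]) < +oo)%E }.

Definition lam_at (T : finType) (q : S -> T) (t : T) : R := fine (lam (q @^-1` [set t])).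
Definition phifun (i : slabel) (y : S) : R[i] := lc (lq i y).

Section one_partition.
Variables (T : finType) (q : S -> T).
Hypothesis mq : forall t, measurable (q @^-1` [set t]).

Lemma label_meas (V : Type) (A : T -> V) (D : set V) : measurable ((fun y => A (q y)) @^-1` D).
Proof.
rewrite (_ : _ @^-1` D = \bigcup_(t in [set t | D (A t)]) (q @^-1` [set t])).
  by apply: fin_bigcup_measurable => //; exact: finite_finset.
apply/seteqP; split=> y /=; first by move=> h; exists (q y).
by move=> [t /= h ->].
Qed.

Lemma label_cmeas (a : T -> R[i]) : cmeas (fun y => a (q y)).
Proof.
split=> _ D mD; rewrite setTI; first exact: (label_meas (fun t => Re (a t))).
exact: (label_meas (fun t => Im (a t))).
Qed.

Lemma label_cint (a : T -> R[i]) : (forall t, a t != 0 -> (lam (q @^-1` [set t]) < +oo)%E) ->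
  cintegrable lam (fun y => a (q y)) /\
  cint lam (fun y => a (q y)) = \sum_t a t * (lam_at q t)%:C%C.
Proof.
move=> af.
have ti t : cintegrable lam (fun y => a t * (\1_(q @^-1` [set t]) y)%:C%C) /\
   cint lam (fun y => a t * (\1_(q @^-1` [set t]) y)%:C%C) = a t * (lam_at q t)%:C%C.
  (* A cell with value 0 may have infinite measure, and its indicator is then not integrable. *)
  have [a0|a0] := eqVneq (a t) 0.
    have -> : (fun y => a t * (\1_(q @^-1` [set t]) y)%:C%C) = (fun y => (0 : R)%:C%C).
      by apply/funext => y; rewrite a0 mul0r.
    split; first by apply: cintegrable_real; exact: integrable0.
    by rewrite cint_real /Rintegral integral0 a0 mul0r.
  have I : lam.-integrable setT (EFin \o \1_(q @^-1` [set t])).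
    apply: integrable_ge0 => //.
    by rewrite integral_indic// setIT af.
  have := cintegrable_lin (a t) (cintegrable_real I) (cintegrable_real (integrable0 _ _)).
  under eq_fun do rewrite addr0; move=> h; split=> //.
  have := cintP (a t) (cintegrable_real I) (cintegrable_real (integrable0 lam setT)).
  under eq_fun do rewrite addr0; move=> ->.
  rewrite !cint_real /Rintegral integral0 addr0 integral_indic// ?setIT//.
have aE y : a (q y) = \sum_t a t * (\1_(q @^-1` [set t]) y)%:C%C.
  rewrite (bigD1 (q y))//= indicE mem_set// mulr1 big1 ?addr0// => t /eqP h.
  by rewrite indicE memNset ?mulr0// => /= /esym.
have : forall r : seq T, cintegrable lam (fun y => \sum_(t <- r) a t * (\1_(q @^-1` [set t]) y)%:C%C) /\
  cint lam (fun y => \sum_(t <- r) a t * (\1_(q @^-1` [set t]) y)%:C%C) = \sum_(t <- r) a t * (lam_at q t)%:C%C.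
  elim=> [|t r [h1 h2]].
    split.
      under [X in cintegrable lam X]eq_fun do rewrite big_nil.
      by apply: (cintegrable_real (u := fun=> 0)); exact: integrable0.
    rewrite big_nil; under [X in cint lam X]eq_fun do rewrite big_nil.
    by rewrite (cint_real (fun=> 0)) /Rintegral integral0.
  have [t1 t2] := ti t; have E : (fun y => \sum_(t0 <- t :: r) a t0 * (\1_(q @^-1` [set t0]) y)%:C%C) =
     (fun y => 1 * (a t * (\1_(q @^-1` [set t]) y)%:C%C) + \sum_(t <- r) a t * (\1_(q @^-1` [set t]) y)%:C%C).
    by apply/funext => y; rewrite big_cons mul1r.
  rewrite E; split; first exact: cintegrable_lin.
  by rewrite cintP// h2 t2 mul1r big_cons.
by under [X in cintegrable lam X]eq_fun do rewrite aE; under [X in cint lam X]eq_fun do rewrite aE; exact.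
Qed.
End one_partition.

Lemma phifun_L2 (i : slabel) : L2 lam (phifun i).
Proof.
split; first exact: (label_cmeas (@lq_meas i) (@lc i)).
have [|[/integrableP[_ h] _] _] := @label_cint _ (lq i) (@lq_meas i) (fun t => (csqn (lc t))%:C%C).
  by move=> t; rewrite -csqn_mulconj => h; apply: lc_fin; apply: contra h => /eqP ->; rewrite mul0r.
apply: le_lt_trans h; apply: ge0_le_integral => //.
- by move=> y _; rewrite lee_fin csqn_ge0.
- by apply: cmeas_csqnE; exact: (label_cmeas (@lq_meas i) (@lc i)).
- apply: measurableT_comp => //; apply/measurable_EFinP.
  exact: (label_cmeas (@lq_meas i) (fun t => (csqn (lc t))%:C%C)).1.
- by move=> y _ /=; rewrite lee_fin ler_norm.
Qed.

Program Definition refine (i : slabel) (T : finType) (q : S -> T) (g : T -> lT i)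
  (mq : forall t, measurable (q @^-1` [set t])) (gq : forall y, lq i y = g (q y)) : slabel :=
  @SLabel T q (fun t => lc (g t)) mq _.
Next Obligation.
move=> i T q g mq gq t /lc_fin; apply: le_lt_trans; apply: le_measure; rewrite ?inE//.
  exact: lq_meas.
by move=> y /=; rewrite gq => ->.
Qed.

Lemma refine_phifun i T q g mq gq : phifun (@refine i T q g mq gq) = phifun i.
Proof. by apply/funext => y; rewrite /phifun /= -gq. Qed.

Lemma pair_meas (T T' : finType) (q : S -> T) (q' : S -> T') :
  (forall t, measurable (q @^-1` [set t])) -> (forall t, measurable (q' @^-1` [set t])) ->
  forall t, measurable ((fun y => (q y, q' y)) @^-1` [set t]).
Proof.
move=> mq mq' [t t'].
rewrite (_ : _ @^-1` _ = q @^-1` [set t] `&` q' @^-1` [set t']); first exact: measurableI.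
by apply/seteqP; split=> y /=; [case=> -> ->|case=> -> ->].
Qed.

End labels.
Arguments lq_meas {R dS S lam} s t.

Section exponential_vectors.
Context {R : realType} {dO} {O : measurableType dO} {P : probability O R}.
Context {dS} {S : measurableType dS} {lam : {measure set S -> \bar R}}.
Context {eta : O -> {measure set S -> \bar R}}.
Hypothesis eta_poisson : poisson_process P lam eta.
Local Notation slabel := (slabel lam).

Definition cntl (T : finType) (q : S -> T) (t : T) (w : O) : nat := cnt eta (q @^-1` [set t]) w.

(* The stochastic (Doleans-Dade) exponential of the simple function c \o q. *)
Definition sexp (T : finType) (q : S -> T) (c : T -> R[i]) (w : O) : R[i] :=
  (\prod_t (1 + c t) ^+ cntl q t w) * cexp (- \sum_t c t * (lam_at lam q t)%:C%C).
Definition lexp (i : slabel) : O -> R[i] := sexp (lq i) (@lc _ _ _ _ i).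

Section one_partition.
Variables (T : finType) (q : S -> T).
Hypothesis mq : forall t, measurable (q @^-1` [set t]).

Lemma cntl_meas t : measurable_fun setT (cntl q t).
Proof. exact: (cnt_meas eta_poisson). Qed.

Lemma nat_cmeas (X : O -> nat) (u : nat -> R[i]) : measurable_fun setT X ->
  cmeas (fun w => u (X w)).
Proof.
move=> mX; split=> _ A mA; rewrite setTI -[X in measurable X]setTI.
  exact: (mX measurableT ((fun k => Re (u k)) @^-1` A) I).
exact: (mX measurableT ((fun k => Im (u k)) @^-1` A) I).
Qed.

Lemma prod_expect (z : T -> R[i]) :
  (forall t, z t != 1 -> (lam (q @^-1` [set t]) < +oo)%E) ->
  cintegrable P (fun w => \prod_t z t ^+ cntl q t w) /\
  cint P (fun w => \prod_t z t ^+ cntl q t w) = cexp (\sum_t (lam_at lam q t)%:C%C * (z t - 1)).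
Proof.
move=> zf.
have one t : cintegrable P (fun w => z t ^+ cntl q t w) /\
   cint P (fun w => z t ^+ cntl q t w) = cexp ((lam_at lam q t)%:C%C * (z t - 1)).
  (* Cells of infinite intensity occur only here, where the power is 1 whatever the count. *)
  have [->|z1] := eqVneq (z t) 1.
    have -> : (fun w => 1 ^+ cntl q t w) = (fun=> (1 : R)%:C%C) :> (O -> R[i]).
      by apply/funext => w; rewrite expr1n.
    have I1 : P.-integrable setT (EFin \o (fun=> 1 : R)).
      by apply: integrable_ge0 => //; rewrite -ge0_fin_numE ?integral_ge0// integral_cst// mul1e fin_num_measure.
    split; first exact: cintegrable_real.
    rewrite cint_real subrr mulr0 cexp0 /Rintegral integral_cst// mul1e.
    by transitivity ((fine (1%E : \bar R))%:C%C) => //; congr ((fine _)%:C%C); exact: probability_setT.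
  have lE : lam (q @^-1` [set t]) = (lam_at lam q t)%:E.
    by rewrite /lam_at fineK// ge0_fin_numE// zf.
  have l0 : 0 <= lam_at lam q t by apply: fine_ge0.
  apply: poisson_cexp => //; first exact: cntl_meas.
  by move=> k; exact: (cnt_law eta_poisson).
pose X (i : 'I_#|T|) := cntl q (enum_val i).
have mX i : measurable_fun setT (X i) by exact: cntl_meas.
have ind (M : 'I_#|T| -> set nat) : P (\bigcap_i (X i @^-1` M i)) = (\prod_(i < #|T|) P (X i @^-1` M i))%E.
  apply: (cnt_indep eta_poisson (B := fun i : 'I_#|T| => q @^-1` [set enum_val i])) => //.
  apply/trivIsetP => i j _ _ /eqP ij; apply/seteqP; split=> // y [/= -> /enum_val_inj].
  exact: ij.
have [h1 h2] := indep_cint mX ind (g := fun i k => z (enum_val i) ^+ k) (fun i => (one (enum_val i)).1).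
have E w : \prod_t z t ^+ cntl q t w = \prod_(i < #|T|) z (enum_val i) ^+ X i w.
  by rewrite [LHS](big_enum_val (fun t => z t ^+ cntl q t w)).
under [X in cintegrable P X]eq_fun do rewrite E.
under [X in cint P X]eq_fun do rewrite E.
split=> //; rewrite h2 cexp_sum [RHS](big_enum_val (fun t => cexp ((lam_at lam q t)%:C%C * (z t - 1)))).
by apply: eq_bigr => i _; rewrite (one (enum_val i)).2.
Qed.

Lemma sexp_cmeas c : cmeas (sexp q c).
Proof.
apply: cmeasM; last exact: cmeas_cst.
by apply: cmeas_prod => t; apply: (nat_cmeas (fun k => (1 + c t) ^+ k)); exact: cntl_meas.
Qed.

(** With b the conjugate of c', the rate of a cell is multiplied by (1 + c)(1 + b) - 1 in the
    expectation, and the two compensators subtract c + b; what remains is c b, the integrand of the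
    inner product. *)
Lemma sexp_dot c c' : (forall t, c t != 0 -> (lam (q @^-1` [set t]) < +oo)%E) ->
  (forall t, c' t != 0 -> (lam (q @^-1` [set t]) < +oo)%E) ->
  cintegrable P (fun w => sexp q c w * (sexp q c' w)^*%C) /\
  cint P (fun w => sexp q c w * (sexp q c' w)^*%C) =
  cexp (\sum_t c t * (c' t)^*%C * (lam_at lam q t)%:C%C).
Proof.
move=> cf cf'; pose z t := (1 + c t) * (1 + c' t)^*%C.
have zf t : z t != 1 -> (lam (q @^-1` [set t]) < +oo)%E.
  rewrite /z; have [->|/cf//] := eqVneq (c t) 0; have [->|/cf'//] := eqVneq (c' t) 0.
  by rewrite !addr0 conjc1 mulr1 eqxx.
have [h1 h2] := prod_expect zf.
pose a := cexp (- \sum_t c t * (lam_at lam q t)%:C%C).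
pose b := cexp (- \sum_t c' t * (lam_at lam q t)%:C%C).
pose k := a * b^*%C.
have E w : sexp q c w * (sexp q c' w)^*%C = k * (\prod_t z t ^+ cntl q t w) + 0.
  rewrite /sexp -/a -/b conjcM conjc_prod /z; under [in RHS]eq_bigr do rewrite exprMn.
  rewrite big_split /k; under [X in _ * (X * _)%R]eq_bigr do rewrite conjcX.
  move: (b^*%C) => b'; set p1 := \prod_t _ ^+ _; set p2 := \prod_t _ ^+ _.
  by rewrite addr0 /=; ring.
under [X in cintegrable P X]eq_fun do rewrite E; under [X in cint P X]eq_fun do rewrite E.
have z0 : cintegrable P (fun=> 0 : R[i]) by apply: (cintegrable_real (u := fun=> 0)); exact: integrable0.
split; first exact: cintegrable_lin.
rewrite cintP// h2 (cint_real (fun=> 0)) /Rintegral integral0 addr0 /k /a /b cexp_sum_conj -!cexpD.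
congr cexp; rewrite -!sumrN -!big_split /=; apply: eq_bigr => t _.
rewrite /z conjcD conjc1; ring.
Qed.
End one_partition.

Lemma lexp_L2 i : L2 P (lexp i).
Proof.
split; first exact: sexp_cmeas (lq_meas i) _.
have [[/integrableP[_ h] _] _] := sexp_dot (lq_meas i) (@lc_fin _ _ _ _ i) (@lc_fin _ _ _ _ i).
apply: le_lt_trans h; apply: ge0_le_integral => //.
- by move=> y _; rewrite lee_fin csqn_ge0.
- by apply: cmeas_csqnE; exact: sexp_cmeas (lq_meas i) _.
- apply: measurableT_comp => //; apply/measurable_EFinP.
  by apply: (cmeasM _ (cmeas_conj _)).1; exact: sexp_cmeas (lq_meas i) _.
- by move=> y _ /=; rewrite lee_fin csqn_mulconj /= ler_norm.
Qed.

(** This holds only almost everywhere: a count is the sum of the counts over the subcells where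
    [eta] is finite on the cell. Cells of label 0 are harmless, since their factors are 1. *)
Lemma refine_lexp (i : slabel) T q g mq gq :
  {ae P, forall w, lexp (@refine _ _ _ lam i T q g mq gq) w = lexp i w}.
Proof.
have nul t : lc t != 0 -> {ae P, forall w, (eta w (lq i @^-1` [set t]) < +oo)%E}.
  move=> /lc_fin lf; exists [set w | eta w (lq i @^-1` [set t]) = +oo%E]; split.
  - exact: (eta_preimage_meas eta_poisson (lq_meas i t) (emeasurable_set1 _)).
  - exact: (poisson_infty eta_poisson (lq_meas i t)).
  - by move=> w /= /negP; rewrite -leNgt leye_eq => /eqP.
have aeall : {ae P, forall w, forall t, lc t != 0 -> (eta w (lq i @^-1` [set t]) < +oo)%E}.
  have : forall r : seq (lT i), {ae P, forall w, forall t, t \in r -> lc t != 0 -> (eta w (lq i @^-1` [set t]) < +oo)%E}.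
    elim=> [|t r IH]; first exact: nearW.
    have [t0|t0] := eqVneq (lc t) 0.
      by apply: filterS IH => w h s; rewrite inE => /predU1P[->|/h//]; rewrite t0 eqxx.
    by apply: filterS2 (nul _ t0) IH => w h1 h s; rewrite inE => /predU1P[->|/h].
  by move=> /(_ (enum (lT i))); apply: filterS => w h t; apply: h; rewrite mem_enum.
have split_set t : lq i @^-1` [set t] = \bigcup_(s in [set` (fun s => g s == t)]) (q @^-1` [set s]).
  apply/seteqP; split=> y /=; first by rewrite gq => h; exists (q y) => //=; apply/eqP.
  by move=> [s /= /eqP <- /= <-].
have tq (D : set T) : trivIset D (fun s => q @^-1` [set s]).
  by apply/trivIsetP => a b _ _ /eqP ab; apply/seteqP; split=> // y [/= -> ?]; exact: ab.
have msum (m : {measure set S -> \bar R}) t :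
    m (lq i @^-1` [set t]) = (\sum_(s | g s == t) m (q @^-1` [set s]))%E.
  rewrite split_set measure_fin_bigcup//.
  rewrite [RHS](@bigfs _ _ _ T (index_enum T) (fun s => g s == t)) ?index_enum_uniq//.
  by move=> s _; rewrite mem_index_enum.
have mle (m : {measure set S -> \bar R}) s : (m (q @^-1` [set s]) <= m (lq i @^-1` [set (g s)]))%E.
  apply: le_measure; rewrite ?inE//; first exact: lq_meas.
  by move=> y /= <-; rewrite gq.
have fsum (m : {measure set S -> \bar R}) t : (m (lq i @^-1` [set t]) < +oo)%E ->
    fine (m (lq i @^-1` [set t])) = \sum_(s | g s == t) fine (m (q @^-1` [set s])).
  move=> mt; rewrite msum sum_fine// => s /eqP gs; rewrite ge0_fin_numE//.
  by apply: (le_lt_trans (mle _ s)); rewrite gs.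
apply: filterS aeall => w hw; rewrite /lexp /sexp /=; congr (_ * cexp (- _)).
  rewrite (partition_big g xpredT)//=; apply: eq_bigr => t _.
  have [c0|c0] := eqVneq (lc t) 0.
    by rewrite c0 addr0 expr1n big1// => s /eqP ->; rewrite c0 addr0 expr1n.
  have wt := hw _ c0; have -> : cntl (lq i) t w = (\sum_(s | g s == t) cntl q s w)%N.
    apply/eqP; rewrite -(eqr_nat R) natr_sum; apply/eqP.
    have := fsum (eta w) t wt; rewrite (cntE eta_poisson (lq_meas i t) wt) /= => ->.
    apply: eq_bigr => s /eqP gs; rewrite (cntE eta_poisson (mq s))//.
    by apply: (le_lt_trans (mle _ s)); rewrite gs.
  rewrite (big_morph (fun n => (1 + lc t) ^+ n) (exprD _) (expr0 _)).
  by apply: eq_bigr => s /eqP ->.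
rewrite [LHS](partition_big g xpredT)//=; apply: eq_bigr => t _.
have [c0|c0] := eqVneq (lc t) 0.
  by rewrite c0 mul0r big1// => s /eqP ->; rewrite c0 mul0r.
rewrite /lam_at (fsum lam t (lc_fin c0)) rmorph_sum mulr_sumr.
by apply: eq_bigr => s /eqP ->.
Qed.

(** [joinl i j] and [joinr i j] are [i] and [j] on their common refinement, where both use the same
    partition and [sexp_dot] applies. *)
Definition joinl (i j : slabel) : slabel :=
  @refine _ _ _ lam i (lT i * lT j)%type (fun y => (lq i y, lq j y)) fst
   (pair_meas (lq_meas i) (lq_meas j)) (fun=> erefl).
Definition joinr (i j : slabel) : slabel :=
  @refine _ _ _ lam j (lT i * lT j)%type (fun y => (lq i y, lq j y)) snd
   (pair_meas (lq_meas i) (lq_meas j)) (fun=> erefl).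

Definition lvec (i : slabel) : cL2_ips lam := cls lam (phifun i).
Definition evec (i : slabel) : cL2_ips P := cls P (lexp i).

Lemma evec_refine (i : slabel) T q g mq gq : evec (@refine _ _ _ lam i T q g mq gq) = evec i.
Proof. by apply: cls_ae; [exact: lexp_L2|exact: lexp_L2|exact: refine_lexp]. Qed.
Lemma lvec_refine (i : slabel) T q g mq gq : lvec (@refine _ _ _ lam i T q g mq gq) = lvec i.
Proof. by rewrite /lvec refine_phifun. Qed.

Lemma evec_dot i j : hdot (evec i) (evec j) = cexp (hdot (lvec i) (lvec j)).
Proof.
have -> : evec i = evec (joinl i j) by rewrite evec_refine.
have -> : evec j = evec (joinr i j) by rewrite evec_refine.
have -> : lvec i = lvec (joinl i j) by rewrite lvec_refine.
have -> : lvec j = lvec (joinr i j) by rewrite lvec_refine.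
rewrite !cls_dot; [|exact: phifun_L2|exact: phifun_L2|exact: lexp_L2|exact: lexp_L2].
pose T : finType := (lT i * lT j)%type; pose q : S -> T := fun y => (lq i y, lq j y).
pose c : T -> R[i] := @lc _ _ _ _ (joinl i j); pose c' : T -> R[i] := @lc _ _ _ _ (joinr i j).
have mq : forall t : T, measurable (q @^-1` [set t]) := lq_meas (joinl i j).
rewrite [LHS](sexp_dot mq (c := c) (c' := c') (@lc_fin _ _ _ _ (joinl i j)) (@lc_fin _ _ _ _ (joinr i j))).2.
congr cexp; have [|_ e] := label_cint (lam := lam) mq (a := fun t => c t * (c' t)^*%C); last by rewrite -e.
move=> t ct; apply: (@lc_fin _ _ _ _ (joinl i j)).
by apply: contra ct => /eqP h; rewrite /c h mul0r.
Qed.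

End exponential_vectors.
Arguments cntl {R dO O dS S} eta [T] q t w.
Arguments sexp {R dO O dS S} lam eta [T] q c w.
Arguments lexp {R dO O dS S lam} eta i w.
Arguments evec {R dO O P dS S lam} eta i.

Definition cind {R : realType} {T : Type} (D : set T) (t : T) : R[i] := (\1_D t)%:C%C.

(** * Restriction to measurable sets *)

Section indicator_operators.
Context {d} {T : measurableType d} {R : realType} {mu : {measure set T -> \bar R}}.
Local Notation L := (cL2_ips mu).
Implicit Types (D E : set T) (x y : L).

Definition iop D : L -> L := mulop (cind D).

Lemma cindE D t : cind D t = (if t \in D then 1 else 0) :> R[i].
Proof. by rewrite /cind indicE; case: (t \in D). Qed.
Lemma cind_in D t : D t -> cind D t = 1 :> R[i].
Proof. by move=> Dt; rewrite cindE mem_set. Qed.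
Lemma cind_out D t : ~ D t -> cind D t = 0 :> R[i].
Proof. by move=> Dt; rewrite cindE memNset. Qed.
Lemma cind_bmeas D : measurable D -> bmeas (cind D : T -> R[i]).
Proof. exact: bmeas_indic. Qed.
Lemma iop_lin D c x y : measurable D -> iop D (c *: x + y) = c *: iop D x + iop D y.
Proof. by move=> mD; apply: mulop_lin; exact: cind_bmeas. Qed.
Lemma iop0 D : measurable D -> iop D 0 = 0.
Proof. by move=> mD; have := iop_lin (-1) 0 0 mD; rewrite scaler0 addr0 scaleN1r addNr. Qed.
Lemma iopI D E x : measurable D -> measurable E -> iop D (iop E x) = iop (D `&` E) x.
Proof.
move=> mD mE; rewrite /iop mulop_comp; [|exact: cind_bmeas..].
congr (mulop _ x); apply/funext => t; rewrite !cindE in_setI.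
by case: (t \in D); rewrite ?mul1r ?mul0r.
Qed.
Lemma iop_cls D f : measurable D -> L2 mu f ->
  iop D (cls mu f) = cls mu (fun t => cind D t * f t).
Proof. by move=> mD Lf; apply: mulop_cls => //; exact: cind_bmeas. Qed.
Lemma iop_dot D x y : measurable D -> hdot (iop D x) y = hdot x (iop D y).
Proof.
move=> mD; rewrite /iop mulop_dot; last exact: cind_bmeas.
by congr (hdot x (mulop _ y)); apply/funext => t; rewrite cindE; case: ifP; rewrite ?conjc1 ?conjc0.
Qed.
Lemma iop_cont D (u : nat -> L) x : measurable D -> hlim u x -> hlim (iop D \o u) (iop D x).
Proof. by move=> mD; apply: mulop_cont; exact: cind_bmeas. Qed.
Lemma iop_fix D f : measurable D -> L2 mu f -> (forall t, ~ D t -> f t = 0) ->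
  iop D (cls mu f) = cls mu f.
Proof.
move=> mD Lf fD; rewrite iop_cls//; congr (cls mu _); apply/funext => t.
have [Dt|Dt] := pselect (D t); first by rewrite cind_in// mul1r.
by rewrite cind_out// mul0r fD.
Qed.
Lemma iop_cvg (D : nat -> set T) x : (forall n, measurable (D n)) -> nondecreasing_seq D ->
  \bigcup_n D n = setT -> hlim (fun n => iop (D n) x) x.
Proof.
move=> mD nD uD; rewrite -[X in hlim _ X]mulop1; apply: (mulop_cvg (C := 1)).
- by move=> n; case: (cind_bmeas (mD n)).
- by move=> n t; exact: csqn_indic.
- move=> t; have : (\bigcup_n D n) t by rewrite uD.
  move=> [N _ DN]; apply: (@ccvg_eventually _ _ _ N) => n Nn.
  by rewrite cind_in//; have /subsetPset := nD _ _ Nn; exact.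
Qed.
Lemma iop_hsub D : measurable D -> hsubspace [set x : L | iop D x = x].
Proof.
move=> mD; split=> [|c x y /= hx hy|u x hu ux] /=.
- exact: iop0.
- by rewrite iop_lin// hx hy.
- have := iop_cont mD ux; rewrite (_ : iop D \o u = u); last first.
    by apply/funext => n; exact: hu.
  by move=> h; exact: (hlim_uniq h ux).
Qed.
Lemma iop_le D x : measurable D -> hnorm (iop D x) <= hnorm x.
Proof.
move=> mD; have := @mulop_le _ _ _ mu (cind D) 1 x; rewrite sqrtr1 mul1r; apply.
  by case: (cind_bmeas mD).
by move=> t; exact: csqn_indic.
Qed.
End indicator_operators.

(** x is the limit of its restrictions to the sets [F n]; such a restriction is the indicator of
    [F n], an element of [M], multiplied by the function x, so that [mult_mem] applies. *)
Lemma L2_hsub_total {d} {T : measurableType d} {R : realType} {mu : {measure set T -> \bar R}}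
    (M : set (cL2_ips mu)) (F : nat -> set T) (x : cL2_ips mu) : hsubspace M ->
  (forall A, measurable A -> bsets (mult_class M) A) ->
  (forall n, measurable (F n)) -> nondecreasing_seq F -> \bigcup_n F n = setT ->
  (forall n, L2 mu (cind (F n))) -> (forall n, M (cls mu (cind (F n)))) -> M x.
Proof.
move=> HM Mi mF ndF uF LF MF.
apply: (hsub_lim HM _ (iop_cvg x mF ndF uF)) => n.
rewrite -(repK x) iop_cls//; last exact: rep_L2.
have Lx := rep_L2 x; have bF := @cind_bmeas _ _ R _ (mF n).
under eq_fun do rewrite mulrC.
have Lxn : L2 mu (fun t => rep x t * cind (F n) t).
  by under [X in L2 mu X]eq_fun do rewrite mulrC; exact: bmeas_L2.
apply: (mult_mem (f := rep x) (h := cind (F n)) HM (MF n) (LF n) _ Lx.1 Lxn).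
have [[mr mi] _] := Lx; split=> _ A mA; apply: sub_sigma_algebra; apply: Mi; [exact: mr|exact: mi].
Qed.

Section label_algebra.
Context {R : realType} {dS} {S : measurableType dS} {lam : {measure set S -> \bar R}}.
Local Notation slabel := (slabel lam).
Local Notation K := (cL2_ips lam).

Lemma in_set_true (A : set S) : (fun y => y \in A) @^-1` [set true] = A.
Proof. by apply/seteqP; split=> y /=; [exact: set_mem|exact: mem_set]. Qed.
Lemma bool_meas (A : set S) : measurable A ->
  forall b : bool, measurable ((fun y => y \in A) @^-1` [set b]).
Proof.
move=> mA [] /=.
  by rewrite in_set_true.
rewrite (_ : _ @^-1` _ = ~` A); first exact: measurableC.
apply/seteqP; split=> y /=; first by move=> /negbT/negP h Ay; apply: h; exact: mem_set.
by move=> h; exact: memNset.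
Qed.

Program Definition setl (A : set S) (z : R[i]) (mA : measurable A) (lA : (lam A < +oo)%E) : slabel :=
  @SLabel _ _ _ lam bool (fun y => y \in A) (fun b => if b then z else 0) (bool_meas mA) _.
Next Obligation.
move=> A z mA lA [] /=; last by rewrite eqxx.
by rewrite in_set_true.
Qed.

(** Since [op 0 0 = 0], a cell with non-zero combined value lies in a cell of finite measure of [i]
    or of [j]. *)
Program Definition comb2 (i j : slabel) (op : R[i] -> R[i] -> R[i]) (op0 : op 0 0 = 0) : slabel :=
  @SLabel _ _ _ lam (lT i * lT j)%type (fun y => (lq i y, lq j y))
   (fun t => op (lc t.1) (lc t.2)) (pair_meas (lq_meas i) (lq_meas j)) _.
Next Obligation.
move=> i j op op0 [t t'] /= h.
have [ct|/lc_fin] := eqVneq (lc t) 0; last first.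
  apply: le_lt_trans; apply: le_measure; rewrite ?inE//; last by move=> y [].
  - exact: pair_meas (lq_meas i) (lq_meas j) _.
  - exact: lq_meas.
have [ct'|/lc_fin] := eqVneq (lc t') 0; last first.
  apply: le_lt_trans; apply: le_measure; rewrite ?inE//; last by move=> y [].
  - exact: pair_meas (lq_meas i) (lq_meas j) _.
  - exact: lq_meas.
by move: h; rewrite ct ct' op0 eqxx.
Qed.

Lemma comb2_phifun i j op op0 y : phifun (@comb2 i j op op0) y = op (phifun i y) (phifun j y).
Proof. by []. Qed.

Lemma lin_op0 c : c * 0 + 0 = 0 :> R[i]. Proof. by rewrite mulr0 addr0. Qed.
Lemma prod_op0 : 0 + 0 + 0 * 0 = 0 :> R[i]. Proof. by rewrite mulr0 !addr0. Qed.
Definition linl c i j := @comb2 i j (fun a b => c * a + b) (lin_op0 c).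
(** From (1 + a)(1 + b) = 1 + (a + b + ab): the simple function whose exponential is, up to a
    constant, the product of the two exponentials. *)
Definition prodl i j := @comb2 i j (fun a b => a + b + a * b) prod_op0.
Definition setl0 : slabel := @setl set0 0 measurable0 (ltac:(by rewrite measure0 ltry)).

Program Definition cutl (i : slabel) (A : set S) (mA : measurable A) : slabel :=
  @SLabel _ _ _ lam (lT i * bool)%type (fun y => (lq i y, y \in A))
   (fun t => if t.2 then lc t.1 else 0) (pair_meas (lq_meas i) (bool_meas mA)) _.
Next Obligation.
move=> i A mA [t []] /=; last by rewrite eqxx.
move=> /lc_fin; apply: le_lt_trans; apply: le_measure; rewrite ?inE//; last by move=> y [].
- exact: pair_meas (lq_meas i) (bool_meas mA) _.
- exact: lq_meas.
Qed.

Lemma cutl_phifun i A mA y : phifun (@cutl i A mA) y = cind A y * phifun i y.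
Proof. by rewrite /phifun /= cindE; case: ifP; rewrite ?mul1r ?mul0r. Qed.
Lemma lvec_cut i A mA : lvec (@cutl i A mA) = iop A (lvec i).
Proof.
rewrite iop_cls//; last exact: phifun_L2.
by congr (cls lam _); apply/funext => y; exact: cutl_phifun.
Qed.
Lemma lvec_lin c i j : lvec (linl c i j) = c *: lvec i + lvec j.
Proof.
rewrite -clsZ; last exact: phifun_L2.
by rewrite -clsD; [|apply: L2Z; exact: phifun_L2|exact: phifun_L2].
Qed.
Lemma lvec0 : lvec setl0 = 0.
Proof.
rewrite -cls0; congr (cls lam _); apply/funext => y.
by rewrite /phifun /=; case: ifP.
Qed.

Hypothesis lam_sf : sigma_finite setT lam.

(** The limits of labels form a closed subspace, stable under restriction to measurable sets and
    containing the indicators of sets of finite measure; [L2_hsub_total] concludes. *)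
Lemma lvec_dense (x : K) (r : R) : 0 < r -> exists i, hnorm (x - lvec i) < r.
Proof.
pose M : set K := [set x | forall r : R, 0 < r -> exists i, hnorm (x - lvec i) < r].
suff : M x by exact.
have HM : hsubspace M.
  split.
  - by move=> e e0; exists setl0; rewrite lvec0 subrr hnorm0.
  - move=> c y z My Mz e e0.
    pose k := Num.sqrt (csqn c) + 1.
    have k0 : 0 < k by rewrite ltr_wpDl// sqrtr_ge0.
    have [i yi] := My _ (divr_gt0 e0 (mulr_gt0 (ltr0n _ 2) k0)).
    have [j zj] := Mz _ (divr_gt0 e0 (ltr0n _ 2)).
    exists (linl c i j); rewrite lvec_lin opprD addrACA -scalerBr.
    rewrite (le_lt_trans (hnormD _ _))// hnormZ (splitr e) ltr_leD// ?(ltW zj)//.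
    move: yi; set s := hnorm _ => yi.
    have : k * s < k * (e / (2 * k)) by rewrite ltr_pM2l.
    have -> : k * (e / (2 * k)) = e / 2 by field; rewrite gt_eqF.
    by apply: le_lt_trans; rewrite ler_wpM2r ?hnorm_ge0// lerDl.
  - move=> u y Mu /hlimP uy e e0; have e2 : 0 < e / 2 by rewrite divr_gt0.
    have [N _ /(_ N (leqnn N)) uN] := uy _ e2.
    have [i ui] := Mu N _ e2; exists i.
    by rewrite (le_lt_trans (hnorm_tri (u N) _ _))// (splitr e) ltrD// hnorm_distC.
have Mi A : measurable A -> bsets (mult_class M) A.
  move=> mA; split; first exact: bmeas_indic.
  move=> y My e e0; have [i yi] := My e e0; exists (cutl i mA).
  rewrite lvec_cut; apply: le_lt_trans yi.
  rewrite (_ : _ - _ = iop A (y - lvec i)); first exact: iop_le.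
  by rewrite addrC -scaleN1r -iop_lin// scaleN1r addrC.
have [F [uF ndF F_fin]] := (sigma_finiteP _ _).1 lam_sf.
have mF n : measurable (F n) by case: (F_fin n).
have MF n : M (cls lam (cind (F n))).
  move=> e e0; exists (setl 1 (mF n) (F_fin n).2); rewrite (_ : lvec _ = cls lam (cind (F n))).
    by rewrite subrr hnorm0.
  by congr (cls lam _); apply/funext => y; rewrite /phifun /= cindE.
have LF n : L2 lam (cind (F n)).
  have := phifun_L2 (setl 1 (mF n) (F_fin n).2); congr L2.
  by apply/funext => y; rewrite /phifun /= cindE.
exact: (@L2_hsub_total _ _ _ lam M F x HM Mi mF ndF (esym uF) LF MF).
Qed.

End label_algebra.

(** Meant for the sigma-algebras [bsets F], where the level sets of the counts and the null sets are
    what is at hand. *)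
Lemma emeas_of_nat {R : realType} {d} {T : measurableType d} (h : T -> \bar R) (N : T -> nat) :
  (forall k, measurable [set x | N x = k]) -> measurable [set x | h x = +oo%E] ->
  (forall x, h x != +oo%E -> h x = (N x)%:R%:E) -> measurable_fun setT h.
Proof.
move=> mN mI hN _ M mM; rewrite setTI.
have -> : h @^-1` M = ((\bigcup_(k in [set k | M k%:R%:E]) [set x | N x = k]) `\` [set x | h x = +oo%E])
     `|` (if pselect (M +oo%E) is left _ then [set x | h x = +oo%E] else set0).
  apply/seteqP; split=> x /=.
    have [hx|hx] := eqVneq (h x) +oo%E; first by rewrite hx => M1; right; case: pselect.
    by move=> M1; left; split; [exists (N x) => //=; rewrite -hN|apply/eqP].
  case=> [[[k /= Mk Nk] /eqP hx]|]; first by rewrite hN// Nk.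
  by case: pselect => //= M1 ->.
apply: measurableU; last by case: (pselect (M +oo%E)).
by apply: measurableD => //; apply: bigcup_measurable => k _; exact: mN.
Qed.

(** * The span of the exponential vectors *)

Section stochastic_exponentials.
Context {R : realType} {dO} {O : measurableType dO} {P : probability O R}.
Context {dS} {S : measurableType dS} {lam : {measure set S -> \bar R}}.
Context {eta : O -> {measure set S -> \bar R}}.
Hypothesis eta_poisson : poisson_process P lam eta.
Hypothesis P_complete : measure_is_complete P.
Hypothesis lam_sf : sigma_finite setT lam.
Local Notation slabel := (slabel lam).
Local Notation K := (cL2_ips lam).
Local Notation L := (cL2_ips P).
Local Notation lexp := (@lexp _ _ _ _ _ lam eta).
Local Notation evec := (@evec _ _ _ P _ _ lam eta).

(** The factors multiply as (1 + c)(1 + c'), and the constant makes up for the term c c' that the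
    new compensator contains. *)
Lemma sexp_mul (T : finType) (q : S -> T) (c c' : T -> R[i]) w :
  sexp lam eta q c w * sexp lam eta q c' w =
  cexp (\sum_t c t * c' t * (lam_at lam q t)%:C%C) *
  sexp lam eta q (fun t => c t + c' t + c t * c' t) w.
Proof.
rewrite /sexp.
have -> : \prod_t (1 + (c t + c' t + c t * c' t)) ^+ cntl eta q t w =
   (\prod_t (1 + c t) ^+ cntl eta q t w) * \prod_t (1 + c' t) ^+ cntl eta q t w.
  rewrite -big_split /=; apply: eq_bigr => t _; rewrite -exprMn; congr (_ ^+ _); ring.
have -> : cexp (- \sum_t (c t + c' t + c t * c' t) * (lam_at lam q t)%:C%C) =
   cexp (- \sum_t c t * (lam_at lam q t)%:C%C) * cexp (- \sum_t c' t * (lam_at lam q t)%:C%C) *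
   cexp (- \sum_t c t * c' t * (lam_at lam q t)%:C%C).
  rewrite -!cexpD -!opprD -!big_split /=; congr (cexp (- _)); apply: eq_bigr => t _; ring.
set p1 := \prod_t _ ^+ _; set p2 := \prod_t _ ^+ _.
set x := cexp _; set y := cexp _.
have : cexp (\sum_t c t * c' t * (lam_at lam q t)%:C%C) *
       cexp (- \sum_t c t * c' t * (lam_at lam q t)%:C%C) = 1 by rewrite -cexpD subrr cexp0.
move: (cexp _) (cexp _) => u v uv.
by transitivity (p1 * p2 * (x * y) * (v * u)); [rewrite uv; ring|ring].
Qed.

(** The integral of [phifun i * phifun j], without conjugation. *)
Definition prodl_const (i j : slabel) : R[i] :=
  \sum_(t : lT (prodl i j)) lc t.1 * lc t.2 * (lam_at lam (lq (prodl i j)) t)%:C%C.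

Lemma lexp_mul i j : {ae P, forall w, lexp i w * lexp j w =
  cexp (prodl_const i j) * lexp (prodl i j) w}.
Proof.
have h1 := @refine_lexp _ _ _ P _ _ lam eta eta_poisson i (lT i * lT j)%type
   (fun y => (lq i y, lq j y)) fst (pair_meas (lq_meas i) (lq_meas j)) (fun=> erefl).
have h2 := @refine_lexp _ _ _ P _ _ lam eta eta_poisson j (lT i * lT j)%type
   (fun y => (lq i y, lq j y)) snd (pair_meas (lq_meas i) (lq_meas j)) (fun=> erefl).
by apply: filterS2 h1 h2 => w <- <-; rewrite /lexp /= sexp_mul.
Qed.

Lemma prodl_const0 i j : (forall y, phifun i y * phifun j y = 0) -> prodl_const i j = 0.
Proof.
move=> h; rewrite /prodl_const big1// => t _.
(* The values on an empty cell may have a non-zero product, but the measure of the cell is 0. *)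
case: (eqVneq (lq (prodl i j) @^-1` [set t]) set0) => [E|/set0P[y /= ty]].
  by rewrite /lam_at E measure0 /= mulr0.
by rewrite -ty /= h mul0r.
Qed.

(** Almost everywhere the product is a multiple of one exponential; this is also what makes it
    square integrable. *)
Lemma cls_lexp_mul i j : L2 P (fun w => lexp i w * lexp j w) /\
  cls P (fun w => lexp i w * lexp j w) = cexp (prodl_const i j) *: evec (prodl i j).
Proof.
have Lp : L2 P (fun w => cexp (prodl_const i j) * lexp (prodl i j) w).
  by apply: L2Z; exact: lexp_L2.
have mij : cmeas (fun w => lexp i w * lexp j w).
  by apply: cmeasM; [exact: (lexp_L2 eta_poisson i).1|exact: (lexp_L2 eta_poisson j).1].
have Lij : L2 P (fun w => lexp i w * lexp j w).
  split=> //; case: Lp => mp; rewrite /sqint.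
  rewrite (ge0_ae_eq_integral (g := fun w => (csqn (lexp i w * lexp j w))%:E) measurableT)//.
  - exact: cmeas_csqnE.
  - exact: cmeas_csqnE.
  - by move=> w _; rewrite lee_fin csqn_ge0.
  - by move=> w _; rewrite lee_fin csqn_ge0.
  - by apply: filterS (lexp_mul i j) => w -> _.
split=> //; rewrite -clsZ; last exact: lexp_L2.
by apply: cls_ae => //; exact: lexp_mul.
Qed.

(** z^eta(B) is a multiple of the exponential of (z - 1) 1_B, so multiplication by it maps
    exponential vectors to multiples of exponential vectors. *)
Lemma zrot_lexp B (mB : measurable B) (lB : (lam B < +oo)%E) w :
  zrot ^+ cnt eta B w = cexp ((zrot - 1) * (fine (lam B))%:C%C) * lexp (setl (zrot - 1) mB lB) w.
Proof.
rewrite /lexp /sexp !big_bool /= !addr0 expr1n mul0r addr0 mulr1.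
have -> : cntl eta (fun y => y \in B) true w = cnt eta B w.
  by rewrite /cntl in_set_true.
rewrite /lam_at in_set_true (addrC 1) subrK mulrCA -cexpD subrr cexp0 mulr1.
by [].
Qed.

Lemma evec0 : evec (@setl0 _ _ _ lam) = cls P (fun=> 1).
Proof.
congr (cls P _); apply/funext => w; rewrite /lexp /sexp !big_bool /=.
by rewrite !mul0r !addr0 !expr1n oppr0 cexp0 !mulr1.
Qed.

Lemma exists_fock : exists e : K -> L,
  (forall x y, hdot (e x) (e y) = cexp (hdot x y)) /\ (forall i, e (lvec i) = evec i).
Proof.
pose I := {p : K * L | exists i : slabel, p = (lvec i, evec i)}.
have gram (p q : I) : hdot (sval p).2 (sval q).2 = cexp (hdot (sval p).1 (sval q).1).
  by have [i ->] := svalP p; have [j ->] := svalP q; exact: (evec_dot eta_poisson).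
have dense (x : K) (r : R) : 0 < r -> exists p : I, hnorm (x - (sval p).1) < r.
  move=> r0; have [i hi] := lvec_dense lam_sf x r0.
  by exists (exist _ (lvec i, evec i) (ex_intro _ i erefl)).
have [e [h1 h2]] := fock_extension (@cL2_complete _ _ _ P) gram dense.
exists e; split=> // i.
exact: (h2 (exist _ (lvec i, evec i) (ex_intro _ i erefl))).
Qed.

Variable e : K -> L.
Hypothesis e_gram : forall x y, hdot (e x) (e y) = cexp (hdot x y).
Hypothesis eE : forall i, e (lvec i) = evec i.

Definition Ksupp (D : set S) : set K := [set u | iop D u = u].
(** The Fock space of L^2(D), realized inside L^2(P). *)
Definition Mspan (D : set S) : set L := closed_span (e @` Ksupp D).
Definition inlab (D : set S) (i : slabel) := forall y, ~ D y -> phifun i y = 0.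

Lemma inlab_Ksupp D i : measurable D -> inlab D i -> Ksupp D (lvec i).
Proof. by move=> mD Di; apply: iop_fix => //; exact: phifun_L2. Qed.

(** Approximating labels may be restricted to [D], since restriction is continuous and fixes u. *)
Lemma Ksupp_approx D u : measurable D -> Ksupp D u ->
  exists s : nat -> slabel, (forall n, inlab D (s n)) /\ hlim (fun n => lvec (s n)) u.
Proof.
move=> mD Du.
have w n : {i | hnorm (u - lvec i) < 2^-1 ^+ n}.
  by apply: cid; apply: (lvec_dense lam_sf); rewrite exprn_gt0// invr_gt0.
exists (fun n => cutl (sval (w n)) mD); split.
  by move=> n y Dy; rewrite cutl_phifun cind_out// mul0r.
have := iop_cont mD (hlim_geo (fun n => svalP (w n))); rewrite Du.
by rewrite (_ : _ \o _ = fun n => lvec (cutl (sval (w n)) mD)) //; apply/funext => n; rewrite lvec_cut.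
Qed.

Lemma e_approx D u : measurable D -> Ksupp D u ->
  exists s : nat -> slabel, [/\ forall n, inlab D (s n), hlim (fun n => lvec (s n)) u &
    hlim (fun n => evec (s n)) (e u)].
Proof.
move=> mD /(Ksupp_approx mD)[s [sD su]]; exists s; split=> //.
have := fock_continuous e_gram su; rewrite (_ : _ \o _ = fun n => evec (s n))//.
by apply/funext => n /=.
Qed.

Lemma Mspan_hsub D : hsubspace (Mspan D). Proof. exact: closed_span_hsub. Qed.
Lemma Mspan_evec D i : measurable D -> inlab D i -> Mspan D (evec i).
Proof.
by move=> mD Di; apply: closed_span_sub; exists (lvec i); [exact: inlab_Ksupp|exact: eE].
Qed.
Lemma Mspan_min D (M : set L) : measurable D -> hsubspace M ->
  (forall i, inlab D i -> M (evec i)) -> Mspan D `<=` M.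
Proof.
move=> mD HM Mi; apply: closed_span_min => // _ [u Du <-].
have [s [sD _ su]] := e_approx mD Du.
by apply: (hsub_lim HM _ su) => n; exact: Mi.
Qed.

Local Notation Zeta := (fun (B : set S) w => eta w B).
Definition etaG (D : set S) : set (set O) := [set A | exists B (M : set (\bar R)),
     [/\ measurable B, B `<=` D, measurable M & A = Zeta B @^-1` M]].

Lemma Mspan_sub D : measurable D -> Mspan D `<=` cL2_sub (sigma_field P Zeta D).
Proof.
move=> mD; apply: Mspan_min => //; first exact: cL2_sub_hsub.
move=> i Di; apply/cL2_subP; exists (lexp i); first exact: lexp_L2.
split=> //; apply: cmeasM; last exact: cmeas_cst.
apply: cmeas_prod => t.
have [c0|c0] := eqVneq (lc t) 0.
  rewrite (_ : (fun _ => _) = fun=> 1); first exact: cmeas_cst.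
  by apply/funext => w; rewrite c0 addr0 expr1n.
(* A cell of non-zero value lies in [D], because the simple function vanishes outside [D]. *)
apply: (nat_cmeas (fun k => (1 + lc t) ^+ k)) => _ M _; rewrite setTI.
have [M' mM' ->] := cnt_preimage eta_poisson M (lq_meas i t).
apply: sub_sigma_algebra; left; exists (lq i @^-1` [set t]), M'; split=> //; first exact: lq_meas.
by move=> y /= ty; apply: contrapT => /Di; rewrite /phifun ty => h; rewrite h eqxx in c0.
Qed.

Lemma zrot_bmeas B : measurable B -> bmeas (fun w => zrot ^+ cnt eta B w : R[i]).
Proof.
move=> mB; split; first by apply: (nat_cmeas (fun k => zrot ^+ k)); exact: cnt_meas eta_poisson _ mB.
by exists 1 => w; rewrite csqnX csqn_zrot expr1n.
Qed.

Lemma zrot_evec B (mB : measurable B) (lB : (lam B < +oo)%E) i :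
  mulop (fun w => zrot ^+ cnt eta B w) (evec i) =
  (cexp ((zrot - 1) * (fine (lam B))%:C%C) * cexp (prodl_const (setl (zrot - 1) mB lB) i)) *:
    evec (prodl (setl (zrot - 1) mB lB) i).
Proof.
rewrite mulop_cls; [|exact: zrot_bmeas|exact: lexp_L2].
under [X in cls P X]eq_fun do rewrite (zrot_lexp mB lB) -mulrA.
have [Lij Eij] := cls_lexp_mul (setl (zrot - 1) mB lB) i.
by rewrite clsZ// Eij scalerA.
Qed.

(** As [B] is included in [D], the product label of (z - 1) 1_B and a label supported in [D] is
    again supported in [D]. *)
Lemma Mspan_zrot D B : measurable D -> measurable B -> B `<=` D -> (lam B < +oo)%E ->
  mult_class (Mspan D) (fun w => zrot ^+ cnt eta B w).
Proof.
move=> mD mB BD lB; have bz := zrot_bmeas mB; split; first exact: bz.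
move=> x.
pose M := [set x | Mspan D (mulop (fun w => zrot ^+ cnt eta B w) x)].
have HM : hsubspace M.
  split.
  - by rewrite /M /=; have -> := mulop0 bz; exact: hsub0 (Mspan_hsub D).
  - move=> c y z My Mz; rewrite /M /=; have -> := mulop_lin c y z bz.
    exact: hsubP (Mspan_hsub D) My Mz.
  - by move=> u y Mu uy; exact: (hsub_lim (Mspan_hsub D) Mu (mulop_cont bz uy)).
apply: (Mspan_min mD HM) => i Di; rewrite /M /=.
rewrite zrot_evec; apply: (hsubZ _ (Mspan_hsub D)).
apply: Mspan_evec => // y Dy; rewrite comb2_phifun Di// !addr0 mulr0 addr0.
by rewrite /phifun /= memNset// => /BD.
Qed.

Lemma Mspan1 D : measurable D -> Mspan D (cls P (fun=> 1)).
Proof.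
by move=> mD; rewrite -evec0; apply: Mspan_evec => // y _; rewrite /phifun /=; case: ifP.
Qed.

(** [bsets_nat] extracts the events eta(B) = k from the powers of z when [lam B] is finite; the
    event of an infinite value is null. Other sets are exhausted by sets of finite intensity. *)
Lemma eta_bsets (F : set (O -> R[i])) (HF : bclass F) D :
  (forall N, P.-negligible N -> bsets F N) ->
  (forall B, measurable B -> B `<=` D -> (lam B < +oo)%E -> F (fun w => zrot ^+ cnt eta B w)) ->
  forall B, measurable B -> B `<=` D ->
  measurable_fun setT (fun w : g_sigma_algebraType (bsets F) => eta w B).
Proof.
move=> Fneg Fz.
have fin B : measurable B -> B `<=` D -> (lam B < +oo)%E ->
    measurable_fun setT (fun w : g_sigma_algebraType (bsets F) => eta w B).
  move=> mB BD lB; apply: (@emeas_of_nat R _ (g_sigma_algebraType (bsets F)) _ (cnt eta B)).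
  - by move=> k; apply/(bsets_measurable HF); apply: bsets_nat => //; exact: Fz.
  - apply/(bsets_measurable HF); apply: Fneg.
    exists [set w | eta w B = +oo%E]; split=> //.
      exact: (eta_preimage_meas eta_poisson mB (emeasurable_set1 _)).
    exact: (poisson_infty eta_poisson mB lB).
  - by move=> w h; apply: (cntE eta_poisson mB); rewrite ltey.
move=> B mB BD; have [H [uH ndH H_fin]] := (sigma_finiteP _ _).1 lam_sf.
apply: (emeasurable_fun_cvg (fun n (w : g_sigma_algebraType (bsets F)) => eta w (B `&` H n))).
  move=> n; have [mH lH] := H_fin n; apply: fin; first exact: measurableI.
    by move=> y [/BD].
  by apply: le_lt_trans lH; apply: le_measure; rewrite ?inE//; exact: measurableI.
move=> w _; have -> : eta w B = eta w (\bigcup_n (B `&` H n)).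
  by rewrite -setI_bigcupr -uH setIT.
apply: nondecreasing_cvg_mu.
- by move=> n; apply: measurableI => //; case: (H_fin n).
- by apply: bigcup_measurable => n _; apply: measurableI => //; case: (H_fin n).
- by move=> m n mn; apply/subsetPset => y [By Hy]; split=> //; have /subsetPset := ndH _ _ mn; exact.
Qed.

Theorem Mspan_eq D : measurable D -> Mspan D = cL2_sub (sigma_field P Zeta D).
Proof.
move=> mD; apply/seteqP; split; first exact: Mspan_sub.
apply: (cL2_sub_min P_complete (Mspan_hsub D) (Mspan1 mD)).
have HF := mult_bclass (Mspan_hsub D).
move=> A [B [M [mB BD mM ->]]]; apply/(bsets_measurable HF).
have := eta_bsets HF (D := D) (fun N hN => mult_negl P_complete (Mspan_hsub D) hN).
move=> /(_ (fun B mB BD lB => Mspan_zrot mD mB BD lB)) /(_ B mB BD measurableT M mM).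
by rewrite setTI.
Qed.

End stochastic_exponentials.

(** * Second quantization and shifts *)

Lemma hnorm_inj {R : realType} {H K : innerProductSpace R} (x : H) (y : K) :
  hnorm x ^+ 2 = hnorm y ^+ 2 -> hnorm x = hnorm y.
Proof. by apply: (@pexpIrn _ 2); rewrite ?nnegrE ?hnorm_ge0. Qed.

Section isometries.
Context {R : realType} {H K : innerProductSpace R}.
Implicit Types T : H -> K.

(** Norms are what change of variables gives directly; inner products follow by polarization
    ([lisom_dot]). *)
Definition lisom T := (forall c x y, T (c *: x + y) = c *: T x + T y) /\
  (forall x, hnorm (T x) = hnorm x).

Lemma lisom0 T : lisom T -> T 0 = 0.
Proof. by move=> [lT _]; have := lT (-1) 0 0; rewrite scaler0 addr0 scaleN1r addNr. Qed.
Lemma lisomZ T c x : lisom T -> T (c *: x) = c *: T x.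
Proof. by move=> hT; have := hT.1 c x 0; rewrite !addr0 lisom0// addr0. Qed.
Lemma lisomD T x y : lisom T -> T (x + y) = T x + T y.
Proof. by move=> hT; have := hT.1 1 x y; rewrite !scale1r. Qed.
Lemma lisomB T x y : lisom T -> T (x - y) = T x - T y.
Proof. by move=> hT; rewrite lisomD// -scaleN1r lisomZ// scaleN1r. Qed.
Lemma lisom_lim T u x : lisom T -> hlim u x -> hlim (T \o u) (T x).
Proof.
move=> hT; rewrite /hlim (_ : (fun n => hnorm ((T \o u) n - T x)) = fun n => hnorm (u n - x))//.
by apply/funext => n /=; rewrite -lisomB// hT.2.
Qed.
Lemma lisom_dot T x y : lisom T -> hdot (T x) (T y) = hdot x y.
Proof.
move=> hT; have re a b : Re (hdot (T a) (T b)) = Re (hdot a b).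
  have := hnormDsq (T a) (T b); rewrite -lisomD// !hT.2 hnormDsq => h.
  have h2 : 2 * Re (hdot a b) = 2 * Re (hdot (T a) (T b)) by move: h; lra.
  by apply: (mulfI _ (esym h2)); rewrite pnatr_eq0.
by apply: complex_eqP => //; rewrite !Im_hdotE -lisomZ// re.
Qed.
Lemma lisom_preim T (M : set K) : lisom T -> hsubspace M -> hsubspace (T @^-1` M).
Proof.
move=> hT HM; split=> [|c x y Mx My|u x Mu ux] /=.
- by rewrite lisom0//; exact: hsub0.
- by rewrite hT.1; exact: hsubP.
- exact: (hsub_lim HM Mu (lisom_lim hT ux)).
Qed.
Lemma lisom_eq T T' : lisom T -> lisom T' -> hsubspace [set x | T x = T' x].
Proof.
move=> hT hT'; split=> [|c x y /= Tx Ty|u x /= Tu ux] /=.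
- by rewrite !lisom0.
- by rewrite hT.1 hT'.1 Tx Ty.
- have h := lisom_lim hT ux; have h' := lisom_lim hT' ux.
  apply: (hlim_uniq h); rewrite (_ : T \o u = T' \o u)//.
  by apply/funext => n /=.
Qed.
End isometries.

Lemma L2_ae {R : realType} {d} {T : measurableType d} {mu : {measure set T -> \bar R}}
    (f g : T -> R[i]) : cmeas f -> L2 mu g -> {ae mu, forall x, f x = g x} -> L2 mu f.
Proof.
move=> mf [mg gi] fg; split=> //; rewrite /sqint.
rewrite (ge0_ae_eq_integral (g := fun w => (csqn (g w))%:E) measurableT)//.
- exact: cmeas_csqnE.
- exact: cmeas_csqnE.
- by move=> w _; rewrite lee_fin csqn_ge0.
- by move=> w _; rewrite lee_fin csqn_ge0.
- by apply: filterS fg => w -> _.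
Qed.

(** * Measure-preserving maps *)

Section measure_preserving.
Context {R : realType} {dS} {S : measurableType dS} {lam : {measure set S -> \bar R}}.
Local Notation K := (cL2_ips lam).

Definition mpres (tau : S -> S) := measurable_fun setT tau /\
  forall B, measurable B -> lam (tau @^-1` B) = lam B.
Definition tauop (tau : S -> S) (x : K) : K := cls lam (rep x \o tau).

Variable tau : S -> S.
Hypothesis mtau : mpres tau.

Lemma mpres_meas B : measurable B -> measurable (tau @^-1` B).
Proof. by move=> mB; rewrite -[X in measurable X]setTI; apply: mtau.1. Qed.

Lemma mpres_cmeas (f : S -> R[i]) : cmeas f -> cmeas (f \o tau).
Proof. by move=> [mr mi]; split; [exact: measurableT_comp mr mtau.1|exact: measurableT_comp mi mtau.1]. Qed.

Lemma mpres_sqint f : cmeas f -> sqint lam (f \o tau) = sqint lam f.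
Proof.
move=> mf; rewrite /sqint.
have := @ge0_integral_pushforward _ _ _ _ _ _ mtau.1 lam setT (fun y => (csqn (f y))%:E) measurableT
  (cmeas_csqnE mf).
rewrite preimage_setT => <-; last by move=> y _; rewrite lee_fin csqn_ge0.
apply: eq_measure_integral; [exact: mtau.1|move=> ? A mA _; exact: (mtau.2 A mA)].
Qed.

Lemma mpres_L2 f : L2 lam f -> L2 lam (f \o tau).
Proof. by move=> [mf fi]; split; [exact: mpres_cmeas|rewrite mpres_sqint]. Qed.

Lemma mpres_ae (Q : S -> Prop) : {ae lam, forall y, Q y} -> {ae lam, forall y, Q (tau y)}.
Proof.
move=> [N [mN N0 QN]]; exists (tau @^-1` N); split; first exact: mpres_meas.
  by rewrite mtau.2.
by move=> y /= h; apply: QN.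
Qed.

Lemma tauop_cls f : L2 lam f -> tauop tau (cls lam f) = cls lam (f \o tau).
Proof.
move=> Lf; apply: cls_ae; [exact: mpres_L2 (rep_L2 _)|exact: mpres_L2|].
exact: (mpres_ae (cls_aeP (rep_L2 _) Lf (repK _))).
Qed.

Lemma tauop_lisom : lisom (tauop tau).
Proof.
split=> [c x y|x].
  rewrite -(repK x) -(repK y); have Lf := rep_L2 x; have Lg := rep_L2 y.
  rewrite -clsZ// -clsD//; last exact: L2Z.
  rewrite !tauop_cls//; last by apply: L2D => //; exact: L2Z.
  rewrite -clsZ; last exact: mpres_L2.
  by rewrite -clsD; [|apply: L2Z; exact: mpres_L2|exact: mpres_L2].
have Lf := rep_L2 x; rewrite -(repK x) (tauop_cls Lf).
apply: hnorm_inj; apply: EFin_inj.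
by rewrite (cls_norm (mpres_L2 Lf)) (cls_norm Lf) mpres_sqint//; case: Lf.
Qed.

Lemma tauop_iop D x : measurable D -> tauop tau (iop D x) = iop (tau @^-1` D) (tauop tau x).
Proof.
move=> mD; have Lx := rep_L2 x; rewrite -(repK x) iop_cls// !tauop_cls//.
  rewrite iop_cls//; first exact: mpres_meas.
  exact: mpres_L2.
by apply: bmeas_L2 => //; exact: cind_bmeas.
Qed.

End measure_preserving.

Lemma tauop_cancel {R : realType} {dS} {S : measurableType dS} {lam : {measure set S -> \bar R}}
    (tau tau' : S -> S) (x : cL2_ips lam) : mpres (lam := lam) tau -> mpres (lam := lam) tau' ->
  cancel tau tau' -> tauop tau (tauop tau' x) = x.
Proof.
move=> m m' k; rewrite {2}/tauop (tauop_cls m (mpres_L2 m' (rep_L2 x))).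
rewrite -[RHS]repK; congr (cls lam _).
by apply/funext => y /=; rewrite k.
Qed.

Lemma iopT {R : realType} {dS} {S : measurableType dS} {lam : {measure set S -> \bar R}}
    (x : cL2_ips lam) : iop setT x = x.
Proof.
rewrite /iop (_ : cind setT = fun=> 1); first exact: mulop1.
by apply/funext => y; rewrite cind_in.
Qed.

Lemma mulop_cst0 {R : realType} {dS} {S : measurableType dS} {lam : {measure set S -> \bar R}}
    (x : cL2_ips lam) : mulop (fun=> 0) x = 0.
Proof. by rewrite /mulop -cls0; congr (cls lam _); apply/funext => y; rewrite mul0r. Qed.

(** * Second quantization of a measure-preserving map *)

Section second_quantization.
Context {R : realType} {dO} {O : measurableType dO} {P : probability O R}.
Context {dS} {S : measurableType dS} {lam : {measure set S -> \bar R}}.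
Context {eta : O -> {measure set S -> \bar R}}.
Hypothesis eta_poisson : poisson_process P lam eta.
Hypothesis P_complete : measure_is_complete P.
Hypothesis lam_sf : sigma_finite setT lam.
Local Notation slabel := (slabel lam).
Local Notation K := (cL2_ips lam).
Local Notation L := (cL2_ips P).
Local Notation lexp := (@lexp _ _ _ _ _ lam eta).
Local Notation evec := (@evec _ _ _ P _ _ lam eta).
Local Notation mpres := (@mpres R _ S lam).
Variable e : K -> L.
Hypothesis e_gram : forall x y, hdot (e x) (e y) = cexp (hdot x y).
Hypothesis eE : forall i, e (lvec i) = evec i.
Local Notation Mspan := (Mspan e).
Hypothesis e_total : Mspan setT = setT.

(** The Gram matrix of exponential vectors is a function of that of their arguments, which
    [tauop tau] preserves. *)
Lemma exists_quant tau : mpres tau -> exists T : L -> L, lisom T /\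
  forall x, T (e x) = e (tauop tau x).
Proof.
move=> mt; have gram x y : hdot (e (tauop tau x)) (e (tauop tau y)) = hdot (e x) (e y).
  by rewrite !e_gram (lisom_dot _ _ (tauop_lisom mt)).
have tot : closed_span (range e) = setT.
  rewrite -e_total /Mspan; congr (closed_span (e @` _)).
  by apply/seteqP; split=> // x _; exact: iopT.
have [T [lT nT eT]] := unitary_extension (@cL2_complete _ _ _ P) tot gram.
exists T; split=> //; split=> // x; apply: hnorm_inj.
by rewrite !hnorm_sq nT.
Qed.

Section quantized_map.
Variables (tau : S -> S) (mt : mpres tau) (T : L -> L).
Hypotheses (iT : lisom T) (TE : forall x, T (e x) = e (tauop tau x)).

Program Definition shl (i : slabel) : slabel :=
  @SLabel _ _ _ lam (lT i) (lq i \o tau) (@lc _ _ _ _ i) _ _.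
Next Obligation. by move=> i t; exact: (mpres_meas mt (lq_meas i t)). Qed.
Next Obligation. by move=> i t /lc_fin h; rewrite comp_preimage mt.2//; exact: lq_meas. Qed.

Lemma lvec_shl i : lvec (shl i) = tauop tau (lvec i).
Proof. by rewrite tauop_cls//; exact: phifun_L2. Qed.

Lemma T_evec i : T (evec i) = evec (shl i).
Proof. by rewrite -!eE TE lvec_shl. Qed.

(** Both sides are multiples of the exponential vector of the transported product label, and the two
    constants agree because tau preserves [lam]. *)
Lemma T_evec_zrot B (mB : measurable B) (lB : (lam B < +oo)%E) i :
  T (mulop (fun w => zrot ^+ cnt eta B w) (evec i)) =
  mulop (fun w => zrot ^+ cnt eta (tau @^-1` B) w) (T (evec i)).
Proof.
have mB' := mpres_meas mt mB.
have lB' : (lam (tau @^-1` B) < +oo)%E by rewrite mt.2.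
rewrite T_evec (zrot_evec eta_poisson mB lB) (zrot_evec eta_poisson mB' lB') lisomZ//.
have at' (T0 : finType) (q : S -> T0) t : measurable (q @^-1` [set t]) ->
    lam_at lam (q \o tau) t = lam_at lam q t.
  by move=> mq; rewrite /lam_at comp_preimage mt.2.
have mp := lq_meas (prodl (setl (zrot - 1) mB lB) i).
rewrite T_evec; congr (_ *: _).
congr (cexp _ * cexp _); first by rewrite mt.2.
by apply: eq_bigr => t _; congr (_ * (_)%:C%C); rewrite -(at' _ _ _ (mp t)).
Qed.

(* Functions on two copies of O whose halves are intertwined by T. *)
Definition pairF : set (O * bool -> R[i]) := [set m |
  [/\ bmeas (fun w => m (w, false)), bmeas (fun w => m (w, true)) &
   forall x, T (mulop (fun w => m (w, false)) x) = mulop (fun w => m (w, true)) (T x)]].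

Lemma pairF_bclass : bclass pairF.
Proof.
split.
- by split=> [||x]; [exact: bmeas_cst|exact: bmeas_cst|rewrite !mulop1].
- move=> c m m' [b0 b1 h] [b0' b1' h']; split; [exact: bmeas_lin|exact: bmeas_lin|move=> x].
  by rewrite (mulop_linm c x b0 b0') (mulop_linm c _ b1 b1') iT.1 h h'.
- move=> m m' [b0 b1 h] [b0' b1' h']; split; [exact: bmeasM|exact: bmeasM|move=> x].
  by rewrite -(mulop_comp x b0 b0') -(mulop_comp _ b1 b1') h h'.
- move=> h m C Fh hC hm.
  have b0 : bmeas (fun w => m (w, false)).
    by apply: (bmeas_cvg (h := fun n w => h n (w, false)) (C := C)) => // n; case: (Fh n).
  have b1 : bmeas (fun w => m (w, true)).
    by apply: (bmeas_cvg (h := fun n w => h n (w, true)) (C := C)) => // n; case: (Fh n).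
  split=> // x.
  have l0 : hlim (fun n => mulop (fun w => h n (w, false)) x) (mulop (fun w => m (w, false)) x).
    by apply: (mulop_cvg (C := C)) => // n; case: (Fh n) => -[].
  have l1 : hlim (fun n => mulop (fun w => h n (w, true)) (T x)) (mulop (fun w => m (w, true)) (T x)).
    by apply: (mulop_cvg (C := C)) => // n; case: (Fh n) => _ [].
  apply: (hlim_uniq (lisom_lim iT l0)); rewrite (_ : _ \o _ = fun n => mulop (fun w => h n (w, true)) (T x))//.
  by apply/funext => n /=; case: (Fh n).
Qed.

(** Both multiplication operators are 0, and T maps 0 to 0. *)
Lemma pairF_negl (N : set (O * bool)) : P.-negligible [set w | N (w, false)] ->
  P.-negligible [set w | N (w, true)] -> bsets pairF N.
Proof.
move=> n0 n1; have m0 := P_complete n0; have m1 := P_complete n1.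
have z (N' : set O) (x : L) : P.-negligible N' -> measurable N' -> mulop (cind N') x = 0.
  move=> hN mN; rewrite -[RHS](mulop_cst0 x); apply: mulop_ae; [exact: cind_bmeas|exact: bmeas_cst|].
  by apply: negligibleS hN => w /= h; apply: contrapT => Nw; apply: h; rewrite cind_out.
have E b : (fun w => (\1_N (w, b))%:C%C) = cind [set w | N (w, b)] :> (O -> R[i]).
  by apply/funext => w; rewrite /cind !indicE; congr ((_)%:R%:C%C); apply/idP/idP => /set_mem h; exact: mem_set.
split; rewrite /= ?E; [exact: cind_bmeas|exact: cind_bmeas|move=> x].
by rewrite !z// lisom0.
Qed.

Lemma pairF_zrot B : measurable B -> (lam B < +oo)%E ->
  pairF (fun p => zrot ^+ (if p.2 then cnt eta (tau @^-1` B) p.1 else cnt eta B p.1)).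
Proof.
move=> mB lB; have mB' := mpres_meas mt mB.
have b0 : bmeas (fun w => zrot ^+ cnt eta B w : R[i]) by exact: (zrot_bmeas eta_poisson).
have b1 : bmeas (fun w => zrot ^+ cnt eta (tau @^-1` B) w : R[i]) by exact: (zrot_bmeas eta_poisson).
split=> // x; pose M := [set x | T (mulop (fun w => zrot ^+ cnt eta B w) x) =
   mulop (fun w => zrot ^+ cnt eta (tau @^-1` B) w) (T x)].
have HM : hsubspace M.
  split=> [|c y z My Mz|u y Mu uy]; rewrite /M /=.
  - by have -> := mulop0 b0; rewrite (lisom0 iT) (mulop0 b1).
  - have -> := mulop_lin c y z b0; rewrite !iT.1.
    by have -> := mulop_lin c (T y) (T z) b1; rewrite My Mz.
  - have l0 := lisom_lim iT (mulop_cont b0 uy).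
    have l1 := mulop_cont b1 (lisom_lim iT uy).
    apply: (hlim_uniq l0).
    rewrite (_ : _ \o _ = mulop (fun w => zrot ^+ cnt eta (tau @^-1` B) w) \o (T \o u))//.
    by apply/funext => n; exact: Mu.
have : Mspan setT x by rewrite e_total.
apply: (Mspan_min lam_sf e_gram eE measurableT HM) => i _.
exact: T_evec_zrot.
Qed.

(** [eta] on the first copy of [O] and its image under tau on the second, as one family of
    functions. Measurability for [bsets (pairF T)] lets T carry a function of [eta] to the same
    function of the image. *)
Definition etah (p : O * bool) (B : set S) : \bar R :=
  if p.2 then eta p.1 (tau @^-1` B) else eta p.1 B.

Lemma etah_meas B : measurable B ->
  measurable_fun setT (fun p : g_sigma_algebraType (bsets pairF) => etah p B).
Proof.
have fin A : measurable A -> (lam A < +oo)%E ->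
    measurable_fun setT (fun p : g_sigma_algebraType (bsets pairF) => etah p A).
  move=> mA lA; have mA' := mpres_meas mt mA.
  have lA' : (lam (tau @^-1` A) < +oo)%E by rewrite mt.2.
  have ninf A0 : measurable A0 -> (lam A0 < +oo)%E -> P.-negligible [set w | eta w A0 = +oo%E].
    move=> mA0 lA0; exists [set w | eta w A0 = +oo%E]; split=> //.
      exact: (eta_preimage_meas eta_poisson mA0 (emeasurable_set1 _)).
    exact: (poisson_infty eta_poisson mA0 lA0).
  apply: (@emeas_of_nat R _ (g_sigma_algebraType (bsets pairF)) _
     (fun p => if p.2 then cnt eta (tau @^-1` A) p.1 else cnt eta A p.1)).
  - by move=> k; apply/(bsets_measurable pairF_bclass); apply: (bsets_nat pairF_bclass); exact: pairF_zrot.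
  - apply/(bsets_measurable pairF_bclass); apply: pairF_negl; exact: ninf.
  - by case=> w [] /= h; rewrite /etah /=; apply: (cntE eta_poisson); rewrite // ltey.
move=> mB; have [H [uH ndH H_fin]] := (sigma_finiteP _ _).1 lam_sf.
have mH n : measurable (B `&` H n) by apply: measurableI => //; case: (H_fin n).
apply: (emeasurable_fun_cvg (fun n (p : g_sigma_algebraType (bsets pairF)) => etah p (B `&` H n))).
  move=> n; apply: fin => //.
  have [mHn] := H_fin n; apply: le_lt_trans; apply: le_measure; rewrite ?inE//.
have E : B = \bigcup_n (B `&` H n) by rewrite -setI_bigcupr -uH setIT.
have nd m n : (m <= n)%N -> B `&` H m `<=` B `&` H n.
  by move=> mn y [By Hy]; split=> //; have /subsetPset := ndH _ _ mn; exact.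
case=> w [] _; rewrite /etah /= {2}E.
  rewrite preimage_bigcup; apply: nondecreasing_cvg_mu.
  - by move=> n; exact: (mpres_meas mt (mH n)).
  - by apply: bigcup_measurable => n _; exact: (mpres_meas mt (mH n)).
  - by move=> m n mn; apply/subsetPset => y; exact: nd.
apply: nondecreasing_cvg_mu => //.
- exact: bigcup_measurable.
- by move=> m n mn; apply/subsetPset; exact: nd.
Qed.

End quantized_map.
End second_quantization.

(** The sigma-algebra of [T] is arbitrary: in the applications it is a subfield, for which only the
    masses of sets inside [D] are known to be measurable. *)
Lemma measurable_integral_param {R : realType} {dT} {T : measurableType dT} {dS}
    {S : measurableType dS} (mu : T -> {measure set S -> \bar R}) (D : set S) (h : S -> \bar R) :
  measurable_fun setT h -> (forall y, 0 <= h y)%E -> (forall y, ~ D y -> h y = 0%E) ->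
  (forall B, measurable B -> B `<=` D -> measurable_fun setT (fun t => mu t B)) ->
  measurable_fun setT (fun t => (\int[mu t]_y h y)%E).
Proof.
move=> mh h0 hD mmu; pose g := nnsfun_approx measurableT mh.
have nd n m : (n <= m)%N -> forall y, ((g n y)%:E <= (g m y)%:E)%E.
  by move=> nm y; rewrite lee_fin; exact/lefP/nd_nnsfun_approx.
have gh y : (fun n => (g n y)%:E) @ \oo --> h y by exact: cvg_nnsfun_approx.
have gD n y : ~ D y -> g n y = 0.
  move=> Dy; have : ((g n y)%:E <= h y)%E.
    have := ereal_nondecreasing_cvgn (u_ := fun n => (g n y)%:E) (fun a b ab => nd a b ab y).
    move=> /(cvg_unique (@ereal_hausdorff _) (gh y)) ->.
    by apply: ereal_sup_ubound; exists n.
  rewrite hD// lee_fin => gy; apply/eqP; rewrite eq_le gy /=.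
  exact: fun_ge0.
apply: (emeasurable_fun_cvg (fun n t => \int[mu t]_y (g n y)%:E)%E).
  move=> n; under eq_fun do rewrite integralT_nnsfun sintegralE.
  apply: emeasurable_fsum => //= r.
  have [->|r0] := eqVneq r 0.
    by under eq_fun do rewrite mul0e; exact: measurable_cst.
  apply: measurable_funeM; apply: mmu; first exact: measurable_sfunP.
  by move=> y /= gy; apply: contrapT => /(gD n); rewrite gy => /eqP; rewrite (negPf r0).
move=> t _.
have -> : (\int[mu t]_y h y = \int[mu t]_y limn (fun n => (g n y)%:E))%E.
  by apply: eq_integral => y _; apply/esym/cvg_lim.
apply: cvg_monotone_convergence => //.
- by move=> n; exact/measurable_EFinP.
- by move=> n y _; rewrite lee_fin.
- by move=> y _ n m nm; exact: nd.
Qed.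

Section truncation.
Context {R : realType} {d} {T : measurableType d} {mu : {measure set T -> \bar R}}.
Lemma trunc_eventually (f : T -> R[i]) t : exists N, forall n, (N <= n)%N -> trunc f n t = f t.
Proof.
exists (Num.truncn (csqn (f t))).+1 => n nt; rewrite /trunc ifT//.
have := @real_truncnS_gt R (csqn (f t)) (num_real _) => /ltW h; apply: (le_trans h).
by rewrite ler_nat.
Qed.
Lemma trunc_hlim f : L2 mu f -> hlim (fun n => cls mu (trunc f n)) (cls mu f).
Proof.
move=> Lf; rewrite -[X in hlim _ X]mulop1.
pose h n t := (\1_[set t | csqn (f t) <= n%:R] t)%:C%C : R[i].
have bh n : bmeas (h n) by apply: trunc_bmeas_ind; case: Lf.
rewrite (_ : (fun n => _) = fun n => mulop (h n) (cls mu f)).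
  apply: (mulop_cvg (C := 1)).
  - by move=> n; case: (bh n).
  - by move=> n t; exact: csqn_indic.
  - by move=> t; exact: trunc_ind_cvg.
apply/funext => n; rewrite mulop_cls//; congr (cls mu _).
by apply/funext => t; exact: truncE.
Qed.
End truncation.

Lemma ccvg_uniq {R : realType} (u : nat -> R[i]) z w : ccvg u z -> ccvg u w -> z = w.
Proof.
move=> /ccvgP[r i] /ccvgP[r' i']; apply: complex_eqP.
  exact: (cvg_unique (@Rhausdorff R) r r').
exact: (cvg_unique (@Rhausdorff R) i i').
Qed.

Lemma mulop_hsub {R : realType} {d} {T : measurableType d} {mu : {measure set T -> \bar R}}
    (m : T -> R[i]) (N : set (cL2_ips mu)) : bmeas m -> hsubspace N ->
  hsubspace (mulop m @^-1` N).
Proof.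
move=> bm HN; split=> [|c y z My Mz|u y Mu uy] /=.
- by rewrite mulop0//; exact: hsub0.
- by have -> := mulop_lin c y z bm; exact: hsubP.
- exact: (hsub_lim HN Mu (mulop_cont bm uy)).
Qed.

Lemma tuple_meas {R : realType} {d} {T : measurableType d} n (h : 'I_n -> T -> \bar R) :
  (forall i, measurable_fun setT (h i)) -> measurable_fun setT (fun w => [tuple h i w | i < n]).
Proof.
move=> mh; apply/measurable_fun_tnthP => i; apply: (eq_measurable_fun (h i)) => //.
by move=> p _ /=; rewrite tnth_mktuple.
Qed.

(** * Images of the functions of the process *)

Section pair_transfer.
Context {R : realType} {dO} {O : measurableType dO} {P : probability O R}.
Local Notation L := (cL2_ips P).
Variable T : L -> L.
Hypotheses (iT : lisom T) (T1 : T (cls P (fun=> 1)) = cls P (fun=> 1)).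
Local Notation F := (pairF T).
Local Notation WF := (g_sigma_algebraType (bsets F)).

Lemma pair_bounded (m : O * bool -> R[i]) : F m ->
  T (cls P (fun w => m (w, false))) = cls P (fun w => m (w, true)).
Proof.
move=> [b0 b1 h]; have := h (cls P (fun=> 1)); rewrite T1.
have L1 : L2 P (fun=> 1 : R[i]) by exact: L2_1.
rewrite (mulop_cls b0 L1) (mulop_cls b1 L1).
by under eq_fun do rewrite mulr1; under [in RHS]eq_fun do rewrite mulr1.
Qed.

(** [pair_bounded] treats the truncations. Their images converge in norm, so a subsequence converges
    almost everywhere; this identifies the second half of g with the image of the first, and shows
    that it is square integrable. *)
Lemma pair_transfer (g : O * bool -> R[i]) : cmeas (g : WF -> R[i]) ->
  L2 P (fun w => g (w, false)) ->
  L2 P (fun w => g (w, true)) /\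
  T (cls P (fun w => g (w, false))) = cls P (fun w => g (w, true)).
Proof.
move=> mg L0; have HF := pairF_bclass iT.
have Ft n : F (trunc g n).
  by apply: (bclass_meas HF (C := n%:R)) => [|t]; [exact: trunc_cmeas|exact: trunc_le].
have mt n : bmeas (fun w => trunc g n (w, true)) by case: (Ft n).
have gt : cmeas (fun w => g (w, true)).
  apply: (cmeas_cvg (h := fun n w => trunc g n (w, true))) => [n|w]; first by case: (mt n).
  by have [N hN] := trunc_eventually g (w, true); exact: (@ccvg_eventually _ _ _ N).
have lT := lisom_lim iT (trunc_hlim L0).
have E : T \o (fun n => cls P (trunc (fun w => g (w, false)) n)) =
    fun n => cls P (fun w => trunc g n (w, true)).
  by apply/funext => n /=; rewrite -(pair_bounded (Ft n)).
rewrite E -(repK (T _)) in lT.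
have [s [sn ae]] := hlim_ae (fun n => L2_bounded (mt n)) (rep_L2 _) lT.
have gr : {ae P, forall w, g (w, true) = rep (T (cls P (fun w => g (w, false)))) w}.
  apply: filterS ae => w hw; have [N hN] := trunc_eventually g (w, true).
  apply: (ccvg_uniq _ hw); apply: (@ccvg_eventually _ _ _ N) => n Nn.
  by apply: hN; exact: leq_trans Nn (sn n).
have Lt : L2 P (fun w => g (w, true)) by exact: L2_ae gt (rep_L2 _) gr.
split=> //; rewrite -[LHS]repK; apply: cls_ae => //; first exact: rep_L2.
by apply: filterS gr => w ->.
Qed.

Lemma tuple_transfer (I : Type) (Zh : I -> O * bool -> \bar R) n (B : 'I_n -> I)
    (f : n.-tuple (\bar R) -> R[i]) :
  (forall i, measurable_fun setT (Zh (B i) : WF -> \bar R)) -> cmeas f ->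
  L2 P (fun w => f [tuple Zh (B i) (w, false) | i < n]) ->
  L2 P (fun w => f [tuple Zh (B i) (w, true) | i < n]) /\
  T (cls P (fun w => f [tuple Zh (B i) (w, false) | i < n])) =
  cls P (fun w => f [tuple Zh (B i) (w, true) | i < n]).
Proof.
move=> mZ [mr mi]; apply: (pair_transfer (g := fun p => f [tuple Zh (B i) p | i < n])).
have mt : measurable_fun setT (fun p : WF => [tuple Zh (B i) p | i < n]).
  exact: (tuple_meas (T := WF)).
by split; [exact: measurableT_comp mr mt|exact: measurableT_comp mi mt].
Qed.
End pair_transfer.

(** * Density of functions of finitely many values, uniqueness of the shift *)

Section tuple_density.
Context {R : realType} {dO} {O : measurableType dO} {P : probability O R}.
Hypothesis P_complete : measure_is_complete P.
Context {dS} {S : measurableType dS} (Z : set S -> O -> \bar R).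
Hypothesis mZ : forall B, measurable B -> measurable_fun setT (Z B).
Local Notation L := (cL2_ips P).

Definition Ztuple n (B : 'I_n -> set S) (w : O) : n.-tuple (\bar R) := [tuple Z (B i) w | i < n].

Lemma Ztuple_meas n (B : 'I_n -> set S) : (forall i, measurable (B i)) ->
  measurable_fun setT (Ztuple B).
Proof.
by move=> mB; apply: tuple_meas => i; exact: mZ.
Qed.

Definition Zgen (D : set S) : set L := [set x | exists n (B : 'I_n -> set S) f,
  [/\ forall i, measurable (B i) /\ B i `<=` D, bmeas f & x = cls P (f \o Ztuple B)]].

Lemma bmeas_Ztuple n (B : 'I_n -> set S) f : (forall i, measurable (B i)) -> bmeas f ->
  bmeas (f \o Ztuple B : O -> R[i]).
Proof.
move=> mB [[mr mi] [C fC]]; split; last by exists C => w; exact: fC.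
by split; [exact: measurableT_comp mr (Ztuple_meas mB)|exact: measurableT_comp mi (Ztuple_meas mB)].
Qed.

(** The closed span contains 1, from the empty tuple, and is stable under the indicators of
    generating events, which only lengthen the tuple. *)
Lemma Zgen_dense D : cL2_sub (sigma_field P Z D) `<=` closed_span (Zgen D).
Proof.
have HN := closed_span_hsub (Zgen D).
apply: (cL2_sub_min P_complete HN).
  apply: closed_span_sub; exists 0%N, (fun=> set0), (fun=> 1); split=> //.
  - by case.
  - exact: bmeas_cst.
move=> _ [A [M [mA AD mM ->]]].
have bA : bmeas (cind (Z A @^-1` M) : O -> R[i]).
  by apply: cind_bmeas; rewrite -[X in measurable X]setTI; exact: mZ.
split; first exact: bA.
have HM := mulop_hsub bA HN.
apply: (closed_span_min HM) => _ [n [B [f [BD bf ->]]]] /=; apply: closed_span_sub.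
have bB : bmeas (f \o Ztuple B : O -> R[i]) by apply: bmeas_Ztuple => // i; case: (BD i).
rewrite (mulop_cls bA (L2_bounded bB)).
(* The set [A] becomes coordinate 0 of the longer tuple. *)
pose B' (i : 'I_n.+1) := oapp B A (unlift ord0 i).
pose g (t : n.+1.-tuple (\bar R)) : n.-tuple (\bar R) := [tuple tnth t (lift ord0 i) | i < n].
have mg : measurable_fun setT g.
  apply/measurable_fun_tnthP => i; apply: (eq_measurable_fun (fun t => tnth t (lift ord0 i))).
    by move=> p _ /=; rewrite tnth_mktuple.
  exact: measurable_tnth.
exists n.+1, B', (fun t => cind M (tnth t ord0) * f (g t)); split.
- by move=> i; rewrite /B'; case: unliftP => [j|] _ /=.
- apply: bmeasM.
    apply: (bmeas_indic (A := (fun t : n.+1.-tuple (\bar R) => tnth t ord0) @^-1` M)).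
    by rewrite -[X in measurable X]setTI; exact: measurable_tnth.
  case: bf => [[mr mi] [C fC]]; split; last by exists C => w.
  by split; [exact: measurableT_comp mr mg|exact: measurableT_comp mi mg].
- congr (cls P _); apply/funext => w /=; rewrite tnth_mktuple /B' unlift_none /=; congr (_ * f _).
  by apply: eq_from_tnth => i; rewrite !tnth_mktuple liftK.
Qed.

End tuple_density.

Section action_facts.
Context {R : realType} {d : nat} {dS} {S : measurableType dS}.
Local Notation V := 'rV[R]_d.
Variables (act : S -> V -> S).
Hypotheses (act0 : forall y, act y 0 = y)
  (actD : forall y a b, act (act y a) b = act y (a + b)).

(** Translation by -c: its preimages are the translates of sets by c, and composition with it
    translates functions by c. *)
Definition tsl (c : V) : S -> S := fun y => act y (- c).

Lemma act_canc c : cancel (act^~ c) (act^~ (- c)).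
Proof. by move=> y; rewrite actD subrr act0. Qed.
Lemma act_cancN c : cancel (act^~ (- c)) (act^~ c).
Proof. by move=> y; rewrite actD addNr act0. Qed.
Lemma translateE B c : translate act B c = tsl c @^-1` B.
Proof.
apply/seteqP; split=> y /=; first by move=> [z Bz <-]; rewrite /tsl act_canc.
by move=> By; exists (tsl c y) => //; exact: act_cancN.
Qed.
Lemma translate0 B : translate act B 0 = B.
Proof. by rewrite translateE /tsl oppr0; apply/seteqP; split=> y /=; rewrite act0. Qed.
Lemma translateD B a b : translate act (translate act B a) b = translate act B (a + b).
Proof. by rewrite !translateE; apply/seteqP; split=> y /=; rewrite /tsl actD opprD addrC. Qed.
Lemma translate_diff A B c : translate act (A `\` B) c = translate act A c `\` translate act B c.
Proof. by rewrite !translateE. Qed.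
Lemma region_translate X a b c :
  region act X (a + c) (b + c) = translate act (region act X a b) c.
Proof. by rewrite /region translate_diff !translateD. Qed.
Lemma tslK c : cancel (tsl c) (tsl (- c)).
Proof. by move=> y; rewrite /tsl actD opprK addNr act0. Qed.
Lemma tslNK c : cancel (tsl (- c)) (tsl c).
Proof. by move=> y; rewrite /tsl actD opprK subrr act0. Qed.
End action_facts.

Section shift_unique.
Context {R : realType} {dO} {O : measurableType dO} {P : probability O R}.
Hypothesis P_complete : measure_is_complete P.
Context {dS} {S : measurableType dS} {d : nat}.
Variables (act : S -> 'rV[R]_d -> S) (X : set S) (Z : set S -> O -> \bar R).
Hypothesis mZ : forall B, measurable B -> measurable_fun setT (Z B).
Local Notation L := (cL2_ips P).

(** [shift] is a choice among the operators satisfying [is_shift]. Any two of them agree on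
    functions of finitely many values, hence by isometry on the closed span of these, which is the
    fibre. *)
Lemma shiftE a b c (T : L -> L) x : is_shift act X Z a b c T ->
  cL2_sub (sigma_field P Z (region act X a b)) x -> Defs.shift act X Z a b c x = T x :> L.
Proof.
move=> sT Mx; have sT' : is_shift act X Z a b c (Defs.shift act X Z a b c : L -> L).
  exact: (xgetPex (fun=> 0 : L) (P := [set T | is_shift act X Z a b c T]) (ex_intro _ T sT)).
move: sT' Mx; set T' := Defs.shift _ _ _ _ _ _; move: T' => T'.
set D := region act X a b; set M := cL2_sub _ => sT' Mx.
have HM : hsubspace M by exact: cL2_sub_hsub.
have iso U : is_shift act X Z a b c U -> forall u y, (forall n, M (u n)) -> M y ->
    hlim u y -> hlim (U \o u) (U y).
  move=> [[_ lU dU] _] u y Mu My; rewrite /hlim.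
  rewrite (_ : (fun n => hnorm ((U \o u) n - U y)) = fun n => hnorm (u n - y))//.
  apply/funext => n /=; have Mn := Mu n.
  have -> : U (u n) - U y = U (u n - y).
    by rewrite [RHS](_ : _ = U (-1 *: y + u n)); [rewrite lU// scaleN1r addrC|rewrite scaleN1r addrC].
  by apply: hnorm_inj; rewrite !hnorm_sq dU//; exact: (hsubB HM).
have HE : hsubspace [set x | M x /\ T' x = T x].
  split.
  - split; first exact: hsub0.
    have [[_ l _] _] := sT; have [[_ l' _] _] := sT'; have M0 := hsub0 HM.
    have := l (-1) 0 0 M0 M0; have := l' (-1) 0 0 M0 M0.
    by rewrite scaler0 addr0 !scaleN1r !addNr => -> ->.
  - move=> k y z [My Ey] [Mz Ez]; split; first exact: hsubP.
    have [[_ l _] _] := sT; have [[_ l' _] _] := sT'.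
    by rewrite l// l'// Ey Ez.
  - move=> u y Mu uy; have Mu' n : M (u n) by case: (Mu n).
    have My := hsub_lim HM Mu' uy; split=> //.
    apply: (hlim_uniq (iso _ sT' _ _ Mu' My uy)).
    rewrite (_ : T' \o u = T \o u); first exact: iso.
    by apply/funext => n; case: (Mu n).
have : closed_span (Zgen Z D) x by exact: Zgen_dense.
move: x {Mx} => x /(closed_span_min HE) h; apply: (h _).2 => {x h} _ [n [B [f [BD bf ->]]]].
have mB i : measurable (B i) by case: (BD i).
have bB := bmeas_Ztuple mZ mB bf.
have cB : is_class (cls P (f \o Ztuple Z B) : L) (f \o Ztuple Z B).
  by apply/is_classP; split=> //; exact: L2_bounded.
split.
  apply/cL2_subP; exists (f \o Ztuple Z B); first exact: L2_bounded.
  split=> //; have mt : measurable_fun setT (Ztuple Z B : g_sigma_algebraType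
      ([set A | exists B (M : set (\bar R)), [/\ measurable B, B `<=` D, measurable M &
         A = Z B @^-1` M]] `|` P.-negligible) -> _).
    apply: (tuple_meas (T := g_sigma_algebraType _)) => i _ N mN.
     rewrite setTI; apply: sub_sigma_algebra; left; exists (B i), N.
    by have [] := BD i.
  case: bf => [[mr mi] _].
  by split; [exact: measurableT_comp mr mt|exact: measurableT_comp mi mt].
have [[mr mi] _] := bf.
have [_ /(_ n B f BD mr mi _ cB) h] := sT; have [_ /(_ n B f BD mr mi _ cB) h'] := sT'.
by move: h h' => /is_classP[_ ->] /is_classP[_ ->].
Qed.
End shift_unique.

Section compound_measurability.
Context {R : realType} {dY} {Y : measurableType dY}.
Local Notation S := (Y * bposR R)%type.

Lemma posR_val_meas : measurable_fun setT (@posR_val R : bposR R -> R).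
Proof. by move=> _ A mA; exists A. Qed.

Definition cden (B : set Y) (z : S) : \bar R := (posR_val z.2 * \1_B z.1)%:E.

Lemma cden_meas B : measurable B -> measurable_fun setT (cden B).
Proof.
move=> mB; apply/measurable_EFinP; apply: measurable_funM.
  exact: measurableT_comp posR_val_meas measurable_snd.
by apply: measurableT_comp measurable_fst; exact: measurable_indic.
Qed.
Lemma cden_ge0 B z : (0 <= cden B z)%E.
Proof. by rewrite lee_fin mulr_ge0// /posR_val ge0. Qed.
Lemma cden_out B z : ~ (B `*` setT) z -> cden B z = 0%E.
Proof.
move=> Bz; rewrite /cden indicE memNset ?mulr0// => Bz1.
by apply: Bz; split.
Qed.

(** Stated for every sigma-algebra on [T] so as to serve for [O], for the completed field of [eta]
    over a region, and for the two copies of [O]. *)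
Lemma compound_meas {dT} {T : measurableType dT} (mu : T -> {measure set S -> \bar R}) (D B : set Y) :
  measurable B -> B `<=` D ->
  (forall A, measurable A -> A `<=` D `*` setT -> measurable_fun setT (fun t => mu t A)) ->
  measurable_fun setT (compound mu B).
Proof.
move=> mB BD mmu; apply: (measurable_integral_param (D := B `*` setT) (h := cden B)).
- exact: cden_meas.
- exact: cden_ge0.
- exact: cden_out.
- by move=> A mA AB; apply: mmu => // z /AB[/BD].
Qed.

End compound_measurability.

Lemma exists_pushforward {R : realType} {d d'} {S : measurableType d} {T : measurableType d'} (m : {measure set S -> \bar R})
    (tau : S -> T) : measurable_fun setT tau ->
  exists mu : {measure set T -> \bar R}, forall A, mu A = m (tau @^-1` A).
Proof.
move=> mt; have X (mu : {measure set T -> \bar R}) : (mu : set T -> \bar R) = pushforward m tau ->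
    exists mu : {measure set T -> \bar R}, forall A, mu A = m (tau @^-1` A).
  by move=> E; exists mu => A; rewrite E.
by unshelve (apply: X; reflexivity).
Qed.

(** * The shift of the Poisson process *)

Section transported_shift.
Context {R : realType} {dO} {O : measurableType dO} {P : probability O R}.
Context {dS} {S : measurableType dS} {lam : {measure set S -> \bar R}}.
Context {eta : O -> {measure set S -> \bar R}}.
Hypothesis eta_poisson : poisson_process P lam eta.
Hypothesis P_complete : measure_is_complete P.
Hypothesis lam_sf : sigma_finite setT lam.
Local Notation K := (cL2_ips lam).
Local Notation L := (cL2_ips P).
Variable e : K -> L.
Hypothesis e_gram : forall x y, hdot (e x) (e y) = cexp (hdot x y).
Hypothesis eE : forall i, e (lvec i) = evec eta i.
Local Notation Mspan := (Mspan e).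
Hypothesis e_total : Mspan setT = setT.
Local Notation mpres := (@mpres R _ S lam).

Lemma quant_Mspan tau (mt : mpres tau) (T : L -> L) : lisom T ->
  (forall x, T (e x) = e (tauop tau x)) ->
  forall D x, measurable D -> Mspan D x -> Mspan (tau @^-1` D) (T x).
Proof.
move=> iT TE D x mD; apply: (closed_span_min (lisom_preim iT (Mspan_hsub e _))).
move=> _ [u Du <-] /=; rewrite TE; apply: closed_span_sub; exists (tauop tau u) => //.
by rewrite /Ksupp /= -tauop_iop// Du.
Qed.

Lemma quant_cancel tau tau' (mt : mpres tau) (mt' : mpres tau') (T T' : L -> L) :
  cancel tau tau' -> lisom T -> lisom T' ->
  (forall x, T (e x) = e (tauop tau x)) -> (forall x, T' (e x) = e (tauop tau' x)) ->
  forall x, T (T' x) = x.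
Proof.
move=> k iT iT' TE TE' x.
have iC : lisom (T \o T') by split=> [c y z|y] /=; [rewrite iT'.1 iT.1|rewrite iT.2 iT'.2].
have iI : lisom (id : L -> L) by split.
have : Mspan setT x by rewrite e_total.
apply: (closed_span_min (lisom_eq iC iI)) => _ [u _ <-] /=.
by rewrite TE' TE (tauop_cancel _ mt mt' k).
Qed.

Lemma quant_one tau (mt : mpres tau) (T : L -> L) : lisom T ->
  (forall x, T (e x) = e (tauop tau x)) -> T (cls P (fun=> 1)) = cls P (fun=> 1).
Proof.
move=> iT TE; have E : cls P (fun=> 1) = e 0 by rewrite -(evec0 (eta := eta) (lam := lam)) -eE lvec0.
by rewrite E TE (lisom0 (tauop_lisom mt)).
Qed.

(** Surjectivity onto the span over the preimage comes from the second quantization of the inverse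
    map. *)
Lemma quant_unitary tau tau' (mt : mpres tau) (mt' : mpres tau') (T T' : L -> L) D :
  measurable D -> cancel tau tau' -> cancel tau' tau -> lisom T -> lisom T' ->
  (forall x, T (e x) = e (tauop tau x)) -> (forall x, T' (e x) = e (tauop tau' x)) ->
  unitary_on (Mspan D) (Mspan (tau @^-1` D)) T.
Proof.
move=> mD k k' iT iT' TE TE'.
have TT' := quant_cancel mt mt' k iT iT' TE TE'.
have T'T := quant_cancel mt' mt k' iT' iT TE' TE.
split; last by move=> x y _ _; exact: lisom_dot.
  split.
  - by move=> x; exact: quant_Mspan.
  - by move=> x y _ _ /(congr1 T'); rewrite !T'T.
  - move=> x Mx; exists (T' x); last exact: TT'.
    have := quant_Mspan mt' iT' TE' (mpres_meas mt mD) Mx.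
    by rewrite (_ : tau' @^-1` (tau @^-1` D) = D)//; apply/seteqP; split=> y /=; rewrite k'.
by move=> c x y _ _; exact: iT.1.
Qed.

Section action.
Context {d : nat} (act : S -> 'rV[R]_d -> S).
Hypothesis act_meas : measurable_action act.
Hypothesis lam_inv : forall a B, measurable B -> lam (translate act B a) = lam B.

Lemma act_fix0 y : act y 0 = y. Proof. by case: act_meas. Qed.
Lemma act_add y a b : act (act y a) b = act y (a + b). Proof. by case: act_meas. Qed.
Lemma tsl_meas c : measurable_fun setT (tsl act c).
Proof.
case: act_meas => _ _ m; apply: (measurableT_comp m (g := fun y => (y, - c : borelV))).
by apply: measurable_fun_pair; [exact: measurable_id|exact: measurable_cst].
Qed.
Lemma tsl_mpres c : mpres (tsl act c).
Proof.
split; first exact: tsl_meas.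
by move=> B mB; rewrite -(translateE act_fix0 act_add) lam_inv.
Qed.

Definition quant c : L -> L := sval (cid (exists_quant e_gram e_total (tsl_mpres c))).
Lemma quant_lisom c : lisom (quant c).
Proof. by rewrite /quant; case: cid => T []. Qed.
Lemma quantE c x : quant c (e x) = e (tauop (tsl act c) x).
Proof. by rewrite /quant; case: cid => T []. Qed.
Lemma quant_unit D c : measurable D ->
  unitary_on (Mspan D) (Mspan (translate act D c)) (quant c).
Proof.
move=> mD; rewrite (translateE act_fix0 act_add).
apply: (quant_unitary (tsl_mpres c) (tsl_mpres (- c)) mD (tslK act_fix0 act_add c)
  (tslNK act_fix0 act_add c) (quant_lisom c) (quant_lisom (- c))); exact: quantE.
Qed.

(** The formula on functions of finitely many counts is [tuple_transfer], applied to [eta] and its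
    translate. *)
Lemma quant_is_shift X a b c : measurable (region act X a b) ->
  is_shift act X (fun B w => eta w B) a b c (quant c).
Proof.
move=> mD; split.
  rewrite (region_translate act_fix0 act_add) -!(Mspan_eq eta_poisson P_complete lam_sf e_gram eE)//.
    exact: quant_unit.
  by rewrite (translateE act_fix0 act_add); exact: (mpres_meas (tsl_mpres c) mD).
move=> n B f BD mr mi x /is_classP[Lx ->]; apply/is_classP.
have mZ i : measurable_fun setT (fun p : g_sigma_algebraType (bsets (pairF (quant c))) =>
    etah (eta := eta) (tsl act c) p (B i)).
  apply: (etah_meas eta_poisson P_complete lam_sf e_gram eE e_total (tsl_mpres c) (quant_lisom c) (quantE c)).
  by case: (BD i).
have := tuple_transfer (quant_lisom c) (quant_one (tsl_mpres c) (quant_lisom c) (quantE c))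
  (Zh := fun B p => etah (eta := eta) (tsl act c) p B) mZ (conj mr mi) Lx.
rewrite (_ : (fun w => f [tuple eta w (translate act (B i) c) | i < n]) =
   (fun w => f [tuple etah (eta := eta) (tsl act c) (w, true) (B i) | i < n]))//.
apply/funext => w; congr f; apply: eq_mktuple => i.
by rewrite (translateE act_fix0 act_add).
Qed.
End action.
End transported_shift.

(** * The shift of the compound process *)

Section compound_shift.
Context {R : realType} {dO} {O : measurableType dO} {P : probability O R}.
Context {dY} {Y : measurableType dY}.
Local Notation S := (Y * bposR R)%type.
Context {lam : {measure set S -> \bar R}} {eta : O -> {measure set S -> \bar R}}.
Hypothesis eta_poisson : poisson_process P lam eta.
Hypothesis P_complete : measure_is_complete P.
Hypothesis lam_sf : sigma_finite setT lam.
Local Notation K := (cL2_ips lam).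
Local Notation L := (cL2_ips P).
Variable e : K -> L.
Hypothesis e_gram : forall x y, hdot (e x) (e y) = cexp (hdot x y).
Hypothesis eE : forall i, e (lvec i) = evec eta i.
Local Notation Mspan := (Mspan e).
Hypothesis e_total : Mspan setT = setT.
Context {d : nat} (act : Y -> 'rV[R]_d -> Y).
Hypothesis act_meas : measurable_action act.
Local Notation acts := (act_fst (Z := bposR R) act).
Hypothesis lam_inv : forall a B, measurable B -> lam (translate acts B a) = lam B.

Lemma act_fst_meas : measurable_action acts.
Proof.
case: act_meas => h0 hD hm; split.
- by case=> y r; rewrite /act_fst /= h0.
- by case=> y r a b; rewrite /act_fst /= hD.
- apply: measurable_fun_pair.
    apply: (measurableT_comp hm (g := fun p : S * borelV => (p.1.1, p.2 : borelV))).
    apply: measurable_fun_pair; last exact: measurable_snd.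
    exact: measurableT_comp measurable_fst measurable_fst.
  exact: measurableT_comp measurable_snd measurable_fst.
Qed.

Lemma xi_meas B : measurable B -> measurable_fun setT (compound eta B).
Proof.
move=> mB; apply: (compound_meas (D := setT)) => // A mA _.
exact: (eta_meas eta_poisson).
Qed.

Lemma translate_fst D c : translate acts (D `*` setT) c = translate act D c `*` setT.
Proof.
apply/seteqP; split=> [_ [[y r] [/= Dy _] <-]|[y r] [/= [z Dz <-] _]].
  by split=> //=; exists y.
by exists (z, r).
Qed.

Lemma region_fst X a b : region acts (X `*` setT) a b = region act X a b `*` setT.
Proof.
rewrite /region !translate_fst; apply/seteqP; split=> [[y r] [[/= ya _] nb]|[y r] [/= [ya nb] _]].
  by split=> //; split=> // yb; apply: nb.
by split=> // -[/= /nb].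
Qed.

(** The operator that shifts [eta] also shifts [xi]: the integral that defines [xi] over [B], taken
    for the translated process, is [xi] over the translate of [B], since translation leaves the
    marks unchanged. *)
Lemma compound_is_shift X a b c (T : L -> L) : measurable (region act X a b) ->
  T = quant e_gram e_total act_fst_meas lam_inv c ->
  (forall D, D = region act X a b \/ D = region act X (a + c) (b + c) ->
    cL2_sub (sigma_field P (compound eta) D) =
    cL2_sub (sigma_field P (fun B w => eta w B) (D `*` setT)) :> set L) ->
  is_shift act X (compound eta) a b c T.
Proof.
move=> mD -> subE.
have [h0 hD _] := act_meas; have [hs0 hsD _] := act_fst_meas.
have mDT : measurable (region acts (X `*` setT) a b) by rewrite region_fst; exact: measurableX.
have [uT _] := quant_is_shift eta_poisson P_complete lam_sf e_gram eE e_total act_fst_meas lam_inv c mDT.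
split; first by move: uT; rewrite !region_fst !subE; [|right|left].
move=> n B f BD mr mi x /is_classP[Lx ->]; apply/is_classP.
set U := quant _ _ _ _ _; pose tau := tsl acts c.
have mt := tsl_mpres act_fst_meas lam_inv c : mpres (lam := lam) tau.
pose xih A (p : O * bool) := if p.2 then compound eta (translate act A c) p.1 else compound eta A p.1.
have mZ i : measurable_fun setT (fun p : g_sigma_algebraType (bsets (pairF U)) => xih (B i) p).
  have [mB _] := BD i.
  (* [etah] is a family of set functions; [compound_meas] asks for measures. *)
  have /choice[mu muE] : forall p : O * bool, exists mu : {measure set S -> \bar R},
      forall A, mu A = etah (eta := eta) tau p A.
    by case=> w [] /=; [exact: exists_pushforward mt.1|exists (eta w)].
  have E p : compound mu (B i) p = xih (B i) p.
    rewrite /xih; case: p (muE p) => w [] /= muw; last first.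
      by apply: eq_measure_integral => A mA _; exact: muw.
    rewrite /compound; transitivity (\int[pushforward (eta w) tau]_z cden (B i) z)%E.
      apply: eq_measure_integral; [exact: mt.1|move=> ? A mA _; exact: muw].
    rewrite ge0_integral_pushforward//; last 3 first.
    - exact: mt.1.
    - exact: cden_meas.
    - by move=> y _; exact: cden_ge0.
    rewrite preimage_setT; apply: eq_integral => -[y r] _ /=; rewrite /cden /=.
    by rewrite (translateE h0 hD) !indicE; congr (_ * (_)%:R)%:E.
  rewrite (_ : (fun _ => _) = compound mu (B i)); last by apply/funext => p; rewrite E.
  apply: (compound_meas (T := g_sigma_algebraType (bsets (pairF U))) (D := setT)) => // A mA _.
  rewrite (_ : (fun _ => _) = (fun p => etah (eta := eta) tau p A)); last by apply/funext => p.
  exact: (etah_meas eta_poisson P_complete lam_sf e_gram eE e_total mt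
     (quant_lisom e_gram e_total act_fst_meas lam_inv c) (quantE e_gram e_total act_fst_meas lam_inv c)).
exact: (tuple_transfer (quant_lisom e_gram e_total act_fst_meas lam_inv c)
  (quant_one eE mt (quant_lisom e_gram e_total act_fst_meas lam_inv c) (quantE e_gram e_total act_fst_meas lam_inv c))
  (Zh := xih) mZ (conj mr mi) Lx).
Qed.
End compound_shift.

(** * Recovering the Poisson process from the compound process *)

Section poisson_moments.
Context {R : realType} {dO} {O : measurableType dO} {P : probability O R}.
Context {dS} {S : measurableType dS} {lam : {measure set S -> \bar R}}.
Context {eta : O -> {measure set S -> \bar R}}.
Hypothesis eta_poisson : poisson_process P lam eta.
Variables (A : set S).
Hypotheses (mA : measurable A) (lA : (lam A < +oo)%E).
Local Notation N := (cnt eta A).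
Local Notation l := (fine (lam A)).

Lemma cnt_set_meas k : measurable (N @^-1` [set k]).
Proof. by rewrite -[X in measurable X]setTI; apply: (cnt_meas eta_poisson mA). Qed.

Lemma cnt_prob k : P (N @^-1` [set k]) = (l ^+ k / k`!%:R * expR (- l))%:E.
Proof.
have lE : lam A = l%:E by rewrite fineK// ge0_fin_numE.
by rewrite (cnt_law eta_poisson k mA lE) poisson_probE// fine_ge0.
Qed.

Lemma cnt_prob_shift j : (\sum_(0 <= k <oo) P (N @^-1` [set (k + j)%N]) = P [set w | (j <= N w)%N])%E.
Proof.
have -> : [set w | (j <= N w)%N] = \bigcup_k (N @^-1` [set (k + j)%N]).
  apply/seteqP; split=> w /=; first by move=> jN; exists (N w - j)%N => //=; rewrite subnK.
  by move=> [k _ /= ->]; exact: leq_addl.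
rewrite measure_semi_bigcup//.
- by move=> k; exact: cnt_set_meas.
- apply/trivIsetP => i k _ _ /eqP ik; apply/seteqP; split=> // w [/= -> /eqP].
  by rewrite eqn_add2r => /eqP.
- by apply: bigcup_measurable => k _; exact: cnt_set_meas.
Qed.

Lemma cnt_prob_sum1 : (\sum_(0 <= k <oo) P (N @^-1` [set k]) = 1)%E.
Proof.
have := cnt_prob_shift 0; rewrite (_ : [set w | _] = setT); last by apply/seteqP; split.
under eq_eseriesr do rewrite addn0.
by move=> ->; exact: probability_setT.
Qed.

(** Term by term: l^(k+2)/(k+2)! is at most l^2 times l^k/k!, and the probabilities add up to 1. *)
Lemma cnt_tail2 : (P [set w | (2 <= N w)%N] <= (l ^+ 2)%:E)%E.
Proof.
have l0 : 0 <= l by exact: fine_ge0.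
rewrite -cnt_prob_shift -[leRHS]mule1 -cnt_prob_sum1 -nneseriesZl//.
apply: lee_nneseries => // k _; rewrite !cnt_prob -EFinM lee_fin mulrA.
rewrite ler_wpM2r ?expR_ge0// addn2 -(add2n k) exprD -mulrA ler_wpM2l ?sqr_ge0// ler_wpM2l ?exprn_ge0//.
rewrite lef_pV2 ?posrE ?ltr0n ?fact_gt0// ler_nat.
by rewrite !factS mulnA leq_pmull// muln_gt0.
Qed.

(** Term by term: k+1 times the probability of k+1 is l times the probability of k. *)
Lemma eta_mean : (\int[P]_w eta w A = lam A)%E.
Proof.
have l0 : 0 <= l by exact: fine_ge0.
pose h k w : \bar R := (k.+1%:R * \1_(N @^-1` [set k.+1]) w)%:E.
have mh k : measurable_fun setT (h k).
  apply/measurable_EFinP; apply: measurable_funM => //.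
  exact: measurable_indic (cnt_set_meas _).
have h0 k w : (0 <= h k w)%E by rewrite lee_fin mulr_ge0.
have E : {ae P, forall w, eta w A = \sum_(0 <= k <oo) h k w}%E.
  exists [set w | eta w A = +oo%E]; split.
  - exact: (eta_preimage_meas eta_poisson mA (emeasurable_set1 _)).
  - exact: (poisson_infty eta_poisson mA lA).
  - move=> w /= nw; apply: contrapT => /eqP; rewrite -ltey => fw; apply: nw.
    rewrite (cntE eta_poisson mA fw); case Ew : (N w) => [|j].
      by rewrite eseries0// => k _ _; rewrite /h indicE memNset ?mulr0//= Ew.
    rewrite (@nneseries_single _ _ j); first by rewrite /h indicE mem_set ?mulr1.
    by move=> i /eqP ij; rewrite /h indicE memNset ?mulr0//= Ew => -[] /esym.
rewrite (ge0_ae_eq_integral (g := fun w => \sum_(0 <= k <oo) h k w)%E)//; last 4 first.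
- exact: (eta_meas eta_poisson).
- exact: ge0_emeasurable_sum.
- by move=> w _; apply: nneseries_ge0.
- by apply: filterS E => w hw _.
rewrite integral_nneseries//.
have lE : lam A = l%:E by rewrite fineK// ge0_fin_numE.
rewrite lE -[RHS]mule1 -cnt_prob_sum1 -nneseriesZl//.
apply: eq_eseriesr => k _; rewrite /h.
under eq_integral do rewrite EFinM.
rewrite ge0_integralZl//; last first.
  by apply/measurable_EFinP; exact: measurable_indic (cnt_set_meas _).
rewrite integral_indic ?setIT//; last exact: cnt_set_meas.
transitivity (k.+1%:R%:E * (l ^+ k.+1 / k.+1`!%:R * expR (- l))%:E)%E.
  by congr (_ * _)%E; exact: cnt_prob.
rewrite cnt_prob -!EFinM; congr (_%:E).
rewrite mulrA [in RHS]mulrA; congr (_ * _).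
rewrite factS natrM invfM exprS; field.
by rewrite nat1r !pnatr_eq0 -lt0n fact_gt0.
Qed.
End poisson_moments.

(** Half of Campbell's formula. As an inequality it is immediate on level sets of infinite
    intensity, where the bound is infinite. *)
Lemma eta_mean_le {R : realType} {dO} {O : measurableType dO} {P : probability O R}
    {dS} {S : measurableType dS} {lam : {measure set S -> \bar R}}
    {eta : O -> {measure set S -> \bar R}} (eta_poisson : poisson_process P lam eta)
    (h : S -> \bar R) : measurable_fun setT h -> (forall y, 0 <= h y)%E ->
  (\int[P]_w \int[eta w]_y h y <= \int[lam]_y h y)%E.
Proof.
move=> mh h0; pose g := nnsfun_approx measurableT mh.
have nd n m : (n <= m)%N -> forall y, ((g n y)%:E <= (g m y)%:E)%E.
  by move=> nm y; rewrite lee_fin; exact/lefP/nd_nnsfun_approx.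
have gh y : (fun n => (g n y)%:E) @ \oo --> h y by exact: cvg_nnsfun_approx.
have mg n : measurable_fun setT (fun y => (g n y)%:E) by exact/measurable_EFinP.
have g0 n y : (0 <= (g n y)%:E)%E by rewrite lee_fin; exact: fun_ge0.
have cvg (mu : {measure set S -> \bar R}) :
    (fun n => \int[mu]_y (g n y)%:E)%E @ \oo --> (\int[mu]_y h y)%E.
  have -> : (\int[mu]_y h y = \int[mu]_y limn (fun n => (g n y)%:E))%E.
    by apply: eq_integral => y _; apply/esym/cvg_lim.
  by apply: cvg_monotone_convergence => // y _ n m nm; exact: nd.
have mI n : measurable_fun setT (fun w => \int[eta w]_y (g n y)%:E)%E.
  apply: (measurable_integral_param (D := setT)) => //; first by move=> y /(_ I).
  by move=> B mB _; exact: (eta_meas eta_poisson).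
apply: (fatou_le (h := fun n w => \int[eta w]_y (g n y)%:E)%E) => //.
- by move=> n w; apply: integral_ge0.
- move=> n; apply: (@le_trans _ _ (\int[lam]_y (g n y)%:E)%E); last first.
    apply: ge0_le_integral => // y _.
    have := ereal_nondecreasing_cvgn (u_ := fun n => (g n y)%:E) (fun a b ab => nd a b ab y).
    move=> /(cvg_unique (@ereal_hausdorff _) (gh y)) ->.
    by apply: ereal_sup_ubound; exists n.
  under eq_integral do rewrite integralT_nnsfun sintegralE fsbig_finite//=.
  rewrite integralT_nnsfun sintegralE fsbig_finite//= ge0_integral_sum//; last 2 first.
  - by move=> r; apply: measurable_funeM; apply: (eta_meas eta_poisson); exact: measurable_sfunP.
  - by move=> r w _; exact: nnsfun_mulemu_ge0.
  rewrite big_seq [leRHS]big_seq; apply: lee_sum => r.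
  rewrite in_fset_set// => /set_mem[y _ yr]; have r0 : 0 <= r by rewrite -yr; exact: fun_ge0.
  rewrite ge0_integralZl//; last by apply: (eta_meas eta_poisson); exact: measurable_sfunP.
  have mr : measurable (g n @^-1` [set r]) by exact: measurable_sfunP.
  apply: lee_wpmul2l => //; have [lf|] := ltP (lam (g n @^-1` [set r])) +oo%E.
    by rewrite (eta_mean eta_poisson mr lf).
  by rewrite leye_eq => /eqP ->; exact: leey.
Qed.

Lemma mem_iffP {T : Type} (A B : set T) x y : (A x <-> B y) <-> (x \in A) = (y \in B).
Proof.
split=> [h|h]; first by apply/idP/idP => /set_mem k; apply: mem_set; exact/h.
by split=> /mem_set k; apply: set_mem; [rewrite -h|rewrite h].
Qed.

(** * Generators, cells and atoms *)

Section generators.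
Context {dY} {Y : measurableType dY}.

(** The sets that do not separate points with equal membership in all [g n] form a sigma-algebra,
    and it contains the generators. So an atom is determined by these memberships. *)
Lemma exists_generators : (exists2 G : set (set Y), countable G & (measurable : set (set Y)) = <<s G >>) ->
  exists g : nat -> set Y, (measurable : set (set Y)) = <<s range g >> /\
    forall A, measurable A -> forall y y', (forall n, g n y <-> g n y') -> A y -> A y'.
Proof.
(* An index that enumerates no generator gets the empty set, which separates no points. *)
move=> [G /countable_injP[f finj] mG]; pose g n := xget set0 [set A | G A /\ f A = n].
have Gm A : G A -> measurable A by rewrite mG; exact: sub_sigma_algebra.
have mg n : measurable (g n).
  by rewrite /g; case: xgetP => [A -> [/Gm]|_].
have gf A : G A -> g (f A) = A.
  move=> GA; rewrite /g; case: xgetP => [B -> [GB fB]|/(_ A)[]//].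
  by apply: finj; rewrite ?inE.
exists g; split.
  apply/seteqP; split; last first.
    by apply: smallest_sub; [exact: sigma_algebra_measurable|move=> _ [n _ <-]].
  rewrite mG; apply: smallest_sub; first exact: smallest_sigma_algebra.
  by move=> A GA; apply: sub_sigma_algebra; exists (f A) => //; exact: gf.
suff : measurable `<=` [set A | forall y y', (forall n, g n y <-> g n y') -> A y <-> A y'].
  by move=> h A mA y y' yy'; exact: (h A mA y y' yy').1.
rewrite mG; apply: smallest_sub.
  split=> [y y' _ //|A hA y y' yy'|A hA y y' yy'].
    by split=> -[_ nA]; split=> //; apply: contra_not nA => /(hA y y' yy').
  by split=> -[n _ An]; exists n => //; apply/(hA n y y' yy').
by move=> A GA y y' yy'; rewrite -(gf A GA).
Qed.

Variable g : nat -> set Y.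
Hypothesis mg : forall n, measurable (g n).
Hypothesis gsep : forall A, measurable A -> forall y y', (forall n, g n y <-> g n y') -> A y -> A y'.

(** Membership vectors index the cells of the n-th partition by a [finType]; some cells may be
    empty. *)
Definition gcell n (y : Y) : {ffun 'I_n -> bool} := [ffun k : 'I_n => y \in g k].

Lemma gcell_meas n t : measurable (gcell n @^-1` [set t]).
Proof.
rewrite (_ : _ @^-1` _ = \bigcap_(k in [set: 'I_n]) (if t k then g k else ~` g k)).
  apply: fin_bigcap_measurable => [|k _]; first exact: finite_finset.
  by case: (t k) => //; exact: measurableC.
apply/seteqP; split=> y /=.
  by move=> <- k _; rewrite ffunE; case: ifPn => [/set_mem//|/negP h gk]; apply: h; exact: mem_set.
move=> h; apply/ffunP => k; rewrite ffunE; have := h k I; case: (t k) => ?; [exact: mem_set|exact: memNset].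
Qed.

Definition gatom (y : Y) : set Y := [set y' | forall n, g n y <-> g n y'].

Lemma gatom_cells y : gatom y = \bigcap_n (gcell n @^-1` [set gcell n y]).
Proof.
apply/seteqP; split=> y' /= h.
  by move=> n _ /=; apply/ffunP => k; rewrite !ffunE; apply/esym/mem_iffP.
move=> n; have /= := h n.+1 I => /ffunP /(_ ord_max); rewrite !ffunE /= => e.
exact/mem_iffP/esym.
Qed.

Lemma gatom_meas y : measurable (gatom y).
Proof. by rewrite gatom_cells; apply: bigcapT_measurable => n; exact: gcell_meas. Qed.

Lemma gcell_refine m n y y' : (m <= n)%N -> gcell n y = gcell n y' -> gcell m y = gcell m y'.
Proof.
move=> mn /ffunP h; apply/ffunP => k; have := h (widen_ord mn k); by rewrite !ffunE.
Qed.
End generators.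

Section rays.
Context {R : realType} {d : nat}.
Lemma ray_meas (a : 'rV[R]_d) : measurable_fun setT (fun s : R => s *: a : borelV).
Proof.
apply: (@measurability _ _ _ (g_sigma_algebraType (@open 'rV[R]_d)) _ _ (@open 'rV[R]_d)) => //.
move=> _ [U oU <-]; rewrite setTI; apply: open_measurable.
by apply: open_comp => // s _; exact: scalel_continuous.
Qed.
End rays.

(** * Atoms are null *)

Section null_atoms.
Context {R : realType} {d : nat} {dY} {Y : measurableType dY}.
Context {act : Y -> 'rV[R]_d -> Y} (act_meas : measurable_action act).
Context {rho : {sigma_finite_measure set Y -> \bar R}}.
Hypothesis rho_inv : forall a (B : set Y), measurable B -> rho (translate act B a) = rho B.
Let act0 : forall y, act y 0 = y. Proof. by case: act_meas. Qed.
Let actD : forall y a b, act (act y a) b = act y (a + b). Proof. by case: act_meas. Qed.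

Lemma ray_act_meas (a : 'rV[R]_d) : measurable_fun setT (fun p : Y * R => act p.1 (- (p.2 *: a))).
Proof.
case: act_meas => _ _ m.
apply: (measurableT_comp m (g := fun p : Y * R => (p.1, - (p.2 *: a) : borelV))).
apply: measurable_fun_pair => //.
rewrite (_ : (fun _ => _) = (fun s : R => s *: (- a) : borelV) \o snd).
  exact: measurableT_comp (ray_meas _) measurable_snd.
by apply/funext => p /=; rewrite scalerN.
Qed.

(** Tonelli's theorem for the set of pairs (y, s) with s in [0, 1] and y in K + s a. Each y occurs
    with at most one s, so its measure is 0; integrated over y first, it is [rho K] by
    invariance. *)
Lemma null_of_disjoint_ray (K : set Y) (a : 'rV[R]_d) : measurable K ->
  (forall y s, 0 < s -> K y -> ~ K (act y (- (s *: a)))) -> rho K = 0%E.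
Proof.
move=> mK dis; pose m2 := @lebesgue_measure R.
pose f (p : Y * R) : \bar R := (\1_K (act p.1 (- (p.2 *: a))) * \1_`[0, 1] p.2)%:E.
have mf : measurable_fun setT f.
  apply/measurable_EFinP; apply: measurable_funM.
    by apply: measurableT_comp (ray_act_meas a); exact: measurable_indic.
  by apply: measurableT_comp measurable_snd; exact: measurable_indic.
have f0 p : (0 <= f p)%E by rewrite lee_fin mulr_ge0.
have := @fubini_tonelli _ _ _ _ _ rho (@lebesgue_measure R) f mf f0.
have -> : (\int[rho]_x \int[m2]_s f (x, s) = 0)%E.
  rewrite integral0_eq// => y _.
  pose D := [set s : R | K (act y (- (s *: a))) /\ `[0, 1]%classic s].
  have mD : measurable D.
    have mKy : measurable_fun setT (fun s : R => act y (- (s *: a))).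
      exact: (measurableT_comp (ray_act_meas a) (pair1_measurable y)).
    apply: measurableI; last exact: measurable_itv.
    by rewrite -[X in measurable X]setTI; apply: mKy.
  have -> : (fun s => f (y, s)) = (fun s => (\1_D s)%:E).
    apply/funext => s; rewrite /f /= !indicE -natrM mulnb; congr ((nat_of_bool _)%:R%:E).
    apply/idP/idP => [/andP[/set_mem h1 /set_mem h2]|/set_mem[h1 h2]].
      by apply: mem_set.
    by apply/andP; split; exact: mem_set.
  rewrite integral_indic// setIT.
  (* Two values of s would put two points of K on one ray. *)
  have uD s t : D s -> D t -> s = t.
    suff lt s' t' : D s' -> D t' -> ~ (s' < t').
      move=> Ds Dt; have := lt _ _ Ds Dt; have := lt _ _ Dt Ds.
      by case: (ltgtP s t).
    move=> [Ks _] [Kt _] st; apply: (dis (act y (- (s' *: a))) (t' - s')) => //.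
      by rewrite subr_gt0.
    by rewrite actD -opprD -scalerDl addrC subrK.
  have [->|/set0P[s Ds]] := eqVneq D set0; first exact: measure0.
  have -> : D = [set s] by apply/seteqP; split=> t /=; [move=> Dt; exact: uD|move=> ->].
  exact: lebesgue_measure_set1.
move=> /esym h.
have E : (\int[m2]_s \int[rho]_y f (y, s) = \int[m2]_(s in `[0%R, 1%R]) rho K)%E.
  rewrite [RHS]integral_mkcond; apply: eq_integral => s _; rewrite patchE.
  have -> : (fun y => f (y, s)) = (fun y => (\1_`[0, 1] s)%:E * (\1_(translate act K (s *: a)) y)%:E)%E.
    apply/funext => y; rewrite -EFinM /f /= mulrC (translateE act0 actD).
    by rewrite !indicE /tsl.
  have mt : measurable (translate act K (s *: a)).
    have ms : measurable_fun setT (tsl act (s *: a)).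
      exact: (measurableT_comp (ray_act_meas a) (pair2_measurable s)).
    by rewrite (translateE act0 actD) -[X in measurable X]setTI; apply: ms.
  rewrite ge0_integralZl//; last first.
    by apply/measurable_EFinP; exact: measurable_indic.
  transitivity ((\1_`[0%R, 1%R]%classic s)%:E * rho K)%E.
    by congr (_ * _)%E; rewrite integral_indic// setIT; exact: rho_inv.
  by rewrite indicE; case: ifP => /= _; rewrite ?mul1e ?mul0e.
move: h; rewrite E integral_cst//.
rewrite /m2 /= lebesgue_measure_itv /= lte_fin ltr01 sube0 mule1.
by [].
Qed.

Context {C : set 'rV[R]_d} (C_cone : closed_convex_cone C) (X : set Y).
Hypotheses (X_meas : measurable X) (X_sub : forall a, C a -> translate act X a `<=` X)
  (X_cap : \bigcap_(a in C) translate act X a = set0).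
Context {g : nat -> set Y} (mg : forall n, measurable (g n)).
Hypothesis gsep : forall A, measurable A -> forall y y', (forall n, g n y <-> g n y') -> A y -> A y'.

(* If y and y - s a lie in one atom, so do all y - n s a, and then y is in X + a. *)
Lemma gatom_null y : X y -> rho (gatom g y) = 0%E.
Proof.
move=> Xy; have [a Ca nXa] : exists2 a, C a & ~ translate act X a y.
  apply: contrapT => h; have : (\bigcap_(a in C) translate act X a) y.
    by move=> a Ca; apply: contrapT => nX; apply: h; exists a.
  by rewrite X_cap.
have mK := gatom_meas mg y.
apply: (null_of_disjoint_ray (a := a) mK) => y1 s s0 Ky1 Ky2.
have step z : gatom g y z -> gatom g y (act z (- (s *: a))).
  move=> Kz; apply: (gsep (A := [set z | gatom g y (act z (- (s *: a)))]) _ (y := y1)) => //.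
    have ms : measurable_fun setT (tsl act (s *: a)).
      exact: (measurableT_comp (ray_act_meas a) (pair2_measurable s)).
    by rewrite -[X in measurable X]setTI; apply: ms.
  by move=> n; rewrite -(Ky1 n) (Kz n).
have iter n : gatom g y (act y (- ((n%:R * s) *: a))).
  elim: n => [|n IH]; first by rewrite mul0r scale0r oppr0 act0.
  have := step _ IH; rewrite actD -opprD -scalerDl.
  by rewrite -natr1 mulrDl mul1r.
(* Then n s >= 1, so (n s - 1) a is in the cone and leads from y - n s a, a point of X, to y - a. *)
pose n := (Num.truncn s^-1).+1.
have ns : 1 <= n%:R * s.
  by rewrite -ler_pdivrMr// div1r ltW// real_truncnS_gt ?num_real.
have Xn : X (act y (- ((n%:R * s) *: a))).
  by apply: (gsep X_meas (y := y)) => //; exact: iter.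
apply: nXa; rewrite (translateE act0 actD) /= /tsl.
apply: (X_sub (a := (n%:R * s - 1) *: a)).
  by case: C_cone => _ _ _; apply => //; rewrite subr_ge0.
rewrite (translateE act0 actD) /= /tsl actD -opprD -{1}(scale1r a) -scalerDl.
by rewrite addrC subrK.
Qed.
End null_atoms.

Section cells_vanish.
Context {R : realType} {dY} {Y : measurableType dY} {rho : {measure set Y -> \bar R}}.
Context {g : nat -> set Y} (mg : forall n, measurable (g n)).
Variable (F : set Y).
Hypotheses (mF : measurable F) (rF : (rho F < +oo)%E)
  (null : forall y, F y -> rho (gatom g y) = 0%E).
Local Notation cell n t := (F `&` gcell g n @^-1` [set t]).

Let mcell n t : measurable (cell n t).
Proof. by apply: measurableI => //; exact: gcell_meas. Qed.

(** The sum is the integral over F of the measure of the cell around y. This measure decreases to at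
    most that of the atom of y, which is 0, and dominated convergence applies because F has finite
    measure. *)
Lemma cell_sum_vanish : (fun n => \sum_t rho (cell n t) * rho (cell n t))%E @ \oo --> 0%E.
Proof.
pose h n y : \bar R := (rho (cell n (gcell g n y)) * (\1_F y)%:E)%E.
have hE n y : h n y = (\sum_t rho (cell n t) * (\1_(cell n t) y)%:E)%E.
  rewrite (bigD1 (gcell g n y))//= big1 ?adde0 => [|t /eqP nt].
    congr (_ * (_)%:R%:E)%E; congr nat_of_bool; apply/mem_iffP.
    by split=> [Fy|[]].
  by rewrite indicE memNset ?mule0// => -[_ /= /esym].
have mh n : measurable_fun setT (h n).
  rewrite (_ : h n = fun y => \sum_t rho (cell n t) * (\1_(cell n t) y)%:E)%E; last by apply/funext.
  apply: emeasurable_sum => t.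
  by apply: measurable_funeM; apply/measurable_EFinP; exact: measurable_indic.
have h0 n y : (0 <= h n y)%E by rewrite mule_ge0// lee_fin.
have ih n : (\int[rho]_y h n y = \sum_t rho (cell n t) * rho (cell n t))%E.
  under eq_integral do rewrite hE.
  rewrite ge0_integral_sum//; last first.
    by move=> t; apply: measurable_funeM; apply/measurable_EFinP; exact: measurable_indic.
  apply: eq_bigr => t _; rewrite ge0_integralZl//; last first.
    by apply/measurable_EFinP; exact: measurable_indic.
  by rewrite integral_indic// setIT.
have hl y : h ^~ y @ \oo --> 0%E.
  have [Fy|nFy] := pselect (F y); last first.
    under eq_fun do rewrite /h indicE memNset// mule0.
    exact: cvg_cst.
  under eq_fun do rewrite /h indicE mem_set// mule1.
  have -> : 0%E = rho (\bigcap_n cell n (gcell g n y)).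
    apply/esym/eqP; rewrite eq_le measure_ge0 andbT -(null Fy).
    apply: le_measure; rewrite ?inE//.
    - exact: bigcapT_measurable.
    - exact: gatom_meas.
    - by move=> y' hy; rewrite gatom_cells => n _; have [] := hy n I.
  apply: nonincreasing_cvg_mu => //.
  - by apply: le_lt_trans rF; apply: le_measure; rewrite ?inE// => z [].
  - exact: bigcapT_measurable.
  - move=> m n mn; apply/subsetPset => z [Fz /= e]; split=> //=.
    exact: gcell_refine mn e.
pose b y : \bar R := (rho F * (\1_F y)%:E)%E.
have bi : rho.-integrable setT b.
  apply/integrableP; split.
    by apply: measurable_funeM; apply/measurable_EFinP; exact: measurable_indic.
  under eq_integral do rewrite gee0_abs ?mule_ge0 ?lee_fin//.
  rewrite ge0_integralZl//; last by apply/measurable_EFinP; exact: measurable_indic.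
  by rewrite integral_indic// setIT lte_mul_pinfty// ge0_fin_numE.
have aeb : {ae rho, forall y n, setT y -> (`|h n y| <= b y)%E}.
  apply: aeW => y n _; rewrite gee0_abs// lee_wpmul2r ?lee_fin//.
  by apply: le_measure; rewrite ?inE// => z [].
have [_ _] := dominated_convergence measurableT mh (measurable_cst 0%E) (aeW rho (fun y _ => hl y)) bi aeb.
rewrite integral0; under eq_fun do rewrite ih.
exact.
Qed.
End cells_vanish.

Lemma measure_exists_le {R : realType} {d} {O : measurableType d} (P : {measure set O -> \bar R})
    (T : finType) (D : T -> set O) : (forall t, measurable (D t)) ->
  measurable [set w | exists t, D t w] /\
  (P [set w | exists t, D t w] <= \sum_t P (D t))%E.
Proof.
move=> mD; have : forall r : seq T, measurable [set w | exists2 t, t \in r & D t w] /\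
    (P [set w | exists2 t, t \in r & D t w] <= \sum_(t <- r) P (D t))%E.
  elim=> [|t r [m IH]].
    have -> : [set w | exists2 t, t \in [::] & D t w] = set0 by apply/seteqP; split=> w //= -[].
    by rewrite big_nil measure0.
  have -> : [set w | exists2 t0, t0 \in t :: r & D t0 w] = D t `|` [set w | exists2 t, t \in r & D t w].
    apply/seteqP; split=> w /=.
      by case=> s; rewrite inE => /predU1P[-> ?|? ?]; [left|right; exists s].
    case=> [Dt|[s sr Ds]]; first by exists t => //; rewrite mem_head.
    by exists s => //; rewrite inE sr orbT.
  split; first exact: measurableU.
  by rewrite big_cons; apply: (le_trans (measureU2 _ _ _)) => //; rewrite leeD2l.
move=> /(_ (index_enum T)).
have -> : [set w | exists2 t, t \in index_enum T & D t w] = [set w | exists t, D t w].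
  by apply/seteqP; split=> w /= [t]; [exists t|exists t => //; rewrite mem_index_enum].
by [].
Qed.

(** * Cells eventually contain at most one point *)

Section simplicity.
Context {R : realType} {dO} {O : measurableType dO} {P : probability O R}.
Context {dY} {Y : measurableType dY} {rho : {measure set Y -> \bar R}}.
Context {dZ} {Z : measurableType dZ} {lam : {measure set (Y * Z) -> \bar R}}.
Context {eta : O -> {measure set (Y * Z) -> \bar R}} (eta_poisson : poisson_process P lam eta).
Context {g : nat -> set Y} (mg : forall n, measurable (g n)).
Variables (F : set Y) (A : set Z) (c : \bar R).
Hypotheses (mF : measurable F) (rF : (rho F < +oo)%E) (mA : measurable A) (c_fin : c \is a fin_num)
  (null : forall y, F y -> rho (gatom g y) = 0%E)
  (lamE : forall B, measurable B -> lam (B `*` A) = (rho B * c)%E).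
Local Notation cell n t := (F `&` gcell g n @^-1` [set t]).

Let mcell n t : measurable (cell n t).
Proof. by apply: measurableI => //; exact: gcell_meas. Qed.
Let rcell n t : (rho (cell n t) < +oo)%E.
Proof. by apply: le_lt_trans rF; apply: le_measure; rewrite ?inE// => z []. Qed.
Let lcell n t : (lam (cell n t `*` A) < +oo)%E.
Proof.
rewrite lamE//; rewrite -ge0_fin_numE; first by rewrite fin_numM// ge0_fin_numE// rcell.
by rewrite -lamE.
Qed.

(** By [cnt_tail2] the probability that some cell of the n-th partition has two points is at most
    c^2 times the sum of [cell_sum_vanish]. A crowded cell of a finer partition lies in a crowded
    cell of a coarser one, so the exceptional event is the intersection of these events. *)
Lemma eta_simple : {ae P, forall w, exists n0, forall n, (n0 <= n)%N -> forall t,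
  (eta w (cell n t `*` A) <= 1)%E}.
Proof.
pose D n t := [set w | (1 < eta w (cell n t `*` A))%E].
pose E n := [set w | exists t, D n t w].
have m1 n t : measurable (D n t).
  have := eta_preimage_meas eta_poisson (measurableX (mcell t) mA) (emeasurable_itv `]1%E, +oo[).
  by congr (measurable _); apply/seteqP; split=> w /=; rewrite in_itv /= andbT.
have PE n : (P (E n) <= (\sum_t rho (cell n t) * rho (cell n t)) * (c * c))%E.
  apply: (le_trans (measure_exists_le P (m1 n)).2).
  rewrite ge0_sume_distrl; last by move=> t _; rewrite mule_ge0.
  apply: lee_sum => t _.
  have mc := measurableX (mcell t) mA.
  have lE : lam (cell n t `*` A) = (fine (lam (cell n t `*` A)))%:E.
    by rewrite fineK// ge0_fin_numE// lcell.
  rewrite muleACA -!lamE// [leRHS](_ : _ = (fine (lam (cell n t `*` A)) ^+ 2)%:E); last first.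
    by rewrite expr2 EFinM -lE.
  apply: le_trans (cnt_tail2 eta_poisson mc (lcell t)).
  have m2 : measurable [set w | (2 <= cnt eta (cell n t `*` A) w)%N].
    rewrite -[X in measurable X]setTI.
    exact: (cnt_meas eta_poisson mc measurableT (Y := [set k | (2 <= k)%N])).
  have mI : measurable [set w | eta w (cell n t `*` A) = +oo%E].
    exact: (eta_preimage_meas eta_poisson mc (emeasurable_set1 _)).
  rewrite -[leRHS]adde0 -(poisson_infty eta_poisson mc (lcell t)).
  apply: le_trans (measureU2 _ m2 mI); apply: le_measure; rewrite ?inE//.
    exact: measurableU.
  move=> w; rewrite /D /= => h; have [wf|] := ltP (eta w (cell n t `*` A)) +oo%E.
    by left; move: h; rewrite (cntE eta_poisson mc wf) lte_fin ltr1n.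
  by rewrite leye_eq => /eqP; right.
have mE n : measurable (E n) by exact: (measure_exists_le P (m1 n)).1.
exists (\bigcap_n E n); split.
- exact: bigcapT_measurable.
- apply/eqP; rewrite eq_le measure_ge0 andbT.
  have lim0 : (fun n => (\sum_t rho (cell n t) * rho (cell n t)) * (c * c))%E @ \oo --> 0%E.
    rewrite -[X in _ --> X](mul0e (c * c)); apply: cvgeZr; first by rewrite fin_numM.
    exact: (cell_sum_vanish mg mF rF null).
  rewrite -(cvg_lim (@ereal_hausdorff _) lim0); apply: lime_ge.
    by apply/cvg_ex; exists 0%E.
  apply: nearW => n; apply: le_trans (PE n); apply: le_measure; rewrite ?inE//.
    exact: bigcapT_measurable.
  by move=> w /(_ n I).
- move=> w /= nw n _; apply: contrapT => nE; apply: nw; exists n => m nm t.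
  apply: contrapT => /negP; rewrite -ltNge => h; apply: nE.
  have [[y [Fy ty]]|emp] := pselect (exists y, cell m t y); last first.
    move: h; rewrite (_ : cell m t `*` A = set0) ?measure0 ?lte_fin ?ltr10//.
    by apply/seteqP; split=> // -[y z] [/= h _]; apply: emp; exists y.
  exists (gcell g n y); apply: (lt_le_trans h); apply: le_measure; rewrite ?inE//.
  - exact: measurableX.
  - exact: measurableX.
  - move=> [y' z] [/= [Fy' ty'] Az]; split=> //=; split=> //=.
    by apply: (gcell_refine nm); rewrite ty'.
Qed.
End simplicity.

Lemma ae_nat {R : realType} {d} {T : measurableType d} (mu : {measure set T -> \bar R})
    (Q : nat -> T -> Prop) : (forall k, {ae mu, forall x, Q k x}) ->
  {ae mu, forall x, forall k, Q k x}.
Proof.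
move=> h; have := negligible_bigcup h; apply: negligibleS => x /= nQ.
by apply: contrapT => nx; apply: nQ => k; apply: contrapT => nk; apply: nx; exists k.
Qed.

Definition rge {R : realType} (x : R) : set (bposR R) := [set r | x <= posR_val r].

Lemma posR_gt0 {R : realType} (r : posR R) : 0 < posR_val r.
Proof. by rewrite /posR_val gt0. Qed.

(** * Counting large jumps from the masses of small cells *)

Section count_limit.
Context {R : realType} {dY} {Y : measurableType dY}.
Local Notation S := (Y * bposR R)%type.
Variable m : {measure set S -> \bar R}.
Hypothesis m_nat : forall B, measurable B -> m B = +oo%E \/ exists k : nat, m B = k%:R%:E.
Context {g : nat -> set Y} (mg : forall n, measurable (g n)).
Variables (F : set Y) (mF : measurable F).
Local Notation cell n t := (F `&` gcell g n @^-1` [set t]).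
Local Notation inv1 k := (k.+1%:R^-1 : R).

Definition small_part (x : R) (z : S) : \bar R :=
  (posR_val z.2 * \1_[set z : S | F z.1 /\ posR_val z.2 < x] z)%:E.

Lemma rge_meas x : measurable (rge x : set (bposR R)).
Proof.
rewrite -[X in measurable X]setTI.
have := posR_val_meas measurableT (measurable_itv `[x, +oo[).
by congr measurable; apply/seteqP; split=> r /=; rewrite in_itv /= andbT.
Qed.
Lemma small_set_meas x : measurable [set z : S | F z.1 /\ posR_val z.2 < x].
Proof.
have := measurableX mF (measurableC (rge_meas x)); congr measurable.
apply/seteqP; split=> [[y r] [/= Fy /negP]|[y r] [/= Fy h]]; first by rewrite -ltNge.
by split=> //=; apply/negP; rewrite -ltNge.
Qed.
Lemma small_part_meas x : measurable_fun setT (small_part x).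
Proof.
apply/measurable_EFinP; apply: measurable_funM.
  exact: measurableT_comp posR_val_meas measurable_snd.
exact: measurable_indic (small_set_meas x).
Qed.
Lemma small_part_ge0 x z : (0 <= small_part x z)%E.
Proof. by rewrite lee_fin mulr_ge0// /posR_val ge0. Qed.

Hypothesis small_int : (\int[m]_z small_part 1 z < +oo)%E.
Hypothesis simple : forall k, exists n0, forall n, (n0 <= n)%N -> forall t,
  (m (cell n t `*` rge (inv1 k)) <= 1)%E.

Let mcell n t : measurable (cell n t).
Proof. by apply: measurableI => //; exact: gcell_meas. Qed.
Let mX B x : measurable B -> measurable (B `*` rge x : set S).
Proof. by move=> mB; apply: measurableX => //; exact: rge_meas. Qed.

Lemma inv1_lt (x : R) : 0 < x -> exists k, inv1 k < x.
Proof.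
move=> x0; exists (Num.truncn x^-1); rewrite -[ltRHS]invrK ltf_pV2 ?posrE ?invr_gt0//.
by rewrite real_truncnS_gt ?num_real.
Qed.

(** Once every cell has at most one jump above a bound smaller than x, there are no more such jumps
    than cells. *)
Lemma rge_fin x : 0 < x -> (m (F `*` rge x) < +oo)%E.
Proof.
move=> x0; have [k kx] := inv1_lt x0; have [n /(_ n (leqnn n)) sn] := simple k.
have [mU leU] := measure_exists_le m (fun t => mX (inv1 k) (mcell (n := n) t)).
apply: (@le_lt_trans _ _ (\sum_(t : {ffun 'I_n -> bool}) 1%E)%E).
  apply: le_trans (le_trans leU (lee_sum _ (fun t _ => sn t))).
  apply: le_measure; rewrite ?inE//; first exact: mX.
  move=> [y r] [/= Fy xr]; exists (gcell g n y); split=> //=.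
  exact: le_trans (ltW kx) xr.
by rewrite sumEFin ltry.
Qed.

(** Only finitely many jumps exceed a given positive bound. The numbers of jumps in [x - e, x) are
    integers that decrease to 0 with e, so one of them is 0. *)
Lemma gap (x : R) : 0 < x -> exists2 e, 0 < e < x &
  m [set z | F z.1 /\ x - e <= posR_val z.2 < x] = 0%E.
Proof.
(* This is x/(k + 2), which stays strictly below x even at k = 0. *)
move=> x0; pose e k := x * inv1 k.+1.
have e0 k : 0 < e k < x.
  by rewrite /e mulr_gt0 ?invr_gt0//= gtr_pMr// invf_lt1 ?ltr1n.
pose G k := [set z : S | F z.1 /\ x - e k <= posR_val z.2 < x].
have mG k : measurable (G k).
  have := measurableD (mX (x - e k) mF) (mX x mF); congr measurable.
  apply/seteqP; split=> [[y r] [[/= Fy h] nx]|[y r] [/= Fy /andP[h hx]]].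
    by split=> //=; rewrite h ltNge; apply/negP => xr; apply: nx.
  by split=> // -[_ /=]; rewrite /rge /= leNgt hx.
have G0 : m (G 0%N) \is a fin_num.
  rewrite ge0_fin_numE//; apply: le_lt_trans (rge_fin (x := x - e 0%N) _).
    by apply: le_measure; rewrite ?inE//; [exact: mX|move=> [y r] [/= Fy /andP[]]].
  by rewrite subr_gt0; case/andP: (e0 0%N).
have ndG : nonincreasing_seq G.
  move=> i j ij; apply/subsetPset => -[y r] [/= Fy /andP[h hx]]; split=> //=; rewrite hx andbT.
  apply: le_trans h; rewrite lerD2l lerN2 ler_pM2l// lef_pV2 ?posrE//.
  by rewrite ler_nat !ltnS.
have IG : \bigcap_k G k = set0.
  apply/seteqP; split=> // -[y r] h; have [/= Fy /andP[_ rx]] := h 0%N I.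
  have [k] : exists k, inv1 k < (x - posR_val r) / x by apply: inv1_lt; rewrite divr_gt0// subr_gt0.
  rewrite ltr_pdivlMr// => hk; have [_ /andP[hk' _]] := h k I.
  have : e k <= x * inv1 k.
    by rewrite ler_pM2l// lef_pV2 ?posrE// ler_nat.
  move: hk hk'; rewrite /= (mulrC x); move: (e k) (inv1 k * x) => a b; lra.
have G0y : (m (G 0%N) < +oo)%E by rewrite -ge0_fin_numE.
have mI : measurable (\bigcap_k G k) by rewrite IG; exact: measurable0.
have := nonincreasing_cvg_mu G0y mG mI ndG.
rewrite IG measure0 => /fine_cvgP[_ /cvgrPdist_lt /(_ 1 ltr01)[N _ /(_ N (leqnn N))]] /=.
rewrite sub0r normrN => h; exists (e N); first exact: e0.
have : (m (G N) < +oo)%E.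
  rewrite -ge0_fin_numE//; move: G0; rewrite !ge0_fin_numE//; apply: le_lt_trans.
  by apply: le_measure; rewrite ?inE//; have /subsetPset := ndG _ _ (leq0n N).
case: (m_nat (mG N)) h => [->//|[k]]; rewrite -/(G N) => -> /= + _.
by rewrite ger0_norm// -[ltRHS]/(1%:R) ltr_nat ltnS leqn0 => /eqP ->.
Qed.

Lemma small_vanish (e : R) : 0 < e -> exists k0, forall k, (k0 <= k)%N ->
  (\int[m]_z small_part (inv1 k) z < e%:E)%E.
Proof.
move=> e0.
have im : m.-integrable setT (small_part 1).
  apply/integrableP; split; first exact: small_part_meas.
  by under eq_integral do rewrite gee0_abs ?small_part_ge0//.
have le k z : (small_part (inv1 k) z <= small_part 1 z)%E.
  rewrite lee_fin ler_wpM2l ?/posR_val ?ge0// !indicE ler_nat.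
  case: (boolP (z \in [set z : S | F z.1 /\ posR_val z.2 < inv1 k])) => // /set_mem[Fz h].
  rewrite mem_set//; split=> //; apply: (lt_le_trans h).
  by rewrite invf_le1// ler1n.
have cv z : (fun k => small_part (inv1 k) z) @ \oo --> 0%E.
  have [k0 hk] := inv1_lt (x := posR_val z.2) (posR_gt0 _).
  apply: cvg_near_cst; exists k0 => // k /= kk.
  rewrite /small_part indicE memNset ?mulr0// => -[_]; apply/negP; rewrite -leNgt.
  apply: (le_trans _ (ltW hk)).
  by rewrite lef_pV2 ?posrE// ler_nat ltnS.
have lez : {ae m, forall z k, setT z -> (`|small_part (inv1 k) z| <= small_part 1 z)%E}.
  by apply: aeW => z k _; rewrite gee0_abs ?small_part_ge0.
have [_ _] := dominated_convergence measurableT (fun k => small_part_meas (inv1 k))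
  (measurable_cst 0%E) (aeW m (fun z _ => cv z)) im lez.
rewrite integral0 => /fine_cvgP[[N1 _ fN] /cvgrPdist_lt /(_ e e0)[N2 _ eN]].
exists (maxn N1 N2) => k; rewrite geq_max => /andP[k1 k2].
have := eN k k2; rewrite /= sub0r normrN => h.
rewrite -[ltLHS]fineK; last exact: fN.
by rewrite lte_fin; apply: le_lt_trans h; exact: ler_norm.
Qed.

Local Notation xi B := (\int[m]_z cden B z)%E.

(** Markov's inequality. *)
Lemma big_jump B x : measurable B -> 0 < x -> (x%:E * m (B `*` rge x) <= xi B)%E.
Proof.
move=> mB x0; have -> : m (B `*` rge x) = (\int[m]_z (\1_(B `*` rge x) z)%:E)%E.
  by rewrite integral_indic ?setIT//; exact: mX.
rewrite -ge0_integralZl//; [|by apply/measurable_EFinP; apply: measurable_indic; exact: mX|by rewrite lee_fin ltW].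
apply: ge0_le_integral => //.
- by move=> z _; rewrite mule_ge0// lee_fin// ltW.
- by apply: measurable_funeM; apply/measurable_EFinP; apply: measurable_indic; exact: mX.
- exact: cden_meas.
- move=> [y r] _; rewrite /cden -EFinM lee_fin !indicE.
  have [/set_mem[/= By xr]|_] := boolP ((y, r) \in B `*` rge x).
    by rewrite mem_set// !mulr1.
  by rewrite mulr0 mulr_ge0// ltW// posR_gt0.
Qed.

(** The cell has at most one jump that is not small; it is below x, hence below x - e by the gap,
    and the small jumps add less than e. *)
Lemma no_big_jump B x e k : measurable B -> B `<=` F -> 0 < e < x -> inv1 k <= x - e ->
  m [set z | F z.1 /\ x - e <= posR_val z.2 < x] = 0%E ->
  (\int[m]_z small_part (inv1 k) z < e%:E)%E ->
  (m (B `*` rge (inv1 k)) <= 1)%E -> m (B `*` rge x) = 0%E -> (xi B < x%:E)%E.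
Proof.
move=> mB BF /andP[e0 ex] kx gap0 sm one none.
pose N := [set z : S | F z.1 /\ x - e <= posR_val z.2 < x] `|` (B `*` rge x).
have mgap : measurable [set z : S | F z.1 /\ x - e <= posR_val z.2 < x].
  have := measurableD (mX (x - e) mF) (mX x mF); congr measurable.
  apply/seteqP; split=> [[y r] [[/= Fy h] nx]|[y r] [/= Fy /andP[h hx]]].
    by split=> //=; rewrite h ltNge; apply/negP => xr; apply: nx.
  by split=> // -[_ /=]; rewrite /rge /= leNgt hx.
have mN : measurable N by apply: measurableU => //; exact: mX.
have N0 : m N = 0%E.
  apply/eqP; rewrite eq_le measure_ge0 andbT.
  have -> : 0%E = (m [set z | F z.1 /\ (x - e <= posR_val z.2 < x)%R] + m (B `*` rge x))%E.
    by rewrite gap0 none adde0.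
  exact: (measureU2 m mgap (mX x mB)).
have xe0 : 0 <= x - e by rewrite subr_ge0 ltW.
pose v z : \bar R := ((x - e)%:E * (\1_(B `*` rge (inv1 k)) z)%:E)%E.
(* Infinite on the null set of excluded jumps: the pointwise bound holds there too, and the integral
   remains 0. *)
pose n z : \bar R := (+oo * (\1_N z)%:E)%E.
have mi (A : set S) : measurable A -> measurable_fun setT (fun z => (\1_A z)%:E : \bar R).
  by move=> mA; apply/measurable_EFinP; exact: measurable_indic.
have mv : measurable_fun setT v by apply: measurable_funeM; apply: mi; exact: mX.
have mn : measurable_fun setT n by apply: measurable_funeM; exact: mi.
have v0 z : (0 <= v z)%E by rewrite mule_ge0// lee_fin.
have n0 z : (0 <= n z)%E by rewrite mule_ge0// lee_fin.
have mk := small_part_meas (inv1 k).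
apply: (@le_lt_trans _ _ (\int[m]_z (small_part (inv1 k) z + (v z + n z)))%E).
  apply: ge0_le_integral => //.
  - by move=> z _; exact: cden_ge0.
  - exact: cden_meas.
  - by apply: emeasurable_funD => //; exact: emeasurable_funD.
  - move=> [y r] _; have r0 := posR_gt0 r.
    have [/set_mem Nz|/negP nN] := boolP ((y, r) \in N).
      by rewrite /n indicE mem_set// mule1 !addey ?leey.
    have {}nN : ~ N (y, r) by move=> h; apply: nN; exact: mem_set.
    rewrite /n indicE memNset// mule0 adde0.
    have [By|nBy] := pselect (B y); last first.
      by rewrite /cden indicE memNset// mulr0 adde_ge0// small_part_ge0.
    rewrite /cden indicE mem_set// mulr1.
    have [rk|kr] := ltP (posR_val r) (inv1 k).
      rewrite -[leLHS]adde0 leeD//.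
      by rewrite /small_part indicE mem_set ?mulr1//; split=> //; exact: BF.
    rewrite -[leLHS]add0e leeD ?small_part_ge0//.
    rewrite /v indicE mem_set// mule1 lee_fin leNgt; apply/negP => xr; apply: nN.
    have [rx|rx] := ltP (posR_val r) x; last by right.
    by left; split; [exact: BF|rewrite /= rx ltW].
rewrite ge0_integralD//; [|by move=> z _; exact: small_part_ge0|by move=> z _; rewrite adde_ge0|exact: emeasurable_funD].
rewrite ge0_integralD// /v /n !ge0_integralZl//; [|exact: mi|apply: mi; exact: mX].
rewrite !integral_indic ?setIT//; last exact: mX.
rewrite N0 mule0 adde0 [ltRHS](_ : _ = e%:E + (x - e)%:E)%E; last first.
  by rewrite -EFinD addrC subrK.
apply: lte_leD => //; last by rewrite -[leRHS]mule1 lee_wpmul2l ?lee_fin.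
by rewrite ge0_fin_numE ?mule_ge0 ?lee_fin//; apply: le_lt_trans (ltry (x - e)); rewrite -[leRHS]mule1 lee_wpmul2l ?lee_fin.
Qed.

(* Once the cells isolate the jumps and the small jumps of F add up to less than the gap
   below x, a cell has mass at least x iff it contains a jump at least x. *)
Lemma count_limit x : 0 < x -> exists n0, forall n, (n0 <= n)%N ->
  (\sum_t (\1_[set z : \bar R | (x%:E <= z)%E] (xi (cell n t)))%:E)%E = m (F `*` rge x).
Proof.
move=> x0; have [e /andP[e0 ex] gap0] := gap x0.
have [k0 hk] := small_vanish e0.
have [k1 hk1] := inv1_lt (x := x - e) (ltac:(by rewrite subr_gt0)).
pose k := maxn k0 k1; have [n0 hn] := simple k.
have kx : inv1 k <= x - e.
  apply: le_trans (ltW hk1); rewrite lef_pV2 ?posrE// ler_nat ltnS leq_maxr//.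
exists n0 => n nn.
have one t : (m (cell n t `*` rge x) <= 1)%E.
  apply: le_trans (hn n nn t); apply: le_measure; rewrite ?inE//; [exact: mX|exact: mX|].
  move=> [y r] [/= cy xr]; split=> //=; apply: le_trans xr; apply: (le_trans kx).
  by rewrite gerBl ltW.
transitivity (\sum_t m (cell n t `*` rge x))%E.
  apply: eq_bigr => t _; rewrite indicE.
  case: (m_nat (mX x (mcell (n := n) t))) => [h|[j h]].
    by have := one t; rewrite h.
  rewrite h; move: (one t); rewrite h lee_fin lern1; case: j h => [|[|//]] h _.
    have lt : (xi (cell n t) < x%:E)%E.
      have e0x : 0 < e < x by rewrite e0 ex.
      exact: (no_big_jump (mcell (n := n) t) (@subIsetl _ _ _) e0x kx gap0 (hk k (leq_maxl _ _)) (hn n nn t) h).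
    by rewrite memNset//= => le; have := lt_le_trans lt le; rewrite ltxx.
  rewrite mem_set//=; apply: le_trans (big_jump (mcell (n := n) t) x0).
  by rewrite h mule1.
have -> : F `*` rge x = \bigcup_(t in [set: {ffun 'I_n -> bool}]) (cell n t `*` rge x).
  apply/seteqP; split=> [[y r] [/= Fy xr]|[y r] [t _ [/= [Fy _] xr]]] //.
  by exists (gcell g n y).
rewrite measure_fin_bigcup//.
- rewrite [LHS](@bigfs _ _ _ _ (index_enum _) xpredT) ?index_enum_uniq//.
    by rewrite (_ : [set` xpredT] = setT)//; apply/seteqP.
  by move=> t; rewrite mem_index_enum.
- exact: finite_finset.
- apply/trivIsetP => s t _ _ /eqP st; apply/seteqP; split=> // -[y r] [[[_ ys] _] [[_ yt] _]].
  by apply: st; rewrite -[s]ys -[t]yt.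
- by move=> t _; exact: mX.
Qed.
End count_limit.

Section completed_measurability.
Context {R : realType} {dO} {O : measurableType dO} {P : probability O R}.
Variable G : set (set O).
Local Notation OG := (g_sigma_algebraType (G `|` P.-negligible)).

Lemma negl_meas (f h : O -> \bar R) : measurable_fun setT (f : OG -> \bar R) ->
  {ae P, forall w, f w = h w} -> measurable_fun setT (h : OG -> \bar R).
Proof.
move=> mf fh _ M mM; rewrite setTI.
pose N := [set w | f w <> h w].
have negl A : A `<=` N -> measurable (A : set OG).
  by move=> AN; apply: sub_sigma_algebra; right; apply: negligibleS fh.
have -> : h @^-1` M = ((f @^-1` M) `\` N) `|` (h @^-1` M `&` N).
  apply/seteqP; split=> w /=.
    move=> hM; have [fw|nfw] := pselect (f w = h w); last by right.
    by left; split; [rewrite fw|move=> /(_ fw)].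
  by case=> [[fM /contrapT <-]|[]].
apply: measurableU; last by apply: negl => w [].
apply: measurableD; last exact: negl.
by rewrite -[X in measurable X]setTI; exact: mf.
Qed.

(** The upper limit is measurable whatever happens on the exceptional null set, and equals h off
    it. *)
Lemma negl_meas_lim (u : nat -> O -> \bar R) (h : O -> \bar R) :
  (forall n, measurable_fun setT (u n : OG -> \bar R)) ->
  {ae P, forall w, exists n0, forall n, (n0 <= n)%N -> u n w = h w} ->
  measurable_fun setT (h : OG -> \bar R).
Proof.
move=> mu uh; apply: (@negl_meas (fun w => limn_esup (u ^~ w))).
  exact: measurable_fun_limn_esup.
apply: filterS uh => w [n0 hn].
have uw : u ^~ w @ \oo --> h w by apply: cvg_near_cst; exists n0.
rewrite is_cvg_limn_esupE; last by apply/cvg_ex; exists (h w).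
exact: cvg_lim.
Qed.
End completed_measurability.

Section sigma_finite_pack.
Context {R : realType} {d} {T : measurableType d} (nu : {measure set T -> \bar R}).
Hypothesis sf : sigma_finite setT nu.
(* Packs a proof of sigma-finiteness, as required by the Fubini theorems. *)
Definition sfm of sigma_finite setT nu : set T -> \bar R := nu.
HB.instance Definition _ := Measure.copy (sfm sf) nu.
HB.instance Definition _ := @Measure_isSigmaFinite.Build _ _ _ (sfm sf) sf.
End sigma_finite_pack.

(** * The intensity measure *)

Section intensity.
Context {R : realType} {dY} {Y : measurableType dY} {rho : {sigma_finite_measure set Y -> \bar R}}.
Context {nu : {measure set (bposR R) -> \bar R}}.
Hypothesis nu_levy : (\int[nu]_r (Num.min (posR_val r) 1)%:E < +oo)%E.
Local Notation S := (Y * bposR R)%type.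
Local Notation lam := (rho \x^ nu)%E.

Lemma min1_meas : measurable_fun setT (fun r : bposR R => (Num.min (posR_val r) 1)%:E : \bar R).
Proof.
apply/measurable_EFinP; apply: measurable_minr; first exact: posR_val_meas.
exact: measurable_cst.
Qed.

(** On [rge x] the integrand of the Levy condition is at least [Num.min x 1]. *)
Lemma nu_rge_fin (x : R) : 0 < x -> (nu (rge x) < +oo)%E.
Proof.
move=> x0; pose c := Num.min x 1; have c0 : 0 < c by rewrite lt_min x0 ltr01.
have : (c%:E * nu (rge x) < +oo)%E.
  apply: le_lt_trans nu_levy.
  have -> : nu (rge x) = (\int[nu]_r (\1_(rge x) r)%:E)%E.
    by rewrite integral_indic ?setIT//; exact: rge_meas.
  have mi : measurable_fun setT (fun r => (\1_(rge x : set (bposR R)) r)%:E : \bar R).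
    by apply/measurable_EFinP; apply: measurable_indic; exact: rge_meas.
  rewrite -ge0_integralZl//; last by rewrite lee_fin ltW.
  apply: ge0_le_integral => //.
  - by move=> r _; rewrite mule_ge0// lee_fin// ltW.
  - exact: measurable_funeM.
  - exact: min1_meas.
  - move=> r _; rewrite -EFinM lee_fin indicE.
    have [/set_mem xr|_] := boolP (r \in rge x).
      by rewrite mulr1 le_min !ge_min xr lexx orbT.
    by rewrite mulr0 le_min ler01 andbT ltW// posR_gt0.
have := measure_ge0 nu (rge x); case: (nu (rge x)) => [r _ _|_|//]; first exact: ltry.
by rewrite gt0_muley ?lte_fin.
Qed.

Lemma rge_cover : \bigcup_k (rge (k.+1%:R^-1 : R)) = setT.
Proof.
apply/seteqP; split=> // r _; have [k hk] := inv1_lt (posR_gt0 r); exists k => //=.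
exact: ltW.
Qed.

Lemma nu_sigma_finite : sigma_finite setT nu.
Proof.
exists (fun k => rge (k.+1%:R^-1 : R)); first by rewrite rge_cover.
by move=> k; split; [exact: rge_meas|apply: nu_rge_fin; rewrite invr_gt0].
Qed.

Lemma lam_setX B A : measurable B -> measurable A -> lam (B `*` A) = (rho B * nu A)%E.
Proof. exact: product_measure2E. Qed.

(** The product is defined by integrating the [rho] sections over [nu]. [nu] is sigma-finite by the
    Levy condition, so uniqueness identifies the product with the one built in the other order, to
    which Tonelli applies. *)
Lemma lam_fubini (h : S -> \bar R) : measurable_fun setT h -> (forall z, 0 <= h z)%E ->
  (\int[lam]_z h z = \int[rho]_y \int[nu]_r h (y, r))%E.
Proof.
move=> mh h0; have := @fubini_tonelli1 _ _ _ _ _ rho (sfm nu_sigma_finite) h mh h0.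
rewrite /fubini_F /= => <-.
apply: eq_measure_integral => A mA _; apply/esym; apply: product_measure_unique => //.
exact: product_measure2E.
Qed.

(** For fixed y in F the integrand is at most [Num.min r 1], so the integral is at most [rho F]
    times the Levy integral. Hence the small jumps over F almost surely have a finite sum. *)
Lemma small_part_int F : measurable F -> (rho F < +oo)%E ->
  (\int[lam]_z small_part F 1 z < +oo)%E.
Proof.
move=> mF rF; rewrite lam_fubini; [|exact: small_part_meas|exact: small_part_ge0].
pose c := (\int[nu]_r (Num.min (posR_val r) 1)%:E)%E.
have c0 : (0 <= c)%E.
  by apply: integral_ge0 => r _; rewrite lee_fin le_min ler01 andbT ltW// posR_gt0.
apply: (@le_lt_trans _ _ (\int[rho]_y (c * (\1_F y)%:E))%E); last first.
  rewrite ge0_integralZl//; last by apply/measurable_EFinP; exact: measurable_indic.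
  by rewrite integral_indic// setIT lte_mul_pinfty// ge0_fin_numE.
have mp := small_part_meas mF (R := R) 1.
apply: ge0_le_integral => //.
- by move=> y _; apply: integral_ge0 => r _; exact: small_part_ge0.
- exact: (@measurable_fun_fubini_tonelli_F _ _ _ _ _ (sfm nu_sigma_finite) (small_part F 1) mp (small_part_ge0 F 1)).
- by apply: measurable_funeM; apply/measurable_EFinP; exact: measurable_indic.
- move=> y _; rewrite indicE; have [/set_mem Fy|/negP nF] := boolP (y \in F).
    rewrite mule1; apply: ge0_le_integral => //.
    + by move=> r _; exact: small_part_ge0.
    + exact: (measurableT_comp mp (pair1_measurable y)).
    + exact: min1_meas.
    + move=> r _; rewrite lee_fin indicE /=; have r0 := posR_gt0 r.
      have [/set_mem[_ /= r1]|_] := boolP ((y, r) \in _).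
        by rewrite mulr1 le_min lexx ltW.
      by rewrite mulr0 le_min ler01 ltW.
  rewrite mule0 integral0_eq// => r _; rewrite /small_part indicE memNset ?mulr0// => -[/= Fy _].
  by apply: nF; exact: mem_set.
Qed.

Lemma lam_sigma_finite : sigma_finite setT lam.
Proof.
have [F [uF ndF F_fin]] := (sigma_finiteP _ _).1 (@sigma_finiteT _ _ _ rho).
exists (fun k => F k `*` rge (k.+1%:R^-1 : R)).
  apply/esym/seteqP; split=> // -[y r] _.
  have : (\bigcup_k F k) y by rewrite -uF.
  have : (\bigcup_k (rge (k.+1%:R^-1 : R))) r by rewrite rge_cover.
  move=> [k _ kr] [j _ jy]; exists (maxn j k) => //; split=> /=.
    by have /subsetPset := ndF _ _ (leq_maxl j k); exact.
  apply: le_trans kr; rewrite lef_pV2 ?posrE// ler_nat ltnS leq_maxr//.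
move=> k; have [mF rF] := F_fin k; split; first by apply: measurableX => //; exact: rge_meas.
rewrite lam_setX//; last exact: rge_meas.
have kf : (nu (rge (k.+1%:R^-1 : R)) < +oo)%E by apply: nu_rge_fin; rewrite invr_gt0.
by rewrite lte_mul_pinfty// ge0_fin_numE.
Qed.

Lemma lam_translate (d : nat) (act : Y -> 'rV[R]_d -> Y) : measurable_action act ->
  (forall a (B : set Y), measurable B -> rho (translate act B a) = rho B) ->
  forall a (B : set S), measurable B -> lam (translate (act_fst act) B a) = lam B.
Proof.
move=> ma inv a B mB; rewrite /product_measure2; apply: eq_integral => r _ /=.
have mBr : measurable (ysection B r) by exact: measurable_ysection.
rewrite -(inv a (ysection B r) mBr).
congr (rho _); apply/seteqP; split=> y.
  rewrite /ysection /= => /set_mem[[y' r'] By /= [<- <-]].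
  by exists y' => //; rewrite /ysection /=; exact: mem_set.
rewrite /ysection /= => -[y' /set_mem By <-].
by apply: mem_set; exists (y', r).
Qed.
End intensity.

(** * The field of the points from the field of the compound process *)

Section recover_points.
Context {R : realType} {dO} {O : measurableType dO} {P : probability O R}.
Context {dY} {Y : measurableType dY} {rho : {sigma_finite_measure set Y -> \bar R}}.
Context {nu : {measure set (bposR R) -> \bar R}}.
Hypothesis nu_levy : (\int[nu]_r (Num.min (posR_val r) 1)%:E < +oo)%E.
Local Notation S := (Y * bposR R)%type.
Local Notation lam := (rho \x^ nu)%E.
Context {eta : O -> {measure set S -> \bar R}}.
Hypothesis eta_poisson : poisson_process P lam eta.
Context {g : nat -> set Y} (mg : forall n, measurable (g n)).
Variables (D : set Y) (mD : measurable D).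
Hypothesis null : forall y, D y -> rho (gatom g y) = 0%E.
Local Notation xi := (compound eta).

Definition xiG : set (set O) := [set A | exists B (M : set (\bar R)),
     [/\ measurable B, B `<=` D, measurable M & A = xi B @^-1` M]].
Local Notation OG := (g_sigma_algebraType (xiG `|` P.-negligible)).

Lemma xi_OG B : measurable B -> B `<=` D -> measurable_fun setT (xi B : OG -> \bar R).
Proof.
by move=> mB BD _ M mM; rewrite setTI; apply: sub_sigma_algebra; left; exists B, M.
Qed.

(** [count_limit] applies to almost every w: [eta_simple] isolates the jumps of each size and
    [small_part_int] makes the small ones summable. The approximants are functions of finitely many
    values of [xi]. *)
Lemma eta_rect F x : measurable F -> F `<=` D -> (rho F < +oo)%E -> 0 < x ->
  measurable_fun setT ((fun w => eta w (F `*` rge x)) : OG -> \bar R).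
Proof.
move=> mF FD rF x0.
pose u n w := (\sum_t (\1_[set z : \bar R | (x%:E <= z)%E]
   (xi (F `&` gcell g n @^-1` [set t]) w))%:E)%E : \bar R.
apply: (negl_meas_lim (u := u)) => [n|].
  apply: emeasurable_sum => t; apply/measurable_EFinP.
  have mx : measurable [set z : \bar R | (x%:E <= z)%E].
    have := emeasurable_itv `[x%:E, +oo[; congr measurable.
    by apply/seteqP; split=> z /=; rewrite in_itv /= andbT.
  have mc : measurable_fun setT (xi (F `&` gcell g n @^-1` [set t]) : OG -> \bar R).
    apply: xi_OG; last by move=> y [/FD].
    by apply: measurableI => //; exact: gcell_meas.
  by apply: measurableT_comp mc; exact: measurable_indic.
have nF y : F y -> rho (gatom g y) = 0%E by move=> /FD; exact: null.
have simple : {ae P, forall w, forall k, exists n0, forall n, (n0 <= n)%N -> forall t,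
    (eta w ((F `&` gcell g n @^-1` [set t]) `*` rge (k.+1%:R^-1 : R)) <= 1)%E}.
  apply: ae_nat => k; have nk : (nu (rge (k.+1%:R^-1 : R)) < +oo)%E.
    by apply: nu_rge_fin => //; rewrite invr_gt0.
  apply: (eta_simple eta_poisson mg mF rF (rge_meas _) (c := nu (rge (k.+1%:R^-1 : R)))) => //.
    by rewrite ge0_fin_numE.
  by move=> B mB; apply: lam_setX => //; exact: rge_meas.
have small : {ae P, forall w, (\int[eta w]_z small_part F 1 z < +oo)%E}.
  apply: ae_lty.
  - apply: (measurable_integral_param (D := setT)).
    + exact: small_part_meas.
    + exact: small_part_ge0.
    + by move=> y /(_ I).
    + by move=> B mB _; exact: (eta_meas eta_poisson).
  - by move=> w; apply: integral_ge0 => z _; exact: small_part_ge0.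
  - apply: le_lt_trans (small_part_int nu_levy mF rF).
    by apply: (eta_mean_le eta_poisson); [exact: small_part_meas|exact: small_part_ge0].
apply: filterS2 simple small => w sw iw.
have nat_w B : measurable B -> eta w B = +oo%E \/ exists k : nat, eta w B = k%:R%:E.
  by case: eta_poisson => -[_ h _] _ _ _; exact: h.
by have [n0 hn] := count_limit nat_w mg mF iw sw x0; exists n0.
Qed.

(** The pi-lambda argument inside a set [W] of almost surely finite mass: complements are
    differences there, valid off a null event, which the completed field contains. *)
Lemma eta_dynkin (W : set S) dT (T : measurableType dT) (phi : S -> T) (G : set (set T)) :
  measurable W -> measurable_fun setT ((fun w => eta w W) : OG -> \bar R) ->
  {ae P, forall w, (eta w W < +oo)%E} -> measurable_fun setT phi ->
  (measurable : set (set T)) = <<s G >> -> setI_closed G ->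
  (forall Q, G Q -> measurable_fun setT ((fun w => eta w (W `&` phi @^-1` Q)) : OG -> \bar R)) ->
  forall Q, measurable Q ->
  measurable_fun setT ((fun w => eta w (W `&` phi @^-1` Q)) : OG -> \bar R).
Proof.
move=> mW eW fW mphi gen Gpi GQ Q mQ.
have mpre Q' : measurable Q' -> measurable (W `&` phi @^-1` Q').
  by move=> mQ'; apply: measurableI => //; rewrite -[X in measurable X]setTI; exact: mphi.
pose H Q' := measurable_fun setT ((fun w => eta w (W `&` phi @^-1` Q')) : OG -> \bar R).
have : <<s G >> Q by rewrite -gen.
apply: (dynkin_induction (P := H) gen Gpi) => //.
- by rewrite /H preimage_setT setIT.
- move=> A mA HA; rewrite /H.
  apply: (@negl_meas _ _ _ _ _ (fun w => eta w W - eta w (W `&` phi @^-1` A)))%E.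
    exact: emeasurable_funB.
  have E : W `&` phi @^-1` (~` A) = W `\` (phi @^-1` A) by [].
  apply: filterS fW => w fw; rewrite E measureD//.
  by rewrite -[X in measurable X]setTI; exact: mphi.
- move=> F mF tF HF; rewrite /H.
  have E w : eta w (W `&` phi @^-1` (\bigcup_k F k)) =
      (\sum_(0 <= k <oo) eta w (W `&` phi @^-1` F k))%E.
    rewrite preimage_bigcup setI_bigcupr measure_semi_bigcup//.
    + by move=> k; exact: mpre.
    + apply/trivIsetP => i j _ _ ij; rewrite setIACA setIid -preimage_setI.
      by move/trivIsetP : tF => /(_ _ _ I I ij) ->; rewrite preimage_set0 setI0.
    + by apply: bigcup_measurable => k _; exact: mpre.
  rewrite (_ : (fun w => _) = fun w => (\sum_(0 <= k <oo) eta w (W `&` phi @^-1` F k))%E).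
    apply: (@ge0_emeasurable_sum _ OG R setT (fun k w => eta w (W `&` phi @^-1` F k)) xpredT) => //.
    by move=> k _; exact: HF.
  by apply/funext => w; exact: E.
Qed.

(** Two uses of [eta_dynkin]: from half-lines to Borel sets of marks, then from rectangles to
    measurable sets of the product. *)
Lemma eta_box F x A : measurable F -> F `<=` D -> (rho F < +oo)%E -> 0 < x -> measurable A ->
  measurable_fun setT ((fun w => eta w ((F `*` rge x) `&` A)) : OG -> \bar R).
Proof.
have fin F' : measurable F' -> (rho F' < +oo)%E -> 0 < x ->
    {ae P, forall w, (eta w (F' `*` rge x) < +oo)%E}.
  move=> mF' rF' x0; have mW : measurable (F' `*` rge x : set S).
    by apply: measurableX => //; exact: rge_meas.
  have lW : (lam (F' `*` rge x) < +oo)%E.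
    rewrite lam_setX//; last exact: rge_meas.
    by rewrite lte_mul_pinfty ?ge0_fin_numE ?nu_rge_fin.
  exists [set w | eta w (F' `*` rge x) = +oo%E]; split.
  - exact: (eta_preimage_meas eta_poisson mW (emeasurable_set1 _)).
  - exact: (poisson_infty eta_poisson mW lW).
  - by move=> w /= /negP; rewrite -leNgt leye_eq => /eqP.
have ray F' Q : measurable F' -> F' `<=` D -> (rho F' < +oo)%E -> 0 < x -> measurable Q ->
    measurable_fun setT ((fun w => eta w ((F' `*` rge x) `&`
      (fun z : S => posR_val z.2) @^-1` Q)) : OG -> \bar R).
  move=> mF' FD' rF' x0; apply: (eta_dynkin (phi := fun z : S => posR_val z.2) (G := @RGenCInfty.G R)).
  - by apply: measurableX => //; exact: rge_meas.
  - exact: eta_rect.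
  - exact: fin.
  - exact: measurableT_comp posR_val_meas measurable_snd.
  - exact: RGenCInfty.measurableE.
  - move=> _ _ [a ->] [b ->]; exists (Num.max a b).
    by apply/seteqP; split=> r /=; rewrite !in_itv /= !andbT ge_max => /andP.
  - move=> _ [a ->]; have := eta_rect mF' FD' rF' (x := Num.max x a).
    rewrite lt_max x0 /= => /(_ isT).
    rewrite (_ : F' `*` rge (Num.max x a) = (F' `*` rge x) `&` (fun z : S => posR_val z.2) @^-1` `[a, +oo[%classic)//.
    apply/seteqP; split=> -[y r] /=; rewrite /rge /= in_itv /= andbT ge_max.
      by case=> Fy /andP[].
    by case=> -[Fy ->].
move=> mF FD rF x0; apply: (eta_dynkin (phi := id)
  (G := [set A1 `*` A2 | A1 in measurable & A2 in measurable])).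
- by apply: measurableX => //; exact: rge_meas.
- exact: eta_rect.
- exact: fin.
- exact: measurable_id.
- exact: measurable_prod_measurableType.
- move=> _ _ [A1 mA1 [A2 mA2 <-]] [B1 mB1 [B2 mB2 <-]].
  exists (A1 `&` B1); first exact: measurableI.
  by exists (A2 `&` B2); [exact: measurableI|rewrite setXI].
- move=> _ [A1 mA1 [A2 [Q mQ QA] <-]].
  have := ray (F `&` A1) Q (measurableI _ _ mF mA1) _ _ x0 mQ.
  rewrite (_ : ((F `&` A1) `*` rge x) `&` (fun z : S => posR_val z.2) @^-1` Q =
     (F `*` rge x) `&` id @^-1` (A1 `*` A2)).
    apply; first by move=> y [/FD].
    by apply: le_lt_trans rF; apply: le_measure; rewrite ?inE//; exact: measurableI.
  rewrite -QA setTI; apply/seteqP; split=> -[y r] /=; first by case=> -[[? ?] ?] ?.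
  by case=> -[? ?] [].
Qed.

(** The boxes of finite intensity, with marks at least 1/(k+1), exhaust the part of the space above
    [D]. *)
Lemma eta_OG B : measurable B -> B `<=` D `*` setT ->
  measurable_fun setT ((fun w => eta w B) : OG -> \bar R).
Proof.
move=> mB BD; have [F [uF ndF F_fin]] := (sigma_finiteP _ _).1 (@sigma_finiteT _ _ _ rho).
pose W k : set S := (F k `&` D) `*` rge (k.+1%:R^-1 : R).
have mFD k : measurable (F k `&` D) by apply: measurableI => //; case: (F_fin k).
have mW k : measurable (W k) by apply: measurableX => //; exact: rge_meas.
apply: (emeasurable_fun_cvg (fun k (w : OG) => eta w (W k `&` B))).
  move=> k; apply: (eta_box (mFD k) _ _ _ mB); [by move=> y []| |by rewrite invr_gt0].
  by have [mF rF] := F_fin k; apply: le_lt_trans rF; apply: le_measure; rewrite ?inE.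
move=> w _; rewrite (_ : eta w B = eta w (\bigcup_k (W k `&` B))).
  apply: nondecreasing_cvg_mu.
  - by move=> k; exact: measurableI.
  - by apply: bigcup_measurable => k _; exact: measurableI.
  - move=> i j ij; apply/subsetPset => -[y r] [[[Fy Dy] ri] Byr]; split=> //; split=> //=.
      by split=> //; have /subsetPset := ndF _ _ ij; exact.
    by apply: le_trans ri; rewrite lef_pV2 ?posrE// ler_nat ltnS.
congr (eta w _); apply/seteqP; split=> [[y r] Byr|z [k _ []]//].
have : (\bigcup_k F k) y by rewrite -uF.
have : (\bigcup_k (rge (k.+1%:R^-1 : R))) r by rewrite rge_cover.
move=> [k _ kr] [j _ jy]; exists (maxn j k) => //; split=> //; split=> /=.
  by split; [have /subsetPset := ndF _ _ (leq_maxl j k); exact|have [] := BD _ Byr].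
apply: le_trans kr; rewrite lef_pV2 ?posrE// ler_nat ltnS leq_maxr//.
Qed.

Theorem sigma_field_compound :
  sigma_field P xi D = sigma_field P (fun B w => eta w B) (D `*` setT).
Proof.
apply/seteqP; split; apply: complete_sigma_sub.
  move=> _ [B [M [mB BD mM ->]]].
  have := compound_meas (T := g_sigma_algebraType (etaG (eta := eta) (D `*` setT) `|` P.-negligible))
    (mu := eta) mB BD _ measurableT mM.
  rewrite setTI; apply=> A mA AD _ N mN; rewrite setTI; apply: sub_sigma_algebra.
  by left; exists A, N.
move=> _ [B [M [mB BD mM ->]]]; have := eta_OG mB BD measurableT mM.
by rewrite setTI.
Qed.
End recover_points.

(** * Multiplication *)

Section polarization.
Context {R : realType} {H : innerProductSpace R}.

Lemma sesq_zero (B : H -> H -> R[i]) (M : set H) : hsubspace M ->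
  (forall c x y z, M x -> M y -> M z -> B (c *: x + y) z = c * B x z + B y z) ->
  (forall c x y z, M x -> M y -> M z -> B z (c *: x + y) = c^*%C * B z x + B z y) ->
  (forall x, M x -> B x x = 0) -> forall x y, M x -> M y -> B x y = 0.
Proof.
move=> HM Bl Br B0 x y Mx My.
have q c : c^*%C * B x y + c * B y x = 0.
  have := B0 (c *: y + x) (hsubP c HM My Mx).
  by rewrite Bl ?Br//; [rewrite !B0// mulr0 add0r addr0 addrC|exact: hsubP..].
have q1 := q 1; have qi := q 'i%C.
move: q1 qi; rewrite conjc1 !mul1r => /eqP; rewrite addrC addr_eq0 => /eqP -> /eqP.
rewrite mulrN -mulNr -mulrDl mulf_eq0 => /orP[|/eqP//].
by rewrite eq_complex /= !(subr0, oppr0, addr0) -opprD oppr_eq0 paddr_eq0 ?ler01// oner_eq0 /= andbF.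
Qed.
End polarization.

Lemma sub_of_lin {K : pzRingType} {V W : lmodType K} (T : V -> W) (M : set V) (x y : V) :
  (forall c a b, M a -> M b -> T (c *: a + b) = c *: T a + T b) -> M x -> M y ->
  T x - T y = T (x - y).
Proof.
move=> lT Mx My; rewrite [x - y]addrC -[- y]scaleN1r (lT _ _ _ My Mx) scaleN1r.
exact: addrC.
Qed.

(** [cL2_mul] chooses a class that is the product of some representatives; changing these on null
    sets does not affect the class. *)
Lemma cL2_mulE {R : realType} {dO} {O : measurableType dO} {P : probability O R} (f g : O -> R[i]) :
  L2 P f -> L2 P g -> L2 P (fun w => f w * g w) ->
  cL2_mul (cls P f) (cls P g) = cls P (fun w => f w * g w).
Proof.
move=> Lf Lg Lfg; rewrite /cL2_mul; case: xgetP => [z -> [f' [g' [Ef Eg /is_classP[Lz ->]]]]|].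
  have Lf' : L2 P f' by apply/cLfun2P; case: f' {Ef Lz}.
  have Lg' : L2 P g' by apply/cLfun2P; case: g' {Eg Lz}.
  rewrite cls_pi in Ef; rewrite cls_pi in Eg.
  apply: cls_ae => //; have := cls_aeP Lf Lf' Ef; have := cls_aeP Lg Lg' Eg.
  by apply: filterS2 => w -> ->.
move=> /(_ (cls P (fun w => f w * g w))) []; move: (Lf) (Lg) => /cLfun2P hf /cLfun2P hg.
exists (CLfun hf), (CLfun hg); split; [exact: clsE|exact: clsE|].
by apply/is_classP; split.
Qed.

(** * Products over disjoint sets *)

Section disjoint_products.
Context {R : realType} {dO} {O : measurableType dO} {P : probability O R}.
Context {dS} {S : measurableType dS} {lam : {measure set S -> \bar R}}.
Context {eta : O -> {measure set S -> \bar R}}.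
Hypothesis eta_poisson : poisson_process P lam eta.
Hypothesis P_complete : measure_is_complete P.
Hypothesis lam_sf : sigma_finite setT lam.
Local Notation slabel := (slabel lam).
Local Notation K := (cL2_ips lam).
Local Notation L := (cL2_ips P).
Variable e : K -> L.
Hypothesis e_gram : forall x y, hdot (e x) (e y) = cexp (hdot x y).
Hypothesis eE : forall i, e (lvec i) = evec eta i.
Local Notation Mspan := (Mspan e).
Local Notation OG D := (g_sigma_algebraType (etaG (eta := eta) D `|` P.-negligible)).

Lemma MspanP D x : measurable D -> Mspan D x <->
  exists2 f, L2 P f & x = cls P f /\ cmeas (f : OG D -> R[i]).
Proof.
move=> mD; rewrite (Mspan_eq eta_poisson P_complete lam_sf e_gram eE mD).
exact: cL2_subP.
Qed.

Lemma e0_one : e 0 = cls P (fun=> 1).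
Proof. by rewrite -(evec0 (eta := eta) (lam := lam)) -eE lvec0. Qed.

Variables (D1 D2 : set S).
Hypotheses (mD1 : measurable D1) (mD2 : measurable D2) (dis : D1 `&` D2 = set0).

Lemma Ksupp_orth (u v : K) : Ksupp D1 u -> Ksupp D2 v -> hdot u v = 0.
Proof.
move=> <- <-; rewrite iop_dot// iopI// dis.
have -> : iop set0 v = 0.
  rewrite /iop -(mulop_cst0 v); congr (mulop _ v).
  by apply/funext => y; rewrite cind_out.
by rewrite hdot0r.
Qed.

(** On exponential vectors of orthogonal arguments all three inner products are exp(0) = 1, and both
    sides extend by linearity and continuity in each variable. Since [e 0] is the constant 1, this
    is independence of the two fields. *)
Lemma Mspan_indep x y : Mspan D1 x -> Mspan D2 y -> hdot x y = hdot x (e 0) * hdot (e 0) y.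
Proof.
move=> Mx My; pose N := [set x | hdot x y = hdot x (e 0) * hdot (e 0) y].
have HN z : hsubspace [set x : L | hdot x z = hdot x (e 0) * hdot (e 0) z].
  split=> [|c x1 x2 /= h1 h2|u x1 /= hu ux] /=.
  - by rewrite !hdot0l mul0r.
  - by rewrite !hdotDl !hdotZl h1 h2 mulrDl mulrA.
  - apply/eqP; rewrite -subr_eq0; apply/eqP.
    have : hdot x1 (z - (hdot (e 0) z)^*%C *: e 0) = 0.
      apply: (hlim_dotl ux) => n; rewrite hdotDr hdotNr hdotZr conjcK hu mulrC.
      by rewrite (mulrC (hdot (e 0) z)) subrr.
    by rewrite hdotDr hdotNr hdotZr conjcK mulrC.
apply: (closed_span_min (HN y)) Mx => _ [u Du <-] /=.
rewrite hdotC [in RHS]hdotC [X in _ = _ * X]hdotC -conjcM; congr (_^*%C); rewrite mulrC.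
apply: (closed_span_min (HN (e u))) My => _ [v Dv <-] /=.
rewrite !e_gram hdot0l hdot0r cexp0 mulr1 hdotC Ksupp_orth//.
by rewrite conjc0 cexp0.
Qed.

Lemma indep_bounded (f g : O -> R) (C : R) :
  measurable_fun setT (f : OG D1 -> R) -> measurable_fun setT (g : OG D2 -> R) ->
  (forall w, 0 <= f w <= C) -> (forall w, 0 <= g w <= C) ->
  (\int[P]_w (f w * g w)%:E = \int[P]_w (f w)%:E * \int[P]_w (g w)%:E)%E.
Proof.
move=> mf mg fC gC.
have sub D : measurable D -> etaG (eta := eta) D `|` P.-negligible `<=` measurable.
  move=> mD A [[B [M [mB _ mM ->]]]|/P_complete//].
  exact: (eta_preimage_meas eta_poisson mB mM).
have mO D (h : O -> R) : measurable D -> measurable_fun setT (h : OG D -> R) -> measurable_fun setT h.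
  move=> mD mh _ A mA; rewrite setTI; have := mh measurableT A mA; rewrite setTI.
  by move: (h @^-1` A); apply: smallest_sub; [exact: sigma_algebra_measurable|exact: sub].
have mf' := mO _ _ mD1 mf; have mg' := mO _ _ mD2 mg.
have B (h : O -> R) : measurable_fun setT h -> (forall w, 0 <= h w <= C) -> bmeas (fun w => (h w)%:C%C : R[i]).
  move=> mh hC; split; first exact: cmeas_real.
  by exists (C ^+ 2) => w; rewrite csqn_real; have /andP[h0 h1] := hC w; rewrite lerXn2r ?nnegrE// (le_trans h0).
have bf := B _ mf' fC; have bg := B _ mg' gC.
have Mf : Mspan D1 (cls P (fun w => (f w)%:C%C)).
  apply/MspanP => //; exists (fun w => (f w)%:C%C); first exact: L2_bounded.
  by split=> //; exact: cmeas_real.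
have Mg : Mspan D2 (cls P (fun w => (g w)%:C%C)).
  apply/MspanP => //; exists (fun w => (g w)%:C%C); first exact: L2_bounded.
  by split=> //; exact: cmeas_real.
have := Mspan_indep Mf Mg; rewrite e0_one.
have L1 : L2 P (fun=> 1 : R[i]) by exact: L2_1.
have Lf := L2_bounded bf; have Lg := L2_bounded bg.
rewrite !cls_dot//.
have -> : (fun w => (f w)%:C%C * ((g w)%:C%C)^*%C) = (fun w => (f w * g w)%:C%C).
  by apply/funext => w; rewrite conjc_real rmorphM.
have -> : (fun w => (f w)%:C%C * (1 : R[i])^*%C) = (fun w => (f w)%:C%C).
  by apply/funext => w; rewrite conjc1 mulr1.
have -> : (fun w => 1 * ((g w)%:C%C : R[i])^*%C) = (fun w => (g w)%:C%C).
  by apply/funext => w; rewrite conjc_real mul1r.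
rewrite !cint_real -rmorphM /= => /complexI h.
have fin (h' : O -> R) : measurable_fun setT h' -> (forall w, 0 <= h' w <= C ^+ 2 + C) -> (\int[P]_w (h' w)%:E)%E \is a fin_num.
  move=> mh hC; rewrite ge0_fin_numE; last by apply: integral_ge0 => w _; rewrite lee_fin; case/andP: (hC w).
  apply: (@le_lt_trans _ _ (\int[P]_w (C ^+ 2 + C)%:E)%E).
    apply: ge0_le_integral => //.
    - by move=> w _; rewrite lee_fin; case/andP: (hC w).
    - exact/measurable_EFinP.
    - by move=> w _; rewrite lee_fin; case/andP: (hC w).
  rewrite integral_cst//; apply: (@le_lt_trans _ _ ((C ^+ 2 + C)%:E * 1)%E); last by rewrite mule1 ltry.
  rewrite lee_wpmul2l//; last exact: probability_le1.
  by rewrite lee_fin; have /andP[a b] := hC point; exact: le_trans b.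
have C0 : 0 <= C by have /andP[a b] := fC point; exact: le_trans b.
have bound (h' : O -> R) : (forall w, 0 <= h' w <= C) -> forall w, 0 <= h' w <= C ^+ 2 + C.
  move=> hC w; have /andP[a b] := hC w; rewrite a /=; apply: (le_trans b).
  by rewrite lerDr sqr_ge0.
rewrite -[LHS]fineK; last first.
  apply: fin; first exact: measurable_funM.
  move=> w; have /andP[a b] := fC w; have /andP[a' b'] := gC w.
  rewrite mulr_ge0//= (le_trans (ler_pM a a' b b'))// expr2 lerDl//.
rewrite -[X in (_ = X * _)%E]fineK; last by apply: fin => //; exact: bound.
rewrite -[X in (_ = _ * X)%E]fineK; last by apply: fin => //; exact: bound.
by rewrite -EFinM; congr (_%:E).
Qed.

Lemma mono_int (u : nat -> O -> R) (h : O -> R) : (forall n, measurable_fun setT (u n)) ->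
  (forall n w, 0 <= u n w) -> (forall m n w, (m <= n)%N -> u m w <= u n w) ->
  (forall w, exists N, forall n, (N <= n)%N -> u n w = h w) ->
  (fun n => \int[P]_w (u n w)%:E)%E @ \oo --> (\int[P]_w (h w)%:E)%E.
Proof.
move=> mu u0 nd uh.
have -> : (\int[P]_w (h w)%:E = \int[P]_w limn (fun n => (u n w)%:E))%E.
  apply: eq_integral => w _; apply/esym/cvg_lim => //.
  by have [N hN] := uh w; apply: cvg_near_cst; exists N => // n /= /hN ->.
apply: cvg_monotone_convergence => //.
- by move=> n; exact/measurable_EFinP.
- by move=> n w _; rewrite lee_fin.
- by move=> w _ m n mn; rewrite lee_fin; exact: nd.
Qed.

Lemma trunc_mono (f : O -> R[i]) m n w : (m <= n)%N -> csqn (trunc f m w) <= csqn (trunc f n w).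
Proof.
move=> mn; rewrite /trunc; case: ifP => h; last by rewrite csqn0 csqn_ge0.
by rewrite ifT// (le_trans h)// ler_nat.
Qed.

(** A product of square integrable functions need not be square integrable; for independent ones the
    integrals of the squares multiply. Truncation reduces this to [indep_bounded], and monotone
    convergence removes it. *)
Lemma prod_sqint f g : L2 P f -> L2 P g -> cmeas (f : OG D1 -> R[i]) -> cmeas (g : OG D2 -> R[i]) ->
  sqint P (fun w => f w * g w) = (sqint P f * sqint P g)%E.
Proof.
move=> [mf If] [mg Ig] mf1 mg2.
pose u n w := csqn (trunc f n w); pose v n w := csqn (trunc g n w).
have mu n : measurable_fun setT (u n) by apply: cmeas_csqn; exact: trunc_cmeas.
have mv n : measurable_fun setT (v n) by apply: cmeas_csqn; exact: trunc_cmeas.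
have uE n : (\int[P]_w (u n w * v n w)%:E = \int[P]_w (u n w)%:E * \int[P]_w (v n w)%:E)%E.
  apply: (indep_bounded (C := n%:R)).
  - by apply: cmeas_csqn; exact: (trunc_cmeas (T := OG D1)).
  - by apply: cmeas_csqn; exact: (trunc_cmeas (T := OG D2)).
  - by move=> w; rewrite csqn_ge0 trunc_le.
  - by move=> w; rewrite csqn_ge0 trunc_le.
have lu : (fun n => \int[P]_w (u n w)%:E)%E @ \oo --> sqint P f.
  apply: mono_int => //.
  - by move=> n w; exact: csqn_ge0.
  - by move=> m n w; exact: trunc_mono.
  - by move=> w; have [N hN] := trunc_eventually f w; exists N => n /hN; rewrite /u => ->.
have lv : (fun n => \int[P]_w (v n w)%:E)%E @ \oo --> sqint P g.
  apply: mono_int => //.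
  - by move=> n w; exact: csqn_ge0.
  - by move=> m n w; exact: trunc_mono.
  - by move=> w; have [N hN] := trunc_eventually g w; exists N => n /hN; rewrite /v => ->.
have luv : (fun n => \int[P]_w (u n w * v n w)%:E)%E @ \oo --> sqint P (fun w => f w * g w).
  rewrite /sqint; apply: mono_int => //.
  - by move=> n; exact: measurable_funM.
  - by move=> n w; rewrite mulr_ge0// csqn_ge0.
  - by move=> m n w mn; rewrite ler_pM ?csqn_ge0// trunc_mono.
  - move=> w; have [N hN] := trunc_eventually f w; have [N' hN'] := trunc_eventually g w.
    exists (maxn N N') => n; rewrite geq_max => /andP[/hN fn /hN' gn].
    by rewrite /u /v fn gn csqnM.
have ff : sqint P f \is a fin_num by rewrite ge0_fin_numE// sqint_ge0.
have fg : sqint P g \is a fin_num by rewrite ge0_fin_numE// sqint_ge0.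
have := cvgeM (mule_def_fin ff fg) lu lv.
under eq_fun do rewrite -uE.
move=> h; apply: (cvg_unique (@ereal_hausdorff R) luv); exact: h.
Qed.

Lemma prod_rep x y : Mspan D1 x -> Mspan D2 y -> exists f g,
  [/\ L2 P f, L2 P g, L2 P (fun w => f w * g w), x = cls P f &
   [/\ y = cls P g, cL2_mul x y = cls P (fun w => f w * g w),
     cmeas (f : OG D1 -> R[i]) & cmeas (g : OG D2 -> R[i])]].
Proof.
move=> /(MspanP _ mD1)[f Lf [xf mf]] /(MspanP _ mD2)[g Lg [yg mg]].
have Lfg : L2 P (fun w => f w * g w).
  split; first by apply: cmeasM; [case: Lf|case: Lg].
  rewrite prod_sqint//; case: Lf => _ If; case: Lg => _ Ig.
  by rewrite lte_mul_pinfty ?sqint_ge0// ge0_fin_numE// sqint_ge0.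
by exists f, g; split=> //; split=> //; rewrite xf yg cL2_mulE.
Qed.

Lemma prod_norm x y : Mspan D1 x -> Mspan D2 y -> hnorm (cL2_mul x y) = hnorm x * hnorm y.
Proof.
move=> Mx My; have [f [g [Lf Lg Lfg -> [-> -> mf mg]]]] := prod_rep Mx My.
have h : hnorm (cls P (fun w => f w * g w)) ^+ 2 = (hnorm (cls P f) * hnorm (cls P g)) ^+ 2.
  apply: EFin_inj; rewrite cls_norm// prod_sqint// exprMn EFinM !cls_norm//.
by apply: (@pexpIrn _ 2) => //; rewrite ?nnegrE ?mulr_ge0 ?hnorm_ge0.
Qed.

Lemma prod_mem x y : Mspan D1 x -> Mspan D2 y -> Mspan (D1 `|` D2) (cL2_mul x y).
Proof.
move=> Mx My; have [f [g [Lf Lg Lfg _ [_ -> mf mg]]]] := prod_rep Mx My.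
apply/MspanP; first exact: measurableU.
exists (fun w => f w * g w) => //; split=> //.
have sub D D' (h : O -> R[i]) : D `<=` D' -> cmeas (h : OG D -> R[i]) -> cmeas (h : OG D' -> R[i]).
  move=> DD'; have GG : etaG (eta := eta) D `|` P.-negligible `<=` etaG (eta := eta) D' `|` P.-negligible.
    by move=> A [[B [M [mB BD mM ->]]]|nA]; [left; exists B, M; split=> //; exact: subset_trans DD'|right].
  by move=> [mr mi]; split=> _ A mA; [have := mr measurableT A mA|have := mi measurableT A mA];
    rewrite !setTI; exact: sub_sigma_algebra2.
by apply: cmeasM; [apply: sub mf; exact: subsetUl|apply: sub mg; exact: subsetUr].
Qed.

Lemma prod_linl (c : R[i]) (x x' y : L) : Mspan D1 x -> Mspan D1 x' -> Mspan D2 y ->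
  cL2_mul (c *: x + x') y = c *: cL2_mul x y + cL2_mul x' y :> L.
Proof.
move=> Mx Mx' /(MspanP _ mD2)[g Lg [-> mg]].
move: Mx Mx' => /(MspanP _ mD1)[f Lf [-> mf]] /(MspanP _ mD1)[f' Lf' [-> mf']].
have pr h : L2 P h -> cmeas (h : OG D1 -> R[i]) -> L2 P (fun w => h w * g w).
  move=> Lh mh; split; first by apply: cmeasM; [case: Lh|case: Lg].
  rewrite prod_sqint//; case: Lh => _ Ih; case: Lg => _ Ig.
  by rewrite lte_mul_pinfty ?sqint_ge0// ge0_fin_numE// sqint_ge0.
have Lcf := L2Z c Lf.
have Lff : L2 P (fun w => c * f w + f' w) by exact: L2D.
have mff : cmeas ((fun w => c * f w + f' w) : OG D1 -> R[i]).
  by apply: cmeasD => //; apply: cmeasM => //; exact: cmeas_cst.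
rewrite -clsZ// -clsD// !cL2_mulE//; [|exact: pr..].
rewrite -clsZ; last exact: pr.
rewrite -clsD; [|by apply: L2Z; exact: pr|exact: pr].
by congr (cls P _); apply/funext => w; rewrite mulrDl mulrA.
Qed.

Lemma prod_linr (c : R[i]) (x y y' : L) : Mspan D1 x -> Mspan D2 y -> Mspan D2 y' ->
  cL2_mul x (c *: y + y') = c *: cL2_mul x y + cL2_mul x y' :> L.
Proof.
move=> /(MspanP _ mD1)[f Lf [-> mf]].
move=> /(MspanP _ mD2)[g Lg [-> mg]] /(MspanP _ mD2)[g' Lg' [-> mg']].
have pr h : L2 P h -> cmeas (h : OG D2 -> R[i]) -> L2 P (fun w => f w * h w).
  move=> Lh mh; split; first by apply: cmeasM; [case: Lf|case: Lh].
  rewrite prod_sqint//; case: Lh => _ Ih; case: Lf => _ If.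
  by rewrite lte_mul_pinfty ?sqint_ge0// ge0_fin_numE// sqint_ge0.
have Lcg := L2Z c Lg.
have Lgg : L2 P (fun w => c * g w + g' w) by exact: L2D.
have mgg : cmeas ((fun w => c * g w + g' w) : OG D2 -> R[i]).
  by apply: cmeasD => //; apply: cmeasM => //; exact: cmeas_cst.
rewrite -clsZ// -clsD// !cL2_mulE//; [|exact: pr..].
rewrite -clsZ; last exact: pr.
rewrite -clsD; [|by apply: L2Z; exact: pr|exact: pr].
by congr (cls P _); apply/funext => w; rewrite mulrDr mulrCA.
Qed.

(** The norms multiply by [prod_norm]; polarization is applied twice, in the left factor with equal
    right factors and then in the right factor. *)
Lemma prod_dot x x' y y' : Mspan D1 x -> Mspan D1 x' -> Mspan D2 y -> Mspan D2 y' ->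
  hdot (cL2_mul x y) (cL2_mul x' y') = hdot x x' * hdot y y'.
Proof.
move=> Mx Mx' My My'; have H1 := Mspan_hsub e D1; have H2 := Mspan_hsub e D2.
have same v : Mspan D2 v -> forall z z', Mspan D1 z -> Mspan D1 z' ->
    hdot (cL2_mul z v) (cL2_mul z' v) = hdot z z' * hdot v v.
  move=> Mv z z' Mz Mz'; apply/eqP; rewrite -subr_eq0; apply/eqP.
  apply: (sesq_zero (B := fun z z' => hdot (cL2_mul z v) (cL2_mul z' v) - hdot z z' * hdot v v) H1) => //.
  - by move=> c a b a' Ma Mb Ma'; rewrite prod_linl// !hdotDl !hdotZl; ring.
  - by move=> c a b a' Ma Mb Ma'; rewrite prod_linl// !hdotDr !hdotZr; ring.
  - by move=> a Ma; rewrite !hdotxxE prod_norm// exprMn rmorphM subrr.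
apply/eqP; rewrite -subr_eq0; apply/eqP.
pose B v v' := hdot (cL2_mul x v) (cL2_mul x' v') - hdot x x' * hdot v v'.
apply: (@sesq_zero _ _ B _ H2 _ _ _ y y' My My'); rewrite /B.
- by move=> c a b a' Ma Mb Ma'; rewrite prod_linr// !hdotDl !hdotZl; ring.
- by move=> c a b a' Ma Mb Ma'; rewrite prod_linr// !hdotDr !hdotZr; ring.
- by move=> v Mv; rewrite same// subrr.
Qed.

Lemma prod_lim (u v : nat -> L) x y : (forall n, Mspan D1 (u n)) -> (forall n, Mspan D2 (v n)) ->
  Mspan D1 x -> Mspan D2 y -> hlim u x -> hlim v y ->
  hlim (fun n => cL2_mul (u n) (v n)) (cL2_mul x y).
Proof.
move=> Mu Mv Mx My ux vy; have H1 := Mspan_hsub e D1; have H2 := Mspan_hsub e D2.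
apply: (hlim_le (e := fun n => hnorm (u n - x) * hnorm (v n) + hnorm x * hnorm (v n - y))).
  move=> n; have E1 : cL2_mul (u n) (v n) - cL2_mul x (v n) = cL2_mul (u n - x) (v n).
    have lin c a b (Ma : Mspan D1 a) (Mb : Mspan D1 b) := prod_linl c Ma Mb (Mv n).
    exact: (sub_of_lin lin (Mu n) Mx).
  have E2 : cL2_mul x (v n) - cL2_mul x y = cL2_mul x (v n - y).
    have lin c a b (Ma : Mspan D2 a) (Mb : Mspan D2 b) := prod_linr c Mx Ma Mb.
    exact: (sub_of_lin lin (Mv n) My).
  apply: (le_trans (hnorm_tri (cL2_mul x (v n)) _ _)).
  have h1 := prod_norm (hsubB H1 (Mu n) Mx) (Mv n); have h2 := prod_norm Mx (hsubB H2 (Mv n) My).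
  by rewrite E1 E2 h1 h2.
have := cvgD (cvgM ux (hlim_norm vy)) (cvgM (cvg_cst (hnorm x)) vy).
by rewrite mul0r mulr0 addr0; exact.
Qed.

(** For labels with disjoint supports the constant of [cls_lexp_mul] is 1 and the product label is
    the sum; both sides are continuous. *)
Lemma prod_exp u v : Ksupp D1 u -> Ksupp D2 v -> cL2_mul (e u) (e v) = e (u + v).
Proof.
move=> Du Dv.
have [s [sD su se]] := e_approx lam_sf e_gram eE mD1 Du.
have [t [tD tv te]] := e_approx lam_sf e_gram eE mD2 Dv.
have Ms n : Mspan D1 (evec eta (s n)) by apply: (Mspan_evec eE mD1).
have Mt n : Mspan D2 (evec eta (t n)) by apply: (Mspan_evec eE mD2).
have Mu : Mspan D1 (e u) by apply: closed_span_sub; exists u.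
have Mv : Mspan D2 (e v) by apply: closed_span_sub; exists v.
have st n : cL2_mul (evec eta (s n) : L) (evec eta (t n)) = e (lvec (s n) + lvec (t n)).
  have [Lst Est] := cls_lexp_mul eta_poisson (s n) (t n).
  rewrite cL2_mulE//; [|exact: lexp_L2|exact: lexp_L2].
  have dj y : phifun (s n) y * phifun (t n) y = 0.
    have [D1y|nD] := pselect (D1 y); last by rewrite sD// mul0r.
    rewrite tD ?mulr0// => D2y.
    by have : (D1 `&` D2) y by []; rewrite dis.
  rewrite Est prodl_const0// cexp0 scale1r -eE; congr (e _).
  rewrite -clsD; [|exact: phifun_L2|exact: phifun_L2].
  by congr (cls lam _); apply/funext => y; rewrite comb2_phifun dj addr0.
have Eu : evec eta \o s = fun n => evec eta (s n) by [].
have l1 := prod_lim Ms Mt Mu Mv se te.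
have l2 := fock_continuous e_gram (hlimD su tv).
apply: (hlim_uniq l1); move: l2; rewrite (_ : _ \o _ = fun n => cL2_mul (evec eta (s n) : L) (evec eta (t n)))//.
by apply/funext => n /=; rewrite st.
Qed.
End disjoint_products.

(** * Uniqueness of the multiplication of the CCR flow *)

Section ccr_multiplication.
Context {R : realType} {d : nat} {H G : innerProductSpace R}.
Variables (W : 'rV[R]_d -> H -> H) (e : H -> G) (a b : 'rV[R]_d).
Local Notation Fa := (ccr_fiber W e a).
Local Notation Fb := (ccr_fiber W e b).

Lemma ccr_mul_lim_l m u x y : is_ccr_mul W e a b m -> (forall n, Fa (u n)) -> Fa x -> Fb y ->
  hlim u x -> hlim (fun n => m (u n) y) (m x y).
Proof.
move=> [_ ml mr md _] Fu Fx Fy ux.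
have HF : hsubspace Fa by exact: closed_span_hsub.
apply: (hlim_le (e := fun n => hnorm (u n - x) * hnorm y)); last first.
  by have := cvgM ux (cvg_cst (hnorm y)); rewrite mul0r; exact.
move=> n; have lin c p q (Fp : Fa p) (Fq : Fa q) := ml c p q y Fp Fq Fy.
rewrite (sub_of_lin lin (Fu n) Fx); set z := u n - x.
have Fz : Fa z by exact: (hsubB HF (Fu n) Fx).
rewrite -(ler_pXn2r (n := 2)) ?nnegrE ?mulr_ge0 ?hnorm_ge0// exprMn hnorm_sq md//.
by rewrite !hdotxxE -rmorphM.
Qed.

Lemma ccr_mul_lim_r m u x y : is_ccr_mul W e a b m -> (forall n, Fb (u n)) -> Fb x -> Fa y ->
  hlim u x -> hlim (fun n => m y (u n)) (m y x).
Proof.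
move=> [_ ml mr md _] Fu Fx Fy ux.
have HF : hsubspace Fb by exact: closed_span_hsub.
apply: (hlim_le (e := fun n => hnorm y * hnorm (u n - x))); last first.
  by have := cvgM (cvg_cst (hnorm y)) ux; rewrite mulr0; exact.
move=> n; have lin c p q (Fp : Fb p) (Fq : Fb q) := mr c y p q Fy Fp Fq.
rewrite (sub_of_lin lin (Fu n) Fx); set z := u n - x.
have Fz : Fb z by exact: (hsubB HF (Fu n) Fx).
rewrite -(ler_pXn2r (n := 2)) ?nnegrE ?mulr_ge0 ?hnorm_ge0// exprMn hnorm_sq md//.
by rewrite !hdotxxE -rmorphM.
Qed.

(** The inner product rule bounds m in each variable, so agreement on pairs of exponential vectors
    passes to the closed spans, one variable after the other. *)
Lemma ccr_mul_unique m m' x y : is_ccr_mul W e a b m -> is_ccr_mul W e a b m' ->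
  Fa x -> Fb y -> m x y = m' x y.
Proof.
move=> hm hm' Fx Fy; have [_ ml mr _ me] := hm; have [_ ml' mr' _ me'] := hm'.
have HFa : hsubspace Fa by exact: closed_span_hsub.
have HFb : hsubspace Fb by exact: closed_span_hsub.
have zero (T : G -> G) F : hsubspace F ->
    (forall c p q, F p -> F q -> T (c *: p + q) = c *: T p + T q) -> T 0 = 0.
  move=> HF lT; have := lT (-1) 0 0 (hsub0 HF) (hsub0 HF).
  by rewrite scaler0 addr0 scaleN1r addNr.
have exa z : ker_adj W a z -> Fa (e z) by move=> kz; apply: closed_span_sub; exists z.
have exb z : ker_adj W b z -> Fb (e z) by move=> kz; apply: closed_span_sub; exists z.
have step z' : ker_adj W b z' -> forall x, Fa x -> m x (e z') = m' x (e z').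
  move=> kz'; have Fz' := exb _ kz'.
  have HE : hsubspace [set x | Fa x /\ m x (e z') = m' x (e z')].
    split.
    - split; first exact: hsub0.
      by rewrite (zero (m^~ (e z')) _ HFa) ?(zero (m'^~ (e z')) _ HFa)// => *; [exact: ml'|exact: ml].
    - by move=> c p q [Fp Ep] [Fq Eq]; split; [exact: (hsubP c HFa Fp Fq)|rewrite ml// ml'// Ep Eq].
    - move=> u p Fu up; have Fu' n : Fa (u n) by case: (Fu n).
      have Fp : Fa p by exact: hsub_lim up.
      split=> //; apply: (hlim_uniq (ccr_mul_lim_l hm Fu' Fp Fz' up)).
      rewrite (_ : (fun n => m (u n) (e z')) = fun n => m' (u n) (e z')); first exact: ccr_mul_lim_l.
      by apply/funext => n; case: (Fu n).
  move=> x0 /(closed_span_min HE) h; apply: (h _).2 => _ [z kz <-]; split; first exact: exa.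
  by rewrite me// me'.
have HE : hsubspace [set y | Fb y /\ m x y = m' x y].
  split.
  - split; first exact: hsub0.
    by rewrite (zero (m x) _ HFb) ?(zero (m' x) _ HFb)// => *; [exact: mr'|exact: mr].
  - by move=> c p q [Fp Ep] [Fq Eq]; split; [exact: (hsubP c HFb Fp Fq)|rewrite mr// mr'// Ep Eq].
  - move=> u p Fu up; have Fu' n : Fb (u n) by case: (Fu n).
    have Fp : Fb p by exact: hsub_lim up.
    split=> //; apply: (hlim_uniq (ccr_mul_lim_r hm Fu' Fp Fx up)).
    rewrite (_ : (fun n => m x (u n)) = fun n => m' x (u n)); first exact: ccr_mul_lim_r.
    by apply/funext => n; case: (Fu n).
apply: (closed_span_min HE _ Fy).2 => _ [z kz <-]; split; first exact: exb.
exact: step.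
Qed.

Lemma ccr_mulE m x y : is_ccr_mul W e a b m -> Fa x -> Fb y -> ccr_mul W e a b x y = m x y.
Proof.
move=> hm; apply: (ccr_mul_unique _ hm).
exact: (xgetPex (fun _ _ => 0) (P := [set m | is_ccr_mul W e a b m]) (ex_intro _ m hm)).
Qed.
End ccr_multiplication.

Section separability.
Context {R : realType}.

(** A dense set of the whole space may miss [M]. For each of its points and each precision, one
    sufficiently close point of [M] is chosen, if there is any. *)
Lemma sub_hseparable (H : innerProductSpace R) (M : set H) : hseparable H ->
  exists2 D : set H, countable D & D `<=` M /\
    forall x (r : R), M x -> 0 < r -> exists2 y, D y & hnorm (x - y) < r.
Proof.
move=> [D cD dD].
pose g (p : H * nat) := xget 0 [set y | M y /\ hnorm (p.1 - y) < p.2.+1%:R^-1].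
pose A := [set p : H * nat | D p.1 /\ exists y, M y /\ hnorm (p.1 - y) < p.2.+1%:R^-1].
exists (g @` A).
  apply: (sub_countable (card_image_le _ _)).
  apply: (@sub_countable _ _ _ (D `*` setT)); first by apply: subset_card_le => -[p n] [].
  exact: countableX.
have gA p : A p -> M (g p) /\ hnorm (p.1 - g p) < p.2.+1%:R^-1.
  by move=> [_ h]; rewrite /g; have := xgetPex 0 h.
split=> [_ [p Ap <-]|x r Mx r0]; first by case: (gA p Ap).
have [k hk] := inv1_lt (divr_gt0 r0 (ltr0n _ 2)).
have [z Dz xz] := dD x (k.+1%:R^-1) (ltac:(by rewrite invr_gt0)).
have Az : A (z, k) by split=> //; exists x; split=> //=; rewrite hnorm_distC.
exists (g (z, k)); first by exists (z, k).
have [_ /= h] := gA _ Az.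
by rewrite (le_lt_trans (hnorm_tri z _ _))// (splitr r) ltrD// (lt_trans _ hk).
Qed.
End separability.

(** * Separability and strong continuity *)

Section countable_totality.
Context {R : realType} {H : innerProductSpace R}.

Lemma rat_approx (x r : R) : 0 < r -> exists q : rat, `|x - ratr q| < r.
Proof.
move=> r0; have [q] := @rat_in_itvoo R (x - r) (x + r) (ltac:(lra)).
rewrite in_itv /= => /andP[h1 h2]; exists q; rewrite ltr_norml; apply/andP; split; lra.
Qed.

Definition ratcoef (J : Type) (p : rat * rat * J) : R[i] * J :=
  ((ratr p.1.1)%:C%C + 'i%C * (ratr p.1.2)%:C%C, p.2).

Lemma sqrt_csqn_le (c : R[i]) : Num.sqrt (csqn c) <= `|Re c| + `|Im c|.
Proof.
have h := addr_ge0 (normr_ge0 (Re c)) (normr_ge0 (Im c)).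
rewrite -(ger0_norm h) -sqrtr_sqr ler_wsqrtr// /csqn.
rewrite -(real_normK (num_real (Re c))) -(real_normK (num_real (Im c))).
have := normr_ge0 (Re c); have := normr_ge0 (Im c); nra.
Qed.

(** The combinations with coefficients in Q + iQ are countably many and approximate all
    combinations. *)
Lemma total_hseparable (J : countType) (phi : J -> H) : closed_span (range phi) = setT -> hseparable H.
Proof.
move=> tot; exists (range (fun s : seq (rat * rat * J) => comb phi (map (@ratcoef J) s))).
  by apply: (sub_countable (card_image_le _ _)); exact: countableP.
move=> x r r0.
have r2 : 0 < r / 2 by rewrite divr_gt0.
have : closed_span (range phi) x by rewrite tot.
move=> /(_ _ r2)[n [c [v [Sv xv]]]].
suff [s hs] : exists s, hnorm (\sum_(i < n) c i *: v i - comb phi (map (@ratcoef J) s)) < r / 2.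
  exists (comb phi (map (@ratcoef J) s)); first by exists s.
  by rewrite (le_lt_trans (hnorm_tri (\sum_(i < n) c i *: v i) _ _))// (splitr r) ltrD.
move: (r / 2) r2 => r' {}r0; move: r' r0; elim: n c v Sv {xv} => [|n IH] c v Sv {}r r0.
  by exists [::]; rewrite big_ord0 /comb big_nil subrr hnorm0.
have r2 : 0 < r / 2 by rewrite divr_gt0.
have [s hs] := IH (fun i => c (widen_ord (leqnSn n) i)) (fun i => v (widen_ord (leqnSn n) i))
  (fun i => Sv _) _ r2.
have [j _ vj] := Sv ord_max.
pose k := hnorm (phi j) + 1; have k0 : 0 < k by rewrite ltr_wpDl// hnorm_ge0.
have rk : 0 < r / (4 * k) by rewrite divr_gt0// mulr_gt0.
have [p hp] := rat_approx (Re (c ord_max)) rk; have [q hq] := rat_approx (Im (c ord_max)) rk.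
exists ((p, q, j) :: s); rewrite big_ord_recr /= /comb big_cons /= addrC opprD addrACA.
rewrite -vj -scalerBl (le_lt_trans (hnormD _ _))// (splitr r) ltrD//.
rewrite hnormZ; set z := c _ - _.
have hz : Num.sqrt (csqn z) < r / (2 * k).
  rewrite (le_lt_trans (sqrt_csqn_le _))//.
  have -> : r / (2 * k) = r / (4 * k) + r / (4 * k) by field; rewrite gt_eqF.
  rewrite ltrD//; move: hp hq; rewrite /z; case: (c ord_max) => a b /=.
    by rewrite !mul0r !mulr0 subr0 addr0.
  by rewrite !mul0r mul1r !add0r.
rewrite (@le_lt_trans _ _ (Num.sqrt (csqn z) * k))//.
  by rewrite ler_wpM2l ?sqrtr_ge0// lerDl.
have -> : r / 2 = r / (2 * k) * k by field; rewrite gt_eqF.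
by rewrite ltr_pM2r.
Qed.
End countable_totality.

Section separable_L2.
Context {d} {S : measurableType d} {R : realType} {lam : {measure set S -> \bar R}}.
Hypothesis lam_sf : sigma_finite setT lam.

Lemma L2_hseparable (I : countType) (g : I -> set S) : (forall i, measurable (g i)) ->
  measurable `<=` <<s range g >> -> hseparable (cL2_ips lam).
Proof.
move=> mg gen.
have [F [uF ndF F_fin]] := (sigma_finiteP _ _).1 lam_sf.
have mF n : measurable (F n) by case: (F_fin n).
(* Finite intersections of generators with an exhausting set: restriction to [g i] adds i to the
   list, so the span of these indicators is stable. *)
pose A (j : seq I * nat) := foldr (fun i B => g i `&` B) (F j.2) j.1.
have mA j : measurable (A j).
  by case: j => s n; elim: s => [|i s IH]; rewrite /A /=; [exact: mF|exact: measurableI].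
have LA j : L2 lam (cind (A j)).
  suff lA : (lam (A j) < +oo)%E.
    have := phifun_L2 (setl 1 (mA j) lA); congr L2.
    by apply/funext => y; rewrite /phifun /= cindE.
  have [_] := F_fin j.2; apply: le_lt_trans; apply: le_measure; rewrite ?inE//.
  by rewrite /A; case: j => s n /=; elim: s => [|i s IH] //= y [_ /IH].
pose phi j : cL2_ips lam := cls lam (cind (A j)).
apply: (@total_hseparable _ _ _ phi); apply/seteqP; split=> // x _.
pose M := closed_span (range phi); have HM : hsubspace M by exact: closed_span_hsub.
have Mg i : bsets (mult_class M) (g i).
  have bg := cind_bmeas (R := R) (mg i).
  split; first exact: bg.
  move=> y My; have HM' : hsubspace [set y | M (iop (g i) y)].
    exact: (mulop_hsub bg HM).
  apply: (closed_span_min HM' _ My) => _ [j _ <-] /=.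
  rewrite (iop_cls (mg i) (LA j)); apply: closed_span_sub; exists (i :: j.1, j.2); first by [].
  congr (cls lam _); apply/funext => t; rewrite !cindE /= in_setI; case: (t \in g i) => /=.
    by rewrite mul1r; case: j.
  by rewrite mul0r.
apply: (@L2_hsub_total _ _ _ lam M F x HM _ mF ndF (esym uF)) => [B mB|n|n].
- apply: (smallest_sub _ _ (gen _ mB)); first exact: bsets_sigma_algebra (mult_bclass HM).
  by move=> _ [i _ <-].
- exact: (LA ([::], n)).
- by apply: closed_span_sub; exists ([::], n).
Qed.
End separable_L2.

Section mark_generators.
Context {R : realType} {dY} {Y : measurableType dY} (g : nat -> set Y).
Hypothesis g_gen : (measurable : set (set Y)) = <<s range g >>.
Local Notation S := (Y * bposR R)%type.

(** Rational thresholds keep the index type countable, as [L2_hseparable] requires. *)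
Definition mark_gen (i : nat + rat) : set S :=
  match i with inl n => g n `*` setT | inr q => setT `*` rge (ratr q) end.

Lemma mark_gen_meas i : measurable (mark_gen i).
Proof.
case: i => [n|q] /=; apply: measurableX => //; last exact: rge_meas.
by rewrite g_gen; apply: sub_sigma_algebra; exists n.
Qed.

Lemma mark_genE : measurable `<=` <<s range mark_gen >>.
Proof.
pose T := g_sigma_algebraType (range mark_gen).
have mT i : measurable (mark_gen i : set T) by apply: sub_sigma_algebra; exists i.
have mf : measurable_fun setT (fst : T -> Y).
  apply: (@measurability _ _ T _ _ _ (range g)) => //.
  move=> _ [_ [n _ <-] <-]; have := mT (inl n); congr measurable.
  by apply/seteqP; split=> -[y r] //= [].
have mv : measurable_fun setT (fun z : T => posR_val z.2).
  apply: (@measurability _ _ T R _ _ (@RGenCInfty.G R)); first exact: RGenCInfty.measurableE.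
  move=> _ [_ [x ->] <-]; rewrite setTI.
  (* r >= x holds iff r >= q for all rational q <= x; [F q] is the complement of the q-th
     condition. *)
  pose F (q : rat) : set T := if ratr q <= x then ~` mark_gen (inr q) else set0.
  have mF q : measurable (F q) by rewrite /F; case: ifP => // _; exact: measurableC.
  rewrite (_ : _ @^-1` _ = ~` \bigcup_q F q).
    by apply: measurableC; exact: bigcupT_measurable_rat.
  apply/seteqP; split=> -[y r] /=; rewrite in_itv /= andbT.
    move=> xr [q _]; rewrite /F; case: ifP => //= qx; apply; split=> //; rewrite /rge /=.
    exact: le_trans xr.
  move=> h; rewrite leNgt; apply/negP => rx; apply: h.
  have [q] := rat_in_itvoo rx; rewrite in_itv /= => /andP[rq qx].
  exists q => //; rewrite /F (ltW qx) => -[_]; rewrite /rge /=; apply/negP.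
  by rewrite -ltNge.
apply: smallest_sub; first exact: smallest_sigma_algebra.
move=> _ [[B mB <-]|[_ [M mM <-] <-]].
  by rewrite -/(measurable (_ : set T)); exact: mf.
rewrite !setTI; rewrite -/(measurable (_ : set T)).
by have := mv measurableT _ mM; rewrite setTI.
Qed.
End mark_generators.

(** * Difference sets of positive measure *)

Section steinhaus.
Context {R : realType}.
Local Notation mu := (@lebesgue_measure R).

Lemma shift_meas (u : R) : measurable_fun setT (fun t : R => t + u).
Proof. by apply: measurable_funD => //; exact: measurable_cst. Qed.

Lemma lebesgue_shift (A : set R) (u : R) : measurable A -> mu ((fun t => t + u) @^-1` A) = mu A.
Proof.
move=> mA; have [m mE] := @exists_pushforward R _ _ (measurableTypeR R) (measurableTypeR R) mu _ (shift_meas u).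
transitivity (m A); first by rewrite mE.
apply/esym; apply: (lebesgue_measure_unique _ mA).
move=> _ [[a b] /= ab <-]; rewrite mE.
rewrite (_ : _ @^-1` _ = `]a - u, b - u]%classic); last first.
  by apply/seteqP; split=> t /=; rewrite !in_itv /= ltrBlDr lerBrDr.
apply: (etrans (lebesgue_measure_itv `]a, b])); apply/esym.
apply: (etrans (lebesgue_measure_itv `]a - u, b - u])).
rewrite /= !lte_fin ltrD2r; case: ifP => // _.
by rewrite -!EFinB; congr (_%:E); ring.
Qed.

(** Take K compact in A of positive measure and U open around K with U minus K of measure less than
    that of K. For small u the translate K + u is in U; were it disjoint from K, it would fit into U
    minus K. *)
Lemma steinhaus (A : set R) : measurable A -> (0 < mu A < +oo)%E ->
  exists2 r : R, 0 < r & forall u, `|u| < r -> exists t, A t /\ A (t + u).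
Proof.
move=> mA /andP[A0 Afin].
have [m mE] : exists m, mu A = m%:E.
  by exists (fine (mu A)); rewrite fineK// ge0_fin_numE// ltW.
have m0 : 0 < m by move: A0; rewrite mE lte_fin.
have [K [cK KA AK]] := lebesgue_regularity_inner mA Afin m0.
have mK : measurable K by apply: closed_measurable; exact: compact_closed.
have K0 : (0 < mu K)%E.
  rewrite lt_neqAle measure_ge0 andbT eq_sym; apply/eqP => muK.
  have E : mu (A `\` K) = (mu A - mu (A `&` K))%E by exact: measureD.
  have {}E : mu (A `\` K) = m%:E by rewrite E (setIidr KA) muK mE sube0.
  have {}AK : (mu (A `\` K) < m%:E)%E by exact: AK.
  by move: AK; rewrite E ltxx.
have Kfin : (mu K < +oo)%E by apply: le_lt_trans Afin; apply: le_measure; rewrite ?inE.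
have [k kE] : exists k, mu K = k%:E.
  by exists (fine (mu K)); rewrite fineK// ge0_fin_numE// ltW.
have k0 : 0 < k by move: K0; rewrite kE lte_fin.
have [U [oU KU UK]] := lebesgue_regularity_outer mK Kfin k0.
have : \forall u \near (0 : R), K `<=` (fun t => U (t + u)).
  have nc := (compact_near_coveringP K).1 cK.
  apply: (nc R (nbhs (0 : R)) (fun u t => U (t + u)) _) => x Kx.
  have Ux : nbhs (x + 0) U by apply: open_nbhs_nbhs; split=> //; rewrite addr0; exact: KU.
  by have := @add_continuous R (x, 0) _ Ux.
move=> /nbhs_ballP[r r0 hr]; exists r => // u ur.
have Ku : K `<=` (fun t => U (t + u)).
  by apply: hr; rewrite /ball /= sub0r normrN.
apply: contrapT => h.
pose K' : set R := (fun t => t + - u) @^-1` K.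
have mKu : measurable K' by rewrite -[X in measurable X]setTI; exact: shift_meas.
have mUK : measurable (U `\` K) by apply: measurableD => //; exact: open_measurable.
have K'U : K' `<=` U `\` K.
  move=> t Kt; split; first by have := Ku _ Kt; rewrite subrK.
  by move=> Kt'; apply: h; exists (t - u); split; [exact: KA|rewrite subrK; exact: KA].
have : (mu K' <= mu (U `\` K))%E by apply: le_measure; rewrite ?inE.
have -> : mu K' = k%:E by rewrite -kE; exact: lebesgue_shift.
by rewrite leNgt UK.
Qed.
End steinhaus.

Lemma hnorm_lt_half {R : realType} {H : innerProductSpace R} (h x y : H) (r : R) :
  hnorm (x - h) < r / 2 -> hnorm (y - h) < r / 2 -> hnorm (x - y) < r.
Proof.
move=> xh yh; rewrite (le_lt_trans (hnorm_tri h _ _))// (splitr r) ltrD//.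
by rewrite hnorm_distC.
Qed.

(** Otherwise countably many null sets would cover [E]. *)
Lemma exists_positive_cover {R : realType} {d} {T : measurableType d} (mu : {measure set T -> \bar R})
    {J : Type} (D : set J) (A : J -> set T) (E : set T) : countable D ->
  (forall h, D h -> measurable (A h)) -> measurable E -> (0 < mu E)%E ->
  E `<=` \bigcup_(h in D) A h -> exists2 h, D h & (0 < mu (A h))%E.
Proof.
move=> cD mA mE E0 EA; apply: contrapT => nh.
have A0 h : D h -> mu (A h) = 0%E.
  move=> Dh; apply/eqP; rewrite eq_le measure_ge0 andbT leNgt; apply/negP => h0.
  by apply: nh; exists h.
have [k kinj] := countable_injP D cD.
pose B n := \bigcup_(h in [set h | D h /\ k h = n]) A h.
have B0 n : mu.-negligible (B n).
  have [[h [Dh kh]]|nD] := pselect (exists h, D h /\ k h = n).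
    exists (A h); split; [exact: mA|exact: A0|].
    move=> t [h' [Dh' kh'] At]; suff <- : h' = h by [].
    by apply: kinj; rewrite ?inE// kh.
  exists set0; split=> // t [h' hh' _]; by apply: nD; exists h'.
have [N [mN N0 BN]] := negligible_bigcup B0.
have : (mu E <= mu N)%E.
  apply: le_measure; rewrite ?inE// => t /EA[h Dh At]; apply: BN.
  by exists (k h) => //; exists h.
by rewrite N0 leNgt E0.
Qed.

(** * Strong continuity of translations *)

Section strong_continuity.
Context {R : realType} {d : nat} {dS} {S : measurableType dS} {lam : {measure set S -> \bar R}}.
Hypothesis lam_sf : sigma_finite setT lam.
Context {act : S -> 'rV[R]_d -> S}.
Hypothesis act_meas : measurable_action act.
Hypothesis lam_inv : forall a B, measurable B -> lam (translate act B a) = lam B.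
Local Notation K := (cL2_ips lam).
Local Notation U a := (tauop (lam := lam) (tsl act a)).
Let act0 := act_fix0 act_meas.
Let actD := act_add act_meas.
Let mt a : mpres (lam := lam) (tsl act a) := tsl_mpres act_meas lam_inv a.

Lemma transl_comp a b (x : K) : U a (U b x) = U (a + b) x.
Proof.
rewrite {2}/tauop (tauop_cls (mt a) (mpres_L2 (mt b) (rep_L2 x))).
congr (cls lam _); apply/funext => y /=; rewrite /tsl actD.
by congr (rep x (act y _)); rewrite opprD.
Qed.

Lemma transl_0 (x : K) : U 0 x = x.
Proof.
rewrite -[RHS]repK; congr (cls lam _); apply/funext => y /=.
by rewrite /tsl oppr0 act0.
Qed.

Lemma transl_dist a b (x : K) : hnorm (U b x - U a x) = hnorm (U (b - a) x - x).
Proof.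
have ab : a + (b - a) = b by rewrite addrC subrK.
have := (tauop_lisom (mt a)).2 (U (b - a) x - x).
by rewrite (lisomB _ _ (tauop_lisom (mt a))) transl_comp ab.
Qed.

Lemma transl_subadd a b (x : K) :
  hnorm (U (a + b) x - x) <= hnorm (U a x - x) + hnorm (U b x - x).
Proof.
apply: le_trans (hnorm_tri (U a x) _ _) _; have := transl_dist a (a + b) x.
by rewrite addrAC subrr add0r => ->; rewrite [leRHS]addrC lexx.
Qed.

(** The squared distance is the integral over the space of a function jointly measurable in the
    point and in t, hence measurable in t by Tonelli. *)
Lemma transl_dist_meas v (x h : K) (r : R) : 0 < r ->
  measurable [set t : R | hnorm (U (t *: v) x - h) < r].
Proof.
move=> r0.
pose f (p : S * R) : \bar R := (csqn (rep x (act p.1 (- (p.2 *: v))) - rep h p.1))%:E.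
have [[xr xi] _] := rep_L2 x; have [[yr yi] _] := rep_L2 h.
have mf : measurable_fun setT f.
  apply: cmeas_csqnE; apply: cmeasB.
    have ma := ray_act_meas act_meas v.
    by split; [exact: (measurableT_comp xr ma)|exact: (measurableT_comp xi ma)].
  by split; [exact: (measurableT_comp yr measurable_fst)|exact: (measurableT_comp yi measurable_fst)].
have f0 p : (0 <= f p)%E by rewrite lee_fin csqn_ge0.
have mG : measurable_fun setT (fun t : R => \int[lam]_y f (y, t))%E.
  exact: (@measurable_fun_fubini_tonelli_G _ _ _ _ _ (sfm lam_sf) f mf f0).
have E t : (\int[lam]_y f (y, t))%E = (hnorm (U (t *: v) x - h) ^+ 2)%:E.
  have Lx := mpres_L2 (mt (t *: v)) (rep_L2 x).
  have -> : U (t *: v) x - h = cls lam (fun y => (rep x \o tsl act (t *: v)) y - rep h y).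
    by rewrite (clsB Lx (rep_L2 h)) repK.
  by rewrite (cls_norm (L2B Lx (rep_L2 h))).
rewrite (_ : [set t | _] = (fun t => \int[lam]_y f (y, t))%E @^-1` `]-oo, (r ^+ 2)%:E[).
  by rewrite -[X in measurable X]setTI; apply: mG => //; exact: emeasurable_itv.
apply/seteqP; split=> t /=; rewrite in_itv /= E lte_fin ltr_pXn2r ?nnegrE ?hnorm_ge0 ?ltW//.
Qed.

(* One of the countably many sets {t | |U_t x - h| < r/2} has positive measure, so that its
   difference set is a neighbourhood of 0. *)
Lemma transl_ray v (x : K) (r : R) : hseparable K -> 0 < r ->
  exists2 s : R, 0 < s & forall t : R, `|t| < s -> hnorm (U (t *: v) x - x) < r.
Proof.
move=> [D cD dD] r0; have r2 : 0 < r / 2 by rewrite divr_gt0.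
pose A h : set R := [set t | hnorm (U (t *: v) x - h) < r / 2] `&` `[0, 1]%classic.
have mA h : measurable (A h) by apply: measurableI; [exact: transl_dist_meas|exact: measurable_itv].
have I1 : @lebesgue_measure R `[0%R, 1%R] = 1%E.
  by rewrite lebesgue_measure_itv /= lte_fin ltr01 sube0.
have [h Dh hA] : exists2 h, D h & (0 < @lebesgue_measure R (A h))%E.
  apply: (@exists_positive_cover R _ (measurableTypeR R) (@lebesgue_measure R) K D A `[0%R, 1%R]%classic cD).
  - by move=> h _; exact: mA.
  - exact: measurable_itv.
  - by apply: (lt_le_trans (y := 1%E)); [exact: lte01|rewrite le_eqVlt; apply/orP; left; apply/eqP; exact: (esym I1)].
  - by move=> t t01; have [h Dh xh] := dD (U (t *: v) x) _ r2; exists h.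
have Afin : (@lebesgue_measure R (A h) < +oo)%E.
  apply: (@le_lt_trans _ _ (@lebesgue_measure R `[0%R, 1%R])).
    apply: (@le_measure _ _ (measurableTypeR R) (@lebesgue_measure R) (A h) `[0%R, 1%R]%classic).
    - by apply: mem_set; exact: mA.
    - by apply: mem_set; exact: measurable_itv.
    - by move=> t [].
  by have -> := I1; exact: ltry.
have [s s0 hs] := steinhaus (mA h) (introT andP (conj hA Afin)).
exists s => // t /hs[u [[/= Au _] [/= At _]]].
have := transl_dist (u *: v) ((u + t) *: v) x.
rewrite -scalerBl addrAC subrr add0r => <-.
exact: hnorm_lt_half At Au.
Qed.

(** The displacement is subadditive, so [transl_ray] along the d coordinate axes suffices. *)
Lemma transl_near0 (x : K) (r : R) : hseparable K -> 0 < r ->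
  exists2 s : R, 0 < s & forall a : 'rV[R]_d, (forall i, `|a ord0 i| < s) -> hnorm (U a x - x) < r.
Proof.
move=> sK r0; have r'0 : 0 < r / d.+1%:R by rewrite divr_gt0.
have [s hs] := choice (fun i => let: ex_intro2 s s0 hs := transl_ray (delta_mx ord0 i) x sK r'0
  in ex_intro (fun s => 0 < s /\ forall t : R, `|t| < s -> hnorm (U (t *: delta_mx ord0 i) x - x) < r / d.+1%:R) s (conj s0 hs)).
exists (\big[Num.min/1]_i s i).
  by apply: (big_ind (fun y : R => 0 < y)) => // [a b a0 b0|i _]; [rewrite lt_min a0|case: (hs i)].
move=> a ai; rewrite (row_sum_delta a).
have le J : hnorm (U (\sum_(i <- J) a ord0 i *: delta_mx ord0 i) x - x) <=
    \sum_(i <- J) r / d.+1%:R.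
  elim: J => [|j J IH]; first by rewrite !big_nil transl_0 subrr hnorm0.
  rewrite !big_cons (le_trans (transl_subadd _ _ _))// lerD// ltW//.
  have [_] := hs j; apply; apply: lt_le_trans (ai j) _; exact: bigmin_le_cond.
(* The sum is d times r/(d + 1), strictly below r also for d = 0. *)
apply: le_lt_trans (le _) _; rewrite sumr_const card_ord -[ltRHS](@mulfVK _ d.+1%:R)//.
by rewrite -[ltLHS]mulr_natr ltr_pM2l// ltr_nat.
Qed.

Lemma transl_cvg (x : K) a : hseparable K ->
  (fun b => hnorm (U b x - U a x)) @ nbhs a --> (0 : R).
Proof.
move=> sK; apply/cvgrPdist_lt => r r0; have [s s0 hs] := transl_near0 x sK r0.
apply/nbhs_ballP; exists s => // b ab; rewrite /= sub0r normrN ger0_norm ?hnorm_ge0// transl_dist.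
apply: hs => i; have [_ /(_ ord0 i)] := ab; rewrite /ball /= !mxE.
by rewrite distrC.
Qed.
End strong_continuity.

(** * The CCR flow *)

Section ccr_realization.
Context {R : realType} {d : nat} {K L : innerProductSpace R}.
Local Notation V := 'rV[R]_d.
Variables (C : set V) (KX : set K) (KD : V -> set K) (e : K -> L).
Variables (U : V -> K -> K) (m : V -> L -> L -> L) (E : prodsys (d := d) L).
Local Notation MD a := (closed_span (e @` KD a)).
Hypotheses (CD : forall a b, C a -> C b -> C (a + b)).
Hypotheses (HK : hsubspace KX) (K_complete : hcomplete K) (K_sep : hseparable K).
Hypothesis L_complete : hcomplete L.
Hypothesis e_gram : forall x y, hdot (e x) (e y) = cexp (hdot x y).
Hypotheses (U_lisom : forall a, lisom (U a)) (U0 : forall x, U 0 x = x)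
  (UD : forall a b x, U (a + b) x = U a (U b x))
  (U_cvg : forall x a, (fun b => hnorm (U b x - U a x)) @ nbhs a --> (0 : R))
  (UX : forall a x, C a -> KX x -> KX (U a x)).
Hypothesis U_adj : forall a, C a -> exists T : K -> K, (forall x, KX x -> KX (T x)) /\
  forall x y, KX x -> KX y -> hdot (T x) y = hdot x (U a y).
Hypothesis KDP : forall a z, C a ->
  KD a z <-> KX z /\ forall y, KX y -> hdot z (U a y) = 0.
Hypotheses
  (m_mem : forall a b x y, C a -> C b -> MD a x -> MD b y -> MD (a + b) (m a x y))
  (m_linl : forall a b c x x' y, C a -> C b -> MD a x -> MD a x' -> MD b y ->
     m a (c *: x + x') y = c *: m a x y + m a x' y)
  (m_linr : forall a b c x y y', C a -> C b -> MD a x -> MD b y -> MD b y' ->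
     m a x (c *: y + y') = c *: m a x y + m a x y')
  (m_dot : forall a b x x' y y', C a -> C b -> MD a x -> MD a x' -> MD b y -> MD b y' ->
     hdot (m a x y) (m a x' y') = hdot x x' * hdot y y')
  (m_exp : forall a b z z', C a -> C b -> KD a z -> KD b z' ->
     m a (e z) (e z') = e (z + U a z')).
Hypotheses (Eset : ps_set E = [set p | C p.1 /\ MD p.1 p.2])
  (Emul : forall x y, ps_set E x -> ps_set E y -> ps_mul E x y = (x.1 + y.1, m x.1 x.2 y.2)).

Let MX := closed_span (e @` KX).
Let HM : hsubspace MX. Proof. exact: closed_span_hsub. Qed.
Let H := sub_ips HK.
Let G := sub_ips HM.
Let W (a : V) (z : H) : H := sproj HK (U a (sval_ips z)).
Let f (z : H) : G := sproj HM (e (sval_ips z)).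

Let svalH_inj (x y : H) : sval_ips x = sval_ips y -> x = y.
Proof. exact: (can_inj (svalK (HM := HK))). Qed.
Let svalG_inj (x y : G) : sval_ips x = sval_ips y -> x = y.
Proof. exact: (can_inj (svalK (HM := HM))). Qed.
Let WE a z : C a -> sval_ips (W a z) = U a (sval_ips z).
Proof. by move=> Ca; rewrite /W sprojK//; apply: UX => //; exact: sval_mem. Qed.
Let fE z : sval_ips (f z) = e (sval_ips z).
Proof.
rewrite /f sprojK//; apply: closed_span_sub; exists (sval_ips z) => //; exact: sval_mem.
Qed.

(** [adjoint] is chosen, so the existence of an adjoint is shown first, from [U_adj]; its kernel is
    the orthogonal complement of the range of [W a]. *)
Let ker_adjE a (z : H) : C a -> ker_adj W a z <-> KD a (sval_ips z).
Proof.
move=> Ca; have [T [TX TE]] := U_adj Ca; pose T' (x : H) : H := sproj HK (T (sval_ips x)).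
have T'E x y : hdot (T' x) y = hdot x (W a y).
  rewrite -!sval_dot WE// /T' sprojK; last by apply: TX; exact: sval_mem.
  by apply: TE; exact: sval_mem.
have adjE x y : hdot (adjoint (W a) x) y = hdot x (W a y).
  exact: (xgetPex (fun=> 0 : H) (P := [set T' | forall x y, hdot (T' x) y = hdot x (W a y)])
    (ex_intro _ T' T'E)).
have -> : ker_adj W a z <-> forall y, hdot z (W a y) = 0.
  split=> [h y|h]; first by rewrite -adjE h hdot0l.
  by apply: hnorm_eq0; rewrite /hnorm adjE h sqrtr0.
rewrite KDP//; split=> [h|[_ h] y].
  split=> [|y Xy]; first exact: sval_mem.
  by have := h (sproj HK y); rewrite -sval_dot WE// sprojK.
by rewrite -sval_dot WE//; apply: h; exact: sval_mem.
Qed.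

Let fiberE a (x : G) : C a -> ccr_fiber W f a x <-> MD a (sval_ips x).
Proof.
move=> Ca; rewrite /ccr_fiber sub_closed_span.
suff -> : sval_ips @` (f @` ker_adj W a) = e @` KD a by [].
apply/seteqP; split=> [_ [_ [z kz <-] <-]|_ [u Du <-]].
  by exists (sval_ips z); [exact/ker_adjE|rewrite fE].
have [Xu _] := (KDP u Ca).1 Du.
exists (f (sproj HK u)); last by rewrite fE sprojK.
by exists (sproj HK u) => //; apply/ker_adjE => //; rewrite sprojK.
Qed.

Let MDX a x : C a -> MD a x -> MX x.
Proof.
move=> Ca; apply: (closed_span_min HM) => _ [u Du <-]; apply: closed_span_sub; exists u => //.
by have [] := (KDP u Ca).1 Du.
Qed.

Let H_sep : hseparable H.
Proof.
have [D cD [DX Dd]] := sub_hseparable KX K_sep.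
exists (sproj HK @` D); first exact: (sub_countable (card_image_le _ _)).
move=> x r r0; have [y Dy xy] := Dd _ _ (sval_mem x) r0.
exists (sproj HK y); first by exists y.
by rewrite -sval_norm svalB sprojK//; exact: DX.
Qed.

Let W_semigroup : isometry_semigroup C W.
Proof.
split.
- move=> a Ca c x y; apply: svalH_inj; rewrite svalP_lin !WE// svalP_lin.
  exact: (U_lisom a).1.
- by move=> a Ca x y; rewrite -sval_dot !WE// (lisom_dot _ _ (U_lisom a)) sval_dot.
- by move=> x; rewrite /W U0 svalK.
- by move=> a b Ca Cb x; apply: svalH_inj; rewrite !WE ?UD//; exact: CD.
- move=> x a Ca; apply/cvgrPdist_lt => r r0.
  have /cvgrPdist_lt/(_ _ r0) := U_cvg (sval_ips x) a.
  by apply: filterS => b hb Cb; rewrite -sval_norm svalB !WE.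
Qed.

Let f_fock : is_fock f.
Proof.
split; first exact: sub_complete.
- by move=> x y; rewrite -sval_dot !fE e_gram sval_dot.
- apply/seteqP; split=> // x _; apply/sub_closed_span.
  apply: (closed_span_min (closed_span_hsub _)) (sval_mem x) => _ [u Xu <-].
  apply: closed_span_sub.
  exists (f (sproj HK u)); last by rewrite fE sprojK.
  by exists (sproj HK u).
Qed.

Let G_mul a (x y : G) : G := sproj HM (m a (sval_ips x) (sval_ips y)).

Let G_mulE a b x y : C a -> C b -> MD a (sval_ips x) -> MD b (sval_ips y) ->
  sval_ips (G_mul a x y) = m a (sval_ips x) (sval_ips y).
Proof.
move=> Ca Cb Mx My; rewrite /G_mul sprojK//.
exact: (MDX (CD Ca Cb) (m_mem Ca Cb Mx My)).
Qed.

Let G_mulP a b : C a -> C b -> is_ccr_mul W f a b (G_mul a).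
Proof.
move=> Ca Cb; have Cab := CD Ca Cb.
have GE x y := @G_mulE a b x y Ca Cb.
split.
- move=> x y /(fiberE _ Ca) Mx /(fiberE _ Cb) My; apply/fiberE => //.
  by rewrite GE//; exact: m_mem.
- move=> c x x' y /(fiberE _ Ca) Mx /(fiberE _ Ca) Mx' /(fiberE _ Cb) My.
  have Ml : MD a (sval_ips (c *: x + x')).
    rewrite svalP_lin; exact: (hsubP c (closed_span_hsub _) Mx Mx').
  apply: svalG_inj; rewrite svalP_lin !GE// svalP_lin.
  exact: (m_linl c Ca Cb Mx Mx' My).
- move=> c x y y' /(fiberE _ Ca) Mx /(fiberE _ Cb) My /(fiberE _ Cb) My'.
  have Ml : MD b (sval_ips (c *: y + y')).
    rewrite svalP_lin; exact: (hsubP c (closed_span_hsub _) My My').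
  apply: svalG_inj; rewrite svalP_lin !GE// svalP_lin.
  exact: (m_linr c Ca Cb Mx My My').
- move=> x x' y y' /(fiberE _ Ca) Mx /(fiberE _ Ca) Mx' /(fiberE _ Cb) My /(fiberE _ Cb) My'.
  by rewrite -!sval_dot !GE//; exact: (m_dot Ca Cb).
- move=> z z' /(ker_adjE _ Ca) Dz /(ker_adjE _ Cb) Dz'.
  have Mz : MD a (sval_ips (f z)) by rewrite fE; apply: closed_span_sub; exists (sval_ips z).
  have Mz' : MD b (sval_ips (f z')) by rewrite fE; apply: closed_span_sub; exists (sval_ips z').
  apply: svalG_inj; rewrite GE// !fE svalD WE//.
  exact: (m_exp Ca Cb Dz Dz').
Qed.

(** The semigroup lives on [KX] and the Fock space is the closed span of [e] over [KX], both taken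
    inside given spaces. The isomorphism is then mere corestriction, and its Borel property is
    [borel_iso_sproj]. *)
Lemma ccr_realization : exists (H G : innerProductSpace R) (W : V -> H -> H) (f : H -> G),
  [/\ hcomplete H, hseparable H, isometry_semigroup C W, is_fock f &
      prodsys_isomorphic E (ccr_prodsys C W f)].
Proof.
exists H, G, W, f; split=> //; first exact: sub_complete.
exists (fun p => (p.1, sproj HM p.2)); split=> //.
- have EX p : ps_set E p -> MX p.2 by rewrite Eset => -[Cp Mp]; exact: (MDX Cp Mp).
  rewrite (_ : ps_set (ccr_prodsys C W f) =
     (fun p : V * G => (p.1, sval_ips p.2)) @^-1` ps_set E); first exact: borel_iso_sproj.
  by rewrite Eset; apply/seteqP; split=> -[a x] /= [Ca] /(fiberE _ Ca) h.
- move=> a; have FX x : ps_fiber E a x -> C a /\ MD a x by rewrite /ps_fiber Eset.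
  split.
  + split.
    * move=> x /FX[Ca Mx]; split=> //=; apply/fiberE => //.
      by rewrite sprojK//; exact: (MDX Ca Mx).
    * move=> x y /set_mem/FX[Ca Mx] /set_mem/FX[_ My] /(congr1 sval_ips) /=.
      by rewrite !sprojK//; [exact: (MDX Ca My)|exact: (MDX Ca Mx)].
    * move=> x [/= Ca /(fiberE _ Ca) Mx]; exists (sval_ips x); last by rewrite /= svalK.
      by rewrite /ps_fiber Eset.
  + move=> c x y /FX[Ca Mx] /FX[_ My]; apply: svalG_inj => /=.
    have Xx := MDX Ca Mx; have Xy := MDX Ca My.
    rewrite sprojK; last exact: (hsubP c HM Xx Xy).
    by rewrite [RHS](svalP_lin c (sproj HM x) (sproj HM y)) !sprojK.
  + move=> x y /FX[Ca Mx] /FX[_ My] /=.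
    have Xx := MDX Ca Mx; have Xy := MDX Ca My.
    by rewrite -sval_dot !sprojK.
- move=> x y Ex Ey; rewrite Emul// /=; move: Ex Ey; rewrite Eset => -[Ca Mx] [Cb My].
  have Xx := MDX Ca Mx; have Xy := MDX Cb My.
  congr (_, _); rewrite (ccr_mulE (G_mulP Ca Cb)).
  + by rewrite /G_mul !sprojK.
  + by apply/fiberE => //; rewrite sprojK.
  + by apply/fiberE => //; rewrite sprojK.
Qed.
End ccr_realization.

Lemma prodsys_eq_isomorphic {R : realType} {d : nat} {H K : innerProductSpace R}
    (E E' : prodsys (d := d) H) (F : prodsys (d := d) K) :
  prodsys_eq E E' -> prodsys_isomorphic E' F -> prodsys_isomorphic E F.
Proof.
move=> [EE mE] [theta [bi th1 un mu]]; exists theta; split.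
- by rewrite EE.
- by rewrite EE.
- by move=> a; have := un a; rewrite /ps_fiber EE.
- move=> x y Ex Ey; rewrite mE//; apply: mu; by rewrite -EE.
Qed.

Lemma iop_diff {d} {T : measurableType d} {R : realType} {mu : {measure set T -> \bar R}}
    (A B : set T) (x : cL2_ips mu) : measurable A -> measurable B -> B `<=` A ->
  iop A x = iop (A `\` B) x + iop B x.
Proof.
move=> mA mB BA; have mAB := measurableD mA mB.
have := mulop_linm 1 x (cind_bmeas mAB) (cind_bmeas mB); rewrite scale1r => <-.
congr (mulop _ x); apply/funext => t; rewrite mul1r !cindE in_setD.
have [/set_mem/BA/mem_set -> /=|_] := boolP (t \in B); first by rewrite add0r.
by rewrite /= andbT addr0.
Qed.

(** * The product system of a Poisson process *)

Section poisson_product_system.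
Context {R : realType} {dO} {O : measurableType dO} {P : probability O R}.
Context {dS} {S : measurableType dS} {lam : {measure set S -> \bar R}}.
Context {eta : O -> {measure set S -> \bar R}}.
Hypothesis eta_poisson : poisson_process P lam eta.
Hypothesis P_complete : measure_is_complete P.
Hypothesis lam_sf : sigma_finite setT lam.
Local Notation K := (cL2_ips lam).
Local Notation L := (cL2_ips P).
Hypothesis K_sep : hseparable K.
Variable e : K -> L.
Hypothesis e_gram : forall x y, hdot (e x) (e y) = cexp (hdot x y).
Hypothesis eE : forall i, e (lvec i) = evec eta i.
Hypothesis e_total : Mspan e setT = setT.
Context {d : nat} (act : S -> 'rV[R]_d -> S).
Hypothesis act_meas : measurable_action act.
Hypothesis lam_inv : forall a B, measurable B -> lam (translate act B a) = lam B.
Context {C : set 'rV[R]_d} {X : set S}.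
Hypotheses (CD : forall a b, C a -> C b -> C (a + b)) (mX : measurable X)
  (X_sub : forall a, C a -> translate act X a `<=` X).
Let act0 := act_fix0 act_meas.
Let actD := act_add act_meas.
Let mt a : mpres (lam := lam) (tsl act a) := tsl_mpres act_meas lam_inv a.
Local Notation U a := (tauop (lam := lam) (tsl act a)).
Local Notation Q a := (quant e_gram e_total act_meas lam_inv a).
Local Notation D0 a := (region act X 0 a).
Local Notation Xa a := (translate act X a).

Lemma translate_meas B a : measurable B -> measurable (translate act B a).
Proof. by move=> mB; rewrite (translateE act0 actD); exact: (mpres_meas (mt a) mB). Qed.

Lemma region_meas a b : measurable (region act X a b).
Proof. by apply: measurableD; exact: translate_meas. Qed.

Let D0E a : D0 a = X `\` Xa a. Proof. by rewrite /region (translate0 act0 actD). Qed.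

Let U_iop a D (x : K) : measurable D -> U a (iop D x) = iop (translate act D a) (U a x).
Proof. by move=> mD; rewrite (tauop_iop (mt a) x mD) (translateE act0 actD). Qed.

Let U_Ksupp a D (x : K) : measurable D -> Ksupp D x -> Ksupp (translate act D a) (U a x).
Proof. by move=> mD Dx; rewrite /Ksupp /= -U_iop// Dx. Qed.

Let Ksupp_mono D D' (x : K) : measurable D -> measurable D' -> D `<=` D' ->
  Ksupp D x -> Ksupp D' x.
Proof.
move=> mD mD' DD' Dx; rewrite /Ksupp /= -[in LHS]Dx (iopI x mD' mD).
by rewrite setIidr.
Qed.

Let X_supp a (x : K) : C a -> Ksupp X x -> Ksupp X (U a x).
Proof.
move=> Ca Xx; apply: (Ksupp_mono (translate_meas a mX) mX (X_sub Ca)).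
exact: U_Ksupp.
Qed.

(** The adjoint on L^2(X) is translation by -a followed by restriction to X. *)
Let X_adj a : C a -> exists T : K -> K, (forall x, Ksupp X x -> Ksupp X (T x)) /\
  forall x y, Ksupp X x -> Ksupp X y -> hdot (T x) y = hdot x (U a y).
Proof.
move=> Ca; exists (fun x => iop X (U (- a) x)); split=> [x _|x y _ Xy].
  by rewrite /Ksupp /= (iopI _ mX mX) setIid.
rewrite (iop_dot _ _ mX) Xy -(lisom_dot _ _ (tauop_lisom (mt a))).
by rewrite (transl_comp act_meas lam_inv) subrr (transl_0 act_meas).
Qed.

(** The range of U_a on L^2(X) is L^2(X + a), whose complement in L^2(X) is L^2 of X minus X + a. *)
Let D0P a (z : K) : C a -> Ksupp (D0 a) z <->
  Ksupp X z /\ forall y, Ksupp X y -> hdot z (U a y) = 0.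
Proof.
move=> Ca; have mXa := translate_meas a mX; have mD0 := region_meas 0 a.
split=> [Dz|[Xz h]].
  split; first by apply: (Ksupp_mono mD0 mX _ Dz); rewrite D0E => y [].
  move=> y Xy; apply: (Ksupp_orth mD0 mXa _ Dz (U_Ksupp a mX Xy)).
  by rewrite D0E; apply/seteqP; split=> // t [[]].
have := iop_diff z mX mXa (X_sub Ca); rewrite -D0E Xz.
suff -> : iop (Xa a) z = 0 by rewrite addr0 => zE; rewrite /Ksupp /= -zE.
apply: hnorm_eq0; rewrite /hnorm.
have -> : hdot (iop (Xa a) z) (iop (Xa a) z) = hdot z (iop (Xa a) z).
  by rewrite (iop_dot _ _ mXa) (iopI _ mXa mXa) setIid.
(* The restriction of z to X + a is itself in the range, so by hypothesis it is orthogonal to z; its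
   norm is therefore 0. *)
have -> : iop (Xa a) z = U a (iop X (U (- a) z)).
  by rewrite (U_iop a _ mX) (transl_comp act_meas lam_inv) subrr (transl_0 act_meas).
by rewrite h ?sqrtr0// /Ksupp /= (iopI _ mX mX) setIid.
Qed.

Let Q_mem a b y : C a -> Mspan e (D0 b) y -> Mspan e (region act X a (a + b)) (Q a y).
Proof.
move=> Ca My; have [[h _ _] _ _] := quant_unit e_gram e_total act_meas lam_inv a (region_meas 0 b).
have := h y My; rewrite -(region_translate act0 actD) add0r (addrC b).
exact.
Qed.

Let dis a b : region act X 0 a `&` region act X a (a + b) = set0.
Proof. by rewrite D0E /region; apply/seteqP; split=> // t [[_ h] []]. Qed.

(** X + a + b is included in X + a, and X + a in X, so removing X + a + b from X can be done in two
    steps. *)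
Let cover a b : C a -> C b -> region act X 0 a `|` region act X a (a + b) = D0 (a + b).
Proof.
move=> Ca Cb; rewrite !D0E /region; apply/seteqP; split=> t.
  case=> -[h1 h2]; split=> //; last exact: X_sub h1.
  move=> h; apply: h2; move: h; rewrite addrC -(translateD act0 actD) => -[y Xy <-].
  by exists y => //; exact: X_sub Xy.
move=> [Xt nt]; have [h|h] := pselect (Xa a t); last by left.
by right.
Qed.

Lemma poisson_ccr : exists (H G : innerProductSpace R) (W : 'rV[R]_d -> H -> H) (f : H -> G),
  [/\ hcomplete H, hseparable H, isometry_semigroup C W, is_fock f &
      prodsys_isomorphic (field_prodsys P act X (fun B w => eta w B) C) (ccr_prodsys C W f)].
Proof.
have mD0 a := region_meas 0 a.
apply: (@ccr_realization R d K L C (Ksupp X) (fun a => Ksupp (D0 a)) e (fun a => U a)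
  (fun a x y => cL2_mul x (Q a y))).
- exact: CD.
- exact: iop_hsub.
- exact: cL2_complete.
- exact: K_sep.
- exact: cL2_complete.
- exact: e_gram.
- by move=> a; exact: (tauop_lisom (mt a)).
- by move=> x; exact: (transl_0 act_meas).
- by move=> a b x; apply/esym; exact: (transl_comp act_meas lam_inv).
- by move=> x a; exact: (transl_cvg lam_sf act_meas lam_inv x a K_sep).
- by move=> a x Ca Xx; exact: X_supp.
- exact: X_adj.
- by move=> a z Ca; exact: D0P.
- move=> a b x y Ca Cb Mx /(Q_mem Ca) My.
  rewrite -/(Mspan e (D0 (a + b))) -(cover Ca Cb).
  exact: (prod_mem eta_poisson P_complete lam_sf e_gram eE (mD0 a) (region_meas a (a + b)) (dis a b) Mx My).
- move=> a b c x x' y Ca Cb Mx Mx' /(Q_mem Ca) My.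
  exact: (prod_linl eta_poisson P_complete lam_sf e_gram eE (mD0 a) (region_meas a (a + b)) (dis a b) c Mx Mx' My).
- move=> a b c x y y' Ca Cb Mx /(Q_mem Ca) My /(Q_mem Ca) My'.
  rewrite (quant_lisom e_gram e_total act_meas lam_inv a).1.
  exact: (prod_linr eta_poisson P_complete lam_sf e_gram eE (mD0 a) (region_meas a (a + b)) (dis a b) c Mx My My').
- move=> a b x x' y y' Ca Cb Mx Mx' /(Q_mem Ca) My /(Q_mem Ca) My'.
  rewrite (prod_dot eta_poisson P_complete lam_sf e_gram eE (mD0 a) (region_meas a (a + b)) (dis a b) Mx Mx' My My').
  by rewrite (lisom_dot _ _ (quant_lisom e_gram e_total act_meas lam_inv a)).
- move=> a b z z' Ca Cb Dz Dz'; rewrite quantE.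
  have Dz'' : Ksupp (region act X a (a + b)) (U a z').
    have := U_Ksupp a (mD0 b) Dz'; rewrite -(region_translate act0 actD) add0r (addrC b).
    exact.
  exact: (prod_exp eta_poisson P_complete lam_sf e_gram eE (mD0 a) (region_meas a (a + b)) (dis a b) Dz Dz'').
- rewrite /field_prodsys /=; apply/seteqP; split=> -[a x] /= [Ca h]; split=> //; move: h.
    by rewrite -(Mspan_eq eta_poisson P_complete lam_sf e_gram eE (mD0 a)).
  by rewrite -/(Mspan e (D0 a)) (Mspan_eq eta_poisson P_complete lam_sf e_gram eE (mD0 a)).
- move=> [a x] [b y] [/= Ca _] [/= Cb Ey]; congr (_, cL2_mul x _).
  apply: (shiftE P_complete (eta_meas eta_poisson) _ Ey).
  exact: (quant_is_shift eta_poisson P_complete lam_sf e_gram eE e_total act_meas lam_inv a (mD0 b)).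
Qed.
End poisson_product_system.

Theorem theorem4p4 (R : realType) (d : nat)
  (C : set 'rV[R]_d)
  (C_cone : closed_convex_cone C)
  (C_spans : forall v : 'rV[R]_d, exists p q, [/\ C p, C q & v = p - q])
  (C_pointed : C `&` [set - p | p in C] = [set 0])
  (dY : measure_display) (Y : measurableType dY)
  (Y_cg : exists2 G : set (set Y), countable G & (measurable : set (set Y)) = <<s G >>)
  (act : Y -> 'rV[R]_d -> Y) (act_meas : measurable_action act)
  (rho0 : {sigma_finite_measure set Y -> \bar R})
  (rho0_inv : forall a (B : set Y), measurable B -> rho0 (translate act B a) = rho0 B)
  (X : set Y) (X_meas : measurable X)
  (X_sub : forall a, C a -> translate act X a `<=` X)
  (X_cap : \bigcap_(a in C) translate act X a = set0)
  (nu : {measure set (bposR R) -> \bar R})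
  (nu_levy : (\int[nu]_r (Num.min (posR_val r) 1)%:E < +oo)%E)
  (dO : measure_display) (O : measurableType dO) (P : probability O R)
  (P_complete : measure_is_complete P)
  (eta : O -> {measure set (Y * bposR R) -> \bar R})
  (eta_poisson : poisson_process P (rho0 \x^ nu)%E eta)
  (O_gen : (measurable : set (set O)) =
     sigma_field P (fun (B : set (Y * bposR R)) w => eta w B) setT) :
  let xi := compound eta in
  let E := field_prodsys P act X xi C in
  let Et := field_prodsys P (act_fst act) (X `*` setT)
              (fun (B : set (Y * bposR R)) w => eta w B) C in
  prodsys_eq E Et /\
  exists (H G : innerProductSpace R) (W : 'rV[R]_d -> H -> H) (e : H -> G),
    [/\ hcomplete H, hseparable H, isometry_semigroup C W, is_fock e &
        prodsys_isomorphic E (ccr_prodsys C W e)].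
Proof.
move=> xi E Et.
have [_ C0 CD _] := C_cone.
have lam_sf := lam_sigma_finite (rho := rho0) nu_levy.
have [g [g_gen gsep]] := exists_generators Y_cg.
have mg n : measurable (g n) by rewrite g_gen; apply: sub_sigma_algebra; exists n.
have K_sep : hseparable (cL2_ips (rho0 \x^ nu)%E).
  exact: (L2_hseparable lam_sf (mark_gen_meas g_gen) (mark_genE g_gen)).
have [e [e_gram eE]] := exists_fock eta_poisson lam_sf.
(* The events of [eta] generate the whole sigma-algebra of [O], so the field over the full set gives
   all of L^2(P). *)
have e_total : Mspan e setT = setT.
  rewrite (Mspan_eq eta_poisson P_complete lam_sf e_gram eE measurableT) -O_gen.
  apply/seteqP; split=> // x _; have [mr mi] := (rep_L2 x).1.
  exists (rep x); first by apply/is_classP; split; [exact: rep_L2|rewrite repK].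
  by move=> A mA; rewrite -[X in measurable X /\ _]setTI -[X in _ /\ measurable X]setTI; split; [exact: mr|exact: mi].
pose act_meas' := act_fst_meas (R := R) act_meas.
have lam_inv := lam_translate (nu := nu) act_meas rho0_inv.
have act0 := act_fix0 act_meas; have actD := act_add act_meas.
have X_sub' a : C a -> translate (act_fst (Z := bposR R) act) (X `*` setT) a `<=` X `*` setT.
  by move=> Ca; rewrite translate_fst => -[y r] [/= /(X_sub _ Ca)].
have mX' : measurable (X `*` setT : set (Y * bposR R)) by exact: measurableX.
have mR a b : measurable (region act X a b).
  by apply: measurableD; rewrite (translateE act0 actD) -[X in measurable X]setTI; apply: tsl_meas.
(* For a in C the region lies in X + a, hence in X, where all atoms are null. *)
have fieldE a b : C a -> sigma_field P xi (region act X a b) =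
    sigma_field P (fun B w => eta w B) (region (act_fst act) (X `*` setT) a b).
  move=> Ca; rewrite region_fst; apply: (sigma_field_compound nu_levy eta_poisson mg) => //.
  by move=> y [/(X_sub _ Ca) Xy _]; exact: (gatom_null act_meas rho0_inv C_cone X_meas X_sub X_cap mg gsep Xy).
have eqE : prodsys_eq E Et.
  split.
    by rewrite /E /Et /field_prodsys /=; apply/seteqP; split=> -[a x] /= [Ca]; rewrite fieldE.
  (* The second quantization of the translation has the defining property of both shifts, and each
     shift is determined on the fibre by [shiftE]. *)
  move=> [a x] [b y] [/= Ca _] [/= Cb Ey]; congr (_, cL2_mul x _).
  have mR' : measurable (region (act_fst (Z := bposR R) act) (X `*` setT) 0 b).
    by rewrite region_fst; exact: measurableX.
  have Ey' := Ey; rewrite fieldE// in Ey'.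
  rewrite (shiftE P_complete (eta_meas eta_poisson) (quant_is_shift eta_poisson P_complete lam_sf e_gram eE
    e_total act_meas' lam_inv a mR') Ey').
  apply: (shiftE P_complete (xi_meas eta_poisson) _ Ey).
  apply: (compound_is_shift eta_poisson P_complete lam_sf eE (e_gram := e_gram) (e_total := e_total) (act_meas := act_meas) (lam_inv := lam_inv) (mR 0 b) erefl).
  move=> D [] ->; rewrite fieldE ?region_fst//.
  by rewrite add0r.
split=> //.
have [H [G [W [f [cH sH iW fF iso]]]]] := poisson_ccr eta_poisson P_complete lam_sf K_sep e_gram eE e_total
  act_meas' lam_inv CD mX' X_sub'.
exists H, G, W, f; split=> //; exact: (prodsys_eq_isomorphic eqE iso).
Qed.
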